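(* Let $p\in\mathbb N$, $0<r<\infty$, and let a canonical system $$\widehat w'(x,\lambda)=\mathrm{i}\lambda J\widehat H(x)\widehat w(x,\lambda),\qquad J=\begin{bmatrix}0 & I_p \\ I_p & 0\end{bmatrix},\qquad \widehat H(x)=\widehat\beta(x)^*\widehat\beta(x),\qquad x\in[0,r],$$ be given, where $\widehat\beta=\begin{bmatrix}\widehat\beta_1&\widehat\beta_2\end{bmatrix}\in\mathcal U^{p\times 2p}[0,r]$ ($\widehat\beta_1,\widehat\beta_2$ being $p\times p$ blocks) satisfies $$\widehat\beta(x)J\widehat\beta(x)^*\equiv0,\qquad \widehat\beta'(x)J\widehat\beta(x)^*\equiv\mathrm{i}I_p,\qquad \det\widehat\beta_2(0)\ne0.$$ Let $\widehat\Phi_1(x)=(\widehat E^{-1}\widehat\beta_1)(x)$ be the $p\times p$ matrix function on $[0,r]$ defined in the context. Then $\widehat\Phi_1\in\mathcal U^{p\times p}[0,r]$, and every Weyl function $\widehat\phi\in\widehat{\mathcal N}(r)$ admits, for any $\delta>0$, the representation $$\widehat\phi(z^2)=-z\int_0^r\mathrm{e}^{\mathrm{i}zt}\widehat\Phi_1(t)\,dt+o\big(z\mathrm{e}^{\mathrm{i}zr}\big)\qquad\text{for } |z|\to\infty,\quad \delta/2<\arg(z)<(\pi-\delta)/2.\tag{$*$}$$ Moreover, $\widehat\Phi_1$ is uniquely determined on $[0,r]$ by the representation $( * )$: if $\widehat\phi\in\widehat{\mathcal N}(r)$ and a continuous $p\times p$ matrix function $\breve\Phi$ on $[0,r]$ is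 such that $( * )$ holds for $\widehat\phi$ (for any $\delta>0$) with $\breve\Phi$ in place of $\widehat\Phi_1$, then $\breve\Phi(x)\equiv\widehat\Phi_1(x)$ on $[0,r]$.
   Context: Notation. $\mathbb C_+$ is the open upper half-plane. $L_2^{p\times q}(0,r)$ is the class of $p\times q$ matrix functions with entries in $L_2(0,r)$, and $L_2^p=L_2^{p\times1}$. $\mathcal U^{p\times q}[0,r]$ is the class of $p\times q$ matrix functions $\mathcal G$ on $[0,r]$ which are differentiable with $\mathcal G'(x)=\mathcal G'(0)+\int_0^x\mathcal G''(t)\,dt$ for some $\mathcal G''\in L_2^{p\times q}(0,r)$ (entries in the Sobolev class $W^{2,2}$). Operators on $L_2^{p}(0,r)$ are applied to matrix functions columnwise. Weyl functions. $\widehat W(x,\lambda)$ is the $2p\times2p$ fundamental solution of the system with $\widehat W(0,\lambda)=I_{2p}$, and $\{\widehat{\mathcal W}_{ik}(r,\lambda)\}_{i,k=1}^2:=\widehat W(r,\lambda)^{-1}$ (with $p\times p$ blocks). A pair $\{\widehat{\mathcal P}_1,\widehat{\mathcal P}_2\}$ of $p\times p$ matrix functions meromorphic in $\mathbb C_+$ is called nonsingular with property-$J$ if $\widehat{\mathcal P}_1^*\widehat{\mathcal P}_1+\widehat{\mathcal P}_2^*\widehat{\mathcal P}_2>0$ at at least one point of $\mathbb C_+$ and $\begin{bmatrix}\widehat{\mathcal P}_1(\lambda)^*&\widehat{\mathcal P}_2(\lambda)^*\end{bmatrix}J\begin{bmatrix}\widehat{\mathcal P}_1(\lambda)\\ \widehat{\mathcal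 P}_2(\lambda)\end{bmatrix}\ge0$ at all points of analyticity in $\mathbb C_+$. $\widehat{\mathcal N}(r)$ is the set of the functions $$\widehat\phi(r,\lambda)=\mathrm{i}\big(\widehat{\mathcal W}_{21}(r,\lambda)\widehat{\mathcal P}_1(\lambda)+\widehat{\mathcal W}_{22}(r,\lambda)\widehat{\mathcal P}_2(\lambda)\big)\big(\widehat{\mathcal W}_{11}(r,\lambda)\widehat{\mathcal P}_1(\lambda)+\widehat{\mathcal W}_{12}(r,\lambda)\widehat{\mathcal P}_2(\lambda)\big)^{-1},$$ where $\{\widehat{\mathcal P}_1,\widehat{\mathcal P}_2\}$ runs over all nonsingular pairs with property-$J$ (removable singularities in $\mathbb C_+$ being removed). Elements of $\widehat{\mathcal N}(r)$ are called Weyl functions of the canonical system on $[0,r]$; they belong to the Herglotz class. The function $\widehat\Phi_1$. In $L_2^p(0,r)$ define $$(Af)(x)=\int_0^x(t-x)f(t)\,dt,\qquad (Kf)(x)=\mathrm{i}\widehat\beta(x)J\int_0^x\widehat\beta(t)^*f(t)\,dt.$$ Under the stated assumptions on $\widehat\beta$ there is a unique bounded, boundedly invertible operator $\widehat E$ on $L_2^p(0,r)$ such that $K=\widehat EA\widehat E^{-1}$ and $\widehat E^{-1}\widehat\beta_2\equiv I_p$. Define $\widehat\Phi_1(x):=(\widehat E^{-1}\widehat\beta_1)(x)$. Asymptotic notation. $o(z\mathrm{e}^{\mathrm{i}zr})$ denotes a matrix function whose norm divided by $|z\mathrm{e}^{\mathrm{i}zr}|$ tends to $0$ as $|z|\to\infty$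 in the indicated angle. *)

(* Defs.v *)
From HB Require Import structures.
From mathcomp Require Import all_boot all_order all_algebra.
From mathcomp Require Import all_classical all_reals all_analysis.
From mathcomp Require Export complex.
Set Implicit Arguments.
Unset Strict Implicit.
Unset Printing Implicit Defensive.
Import Order.TTheory GRing.Theory Num.Theory numFieldNormedType.Exports.
Local Open Scope classical_set_scope.
Local Open Scope ring_scope.
Local Open Scope sesquilinear_scope.
Local Open Scope complex_scope.

Local Notation reC := complex.Re.
Local Notation imC := complex.Im.

(* The complex numbers over R, packed as a numClosedFieldType: the topology and
   the norm of MathComp-Analysis (and those of the matrices over it) are
   inferred for the sort of a packed numFieldType, not for R[i] itself. *)
Definition cplx (R : realType) : numClosedFieldType := R[i].

Section ComplexAnalysis.
Context {R : realType}.
Local Notation C := (cplx R).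
Local Notation mu := (@lebesgue_measure R).

Definition imag_unit : C := 0 +i* 1.

Definition cexp (z : C) : C :=
  (expR (reC z) * cos (imC z)) +i* (expR (reC z) * sin (imC z)).

Definition upper_half_plane : set C := [set z | 0 < imC z].

Definition analytic_at (f : C -> C) (z0 : C) : Prop :=
  exists a : nat -> C, \forall z \near z0,
    series (fun k => a k * (z - z0) ^+ k) @ \oo --> f z.

(* Laurent expansion with finite principal part in a punctured neighbourhood;
   the value f z0 itself is irrelevant. *)
Definition meromorphic_at (f : C -> C) (z0 : C) : Prop :=
  exists (m : nat) (a : nat -> C), \forall z \near z0^',
    series (fun k => a k * (z - z0) ^+ k) @ \oo --> (z - z0) ^+ m * f z.

Definition mx_analytic_at m n (P : C -> 'M[C]_(m, n)) (z0 : C) : Prop :=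
  forall i j, analytic_at (fun z => P z i j) z0.

Definition mx_meromorphic m n (D : set C) (P : C -> 'M[C]_(m, n)) : Prop :=
  forall z0, D z0 -> forall i j, meromorphic_at (fun z => P z i j) z0.

Definition posdef n (M : 'M[C]_n) : Prop :=
  forall v : 'cV[C]_n, v != 0 -> 0 < (v^t* *m M *m v) 0 0.

Definition possemidef n (M : 'M[C]_n) : Prop :=
  forall v : 'cV[C]_n, 0 <= (v^t* *m M *m v) 0 0.

Definition cintegral (D : set R) (f : R -> C) : C :=
  (\int[mu]_(t in D) reC (f t)) +i* (\int[mu]_(t in D) imC (f t)).

Definition mxintegral m n (D : set R) (G : R -> 'M[C]_(m, n)) : 'M[C]_(m, n) :=
  \matrix_(i, j) cintegral D (fun t => G t i j).

(* D is the derivative of G at x as a function on [0, r] (one-sided at 0, r). *)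
Definition is_deriv_on (r : R) m n (G : R -> 'M[C]_(m, n)) (x : R)
    (D : 'M[C]_(m, n)) : Prop :=
  ((y - x)^-1)%:C *: (G y - G x) @[y --> within `[0, r] x^'] --> D.

End ComplexAnalysis.

Section L2.
Context {R : realType}.
Local Notation C := (cplx R).
Local Notation mu := (@lebesgue_measure R).
Variable r : R.

Definition l2normsq m n (G : R -> 'M[C]_(m, n)) : \bar R :=
  (\int[mu]_(t in `]0%R, r[)
     (\sum_i \sum_j (reC (G t i j) ^+ 2 + imC (G t i j) ^+ 2)%R)%:E)%E.

Definition isL2 m n (G : R -> 'M[C]_(m, n)) : Prop :=
  (forall i j, measurable_fun `]0, r[ (fun t => reC (G t i j)) /\
               measurable_fun `]0, r[ (fun t => imC (G t i j))) /\
  (l2normsq G < +oo)%E.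

Definition ae_equal m n (F G : R -> 'M[C]_(m, n)) : Prop :=
  {ae mu, forall x, x \in `]0, r[ -> F x = G x}.

(* The class U^{m x n}[0, r] (entries in W^{2,2}). *)
Definition classU m n (G : R -> 'M[C]_(m, n)) : Prop :=
  exists G1 G2 : R -> 'M[C]_(m, n),
    [/\ forall x : R, x \in `[0, r] -> is_deriv_on r G x (G1 x),
        isL2 G2
      & forall x : R, x \in `[0, r] -> G1 x = G1 0 + mxintegral `[0, x] G2].

(* Elements of L_2^n(0, r) are represented by functions, up to equality a.e.;
   linearity and boundedness make T compatible with that equality. *)
Definition bounded_operator n
    (T : (R -> 'cV[C]_n) -> (R -> 'cV[C]_n)) : Prop :=
  [/\ forall f, isL2 f -> isL2 (T f),
      forall (a : C) f g, isL2 f -> isL2 g ->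
        ae_equal (T (fun x => a *: f x + g x)) (fun x => a *: T f x + T g x)
    & exists M : R, forall f, isL2 f ->
        (l2normsq (T f) <= (M ^+ 2)%:E * l2normsq f)%E].

Definition columnwise n (T : (R -> 'cV[C]_n) -> (R -> 'cV[C]_n)) m
    (G : R -> 'M[C]_(n, m)) : R -> 'M[C]_(n, m) :=
  fun x => \matrix_(i, j) T (fun t => col j (G t)) x i 0.

End L2.

Section CanonicalSystem.
Context {R : realType}.
Local Notation C := (cplx R).
Variables (p : nat) (r : R) (beta : R -> 'M[C]_(p, p + p)).

Definition Jmx : 'M[C]_(p + p) := block_mx 0 1%:M 1%:M 0.

Definition beta1 (x : R) : 'M[C]_p := lsubmx (beta x).
Definition beta2 (x : R) : 'M[C]_p := rsubmx (beta x).

Definition Hmx (x : R) : 'M[C]_(p + p) := (beta x)^t* *m beta x.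

Definition opA (f : R -> 'cV[C]_p) : R -> 'cV[C]_p :=
  fun x => mxintegral `[0, x] (fun t => (t - x)%:C *: f t).

Definition opK (f : R -> 'cV[C]_p) : R -> 'cV[C]_p :=
  fun x => imag_unit *:
    (beta x *m Jmx *m mxintegral `[0, x] (fun t => (beta t)^t* *m f t)).

(* E is bounded with bounded inverse Einv, K = E A E^{-1}, E^{-1} beta2 = I. *)
Definition similarity_operator
    (E Einv : (R -> 'cV[C]_p) -> (R -> 'cV[C]_p)) : Prop :=
  [/\ bounded_operator r E /\ bounded_operator r Einv,
      forall f, isL2 r f ->
        ae_equal r (E (Einv f)) f /\ ae_equal r (Einv (E f)) f,
      forall f, isL2 r f -> ae_equal r (opK f) (E (opA (Einv f)))
    & ae_equal r (columnwise Einv beta2) (fun=> 1%:M)].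

Definition fundamental_solution (W : R -> C -> 'M[C]_(p + p)) : Prop :=
  forall lambda : C, W 0 lambda = 1%:M /\
    forall x : R, x \in `[0, r] ->
      is_deriv_on r (fun t => W t lambda) x
        ((imag_unit * lambda) *: (Jmx *m Hmx x *m W x lambda)).

(* Values at singular points are meaningless, so both conditions are imposed
   at points of analyticity only. *)
Definition nonsingular_propertyJ (P1 P2 : C -> 'M[C]_p) : Prop :=
  let analytic z := mx_analytic_at P1 z /\ mx_analytic_at P2 z in
  [/\ mx_meromorphic upper_half_plane P1 /\ mx_meromorphic upper_half_plane P2,
      exists2 z, upper_half_plane z &
        analytic z /\ posdef ((P1 z)^t* *m P1 z + (P2 z)^t* *m P2 z)
    & forall z, upper_half_plane z -> analytic z ->
        possemidef ((col_mx (P1 z) (P2 z))^t* *m Jmx *m col_mx (P1 z) (P2 z))].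

Definition weyl_lft (Wr : C -> 'M[C]_(p + p)) (P1 P2 : C -> 'M[C]_p)
    (z : C) : 'M[C]_p :=
  let V := invmx (Wr z) in
  imag_unit *: ((dlsubmx V *m P1 z + drsubmx V *m P2 z) *m
                invmx (ulsubmx V *m P1 z + ursubmx V *m P2 z)).

(* phi is the linear-fractional transform with its removable singularities
   removed: at z0 it takes the limit of the transform over z -> z0, z != z0.
   The limit disregards the isolated points at which P1 or P2 is singular or
   the matrix being inverted degenerates; at all other points it is the value
   given by the formula. *)
Definition weyl_function (phi : C -> 'M[C]_p) : Prop :=
  exists (W : R -> C -> 'M[C]_(p + p)) (P1 P2 : C -> 'M[C]_p),
    [/\ fundamental_solution W, nonsingular_propertyJ P1 P2
      & forall z0, upper_half_plane z0 -> forall L : 'M[C]_p,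
          weyl_lft (W r) P1 P2 z @[z --> z0^'] --> L -> phi z0 = L].

Definition sector (delta : R) : set C :=
  [set z | exists rho theta : R,
     [/\ 0 < rho, delta / 2 < theta < (pi - delta) / 2
       & z = (rho * cos theta) +i* (rho * sin theta)]].

(* phi (z^2) = - z \int_0^r e^{izt} Phi(t) dt + o(z e^{izr}) as |z| -> oo in
   each of the angles delta/2 < arg z < (pi - delta)/2, delta > 0. *)
Definition weyl_representation (phi : C -> 'M[C]_p) (Phi : R -> 'M[C]_p)
    : Prop :=
  forall delta : R, 0 < delta ->
  forall eps : R, 0 < eps ->
  exists M : R, forall z : C, sector delta z -> M%:C < `|z| ->
    `| phi (z ^+ 2) -
       - z *: mxintegral `[0, r] (fun t => cexp (imag_unit * z * t%:C) *: Phi t) |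
    <= eps%:C * `| z * cexp (imag_unit * z * r%:C) |.

End CanonicalSystem.

Arguments Jmx {R} p.

(* Main.v *)
(* Representation.  Write W for the fundamental solution and phi for a Weyl
   function.  For u = [v; -i phi v] property-J gives (W(r)u)^* J W(r)u >= 0, and
   the energy identity turns this into a bound on the L2 norm of beta W u, hence
   of h = E^{-1}(beta W u), by Re(v^*(-i phi v)) / Im lambda.  The relation
   K = E A E^{-1} says that h = Phi1 v - i phi v + lambda A h; integrating by
   parts against e^{izt}, lambda = z^2, yields the exact formula
     phi v + z int_0^r e^{izt} Phi1 v dt
       = e^{izr} (phi v + z m(r) - i z^2 n(r)),  m = int h,  n = int m,
   and the bound on h makes the bracket o(z).

   Regularity.  A unitary gauge factor turns beta into a solution of
   beta'' = Q beta with Q = Q^* in L2.  The operator E sends t^{2j}/(2j)! c to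
   y_j c, where y_0 = beta2 and y_{j+1} = - K y_j, so that y_j'' = Q y_j + y_{j-1},
   and it sends an even polynomial P to u(x,0), u(x,t) = sum_j P^{(2j)}(t) y_j(x).
   This u solves u_xx = u_tt + Q u, and d'Alembert's formula bounds it by
   sup |P'|.  Letting even polynomials tend to |t| shows that E(t c) is in
   W^{2,2}, without constructing the kernel of E.  For suitable constants C, D the
   function beta1 - beta2 C - E(t) D vanishes to second order at 0, hence lies in
   the range of K, and so Phi1 - C - t D lies in the range of A.

   Uniqueness.  The difference f of two admissible functions has a finite Laplace
   transform of size e^{- r Re zeta} on a ray; a maximum principle in a sector
   carries the bound over to the positive half-line, and Mikusinski's kernel
   gives f = 0. *)

From HB Require Import structures.
From mathcomp Require Import all_boot all_order all_algebra.
From mathcomp Require Import all_classical all_reals all_analysis.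
From mathcomp Require Import ring lra measurable_realfun.
Require Import Defs.
Set Implicit Arguments.
Unset Strict Implicit.
Unset Printing Implicit Defensive.
Import Order.TTheory GRing.Theory Num.Theory numFieldNormedType.Exports.
Local Open Scope classical_set_scope.
Local Open Scope ring_scope.
Local Open Scope sesquilinear_scope.

(** What is known of [E] is its value on constants and its relation to A and K. Powers of A turn
    constants into even monomials only, whereas correcting beta1 to second order at 0 takes a
    function with nonzero slope there. Even polynomials approximate |t|, and |t| = t on [0, r]:
    hence the wave equation is considered for t of both signs.

    The energy bound contains phi itself, so each estimate carries a factor 1 + |phi|, which is
    absorbed because |z e^{izr}| stays bounded in the angle. The plain bound |n| <= r sup |m| would
    give only O(z) for the bracket; the gain to o(z) is an interpolation between h, m and n. A Weyl
    function is defined through limits at single points; that these limits exist rests on a local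
    bound for the transform, again drawn from the energy.

    For uniqueness, the asymptotics hold inside the open first quadrant of z, but the real
    exponentials in Mikusinski's kernel sit at z = i x, on the boundary that every angle excludes.
    The maximum principle bridges this gap. *)

Notation Rez := (@complex.Re _).
Notation Imz := (@complex.Im _).
Local Notation "x %:C" := (real_complex _ x).
Local Notation "x +i* y" := (complex.Complex x y).

(** * Moduli of complex numbers and matrices *)

Section ComplexModulus.
Context {R : realType}.
Local Notation C := (cplx R).
Implicit Types (z w : C) (x y : R).

Lemma ReD z w : Rez (z + w) = Rez z + Rez w. Proof. by case: z w => [? ?] [? ?]. Qed.
Lemma ImD z w : Imz (z + w) = Imz z + Imz w. Proof. by case: z w => [? ?] [? ?]. Qed.
Lemma ReN z : Rez (- z) = - Rez z. Proof. by case: z. Qed.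
Lemma ImN z : Imz (- z) = - Imz z. Proof. by case: z. Qed.
Lemma ReM z w : Rez (z * w) = Rez z * Rez w - Imz z * Imz w.
Proof. by case: z w => [? ?] [? ?]. Qed.
Lemma ImM z w : Imz (z * w) = Rez z * Imz w + Imz z * Rez w.
Proof. by case: z w => [? ?] [? ?]. Qed.
Lemma ReJ z : Rez (z^*) = Rez z. Proof. by case: z. Qed.
Lemma ImJ z : Imz (z^*) = - Imz z. Proof. by case: z. Qed.
Definition reimE := (ReD, ImD, ReN, ImN, ReM, ImM, ReJ, ImJ).

Lemma complex_ext z w : Rez z = Rez w -> Imz z = Imz w -> z = w.
Proof. by case: z w => [? ?] [? ?] /= -> ->. Qed.

(** The norm on [C] takes values in [C]; a modulus with values in [R] can be integrated and compared
    by real arithmetic. *)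
Definition cabs z : R := Num.sqrt (Rez z ^+ 2 + Imz z ^+ 2).

Lemma normCE z : `|z| = (cabs z)%:C. Proof. exact: normc_def. Qed.

Lemma cabs_ge0 z : 0 <= cabs z. Proof. exact: sqrtr_ge0. Qed.
Hint Resolve cabs_ge0 : core.

Lemma cabs_sqr z : cabs z ^+ 2 = Rez z ^+ 2 + Imz z ^+ 2.
Proof. by rewrite sqr_sqrtr// addr_ge0// sqr_ge0. Qed.

Lemma CI x y : x%:C = y%:C :> C -> x = y. Proof. by case. Qed.
Lemma leC x y : (x%:C <= y%:C :> C) = (x <= y). Proof. exact: lecR. Qed.
Lemma ltC x y : (x%:C < y%:C :> C) = (x < y). Proof. exact: ltcR. Qed.
Lemma CD x y : (x + y)%:C = x%:C + y%:C :> C. Proof. by apply: complex_ext; rewrite ?reimE//= addr0. Qed.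
Lemma CN x : (- x)%:C = - x%:C :> C. Proof. by apply: complex_ext; rewrite ?reimE//= oppr0. Qed.
Lemma CB x y : (x - y)%:C = x%:C - y%:C :> C. Proof. by rewrite CD CN. Qed.
Lemma CM x y : (x * y)%:C = x%:C * y%:C :> C.
Proof. by apply: complex_ext; rewrite ?reimE/= ?mulr0 ?mul0r ?subr0 ?addr0. Qed.
Lemma C0E : 0%:C = 0 :> C. Proof. by []. Qed.
Lemma C1E : 1%:C = 1 :> C. Proof. by []. Qed.
Lemma CX x n : (x ^+ n)%:C = x%:C ^+ n :> C.
Proof. by elim: n => [|n IH]; rewrite ?expr0// !exprS CM IH. Qed.
Lemma Cnat n : n%:R%:C = n%:R :> C.
Proof. by elim: n => [|n IH] //; rewrite !mulrS CD IH. Qed.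
Lemma CV x : (x^-1)%:C = (x%:C)^-1 :> C.
Proof.
have [->|x0] := eqVneq x 0; first by rewrite invr0 C0E invr0.
have xC : x%:C != 0 :> C by apply/eqP => -[] /eqP; apply/negP.
by apply: (mulfI xC); rewrite -CM !divff.
Qed.
Lemma C_eq0 x : (x%:C == 0 :> C) = (x == 0).
Proof. by apply/eqP/eqP => [[]|->]. Qed.

Lemma cabsM z w : cabs (z * w) = cabs z * cabs w.
Proof. by apply: CI; rewrite CM -!normCE normrM. Qed.
Lemma cabsD z w : cabs (z + w) <= cabs z + cabs w.
Proof. by rewrite -leC CD -!normCE ler_normD. Qed.
Lemma cabsN z : cabs (- z) = cabs z.
Proof. by apply: CI; rewrite -!normCE normrN. Qed.
Lemma cabsB z w : cabs (z - w) <= cabs z + cabs w.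
Proof. by rewrite -(cabsN w) cabsD. Qed.
Lemma cabsBC z w : cabs (z - w) = cabs (w - z).
Proof. by rewrite -cabsN opprB. Qed.
Lemma cabs_lower z w : cabs z - cabs w <= cabs (z + w).
Proof. by rewrite lerBlDr -(cabsN w) -{1}(addrK w z) cabsD. Qed.
Lemma cabs_lowerB z w : cabs z - cabs w <= cabs (z - w).
Proof. by rewrite -(cabsN w) cabs_lower. Qed.
Lemma cabs0 : cabs 0 = 0. Proof. by apply: CI; rewrite -normCE normr0. Qed.
Lemma cabs1 : cabs 1 = 1. Proof. by apply: CI; rewrite -normCE normr1. Qed.
Lemma cabs_eq0 z : (cabs z == 0) = (z == 0).
Proof. by rewrite -C_eq0 -normCE normr_eq0. Qed.
Lemma cabs_gt0 z : (0 < cabs z) = (z != 0).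
Proof. by rewrite lt_def cabs_eq0 cabs_ge0 andbT. Qed.
Lemma cabsX z n : cabs (z ^+ n) = cabs z ^+ n.
Proof. by elim: n => [|n IH]; rewrite ?expr0 ?cabs1// !exprS cabsM IH. Qed.
Lemma cabsV z : cabs z^-1 = (cabs z)^-1.
Proof. have [->|z0] := eqVneq z 0; first by rewrite invr0 cabs0 invr0.
by apply: CI; rewrite CV -!normCE normrV ?unitfE. Qed.
Lemma cabs_real x : cabs x%:C = `|x|.
Proof. by rewrite /cabs /= expr0n addr0 sqrtr_sqr. Qed.
Lemma cabs_nat n : cabs n%:R = n%:R :> R.
Proof. by rewrite -Cnat cabs_real ger0_norm. Qed.
Lemma cabsJ z : cabs (z^*) = cabs z.
Proof. by rewrite /cabs !reimE sqrrN. Qed.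
Lemma cabs_Re z : `|Rez z| <= cabs z.
Proof. by rewrite -[`|_|]sqrtr_sqr ler_wsqrtr// lerDl sqr_ge0. Qed.
Lemma cabs_Im z : `|Imz z| <= cabs z.
Proof. by rewrite -[`|_|]sqrtr_sqr ler_wsqrtr// lerDr sqr_ge0. Qed.
Lemma cabs_le z : cabs z <= `|Rez z| + `|Imz z|.
Proof.
rewrite -(ler_pXn2r (n:=2)) ?nnegrE ?addr_ge0// cabs_sqr sqrrD !real_normK ?num_real//.
by rewrite addrAC lerDl mulrn_wge0 ?mulr_ge0.
Qed.
Lemma cabs_i : cabs imag_unit = 1.
Proof. by rewrite /cabs /= expr0n add0r expr1n sqrtr1. Qed.
Lemma cabs_sum I (s : seq I) (P : pred I) (F : I -> C) :
  cabs (\sum_(i <- s | P i) F i) <= \sum_(i <- s | P i) cabs (F i).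
Proof.
elim/big_ind2: _ => [|a b c d h1 h2|//]; first by rewrite cabs0.
by rewrite (le_trans (cabsD _ _)) ?lerD.
Qed.
Lemma sqr_i : imag_unit * imag_unit = -1 :> C.
Proof. by apply: complex_ext; rewrite !reimE /= ?mul0r ?mulr0 ?mulr1 ?sub0r ?addr0 ?oppr0. Qed.
Lemma conjC_i : imag_unit^* = - imag_unit :> C.
Proof. by apply: complex_ext; rewrite !reimE /= ?oppr0. Qed.
Lemma conjC_real x : (x%:C)^* = x%:C :> C.
Proof. by apply: complex_ext; rewrite !reimE /= ?oppr0. Qed.
Lemma mulCJ z : z^* * z = (cabs z ^+ 2)%:C.
Proof. by apply: complex_ext; rewrite ?cabs_sqr !reimE /=; ring. Qed.

End ComplexModulus.
#[global] Hint Extern 0 (is_true (0 <= cabs _)) => exact: cabs_ge0 : core.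

Section MatrixModulus.
Context {R : realType}.
Local Notation C := (cplx R).

(** The entrywise l1 norm: real-valued, submultiplicative for products of all shapes, and defining
    the same convergence as the matrix norm of the statement ([cvg_mabs]). *)
Definition mabs m n (A : 'M[C]_(m, n)) : R := \sum_i \sum_j cabs (A i j).

Lemma mabs_ge0 m n (A : 'M[C]_(m, n)) : 0 <= mabs A.
Proof. by apply: sumr_ge0 => i _; apply: sumr_ge0. Qed.

Lemma mabsD m n (A B : 'M[C]_(m, n)) : mabs (A + B) <= mabs A + mabs B.
Proof.
rewrite /mabs -big_split/= ler_sum// => i _; rewrite -big_split/= ler_sum// => j _.
by rewrite mxE cabsD.
Qed.
Lemma mabsN m n (A : 'M[C]_(m, n)) : mabs (- A) = mabs A.
Proof. by apply: eq_bigr => i _; apply: eq_bigr => j _; rewrite mxE cabsN. Qed.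
Lemma mabsB m n (A B : 'M[C]_(m, n)) : mabs (A - B) <= mabs A + mabs B.
Proof. by rewrite -(mabsN B) mabsD. Qed.
Lemma mabs0 m n : mabs (0 : 'M[C]_(m, n)) = 0.
Proof. by rewrite /mabs big1// => i _; rewrite big1// => j _; rewrite mxE cabs0. Qed.
Lemma mabsZ m n c (A : 'M[C]_(m, n)) : mabs (c *: A) = cabs c * mabs A.
Proof.
rewrite /mabs mulr_sumr; apply: eq_bigr => i _; rewrite mulr_sumr.
by apply: eq_bigr => j _; rewrite mxE cabsM.
Qed.
Lemma mabs_entry m n (A : 'M[C]_(m, n)) i j : cabs (A i j) <= mabs A.
Proof.
rewrite /mabs (bigD1 i)//= (bigD1 j)//= -addrA lerDl addr_ge0//.
  by rewrite sumr_ge0.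
by apply: sumr_ge0 => ? _; apply: sumr_ge0.
Qed.
Lemma mabsM m n q (A : 'M[C]_(m, n)) (B : 'M[C]_(n, q)) :
  mabs (A *m B) <= mabs A * mabs B.
Proof.
rewrite /mabs mulr_suml ler_sum// => i _.
apply: (@le_trans _ _ (\sum_j \sum_k cabs (A i k) * cabs (B k j))).
  apply: ler_sum => j _; rewrite mxE (le_trans (cabs_sum _ _ _))//.
  by apply: ler_sum => k _; rewrite cabsM.
rewrite exchange_big /= mulr_suml ler_sum// => k _.
rewrite -mulr_sumr ler_wpM2l// [leRHS](bigD1 k)//= lerDl sumr_ge0// => k' _.
by rewrite sumr_ge0.
Qed.
Lemma mabs_eq0 m n (A : 'M[C]_(m, n)) : mabs A = 0 -> A = 0.
Proof.
move=> h; apply/matrixP => i j; apply/eqP; rewrite mxE -cabs_eq0 eq_le cabs_ge0 andbT.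
by rewrite -h mabs_entry.
Qed.
Lemma mabsJ m n (A : 'M[C]_(m, n)) : mabs (A^t*) = mabs A.
Proof.
by rewrite /mabs exchange_big; apply: eq_bigr => i _; apply: eq_bigr => j _; rewrite !mxE cabsJ.
Qed.
Lemma mabs_sum m n I (s : seq I) (P : pred I) (F : I -> 'M[C]_(m, n)) :
  mabs (\sum_(i <- s | P i) F i) <= \sum_(i <- s | P i) mabs (F i).
Proof.
elim/big_ind2: _ => [|a b c d h1 h2|//]; first by rewrite mabs0.
by rewrite (le_trans (mabsD _ _)) ?lerD.
Qed.

End MatrixModulus.
#[global] Hint Extern 0 (is_true (0 <= mabs _)) => exact: mabs_ge0 : core.

(** * Integrals over [0, x] and absolutely continuous functions *)

Lemma aeS (R : realType) (P Q : R -> Prop) :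
  {ae lebesgue_measure, forall x, P x} -> (forall x, P x -> Q x) ->
  {ae (@lebesgue_measure R), forall x, Q x}.
Proof. by move=> hp h; apply: (@filterS _ (almost_everywhere (@lebesgue_measure R)) _ P Q). Qed.

Lemma aeS2 (R : realType) (P Q S : R -> Prop) :
  {ae lebesgue_measure, forall x, P x} -> {ae lebesgue_measure, forall x, Q x} ->
  (forall x, P x -> Q x -> S x) ->
  {ae (@lebesgue_measure R), forall x, S x}.
Proof.
by move=> hp hq h; apply: (@filterS2 _ (almost_everywhere (@lebesgue_measure R)) _ P Q S).
Qed.

Lemma integrable_EFinZl (R : realType) (D : set (measurableTypeR R)) (c : R) (f : R -> R) :
  measurable D -> (@lebesgue_measure R).-integrable D (EFin \o f) ->
  (@lebesgue_measure R).-integrable D (EFin \o (fun x => c * f x)).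
Proof. by move=> mD h; apply: eq_integrable (integrableZl mD c h). Qed.

Section RealIntegrals.
Context {R : realType}.
Variable r : R.
Hypothesis r0 : 0 < r.
Local Notation mu := (@lebesgue_measure R).
Implicit Types (f g : R -> R) (x : R).

(** These classes live on the closed interval, so that primitives make sense up to both end points;
    [isL2] uses the open interval, and [isL2_mL2] and [mL2_isL2] translate between the two. *)
Definition L2r f := measurable_fun `[0, r] f /\
  mu.-integrable `[0, r] (fun t => (f t ^+ 2)%:E).
Definition BMr f := measurable_fun `[0, r] f /\
  exists B : R, forall x, 0 <= x <= r -> `|f x| <= B.
Definition L1r f := mu.-integrable `[0, r] (EFin \o f).
Definition Ir x f := \int[mu]_(t in `[0, x]) f t.

Lemma BMr_L1 f : BMr f -> L1r f.
Proof.
move=> [mf [B fB]]; apply: measurable_bounded_integrable => //=.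
  by rewrite lebesgue_measure_itv/=; case: ifP => _; rewrite ?ltry// -EFinD ltry.
by exists B; split; rewrite ?num_real// => y yB x /=; rewrite in_itv/= => /fB /le_trans; apply; exact: ltW.
Qed.

Lemma L1r_meas f : L1r f -> measurable_fun `[0, r] f.
Proof. by move=> /measurable_int /measurable_EFinP. Qed.

Lemma L1r_le f g : measurable_fun `[0, r] f -> L1r g ->
  (forall x, 0 <= x <= r -> `|f x| <= `|g x|) -> L1r f.
Proof.
move=> mf ig fg; apply: (le_integrable _ _ _ ig) => //; exact/measurable_EFinP.
Qed.

Lemma BMrX f : BMr f -> BMr (fun x => f x ^+ 2).
Proof.
move=> [mf [B fB]]; split; first exact: measurable_funX.
by exists (B ^+ 2) => x /fB fx; rewrite normrX lerXn2r// nnegrE// (le_trans _ fx).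
Qed.

Lemma BMr_L2 f : BMr f -> L2r f.
Proof. by move=> h; split; [case: h|exact: (BMr_L1 (BMrX h))]. Qed.

Lemma BMr_cst c : BMr (fun=> c).
Proof. by split=> //; exists `|c|. Qed.
Lemma BMrD f g : BMr f -> BMr g -> BMr (fun x => f x + g x).
Proof.
move=> [mf [B fB]] [mg [D gD]]; split; first exact: measurable_funD.
by exists (B + D) => x xr; rewrite (le_trans (ler_normD _ _))// lerD ?fB ?gD.
Qed.
Lemma BMrM f g : BMr f -> BMr g -> BMr (fun x => f x * g x).
Proof.
move=> [mf [B fB]] [mg [D gD]]; split; first exact: measurable_funM.
by exists (B * D) => x xr; rewrite normrM ler_pM ?fB ?gD.
Qed.
Lemma BMrN f : BMr f -> BMr (fun x => - f x).
Proof.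
move=> [mf [B fB]]; split; first exact: measurableT_comp.
by exists B => x xr; rewrite normrN fB.
Qed.

Lemma L1rD f g : L1r f -> L1r g -> L1r (fun x => f x + g x).
Proof. by move=> hf hg; apply: (eq_integrable _ _ _ _ (integrableD _ hf hg)). Qed.
Lemma L1rN f : L1r f -> L1r (fun x => - f x).
Proof. by move=> hf; apply: (eq_integrable _ _ _ _ (integrableN hf)). Qed.
Lemma L1rZ c f : L1r f -> L1r (fun x => c * f x).
Proof. by move=> hf; apply: (eq_integrable _ _ _ _ (integrableZl _ c hf)). Qed.
Lemma L1r_abs f : L1r f -> L1r (fun x => `|f x|).
Proof. by move=> hf; exact: (integrable_norm hf). Qed.

Lemma L1r_BM f g : L1r f -> BMr g -> L1r (fun x => f x * g x).
Proof.
move=> hf [mg [B gB]]; apply: (@L1r_le (fun x => f x * g x) (fun x => B * f x)).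
- by apply: measurable_funM => //; exact: L1r_meas.
- exact: L1rZ.
by move=> x /gB gx; rewrite !normrM mulrC ler_wpM2r// (le_trans gx)// ler_norm.
Qed.

Lemma L2r_mul_L1 f g : L2r f -> L2r g -> L1r (fun x => f x * g x).
Proof.
move=> [mf f2] [mg g2]; apply: (@L1r_le _ (fun x => f x ^+ 2 + g x ^+ 2)).
- exact: measurable_funM.
- exact: (@L1rD (fun x => f x ^+ 2) (fun x => g x ^+ 2)).
move=> x _; rewrite normrM [leRHS]ger0_norm ?addr_ge0 ?sqr_ge0//.
rewrite -(real_normK (num_real (f x))) -(real_normK (num_real (g x))).
have := sqr_ge0 (`|f x| - `|g x|); have := mulr_ge0 (normr_ge0 (f x)) (normr_ge0 (g x)).
nra.
Qed.
Lemma L2r_L1 f : L2r f -> L1r f.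
Proof.
move=> hf; have := L2r_mul_L1 hf (BMr_L2 (BMr_cst 1)).
by apply: eq_integrable => // x _ /=; rewrite mulr1.
Qed.
Lemma L2r_sqr f : L2r f -> L1r (fun x => f x ^+ 2). Proof. by case. Qed.
Lemma L2rD f g : L2r f -> L2r g -> L2r (fun x => f x + g x).
Proof.
move=> hf hg; split; first by apply: measurable_funD; [case: hf|case: hg].
have h := L1rD (L1rD (L2r_sqr hf) (L2r_sqr hg)) (L1rZ 2 (L2r_mul_L1 hf hg)).
by apply: (eq_integrable _ _ _ _ h) => // x _ /=; congr (_%:E); ring.
Qed.
Lemma L2r_BM f g : L2r f -> BMr g -> L2r (fun x => f x * g x).
Proof.
move=> [mf f2] [mg [B gB]]; split; first exact: measurable_funM.
apply: (@L1r_le (fun x => (f x * g x) ^+ 2) (fun x => B ^+ 2 * f x ^+ 2)).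
- by apply: measurable_funX; exact: measurable_funM.
- exact: (@L1rZ _ (fun x => f x ^+ 2)).
move=> x /gB gx; rewrite exprMn mulrC !ger0_norm; [|by rewrite mulr_ge0 ?sqr_ge0..].
rewrite ler_wpM2r ?sqr_ge0// -(real_normK (num_real (g x))) lerXn2r// nnegrE//.
exact: le_trans gx.
Qed.
Lemma L2rN f : L2r f -> L2r (fun x => - f x).
Proof.
move=> [mf f2]; split; first exact: measurableT_comp.
by apply: (eq_integrable _ _ _ _ f2) => // x _; rewrite sqrrN.
Qed.

Lemma L1r_sub f x : x <= r -> L1r f -> mu.-integrable `[0, x] (EFin \o f).
Proof.
move=> xr; apply: integrableS => //.
by move=> y /=; rewrite !in_itv/= => /andP[-> /le_trans]; exact.
Qed.

Lemma IrD f g x : x <= r -> L1r f -> L1r g ->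
  Ir x (fun t => f t + g t) = Ir x f + Ir x g.
Proof. by move=> xr hf hg; apply: RintegralD => //; exact: L1r_sub. Qed.
Lemma IrZ c f x : x <= r -> L1r f -> Ir x (fun t => c * f t) = c * Ir x f.
Proof. by move=> xr hf; apply: RintegralZl => //; exact: L1r_sub. Qed.
Lemma IrN f x : x <= r -> L1r f -> Ir x (fun t => - f t) = - Ir x f.
Proof.
move=> xr hf; rewrite -mulN1r -IrZ//; apply: eq_Rintegral => t _.
by rewrite mulN1r.
Qed.
Lemma Ir_le f g x : x <= r -> L1r f -> L1r g ->
  (forall t, 0 <= t <= x -> f t <= g t) -> Ir x f <= Ir x g.
Proof.
move=> xr hf hg fg; apply: le_Rintegral => //; try exact: L1r_sub.
Qed.
Lemma Ir_eq f g x : (forall t, 0 <= t <= x -> f t = g t) -> Ir x f = Ir x g.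
Proof. by move=> fg; apply: eq_Rintegral => t; rewrite inE/= in_itv/= => /fg. Qed.
Lemma Ir_abs f x : x <= r -> L1r f -> `|Ir x f| <= Ir x (fun t => `|f t|).
Proof. by move=> xr hf; apply: le_normr_Rintegral => //; exact: L1r_sub. Qed.
Lemma Ir_cst c x : 0 <= x -> Ir x (fun=> c) = c * x.
Proof.
move=> x0; rewrite /Ir Rintegral_cst//= lebesgue_measure_itv/=.
rewrite lte_fin; case: ltP => /= [_|h]; first by rewrite oppr0 addr0.
by have -> : x = 0 by apply/eqP; rewrite eq_le x0 h.
Qed.
Lemma Ir_ge0 f x : (forall t, 0 <= t <= x -> 0 <= f t) -> 0 <= Ir x f.
Proof. by move=> h; apply: Rintegral_ge0 => t /=; rewrite in_itv; exact: h. Qed.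
Lemma Ir0 f : Ir 0 f = 0.
Proof. by rewrite /Ir set_itv1 Rintegral_set1. Qed.

Lemma Ir_mono f x y : 0 <= x <= y -> y <= r -> L1r f ->
  (forall t, 0 <= t <= y -> 0 <= f t) -> Ir x f <= Ir y f.
Proof.
move=> /andP[x0 xy] yr hf f0; rewrite -subr_ge0 /Ir Rintegral_itvB ?bnd_simp//.
  apply: Rintegral_ge0 => t /=; rewrite in_itv/= => /andP[xt ty].
  by rewrite f0// ty (le_trans x0 (ltW xt)).
exact: L1r_sub.
Qed.

Lemma within_cont_BM f : {within `[0, r], continuous f} -> BMr f.
Proof.
move=> cf; split; first exact: subspace_continuous_measurable_fun.
have [M [_ hM]] : bounded_set (f @` `[0, r]).
  by apply: compact_bounded; apply: continuous_compact => //; exact: segment_compact.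
exists (M + 1) => x xr; apply: (hM (M + 1)); first by rewrite ltrDl.
by exists x.
Qed.

Lemma Ir_cont f : L1r f -> {within `[0, r], continuous (fun x => Ir x f)}.
Proof. by move=> hf; apply: parameterized_integral_continuous => //; exact: ltW. Qed.

Lemma Ir_BM f : L1r f -> BMr (fun x => Ir x f).
Proof.
move=> hf; split.
  by apply: subspace_continuous_measurable_fun => //; exact: Ir_cont.
exists (Ir r (fun t => `|f t|)) => x /andP[x0 xr].
by rewrite (le_trans (Ir_abs xr hf))// Ir_mono ?x0//; exact: L1r_abs.
Qed.

(** Equality is assumed inside the open interval only, as in [ae_equal]; the end points 0 and r form
    a null set. *)
Lemma Ir_ae f g x : x <= r -> L1r f -> L1r g ->
  {ae mu, forall t, 0 < t < r -> f t = g t} -> Ir x f = Ir x g.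
Proof.
move=> xr hf hg fg; rewrite /Ir /Rintegral; congr fine.
apply: ae_eq_integral => //.
- by have /measurable_int := L1r_sub xr hf.
- by have /measurable_int := L1r_sub xr hg.
have h0 : {ae mu, forall t, t <> 0 /\ t <> r}.
  exists [set 0; r]; split.
  - exact: measurableU.
  - by apply/eqP; rewrite -measure_le0 (le_trans (measureU2 _ _ _))//= !lebesgue_measure_set1 adde0.
  - move=> t /= /not_andP[]/contrapT ->; [by left|by right].
apply: (aeS2 fg h0) => t h [t0 tr] /=; rewrite in_itv/= => /andP[t1 t2].
rewrite h// !lt_neqAle t1 (le_trans t2 xr) !andbT; apply/andP; split; last exact/eqP.
by rewrite eq_sym; exact/eqP.
Qed.

End RealIntegrals.

(** * Integration by parts for primitives of integrable functions *)

Section ProductRule.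
Context {R : realType}.
Variable r : R.
Hypothesis r0 : 0 < r.
Local Notation mu := (@lebesgue_measure R).
Local Notation Ir := (@Ir R).

(** The product is the integral of f(a) g(b) over the square [0, x]^2, and the two terms on the
    right are its parts over the triangles on either side of the diagonal. Fubini on the triangle a
    < b identifies the two iterated integrals. *)
Lemma Ir_prod (f g : R -> R) (x : R) : 0 <= x <= r -> L1r r f -> L1r r g ->
  Ir x f * Ir x g = Ir x (fun s => f s * Ir s g) + Ir x (fun s => Ir s f * g s).
Proof.
move=> /andP[x0 xr] hf hg.
have fx := L1r_sub xr hf; have gx := L1r_sub xr hg.
pose F : R -> R := f \_ `[0, x]; pose G : R -> R := g \_ `[0, x].
have iF : mu.-integrable setT (EFin \o F).
  by rewrite -restrict_EFin; apply/integrable_restrict => //; rewrite setTI.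
have iG : mu.-integrable setT (EFin \o G).
  by rewrite -restrict_EFin; apply/integrable_restrict => //; rewrite setTI.
have mF : measurable_fun setT F by apply/measurable_EFinP; exact: (measurable_int _ iF).
have mG : measurable_fun setT G by apply/measurable_EFinP; exact: (measurable_int _ iG).
(* The density f(a) g(b), cut off outside [0, x] and restricted to the triangle a < b. *)
pose h (z : R * R) := (F z.1 * G z.2 * (z.1 < z.2)%R%:R)%:E.
have mh : measurable_fun setT h.
  apply/measurable_EFinP; apply: measurable_funM.
    by apply: measurable_funM; apply: measurableT_comp.
  rewrite (_ : (fun _ => _) = \1_([set z : R * R | (z.1 < z.2)%R])); last first.
    by apply/funext => z; rewrite indicE mem_setE.
  apply: measurable_indic; rewrite -[X in measurable X]setTI.
  exact: (measurable_fun_ltr measurable_fst measurable_snd measurableT (Y := [set true])).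
have ih : (mu \x mu)%E.-integrable setT h.
  apply: (iffRL (@integrable12ltyP _ _ (measurableTypeR R) (measurableTypeR R) R mu mu h mh)).
  pose c := (\int[mu]_b (`|G b|)%:E)%E.
  have c0 : (0 <= c)%E by apply: integral_ge0 => b _; rewrite lee_fin.
  have cf : c \is a fin_num.
    by apply: integrable_fin_num => //; exact: integrable_norm.
  have E a : (\int[mu]_b (`|F a| * `|G b|)%:E = `|F a|%:E * c)%E.
    under eq_integral do rewrite EFinM.
    rewrite ge0_integralZl// ?lee_fin//.
    by apply/measurable_EFinP; exact: measurableT_comp.
  apply: (@le_lt_trans _ _ (\int[mu]_a (`|F a|%:E * c))%E).
    apply: ge0_le_integral => //.
    - by move=> a _; exact: integral_ge0.
    - apply: (@measurable_fun_fubini_tonelli_F _ _ (measurableTypeR R) (measurableTypeR R) R mu (fun z => `|h z|%E)) => //.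
      exact: measurableT_comp.
    - by apply: emeasurable_funM => //; apply/measurable_EFinP; exact: measurableT_comp.
    - move=> a _; rewrite -E; apply: ge0_le_integral => //.
      + apply: measurableT_comp => //; apply/measurable_EFinP; apply: measurable_funM.
          by rewrite /=; apply: measurable_funM.
        rewrite /= (_ : (fun _ => _) = \1_(`]a, +oo[%classic)).
          exact: measurable_indic.
        by apply/funext => z; rewrite indicE mem_setE in_itv/= andbT.
      + by apply/measurable_EFinP; apply: measurable_funM => //; exact: measurableT_comp.
      + move=> b _; rewrite lee_fin /= !normrM ler_piMr ?mulr_ge0//.
        by case: ltP => _; rewrite ?normr1 ?normr0.
  rewrite -(fineK cf) ge0_integralZr//.
  - rewrite fineK// lte_mul_pinfty//; first by apply: integral_ge0 => b _; rewrite lee_fin.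
      by apply: integrable_fin_num => //; exact: integrable_norm.
    by rewrite ltey_eq cf.
  - by apply/measurable_EFinP; exact: measurableT_comp.
  - by rewrite fineK.
have subx a y : 0 <= a <= x -> (y \in `]a, x] -> y \in `[0, x]).
  by move=> /andP[a0 _]; rewrite !in_itv/= => /andP[ay ->]; rewrite (le_trans a0 (ltW ay)).
have inner1 a : (\int[mu]_b h (a, b) = ((fun a => f a * (Ir x g - Ir a g)) \_ `[0, x] a)%:E)%E.
  rewrite patchE; case: ifPn => [|ax]; last first.
    by rewrite integral0_eq// => b _; rewrite /h /F/= patchE (negbTE ax) !mul0r.
  rewrite inE/= in_itv/= => /andP[a0 ax].
  rewrite /Ir Rintegral_itvB ?bnd_simp// -RintegralZl//; last first.
    apply: integrableS gx => // y /= /(subx a y); apply.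
    by rewrite a0 ax.
  rewrite /Rintegral fineK; last first.
    apply: integrable_fin_num => //.
    have gx' : mu.-integrable `]a, x] (EFin \o g).
      by apply: integrableS gx => // y /= /(subx a y); apply; rewrite a0 ax.
    exact: (integrable_EFinZl (f a) (measurable_itv _) gx').
  rewrite [RHS]integral_mkcond; apply: eq_integral => b _.
  rewrite /h /F/= !patchE; rewrite mem_set/= ?in_itv/= ?a0//.
  case: ifPn => [|/negP]; rewrite !inE/= !in_itv/=; last first.
    move=> hb; rewrite /G patchE; case: ifPn; last by rewrite mulr0 mul0r.
    rewrite inE/= in_itv/= => /andP[_ bx]; case: ltP; last by rewrite mulr0.
    by move=> ab; exfalso; apply: hb; rewrite ab.
  by move=> /andP[ab bx]; rewrite ab mulr1 /G patchE mem_set//= in_itv/= bx (le_trans a0 (ltW ab)).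
have inner2 b : (\int[mu]_a h (a, b) = ((fun b => Ir b f * g b) \_ `[0, x] b)%:E)%E.
  rewrite patchE; case: ifPn => [|bx]; last first.
    by rewrite integral0_eq// => a _; rewrite /h /G/= [(g \_ _) b]patchE (negbTE bx) mulr0 mul0r.
  rewrite inE/= in_itv/= => /andP[b0 bx].
  have ib : mu.-integrable `[0, b] (EFin \o f).
    by apply: L1r_sub hf; exact: le_trans xr.
  have ib' : mu.-integrable `[0, b[ (EFin \o f).
    by apply: integrableS ib => // y /=; rewrite !in_itv/= => /andP[-> /ltW].
  (* The strict inequality a < b leaves [0, b) as the slice; the missing end point is a null set. *)
  rewrite /Ir -Rintegral_itv_bndo_bndc// mulrC -RintegralZl//.
  rewrite /Rintegral fineK; last first.
    apply: integrable_fin_num => //.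
    exact: (integrable_EFinZl (g b) (measurable_itv _) ib').
  rewrite [RHS]integral_mkcond; apply: eq_integral => a _.
  have Gb : G b = g b by rewrite /G patchE mem_set//= in_itv/= b0.
  rewrite /h /= Gb patchE.
  case: ifPn => [|/negP]; rewrite !inE/= !in_itv/=; last first.
    move=> hb; rewrite /F patchE; case: ifPn; last by rewrite !mul0r.
    rewrite inE/= in_itv/= => /andP[a0 _]; case: ltP; last by rewrite mulr0.
    by move=> ab; exfalso; apply: hb; rewrite ab a0.
  move=> /andP[a0 ab]; rewrite ab mulr1 /F patchE mem_set//= ?in_itv/= ?a0 ?(le_trans (ltW ab))//.
  by rewrite mulrC.
have := Fubini ih.
under eq_integral do rewrite inner1.
under [RHS]eq_integral do rewrite inner2.
move=> /(congr1 fine) E0.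
have <- : Ir x (fun a => f a * (Ir x g - Ir a g)) = Ir x (fun b => Ir b f * g b).
  by rewrite /Ir [LHS]Rintegral_mkcond [RHS]Rintegral_mkcond; exact: E0.
have bg := Ir_BM r0 hg.
have E : Ir x (fun a => f a * (Ir x g - Ir a g)) = Ir x (fun a => Ir x g * f a + - (f a * Ir a g)).
  by apply: Ir_eq => t _; ring.
rewrite E (IrD xr) ?(IrN xr) ?(IrZ _ xr)//.
- by ring.
- exact: L1r_BM.
- exact: L1rZ.
- by apply: L1rN; exact: L1r_BM.
Qed.

End ProductRule.

(** * Complex integrals and functions with a square-integrable derivative *)

Section ComplexIntegrals.
Context {R : realType}.
Variable r : R.
Hypothesis r0 : 0 < r.
Local Notation C := (cplx R).
Local Notation mu := (@lebesgue_measure R).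
Local Notation L1r := (L1r r).
Local Notation L2r := (L2r r).
Local Notation BMr := (BMr r).
Implicit Types (f g F G : R -> C) (x : R).

Definition CBM f := BMr (fun t => Rez (f t)) /\ BMr (fun t => Imz (f t)).
Definition CL1 f := L1r (fun t => Rez (f t)) /\ L1r (fun t => Imz (f t)).
Definition CL2 f := L2r (fun t => Rez (f t)) /\ L2r (fun t => Imz (f t)).
Definition cint x f := cintegral `[0, x] f.

Lemma cintE x f : cint x f = Ir x (fun t => Rez (f t)) +i* Ir x (fun t => Imz (f t)).
Proof. by []. Qed.

Lemma eq_BMr (u v : R -> R) : (forall x, 0 <= x <= r -> u x = v x) -> BMr u -> BMr v.
Proof.
move=> uv [mu [B uB]]; split; last by exists B => x xr; rewrite -uv// uB.
by apply: eq_measurable_fun mu => x; rewrite inE/= in_itv/=; exact: uv.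
Qed.
Lemma eq_L1r (u v : R -> R) : (forall x, 0 <= x <= r -> u x = v x) -> L1r u -> L1r v.
Proof.
move=> uv; apply: eq_integrable => // x; rewrite inE/= in_itv/= => h.
by rewrite uv.
Qed.
Lemma eq_L2r (u v : R -> R) : (forall x, 0 <= x <= r -> u x = v x) -> L2r u -> L2r v.
Proof.
move=> uv [mu u2]; split; first by apply: eq_measurable_fun mu => x; rewrite inE/= in_itv/=; exact: uv.
by apply: (@eq_L1r (fun x => u x ^+ 2) (fun x => v x ^+ 2)) u2 => x /uv ->.
Qed.
Lemma eq_CBM f g : (forall x, 0 <= x <= r -> f x = g x) -> CBM f -> CBM g.
Proof. by move=> fg [h1 h2]; split; [apply: eq_BMr h1|apply: eq_BMr h2] => x /fg ->. Qed.
Lemma eq_CL1 f g : (forall x, 0 <= x <= r -> f x = g x) -> CL1 f -> CL1 g.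
Proof. by move=> fg [h1 h2]; split; [apply: eq_L1r h1|apply: eq_L1r h2] => x /fg ->. Qed.
Lemma eq_CL2 f g : (forall x, 0 <= x <= r -> f x = g x) -> CL2 f -> CL2 g.
Proof. by move=> fg [h1 h2]; split; [apply: eq_L2r h1|apply: eq_L2r h2] => x /fg ->. Qed.

Lemma CBM_cst c : CBM (fun=> c). Proof. by split; exact: BMr_cst. Qed.
Lemma CBM_D f g : CBM f -> CBM g -> CBM (fun x => f x + g x).
Proof.
move=> [h1 h2] [k1 k2]; split.
  by apply: eq_BMr (BMrD h1 k1) => x _; rewrite reimE.
by apply: eq_BMr (BMrD h2 k2) => x _; rewrite reimE.
Qed.
Lemma CBM_M f g : CBM f -> CBM g -> CBM (fun x => f x * g x).
Proof.
move=> [h1 h2] [k1 k2]; split.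
  by apply: eq_BMr (BMrD (BMrM h1 k1) (BMrN (BMrM h2 k2))) => x _; rewrite reimE.
by apply: eq_BMr (BMrD (BMrM h1 k2) (BMrM h2 k1)) => x _; rewrite reimE.
Qed.
Lemma CBM_J f : CBM f -> CBM (fun x => (f x)^*).
Proof.
move=> [h1 h2]; split; first by apply: eq_BMr h1 => x _; rewrite reimE.
by apply: eq_BMr (BMrN h2) => x _; rewrite reimE.
Qed.
Lemma CBM_Z c f : CBM f -> CBM (fun x => c * f x).
Proof. by move=> hf; apply: CBM_M => //; exact: CBM_cst. Qed.
Lemma CBM_N f : CBM f -> CBM (fun x => - f x).
Proof. by move=> hf; apply: eq_CBM (CBM_Z (-1) hf) => x _; rewrite mulN1r. Qed.
Lemma CBM_sum I (s : seq I) (P : pred I) (f : I -> R -> C) : (forall i, CBM (f i)) ->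
  CBM (fun x => \sum_(i <- s | P i) f i x).
Proof.
move=> hf; elim: s => [|i s IH].
  by apply: eq_CBM (CBM_cst 0) => x _; rewrite big_nil.
case Pi: (P i).
  by apply: eq_CBM (CBM_D (hf i) IH) => x _; rewrite big_cons Pi.
by apply: eq_CBM IH => x _; rewrite big_cons Pi.
Qed.
Lemma CBM_bound f : CBM f -> exists2 B : R, 0 <= B & forall x, 0 <= x <= r -> cabs (f x) <= B.
Proof.
move=> [[_ [B hB]] [_ [D hD]]]; have h0 : (0 : R) <= 0 <= r by rewrite lexx ltW.
exists (B + D); first by rewrite addr_ge0// (le_trans _ (hB 0 h0), le_trans _ (hD 0 h0)).
by move=> x xr; rewrite (le_trans (cabs_le _))// lerD ?hB ?hD.
Qed.
Lemma CBM_CL2 f : CBM f -> CL2 f.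
Proof. by move=> [h1 h2]; split; exact: BMr_L2. Qed.
Lemma CL2_CL1 f : CL2 f -> CL1 f.
Proof. by move=> [h1 h2]; split; exact: L2r_L1. Qed.
Lemma CBM_CL1 f : CBM f -> CL1 f.
Proof. by move=> /CBM_CL2/CL2_CL1. Qed.

Lemma CL1_D f g : CL1 f -> CL1 g -> CL1 (fun x => f x + g x).
Proof.
move=> [h1 h2] [k1 k2]; split.
  by apply: eq_L1r (L1rD h1 k1) => x _; rewrite reimE.
by apply: eq_L1r (L1rD h2 k2) => x _; rewrite reimE.
Qed.
Lemma CL1_BM f g : CL1 f -> CBM g -> CL1 (fun x => f x * g x).
Proof.
move=> [h1 h2] [k1 k2]; split.
  by apply: eq_L1r (L1rD (L1r_BM h1 k1) (L1rN (L1r_BM h2 k2))) => x _; rewrite reimE.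
by apply: eq_L1r (L1rD (L1r_BM h1 k2) (L1r_BM h2 k1)) => x _; rewrite reimE.
Qed.
Lemma CL1_Z c f : CL1 f -> CL1 (fun x => c * f x).
Proof. by move=> hf; apply: eq_CL1 (CL1_BM hf (CBM_cst c)) => x _; rewrite mulrC. Qed.
Lemma CL1_N f : CL1 f -> CL1 (fun x => - f x).
Proof. by move=> hf; apply: eq_CL1 (CL1_Z (-1) hf) => x _; rewrite mulN1r. Qed.

Lemma CL2_D f g : CL2 f -> CL2 g -> CL2 (fun x => f x + g x).
Proof.
move=> [h1 h2] [k1 k2]; split.
  by apply: eq_L2r (L2rD h1 k1) => x _; rewrite reimE.
by apply: eq_L2r (L2rD h2 k2) => x _; rewrite reimE.
Qed.
Lemma CL2_BM f g : CL2 f -> CBM g -> CL2 (fun x => f x * g x).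
Proof.
move=> [h1 h2] [k1 k2]; split.
  by apply: eq_L2r (L2rD (L2r_BM h1 k1) (L2rN (L2r_BM h2 k2))) => x _; rewrite reimE.
by apply: eq_L2r (L2rD (L2r_BM h1 k2) (L2r_BM h2 k1)) => x _; rewrite reimE.
Qed.
Lemma CL2_Z c f : CL2 f -> CL2 (fun x => c * f x).
Proof. by move=> hf; apply: eq_CL2 (CL2_BM hf (CBM_cst c)) => x _; rewrite mulrC. Qed.
Lemma CL2_N f : CL2 f -> CL2 (fun x => - f x).
Proof. by move=> hf; apply: eq_CL2 (CL2_Z (-1) hf) => x _; rewrite mulN1r. Qed.
Lemma CL2_J f : CL2 f -> CL2 (fun x => (f x)^*).
Proof.
move=> [h1 h2]; split; first by apply: eq_L2r h1 => x _; rewrite reimE.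
by apply: eq_L2r (L2rN h2) => x _; rewrite reimE.
Qed.
Lemma CL2_sum I (s : seq I) (P : pred I) (f : I -> R -> C) : (forall i, CL2 (f i)) ->
  CL2 (fun x => \sum_(i <- s | P i) f i x).
Proof.
move=> hf; elim: s => [|i s IH].
  by apply: eq_CL2 (CBM_CL2 (CBM_cst 0)) => x _; rewrite big_nil.
case Pi: (P i).
  by apply: eq_CL2 (CL2_D (hf i) IH) => x _; rewrite big_cons Pi.
by apply: eq_CL2 IH => x _; rewrite big_cons Pi.
Qed.

Lemma cintD f g x : x <= r -> CL1 f -> CL1 g ->
  cint x (fun t => f t + g t) = cint x f + cint x g.
Proof.
move=> xr [h1 h2] [k1 k2]; apply: complex_ext; rewrite !cintE reimE /= -(IrD xr)//;
by apply: Ir_eq => t _; rewrite reimE.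
Qed.
Lemma cintZ c f x : x <= r -> CL1 f -> cint x (fun t => c * f t) = c * cint x f.
Proof.
move=> xr [h1 h2]; apply: complex_ext; rewrite !cintE reimE /= -!(IrZ _ xr)//.
  have a1 := L1rZ (Rez c) h1; have a2 := L1rZ (Imz c) h2.
  rewrite -(IrN xr a2) -(IrD xr a1 (L1rN a2)).
  by apply: Ir_eq => t _; rewrite reimE.
rewrite -(IrD xr); [|exact: L1rZ..].
by apply: Ir_eq => t _; rewrite reimE.
Qed.
Lemma cintN f x : x <= r -> CL1 f -> cint x (fun t => - f t) = - cint x f.
Proof.
move=> xr hf; rewrite -mulN1r -cintZ//; congr cint; apply/funext => t.
by rewrite mulN1r.
Qed.
Lemma cint_eq f g x : (forall t, 0 <= t <= x -> f t = g t) -> cint x f = cint x g.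
Proof. by move=> fg; rewrite !cintE; congr (_ +i* _); apply: Ir_eq => t /fg ->. Qed.
Lemma cint_ae f g x : x <= r -> CL1 f -> CL1 g ->
  {ae mu, forall t, 0 < t < r -> f t = g t} -> cint x f = cint x g.
Proof.
move=> xr [h1 h2] [k1 k2] fg; rewrite !cintE; congr (_ +i* _).
  by apply: (@Ir_ae _ r) => //; apply: (aeS fg) => t h /h ->.
by apply: (@Ir_ae _ r) => //; apply: (aeS fg) => t h /h ->.
Qed.
Lemma cintJ f x : x <= r -> CL1 f -> cint x (fun t => (f t)^*) = (cint x f)^*.
Proof.
move=> xr [h1 h2]; apply: complex_ext; rewrite !cintE reimE /=.
  by apply: Ir_eq => t _; rewrite reimE.
by rewrite -(IrN xr h2); apply: Ir_eq => t _; rewrite reimE.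
Qed.
Lemma cint0 f : cint 0 f = 0.
Proof. by rewrite cintE !Ir0. Qed.
Lemma cint_cst c x : 0 <= x -> cint x (fun=> c) = c * x%:C.
Proof.
move=> x0; rewrite cintE !Ir_cst//; apply: complex_ext; by rewrite reimE /= ?mulr0 ?subr0 ?add0r.
Qed.
Lemma cint_sum I (s : seq I) (P : pred I) (f : I -> R -> C) x : x <= r ->
  (forall i, CL1 (f i)) ->
  cint x (fun t => \sum_(i <- s | P i) f i t) = \sum_(i <- s | P i) cint x (f i).
Proof.
move=> xr hf; have h s' : CL1 (fun t => \sum_(i <- s' | P i) f i t) /\
    cint x (fun t => \sum_(i <- s' | P i) f i t) = \sum_(i <- s' | P i) cint x (f i).
  elim: s' => [|i s' [IH1 IH2]].
    split; first by apply: eq_CL1 (CBM_CL1 (CBM_cst 0)) => t _; rewrite big_nil.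
    rewrite big_nil (cint_eq (g := fun=> 0)); last by move=> t _; rewrite big_nil.
    by rewrite cintE /Ir /Rintegral integral0.
  case Pi: (P i); last first.
    split; first by apply: eq_CL1 IH1 => t _; rewrite big_cons Pi.
    by rewrite big_cons Pi -IH2; apply: cint_eq => t _; rewrite big_cons Pi.
  split; first by apply: eq_CL1 (CL1_D (hf i) IH1) => t _; rewrite big_cons Pi.
  by rewrite big_cons Pi -IH2 -cintD//; apply: cint_eq => t _; rewrite big_cons Pi.
by case: (h s).
Qed.

Lemma L1r_cabs f : CL1 f -> L1r (fun t => cabs (f t)).
Proof.
move=> [h1 h2]; apply: (@L1r_le _ r _ (fun t => `|Rez (f t)| + `|Imz (f t)|)).
- apply: (measurable_comp (F := setT) (f := fun y : R => Num.sqrt y)) => //.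
    by apply: continuous_measurable_fun; exact: sqrt_continuous.
  by apply: measurable_funD; apply: measurable_funX; exact: L1r_meas.
- by apply: L1rD; exact: L1r_abs.
by move=> t _; rewrite ger0_norm// ger0_norm ?addr_ge0// cabs_le.
Qed.

(** Multiplication by a unimodular constant makes the integral a nonnegative real number, and then
    the real inequality for the real part applies. *)
Lemma cint_abs f x : x <= r -> CL1 f -> cabs (cint x f) <= Ir x (fun t => cabs (f t)).
Proof.
move=> xr hf; have [->|I0] := eqVneq (cint x f) 0; first by rewrite cabs0 Ir_ge0.
pose w := (cint x f)^* / (cabs (cint x f))%:C.
have c0 : 0 < cabs (cint x f) by rewrite cabs_gt0.
have wI : w * cint x f = (cabs (cint x f))%:C.
  by rewrite /w mulrAC mulCJ expr2 CM mulfK// C_eq0 gt_eqF.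
have w1 : cabs w = 1.
  by rewrite /w cabsM cabsV cabsJ cabs_real ger0_norm// divff// gt_eqF.
have -> : cabs (cint x f) = Ir x (fun t => Rez (w * f t)).
  by have := congr1 Rez wI; rewrite -cintZ//= => <-.
apply: (Ir_le xr); [by case: (CL1_Z w hf)|exact: L1r_cabs|].
move=> t _; rewrite (le_trans (ler_norm _))// (le_trans (cabs_Re _))//.
by rewrite cabsM w1 mul1r.
Qed.

Lemma cint_le f (g : R -> R) x : x <= r -> CL1 f -> L1r g ->
  (forall t, 0 <= t <= x -> cabs (f t) <= g t) -> cabs (cint x f) <= Ir x g.
Proof.
move=> xr hf hg fg; apply: (le_trans (cint_abs xr hf)).
by apply: (Ir_le xr) => //; exact: L1r_cabs.
Qed.

Lemma cint_le_cst f B x : 0 <= x <= r -> CL1 f ->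
  (forall t, 0 <= t <= x -> cabs (f t) <= B) -> cabs (cint x f) <= B * x.
Proof.
move=> /andP[x0 xr] hf fB; rewrite -(Ir_cst B x0).
by apply: cint_le => //; exact: BMr_L1 (BMr_cst r B).
Qed.

Lemma CBM_cint f : CL1 f -> CBM (fun x => cint x f).
Proof. by move=> [h1 h2]; split; exact: Ir_BM. Qed.

(** Class W^{1,2}, with the density [f] carried along: a pointwise derivative exists in general only
    almost everywhere. *)
Definition AC F f := CL2 f /\ forall x, 0 <= x <= r -> F x = F 0 + cint x f.

Lemma AC_L1 F f : AC F f -> CL1 f. Proof. by move=> [/CL2_CL1]. Qed.

Lemma AC_BM F f : AC F f -> CBM F.
Proof.
move=> hF; have := CBM_D (CBM_cst (F 0)) (CBM_cint (AC_L1 hF)).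
by move=> h; apply: eq_CBM h => x xr; case: hF => _ hh; rewrite -hh.
Qed.

Lemma AC_ext F f G g : (forall x, 0 <= x <= r -> F x = G x) ->
  (forall x, 0 <= x <= r -> f x = g x) -> AC F f -> AC G g.
Proof.
move=> FG fg [h1 h2]; split; first exact: eq_CL2 h1.
move=> x xr; rewrite -!FG ?lexx ?(ltW r0)// h2//; congr (_ + _); apply: cint_eq => t /andP[t0 tx].
by apply: fg; rewrite t0 (le_trans tx)//; case/andP: xr.
Qed.

Lemma AC_ext_ae F f g : CL2 g -> {ae mu, forall x, 0 < x < r -> f x = g x} -> AC F f -> AC F g.
Proof.
move=> hg fg [h1 h2]; split=> // x xr; rewrite h2//; congr (_ + _).
by apply: cint_ae => //; [case/andP: xr|exact: CL2_CL1..].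
Qed.

Lemma AC_cst c : AC (fun=> c) (fun=> 0).
Proof.
split; first exact: CBM_CL2 (CBM_cst 0).
by move=> x /andP[x0 _]; rewrite cint_cst// mul0r addr0.
Qed.

Lemma AC_cint c f : CL2 f -> AC (fun x => c + cint x f) f.
Proof. by move=> hf; split=> // x xr; rewrite cint0 addr0. Qed.

Lemma AC_D F f G g : AC F f -> AC G g -> AC (fun x => F x + G x) (fun x => f x + g x).
Proof.
move=> [h1 h2] [k1 k2]; split; first exact: CL2_D.
move=> x xr; rewrite cintD; [|by case/andP: xr|exact: CL2_CL1..].
by rewrite h2// k2//; ring.
Qed.

Lemma AC_Z c F f : AC F f -> AC (fun x => c * F x) (fun x => c * f x).
Proof.
move=> [h1 h2]; split; first exact: CL2_Z.
move=> x xr; rewrite cintZ; [|by case/andP: xr|exact: CL2_CL1].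
by rewrite h2//; ring.
Qed.

Lemma AC_N F f : AC F f -> AC (fun x => - F x) (fun x => - f x).
Proof. by move=> /(AC_Z (-1)); apply: AC_ext => x _; rewrite mulN1r. Qed.

Lemma AC_J F f : AC F f -> AC (fun x => (F x)^*) (fun x => (f x)^*).
Proof.
move=> [h1 h2]; split; first exact: CL2_J.
move=> x xr; rewrite cintJ; [|by case/andP: xr|exact: CL2_CL1].
by rewrite h2// rmorphD.
Qed.

Lemma AC_sum I (s : seq I) (P : pred I) (F f : I -> R -> C) :
  (forall i, AC (F i) (f i)) ->
  AC (fun x => \sum_(i <- s | P i) F i x) (fun x => \sum_(i <- s | P i) f i x).
Proof.
move=> hF; split; first by apply: CL2_sum => i; case: (hF i).
move=> x xr; rewrite cint_sum; [|by case/andP: xr|by move=> i; exact: AC_L1 (hF i)].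
by rewrite -big_split/=; apply: eq_bigr => i _; case: (hF i) => _ ->.
Qed.

Lemma cint_prod f g x : 0 <= x <= r -> CL1 f -> CL1 g ->
  cint x f * cint x g = cint x (fun t => f t * cint t g) + cint x (fun t => cint t f * g t).
Proof.
move=> xr hf hg; have xr' : x <= r by case/andP: xr.
have [f1 f2] := hf; have [g1 g2] := hg.
have I1 u v : L1r u -> L1r v -> L1r (fun t => u t * Ir t v).
  by move=> hu hv; apply: L1r_BM => //; exact: Ir_BM.
have I2 u v : L1r u -> L1r v -> L1r (fun t => Ir t u * v t).
  by move=> hu hv; apply: eq_L1r (I1 _ _ hv hu) => t _; rewrite mulrC.
have e1 : cint x (fun t => f t * cint t g) =
  (Ir x (fun t => Rez (f t) * Ir t (fun t => Rez (g t))) - Ir x (fun t => Imz (f t) * Ir t (fun t => Imz (g t))))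
  +i* (Ir x (fun t => Rez (f t) * Ir t (fun t => Imz (g t))) + Ir x (fun t => Imz (f t) * Ir t (fun t => Rez (g t)))).
  rewrite cintE; congr (_ +i* _).
    rewrite -(IrN xr') -?(IrD xr'); [|exact: I1|by apply: L1rN; exact: I1|exact: I1].
    by apply: Ir_eq => t _; rewrite reimE.
  rewrite -(IrD xr'); [|exact: I1..].
  by apply: Ir_eq => t _; rewrite reimE.
have e2 : cint x (fun t => cint t f * g t) =
  (Ir x (fun t => Ir t (fun t => Rez (f t)) * Rez (g t)) - Ir x (fun t => Ir t (fun t => Imz (f t)) * Imz (g t)))
  +i* (Ir x (fun t => Ir t (fun t => Rez (f t)) * Imz (g t)) + Ir x (fun t => Ir t (fun t => Imz (f t)) * Rez (g t))).
  rewrite cintE; congr (_ +i* _).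
    rewrite -(IrN xr') -?(IrD xr'); [|exact: I2|by apply: L1rN; exact: I2|exact: I2].
    by apply: Ir_eq => t _; rewrite reimE.
  rewrite -(IrD xr'); [|exact: I2..].
  by apply: Ir_eq => t _; rewrite reimE.
rewrite e1 e2 !cintE; apply: complex_ext; rewrite !reimE /=.
  by rewrite (Ir_prod r0 xr f1 g1) (Ir_prod r0 xr f2 g2) opprD addrACA.
by rewrite (Ir_prod r0 xr f1 g2) (Ir_prod r0 xr f2 g1) addrACA.
Qed.

(** After subtraction of the initial values this is [cint_prod]. *)
Lemma AC_M F f G g : AC F f -> AC G g ->
  AC (fun x => F x * G x) (fun x => f x * G x + F x * g x).
Proof.
move=> hF hG; have FB := AC_BM hF; have GB := AC_BM hG.
have [h1 h2] := hF; have [k1 k2] := hG.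
have m1 : CL2 (fun x => f x * G x) by exact: CL2_BM.
have m2 : CL2 (fun x => F x * g x).
  by apply: eq_CL2 (CL2_BM k1 FB) => t _; rewrite mulrC.
split; first exact: CL2_D.
move=> x xr; have xr' : x <= r by case/andP: xr.
have f1 := AC_L1 hF; have g1 := AC_L1 hG.
rewrite cintD//; [|exact: CL2_CL1..].
have n1 : CL1 (fun t => f t * cint t g) by apply: CL1_BM => //; exact: CBM_cint.
have n2 : CL1 (fun t => cint t f * g t).
  by apply: eq_CL1 (CL1_BM g1 (CBM_cint f1)) => t _; rewrite mulrC.
have -> : cint x (fun t => f t * G t) = G 0 * cint x f + cint x (fun t => f t * cint t g).
  rewrite -cintZ// -cintD//; last exact: CL1_Z.
  apply: cint_eq => t /andP[t0 tx]; rewrite k2 ?t0 ?(le_trans tx)//; ring.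
have -> : cint x (fun t => F t * g t) = F 0 * cint x g + cint x (fun t => cint t f * g t).
  rewrite -cintZ// -cintD//; last exact: CL1_Z.
  apply: cint_eq => t /andP[t0 tx]; rewrite h2 ?t0 ?(le_trans tx)//; ring.
rewrite h2// k2// mulrDr !mulrDl -(addrA (F 0 * G 0)).
have := cint_prod xr f1 g1; move=> E.
rewrite [X in _ + X = _](_ : _ = (cint x f * G 0 + F 0 * cint x g) + (cint x f * cint x g)); last by ring.
by rewrite E; ring.
Qed.

Lemma AC_cont F f : AC F f -> {within `[0, r], continuous (fun x => Rez (F x))} /\
  {within `[0, r], continuous (fun x => Imz (F x))}.
Proof.
move=> [/CL2_CL1[f1 f2] h]; split.
  have := within_continuousD (@continuous_subspaceT _ _ `[0, r]%classic (cst (Rez (F 0))) (@cst_continuous _ _ _)) (Ir_cont r0 f1).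
  apply: subspace_eq_continuous => x; rewrite inE/= in_itv/= => /h hx.
  by rewrite /from_subspace /= hx reimE cintE.
have := within_continuousD (@continuous_subspaceT _ _ `[0, r]%classic (cst (Imz (F 0))) (@cst_continuous _ _ _)) (Ir_cont r0 f2).
apply: subspace_eq_continuous => x; rewrite inE/= in_itv/= => /h hx.
by rewrite /from_subspace /= hx reimE cintE.
Qed.

(* Within [0, r], one-sided at the end points. *)
Definition rderiv (F : R -> R) (x l : R) := forall e : R, 0 < e ->
  exists2 d : R, 0 < d & forall y, 0 <= y <= r -> y != x -> `|y - x| < d ->
    `|(y - x)^-1 * (F y - F x) - l| < e.

Definition rcont (F : R -> R) (x : R) := forall e : R, 0 < e ->
  exists2 d : R, 0 < d & forall y, 0 <= y <= r -> `|y - x| < d -> `|F y - F x| < e.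

Lemma within_rcont (F : R -> R) : (forall x, 0 <= x <= r -> rcont F x) ->
  {within `[0, r], continuous F}.
Proof.
move=> h; apply/continuous_within_itvP => //; split.
- move=> x; rewrite in_itv/= => /andP[x0 xr]; apply/cvgrPdist_lt => e e0.
  have [|d d0 hd] := h x _ e e0; first by rewrite !ltW.
  near=> y; rewrite distrC; apply: hd.
    by apply/andP; split; apply: ltW; near: y; [exact: lt_nbhsr|exact: lt_nbhsl].
  by near: y; apply/nbhs_normP; exists d => // y; rewrite /ball_/= distrC.
- apply/cvgrPdist_lt => e e0.
  have [|d d0 hd] := h 0 _ e e0; first by rewrite lexx ltW.
  near=> y; rewrite distrC; apply: hd.
    by apply/andP; split; apply: ltW; near: y; [exact: nbhs_right_gt|exact: nbhs_right_lt].
  have y0 : 0 < y by near: y; exact: nbhs_right_gt.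
  by rewrite subr0 gtr0_norm//; near: y; exact: nbhs_right_lt.
- apply/cvgrPdist_lt => e e0.
  have [|d d0 hd] := h r _ e e0; first by rewrite lexx ltW.
  near=> y; rewrite distrC; apply: hd.
    by apply/andP; split; apply: ltW; near: y; [exact: nbhs_left_gt|exact: nbhs_left_lt].
  have yr : y < r by near: y; exact: nbhs_left_lt.
  rewrite distrC gtr0_norm ?subr_gt0// ltrBlDr -ltrBlDl; near: y; apply: nbhs_left_gt.
  by rewrite gtrBl.
Unshelve. all: by end_near.
Qed.

Lemma within_cont_rcont (F : R -> R) : {within `[0, r], continuous F} ->
  forall x, 0 <= x <= r -> rcont F x.
Proof.
move=> /subspace_continuousP h x xr e e0.
have /(h x) : `[0, r]%classic x by rewrite /= in_itv.
move=> /cvgrPdist_lt/(_ _ e0); rewrite near_withinE => /nbhs_normP[d /= d0 hd].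
exists d => // y yr yd; rewrite distrC; apply: hd; last by rewrite /= in_itv.
by rewrite /ball_/= distrC.
Qed.

Lemma rderiv_rcont (F : R -> R) x l : rderiv F x l -> rcont F x.
Proof.
move=> h e e0; have [d d0 hd] := h 1 ltr01.
have K0 : 0 < `|l| + 1 by rewrite ltr_wpDl.
exists (Num.min d (e / (`|l| + 1))); first by rewrite lt_min d0 divr_gt0.
move=> y yr; rewrite lt_min => /andP[y1]; rewrite ltr_pdivlMr// => y2.
have [->|yx] := eqVneq y x; first by rewrite subrr normr0.
have h1 := hd y yr yx y1; apply: le_lt_trans y2.
have -> : F y - F x = (y - x) * ((y - x)^-1 * (F y - F x)).
  by rewrite mulrA divff ?mul1r// subr_eq0.
rewrite normrM ler_wpM2l// -lerBlDl (le_trans (lerB_dist _ _))//; exact: ltW.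
Qed.

Lemma rderiv_is_derive (F : R -> R) x l : 0 < x < r -> rderiv F x l -> is_derive x 1 F l.
Proof.
move=> /andP[x0 xr] h; apply/is_derive1_caratheodory.
exists (fun y => if y == x then l else (y - x)^-1 * (F y - F x)); split.
- move=> y; case: eqP => [->|/eqP yx]; first by rewrite !subrr mulr0.
  by rewrite mulrC mulrA divff ?mul1r// subr_eq0.
- apply/cvgrPdist_lt => e e0; rewrite eqxx; have [d d0 hd] := h e e0.
  near=> y.
  have yr : 0 <= y <= r.
    by apply/andP; split; apply: ltW; near: y; [exact: lt_nbhsr|exact: lt_nbhsl].
  have yd : `|y - x| < d.
    by near: y; apply/nbhs_normP; exists d => // y; rewrite /ball_/= distrC.
  case: eqP => [_|/eqP yx]; first by rewrite subrr normr0.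
  by rewrite distrC; apply: hd.
- by rewrite eqxx.
Unshelve. all: by end_near.
Qed.

Lemma Ir_FTC2 (F f : R -> R) x : 0 <= x <= r ->
  (forall x, 0 <= x <= r -> rderiv F x (f x)) -> (forall x, 0 <= x <= r -> rcont f x) ->
  F x = F 0 + Ir x f.
Proof.
move=> /andP[]; rewrite le_eqVlt => /predU1P[<- _ _ _|x0 xr dF cf]; first by rewrite Ir0 addr0.
have sub y : 0 <= y <= x -> 0 <= y <= r by move=> /andP[-> /le_trans]; apply.
have cF : {within `[0, r], continuous F}.
  by apply: within_rcont => y yr; exact: rderiv_rcont (dF y yr).
have cFx : {within `[0, x], continuous F}.
  by apply: continuous_subspaceW cF => y /=; rewrite !in_itv/=; exact: sub.
have cfx : {within `[0, x], continuous f}.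
  apply: (@continuous_subspaceW _ _ _ `[0, r]) => [y /=|]; first by rewrite !in_itv/=; exact: sub.
  exact: within_rcont.
have der y : y \in `]0, x[ -> is_derive y 1 F (f y).
  rewrite in_itv/= => /andP[y0 yx]; apply: rderiv_is_derive; first by rewrite y0 (lt_le_trans yx).
  by apply: dF; rewrite !ltW// (lt_le_trans yx).
have [_ cF0 cFx'] := (continuous_within_itvP F x0).1 cFx.
rewrite /Ir /Rintegral (continuous_FTC2 x0 cfx (F := F)).
- by rewrite -EFinB /= addrC subrK.
- by split=> // y /der [].
- by move=> y /der h; rewrite derive1E; case: h.
Qed.

Definition Cderiv (F : R -> C) x l := forall e : R, 0 < e ->
  exists2 d : R, 0 < d & forall y, 0 <= y <= r -> y != x -> `|y - x| < d ->
    cabs (((y - x)^-1)%:C * (F y - F x) - l) < e.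
Definition Ccont (F : R -> C) x := forall e : R, 0 < e ->
  exists2 d : R, 0 < d & forall y, 0 <= y <= r -> `|y - x| < d -> cabs (F y - F x) < e.

Lemma Cderiv_reim F x l : Cderiv F x l -> rderiv (fun t => Rez (F t)) x (Rez l) /\
  rderiv (fun t => Imz (F t)) x (Imz l).
Proof.
move=> h; split=> e e0; have [d d0 hd] := h e e0; exists d => // y yr yx yd.
  apply: le_lt_trans (hd y yr yx yd); apply: le_trans (cabs_Re _).
  by rewrite !reimE /= mul0r subr0.
apply: le_lt_trans (hd y yr yx yd); apply: le_trans (cabs_Im _).
by rewrite !reimE /= mul0r addr0.
Qed.

Lemma Ccont_reim F x : Ccont F x -> rcont (fun t => Rez (F t)) x /\ rcont (fun t => Imz (F t)) x.
Proof.
move=> h; split=> e e0; have [d d0 hd] := h e e0; exists d => // y yr yd.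
  apply: le_lt_trans (hd y yr yd); apply: le_trans (cabs_Re _); by rewrite !reimE.
apply: le_lt_trans (hd y yr yd); apply: le_trans (cabs_Im _); by rewrite !reimE.
Qed.

Lemma Ccont_CBM F : (forall x, 0 <= x <= r -> Ccont F x) -> CBM F.
Proof.
move=> h; split; apply: within_cont_BM; apply: within_rcont => x /h /Ccont_reim [] //.
Qed.

Lemma AC_deriv F f : (forall x, 0 <= x <= r -> Cderiv F x (f x)) ->
  (forall x, 0 <= x <= r -> Ccont f x) -> AC F f.
Proof.
move=> dF cf; split; first exact/CBM_CL2/Ccont_CBM.
move=> x xr; apply: complex_ext; rewrite cintE reimE /=.
  apply: (@Ir_FTC2 (fun t => Rez (F t)) (fun t => Rez (f t))) => // y yr.
    by case: (Cderiv_reim (dF y yr)).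
  by case: (Ccont_reim (cf y yr)).
apply: (@Ir_FTC2 (fun t => Imz (F t)) (fun t => Imz (f t))) => // y yr.
- by case: (Cderiv_reim (dF y yr)).
- by case: (Ccont_reim (cf y yr)).
Qed.

(** The bound is asked for on (x, y] only; the factor 2 comes from treating real and imaginary parts
    separately. *)
Lemma cint_split f x y : 0 <= x <= y -> y <= r -> CL1 f -> forall B : R,
  (forall t, x < t <= y -> cabs (f t) <= B) -> cabs (cint y f - cint x f) <= 2 * B * (y - x).
Proof.
move=> /andP[x0 xy] yr [f1 f2] B hB.
have key (u : R -> R) : L1r u -> (forall t, x < t <= y -> `|u t| <= B) -> `|Ir y u - Ir x u| <= B * (y - x).
  move=> hu uB; have hy := L1r_sub yr hu.
  rewrite /Ir Rintegral_itvB ?bnd_simp//.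
  have hs : mu.-integrable `]x, y] (EFin \o u).
    by apply: integrableS hy => // t /=; rewrite !in_itv/= => /andP[xt ->]; rewrite (le_trans x0 (ltW xt)).
  have hc : mu.-integrable `]x, y] (EFin \o cst B).
    have := L1r_sub yr (BMr_L1 (BMr_cst r B)).
    by apply: integrableS => // t /=; rewrite !in_itv/= => /andP[xt ->]; rewrite (le_trans x0 (ltW xt)).
  apply: (le_trans (le_normr_Rintegral _ hs)) => //.
  apply: (@le_trans _ _ (\int[mu]_(t in `]x, y]) B)).
    apply: le_Rintegral => //; first exact: integrable_norm.
  rewrite Rintegral_cst//= lebesgue_measure_itv/= lte_fin.
  case: ltP => [_|yx] /=; first by [].
  by have -> : y = x; [apply/eqP; rewrite eq_le yx|rewrite subrr mulr0].
have e : cint y f - cint x f = (Ir y (fun t => Rez (f t)) - Ir x (fun t => Rez (f t))) +i* (Ir y (fun t => Imz (f t)) - Ir x (fun t => Imz (f t))).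
  by apply: complex_ext; rewrite !reimE.
rewrite e (le_trans (cabs_le _))//= -mulrA mulr_natl mulr2n lerD// key// => t tx.
  by rewrite (le_trans (cabs_Re _))// hB.
by rewrite (le_trans (cabs_Im _))// hB.
Qed.

Lemma AC_Ccont F f : AC F f -> forall x, 0 <= x <= r -> Ccont F x.
Proof.
move=> /AC_cont[h1 h2] x xr e e0.
have e2 : 0 < e / 2 by rewrite divr_gt0.
have [d d0 hd] := within_cont_rcont h1 xr e2.
have [d' d0' hd'] := within_cont_rcont h2 xr e2.
exists (Num.min d d'); first by rewrite lt_min d0.
move=> y yr; rewrite lt_min => /andP[y1 y2].
rewrite (le_lt_trans (cabs_le _))// !reimE (splitr e) ltrD//; [exact: hd|exact: hd'].
Qed.

(** F y - F x - (y - x) f x is the integral of f - f x between x and y, which continuity of [f] at x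
    makes small against y - x. *)
Lemma AC_Cderiv F f : AC F f -> (forall x, 0 <= x <= r -> Ccont f x) ->
  forall x, 0 <= x <= r -> Cderiv F x (f x).
Proof.
move=> hF cf x xr e e0.
have e4 : 0 < e / 4 by rewrite divr_gt0.
have [d d0 hd] := cf x xr _ e4; exists d => // y yr yx yd.
have hl := AC_L1 hF; have [_ h] := hF.
have hG : CL1 (fun t => f t - f x) by apply: CL1_D => //; exact: CBM_CL1 (CBM_cst _).
have G (u v : R) : 0 <= u <= v -> v <= r -> F v - F u - (v - u)%:C * f x = cint v (fun t => f t - f x) - cint u (fun t => f t - f x).
  move=> /andP[u0 uv] vr; have v0 := le_trans u0 uv; have ur := le_trans uv vr.
  have kk w : 0 <= w <= r -> cint w (fun t => f t - f x) = cint w f - f x * w%:C.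
    move=> /andP[w0 wr]; rewrite cintD//; last exact: CBM_CL1 (CBM_cst _).
    by rewrite cint_cst// mulNr.
  rewrite !kk ?u0 ?v0// (h v) ?v0// (h u) ?u0// CB; ring.
have bound : cabs (F y - F x - (y - x)%:C * f x) <= 2 * (e / 4) * `|y - x|.
  case: (leP x y) => xy.
    rewrite G; [|by case/andP: xr => ->|by case/andP: yr].
    rewrite ger0_norm ?subr_ge0//; apply: cint_split => //; [by case/andP: xr => ->|by case/andP: yr|].
    move=> t /andP[xt ty]; apply/ltW/hd; last first.
      by rewrite gtr0_norm ?subr_gt0// (le_lt_trans _ yd)// ger0_norm ?subr_ge0// lerD2r.
    by case/andP: xr => x0 _; case/andP: yr => _ yr; rewrite (le_trans x0 (ltW xt)) (le_trans ty).
  have -> : F y - F x - (y - x)%:C * f x = - (F x - F y - (x - y)%:C * f x) by rewrite !CB; ring.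
  rewrite cabsN G; [|by case/andP: yr => -> _; rewrite ltW|by case/andP: xr].
  rewrite distrC gtr0_norm ?subr_gt0//; apply: cint_split => //; [by case/andP: yr => -> _; rewrite ltW|by case/andP: xr|].
  move=> t /andP[yt tx]; apply/ltW/hd; last first.
    rewrite distrC ger0_norm ?subr_ge0// (le_lt_trans _ yd)// distrC gtr0_norm ?subr_gt0// lerD2l lerN2; exact: ltW.
  by case/andP: yr => y0 _; case/andP: xr => _ xr; rewrite (le_trans y0 (ltW yt)) (le_trans tx).
have yx0 : y - x != 0 by rewrite subr_eq0.
have -> : ((y - x)^-1)%:C * (F y - F x) - f x = ((y - x)^-1)%:C * (F y - F x - (y - x)%:C * f x).
  by rewrite [RHS]mulrBr mulrA -CM mulVf// C1E mul1r.
rewrite cabsM cabs_real normfV mulrC ltr_pdivrMr ?normr_gt0//.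
apply: (le_lt_trans bound); rewrite ltr_pM2r ?normr_gt0//; lra.
Qed.

End ComplexIntegrals.

(** * Power series and meromorphic functions *)

Section ComplexTopology.
Context {R : realType}.
Local Notation C := (cplx R).

Lemma posC (e : C) : 0 < e -> 0 < Rez e /\ e = (Rez e)%:C.
Proof.
by case: e => a b /=; rewrite ltcE /= => /andP[/eqP -> h]; split.
Qed.

Lemma near_C (z0 : C) (P : C -> Prop) :
  (\forall z \near z0, P z) <->
  exists2 d : R, 0 < d & forall z, cabs (z - z0) < d -> P z.
Proof.
split.
  move=> /nbhs_normP[e /= /posC[e0 eE] h]; exists (Rez e) => // z zd.
  by apply: h => /=; rewrite eE distrC normCE ltC.
move=> [d d0 h]; apply/nbhs_normP; exists d%:C => /=; first by rewrite ltcR.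
by move=> z /=; rewrite distrC normCE ltC => /h.
Qed.

Lemma near_C' (z0 : C) (P : C -> Prop) :
  (\forall z \near z0^', P z) <->
  exists2 d : R, 0 < d & forall z, z != z0 -> cabs (z - z0) < d -> P z.
Proof.
split.
  rewrite near_withinE => /near_C[d d0 h]; exists d => // z zz0 zd.
  exact: h.
move=> [d d0 h]; rewrite near_withinE; apply/near_C; exists d => // z zd zz0.
exact: h.
Qed.

Lemma cvg_C (T : Type) (F : set_system T) {FF : Filter F} (f : T -> C) (l : C) :
  f @ F --> l <-> forall e : R, 0 < e -> \forall x \near F, cabs (f x - l) < e.
Proof.
split=> [/cvgrPdist_lt h e e0|h].
  have e0' : 0 < e%:C :> C by rewrite ltcR.
  by have := h _ e0'; apply: filterS => x; rewrite distrC normCE ltC.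
apply/cvgrPdist_lt => e /posC[e0 ->]; apply: filterS (h _ e0) => x.
by rewrite distrC normCE ltC.
Qed.

Lemma cvg_atC (f : C -> C) (z0 l : C) :
  f z @[z --> z0] --> l <-> forall e : R, 0 < e ->
    exists2 d : R, 0 < d & forall z, cabs (z - z0) < d -> cabs (f z - l) < e.
Proof.
split=> [/(@cvg_C _ _ (nbhs_filter _)) h e /h /near_C //|h].
by apply/(@cvg_C _ _ (nbhs_filter _)) => e /h hd; exact/near_C.
Qed.

Lemma cvg_atC' (f : C -> C) (z0 l : C) :
  f z @[z --> z0^'] --> l <-> forall e : R, 0 < e ->
    exists2 d : R, 0 < d & forall z, z != z0 -> cabs (z - z0) < d -> cabs (f z - l) < e.
Proof.
split=> [/(@cvg_C _ _ (dnbhs_filter _)) h e /h /near_C' //|h].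
by apply/(@cvg_C _ _ (dnbhs_filter _)) => e /h hd; exact/near_C'.
Qed.

Lemma cvgn_C (f : nat -> C) (l : C) :
  f @ \oo --> l <-> forall e : R, 0 < e -> exists N, forall n, (N <= n)%N -> cabs (f n - l) < e.
Proof.
rewrite cvg_C; split=> h e e0.
  by have [N _ hN] := h e e0; exists N.
by have [N hN] := h e e0; exists N.
Qed.

Lemma exp_small (K q e : R) : 0 <= q < 1 -> 0 < e ->
  exists N, forall n, (N <= n)%N -> K * q ^+ n < e.
Proof.
move=> /andP[q0 q1] e0.
have /cvgrPdist_lt/(_ e e0)[N _ hN] : geometric K q @ \oo --> 0.
  by apply: cvg_geometric; rewrite ger0_norm.
exists N => n /hN; rewrite /geometric /= sub0r normrN.
exact/le_lt_trans/ler_norm.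
Qed.

(* Only real sequences are known to be complete, so limits are taken
   separately for the real and the imaginary part. *)
Lemma geo_cauchy_C (s : nat -> C) (B q : R) : 0 <= B -> 0 <= q < 1 ->
  (forall n, cabs (s n.+1 - s n) <= B * q ^+ n) ->
  exists l : C, forall n, cabs (s n - l) <= B / (1 - q) * q ^+ n.
Proof.
move=> B0 /andP[q0 q1] hs.
have q1' : 0 < 1 - q by rewrite subr_gt0.
have tele (t : nat -> C) n m : (n <= m)%N -> (forall n, cabs (t n.+1 - t n) <= B * q ^+ n) ->
    cabs (t m - t n) <= B / (1 - q) * (q ^+ n - q ^+ m).
  move=> nm ht; elim: m nm => [|m IH].
    by rewrite leqn0 => /eqP ->; rewrite !subrr cabs0 mulr0.
  rewrite leq_eqVlt => /predU1P[->|nm]; first by rewrite !subrr cabs0 mulr0.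
  rewrite -(subrK (t m) (t m.+1)) -addrA (le_trans (cabsD _ _))//.
  rewrite (le_trans (lerD (ht m) (IH nm)))//.
  rewrite le_eqVlt; apply/orP; left; apply/eqP; rewrite exprS; field.
  by rewrite gt_eqF.
have lim (u : nat -> R) : (forall n m, (n <= m)%N -> `|u m - u n| <= B / (1 - q) * q ^+ n) ->
    exists l : R, u @ \oo --> l.
  move=> hu; suff hc : cvgn u by exists (limn u : R).
  apply: cauchy_cvg; apply/cauchy_exP => e e0.
  have [|N hN] := @exp_small (B / (1 - q)) q e _ e0; first by rewrite q0.
  exists (u N); exists N => // n /= Nn.
  by rewrite -ball_normE /ball_ /= distrC (le_lt_trans (hu _ _ Nn))// hN.
have bnd n m : (n <= m)%N -> cabs (s m - s n) <= B / (1 - q) * q ^+ n.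
  move=> nm; apply: (le_trans (tele _ _ _ nm hs)).
  by rewrite ler_wpM2l ?gerBl ?exprn_ge0// divr_ge0// ltW.
have [|a ha] := lim (fun n => Rez (s n)).
  by move=> n m /bnd; apply: le_trans; rewrite -ReN -ReD cabs_Re.
have [|b hb] := lim (fun n => Imz (s n)).
  by move=> n m /bnd; apply: le_trans; rewrite -ImN -ImD cabs_Im.
exists (a +i* b) => n.
apply/ler_addgt0Pr => e e0.
have e2 : 0 < e / 2 by rewrite divr_gt0.
move/cvgrPdist_lt : ha => /(_ _ e2)[Na _ ha].
move/cvgrPdist_lt : hb => /(_ _ e2)[Nb _ hb].
pose m := maxn n (maxn Na Nb).
rewrite -(subrK (s m) (s n)) -addrA (le_trans (cabsD _ _))// lerD//.
  by rewrite cabsBC bnd// leq_maxl.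
rewrite (le_trans (cabs_le _))// !reimE /= (splitr e) lerD// ltW// distrC.
  by apply: ha => /=; rewrite /m !leq_max leqnn !orbT.
by apply: hb => /=; rewrite /m !leq_max leqnn !orbT.
Qed.

End ComplexTopology.

(** * Power series with geometric remainders; zeros and poles *)

Section PowerSeries.
Context {R : realType}.
Local Notation C := (cplx R).
Implicit Types (f g : C -> C) (z w h : C).

Definition psum (a : nat -> C) h n := \sum_(k < n) a k * h ^+ k.

(** A power series is encoded by its remainders of all orders on a closed disc. Order n = 0 says
    that [f] is bounded by [B]; convergence to [f] follows for |h| < rho. In this form sums and
    products are finite estimates. *)
Definition PSdata (a : nat -> C) (B rho : R) f z0 := [/\ 0 < rho, 0 <= B &
  forall h n, cabs h <= rho ->
    cabs (f (z0 + h) - psum a h n) <= B * (cabs h / rho) ^+ n].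

Definition PSat f z0 := exists a B rho, PSdata a B rho f z0.

Lemma psumS a h n : psum a h n.+1 = psum a h n + a n * h ^+ n.
Proof. by rewrite /psum big_ord_recr. Qed.

(** Cauchy's coefficient estimate up to a factor 2: at h = rho the remainders of orders n and n + 1
    differ by a_n rho^n. *)
Lemma PS_coef a B rho f z0 n : PSdata a B rho f z0 -> cabs (a n) * rho ^+ n <= 2 * B.
Proof.
move=> [rho0 B0 hf]; have hr : cabs rho%:C = rho by rewrite cabs_real ger0_norm// ltW.
have := lerD (hf rho%:C n.+1 _) (hf rho%:C n _).
rewrite hr divff ?gt_eqF// !expr1n mulr1 => /(_ (lexx _) (lexx _)) h.
have -> : 2 * B = B + B by ring.
apply: le_trans h; rewrite -[X in _ <= X + _]cabsN (le_trans _ (cabsD _ _))//.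
by rewrite -[rho in X in X <= _]hr -cabsX -cabsM psumS le_eqVlt; apply/orP; left; apply/eqP; congr cabs; ring.
Qed.

Lemma PS_shrink a B rho rho' f z0 : 0 < rho' -> rho' <= rho ->
  PSdata a B rho f z0 -> PSdata a B rho' f z0.
Proof.
move=> r0' rr [rho0 B0 hf]; split=> // h n hr.
rewrite (le_trans (hf h n (le_trans hr rr)))// ler_wpM2l// lerXn2r ?nnegrE ?divr_ge0//; [exact: ltW..|].
by rewrite ler_wpM2l// lef_pV2 ?posrE.
Qed.

Lemma PS_near f g z0 (d : R) : 0 < d -> (forall h, cabs h <= d -> f (z0 + h) = g (z0 + h)) ->
  PSat f z0 -> PSat g z0.
Proof.
move=> d0 fg [a [B [rho hf]]]; have rho0 : 0 < rho by case: hf.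
have [|||_ B0 h'] := @PS_shrink a B rho (Num.min rho d) f z0 => //.
- by rewrite lt_min rho0.
- by rewrite ge_min lexx.
exists a, B, (Num.min rho d); split=> //; first by rewrite lt_min rho0.
by move=> h n hr; rewrite -fg ?h'//; move: hr; rewrite le_min => /andP[].
Qed.

Lemma PS_bound a B rho f z0 h : PSdata a B rho f z0 -> cabs h <= rho -> cabs (f (z0 + h)) <= B.
Proof.
by move=> [_ _ hf] /(hf h 0%N); rewrite /psum big_ord0 subr0 expr0 mulr1.
Qed.

Lemma PS_cst c z0 : PSat (fun=> c) z0.
Proof.
exists (fun k => if k is 0%N then c else 0), (cabs c), 1; split=> // h n _.
case: n => [|n]; first by rewrite /psum big_ord0 subr0 expr0 mulr1.
rewrite /psum big_ord_recl big1; last by move=> i _; rewrite mul0r.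
by rewrite expr0 mulr1 addr0 subrr cabs0 mulr_ge0// exprn_ge0// divr_ge0.
Qed.

Lemma PS_id z0 : PSat id z0.
Proof.
exists (fun k => if k is 0%N then z0 else if k is 1%N then 1 else 0), (cabs z0 + 1), 1; split=> //.
  by rewrite addr_ge0.
move=> h n h1; case: n => [|[|n]].
- by rewrite /psum big_ord0 subr0 expr0 mulr1 (le_trans (cabsD _ _))// lerD.
- rewrite /psum big_ord1 expr0 mulr1 addrC addKr divr1 expr1.
  by rewrite mulrDl mul1r lerDr mulr_ge0.
rewrite /psum 2!big_ord_recl big1; last by move=> i _; rewrite mul0r.
rewrite expr0 mulr1 addr0 /bump/= mul1r expr1 subrr cabs0.
by rewrite mulr_ge0 ?addr_ge0// exprn_ge0// divr_ge0.
Qed.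

Lemma PS_D f g z0 : PSat f z0 -> PSat g z0 -> PSat (fun z => f z + g z) z0.
Proof.
move=> [a [B [rho hf]]] [b [D [sig hg]]].
have r0 : 0 < rho by case: hf.
have s0 : 0 < sig by case: hg.
pose m := Num.min rho sig; have m0 : 0 < m by rewrite lt_min r0.
have [||_ B0 hf'] := PS_shrink _ _ hf (rho' := m) => //; first by rewrite ge_min lexx.
have [||_ D0 hg'] := PS_shrink _ _ hg (rho' := m) => //; first by rewrite ge_min lexx orbT.
exists (fun k => a k + b k), (B + D), m; split=> //; first by rewrite addr_ge0.
move=> h n hm; rewrite mulrDl.
have -> : psum (fun k => a k + b k) h n = psum a h n + psum b h n.
  by rewrite /psum -big_split/=; apply: eq_bigr => k _; rewrite mulrDl.
by rewrite opprD addrACA (le_trans (cabsD _ _))// lerD ?hf' ?hg'.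
Qed.

Lemma nat_pow_bound n : n%:R <= 2 ^+ n :> R.
Proof. by rewrite -natrX ler_nat ltnW// ltn_expl. Qed.

(** With q = |h|/m the Cauchy product has a remainder of at most (2n + 1) B D q^n. Halving the
    radius replaces q by 2q, and 2^n absorbs the factor 2n + 1, which leaves the constant 3 B D. *)
Lemma PS_M f g z0 : PSat f z0 -> PSat g z0 -> PSat (fun z => f z * g z) z0.
Proof.
move=> [a [B [rho hf]]] [b [D [sig hg]]].
have r0 : 0 < rho by case: hf.
have s0 : 0 < sig by case: hg.
pose m := Num.min rho sig; have m0 : 0 < m by rewrite lt_min r0.
have {}hf : PSdata a B m f z0 by apply: PS_shrink hf => //; rewrite ge_min lexx.
have {}hg : PSdata b D m g z0 by apply: PS_shrink hg => //; rewrite ge_min lexx orbT.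
have B0 : 0 <= B by case: hf.
have D0 : 0 <= D by case: hg.
pose c n := \sum_(i < n.+1) a i * b (n - i)%N.
(* Regrouping by the index of the first factor pairs each coefficient with a complete partial sum of
   the second, so that the remainders of [g] can be inserted. *)
have cE h n : psum c h n = \sum_(i < n) a i * h ^+ i * psum b h (n - i).
  elim: n => [|n IH]; first by rewrite /psum !big_ord0.
  rewrite psumS IH big_ord_recr /= subSnn [psum b h 1]psumS [psum b h 0]big_ord0 add0r expr0 mulr1.
  rewrite [RHS](_ : _ = \sum_(i < n) (a i * h ^+ i * psum b h (n - i) + a i * b (n - i)%N * h ^+ n) + a n * h ^+ n * b 0%N); last first.
    congr (_ + _); apply: eq_bigr => i _; rewrite subSn 1?ltnW// -/(psum b h (n - i).+1) psumS mulrDr; congr (_ + _).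
    have -> : h ^+ n = h ^+ (n - i) * h ^+ i by rewrite -exprD subnK// ltnW.
    ring.
  rewrite big_split /= -addrA; congr (_ + _).
  rewrite /c big_ord_recr /= subnn mulrDl mulr_suml; congr (_ + _); ring.
exists c, (3 * B * D), (m / 2); split.
- by rewrite divr_gt0.
- by rewrite !mulr_ge0.
move=> h n hm; have hm' : cabs h <= m by rewrite (le_trans hm)// ler_pdivrMr// ler_peMr ?ltW// ltr1n.
pose q := cabs h / m; have q0 : 0 <= q by rewrite divr_ge0// ltW.
have -> : cabs h / (m / 2) = 2 * q by rewrite /q; field; rewrite gt_eqF.
have [_ _ hf'] := hf; have [_ _ hg'] := hg.
have main : cabs (f (z0 + h) * g (z0 + h) - psum c h n) <= (2 * n%:R + 1) * B * D * q ^+ n.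
  rewrite cE.
  have -> : f (z0 + h) * g (z0 + h) - \sum_(i < n) a i * h ^+ i * psum b h (n - i) =
      \sum_(i < n) a i * h ^+ i * (g (z0 + h) - psum b h (n - i)) + (f (z0 + h) - psum a h n) * g (z0 + h).
    under [in RHS]eq_bigr do rewrite mulrBr.
    by rewrite sumrB -mulr_suml -/(psum a h n); ring.
  have -> : (2 * n%:R + 1) * B * D * q ^+ n = n%:R * (2 * B * D * q ^+ n) + B * D * q ^+ n by ring.
  rewrite (le_trans (cabsD _ _))// lerD//; last first.
    by rewrite cabsM mulrAC ler_pM// ?hf'// (PS_bound hg).
  rewrite (le_trans (cabs_sum _ _ _))//.
  rewrite [leRHS](_ : _ = \sum_(i < n) 2 * B * D * q ^+ n); last first.
    by rewrite sumr_const card_ord mulr_natl.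
  apply: ler_sum => i _; rewrite !cabsM cabsX.
  have -> : 2 * B * D * q ^+ n = (2 * B * q ^+ i) * (D * q ^+ (n - i)).
    have -> : q ^+ n = q ^+ i * q ^+ (n - i) by rewrite -exprD subnKC// ltnW.
    ring.
  rewrite ler_pM ?mulr_ge0 ?exprn_ge0// ?hg'//.
  have := PS_coef i hf; rewrite /q expr_div_n => hc.
  have -> : cabs (a i) * cabs h ^+ i = (cabs (a i) * m ^+ i) * (cabs h ^+ i / m ^+ i).
    by field; rewrite expf_neq0// gt_eqF.
  by rewrite ler_wpM2r// divr_ge0 ?exprn_ge0// ltW.
apply: (le_trans main); rewrite [(2 * q) ^+ n]exprMn.
have -> : 3 * B * D * (2 ^+ n * q ^+ n) = (3 * 2 ^+ n) * B * D * q ^+ n by ring.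
rewrite !ler_wpM2r ?exprn_ge0//.
have := nat_pow_bound n; have : 1 <= 2 ^+ n :> R by rewrite exprn_ege1// ler1n.
lra.
Qed.

Lemma PS_inv z0 w : z0 != w -> PSat (fun z => (z - w)^-1) z0.
Proof.
rewrite -subr_eq0; set d := z0 - w => d0.
have cd0 : 0 < cabs d by rewrite cabs_gt0.
exists (fun k => (- 1) ^+ k / d ^+ k.+1), (2 / cabs d), (cabs d / 2); split.
- by rewrite divr_gt0.
- by rewrite divr_ge0.
move=> h n hd; have dh : cabs d / 2 <= cabs (d + h).
  by rewrite (le_trans _ (cabs_lower _ _))//; lra.
have dh0 : d + h != 0 by rewrite -cabs_gt0 (lt_le_trans _ dh)// divr_gt0.
have E : (z0 + h - w)^-1 - psum (fun k => (- 1) ^+ k / d ^+ k.+1) h n = (- h / d) ^+ n / (d + h).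
  have -> : z0 + h - w = d + h by rewrite /d; ring.
  elim: n => [|n IH]; first by rewrite /psum big_ord0 subr0 expr0 mul1r.
  rewrite psumS opprD addrA IH !expr_div_n !exprS [(- h) ^+ n]exprNn; field.
  by rewrite d0 dh0 expf_neq0.
rewrite E cabsM cabsV cabsX cabsM cabsV cabsN mulrC.
rewrite ler_pM ?invr_ge0 ?exprn_ge0 ?divr_ge0//.
  by rewrite -[leRHS]invrK lef_pV2 ?posrE ?cabs_gt0// ?invr_gt0 ?divr_gt0// invf_div.
rewrite lerXn2r ?nnegrE ?divr_ge0 ?ler_wpM2l ?lef_pV2 ?posrE ?divr_gt0//; lra.
Qed.

Lemma lerX (x y : R) n : 0 <= x <= y -> x ^+ n <= y ^+ n.
Proof. by move=> /andP[x0 xy]; rewrite lerXn2r ?nnegrE// (le_trans x0). Qed.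

Lemma geo_sum (q : R) n K : 0 <= q <= 1 / 2 -> (n <= K)%N ->
  \sum_(n <= j < K) q ^+ j <= 2 * q ^+ n.
Proof.
move=> /andP[q0 q1] nK; suff : \sum_(n <= j < K) q ^+ j <= 2 * q ^+ n - 2 * q ^+ K.
  by move/le_trans; apply; rewrite gerBl mulr_ge0// exprn_ge0.
elim: K nK => [|K IH]; first by rewrite leqn0 => /eqP ->; rewrite big_geq// subrr.
rewrite leq_eqVlt => /predU1P[->|nK]; first by rewrite big_geq// subrr.
rewrite big_nat_recr//= (le_trans (lerD (IH nK) (lexx _)))//.
by rewrite exprS; have := exprn_ge0 K q0; nra.
Qed.

Lemma binom_term (x y : R) k j : 0 <= x -> 0 <= y -> 'C(k, j)%:R * x ^+ (k - j) * y ^+ j <= (x + y) ^+ k.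
Proof.
move=> x0 y0; case: (leqP j k) => jk; last by rewrite bin_small// !mul0r exprn_ge0// addr_ge0.
rewrite exprDn (bigD1 (inord j))//= inordK// -[in leRHS]mulr_natl mulrA lerDl sumr_ge0// => i _.
by rewrite mulrn_wge0// mulr_ge0// exprn_ge0.
Qed.

(** The new coefficients are the sums over k of C(k, j) a_k w^{k-j}. They converge geometrically
    because |w| <= rho/4 = tau gives C(k, j) |w|^{k-j} tau^j <= (rho/2)^k. *)
Lemma PS_shift a B rho f z0 w : PSdata a B rho f z0 -> cabs w <= rho / 4 -> PSat f (z0 + w).
Proof.
move=> hf hw; have [rho0 B0 hf'] := hf.
pose tau := rho / 4; have tau0 : 0 < tau by rewrite divr_gt0.
pose s j K := \sum_(k < K) 'C(k, j)%:R * a k * w ^+ (k - j).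
have sS j K : cabs (s j K.+1 - s j K) <= (tau ^- j * (2 * B)) * (1 / 2) ^+ K.
  rewrite /s big_ord_recr /= addrAC subrr add0r !cabsM cabs_nat cabsX.
  have h1 : 'C(K, j)%:R * cabs w ^+ (K - j) * tau ^+ j <= (rho / 2) ^+ K.
    have t0 := ltW tau0; rewrite (le_trans (binom_term _ _ _ _))//.
    have -> : rho / 2 = tau + tau by rewrite /tau; field.
    by rewrite lerXn2r ?nnegrE ?addr_ge0// lerD2r.
  have h2 := PS_coef K hf.
  have tj : 0 < tau ^+ j by rewrite exprn_gt0.
  rewrite -(ler_pM2l tj) [leRHS](_ : _ = 2 * B * (1 / 2) ^+ K); last first.
    by field; rewrite gt_eqF.
  have -> : tau ^+ j * ('C(K, j)%:R * cabs (a K) * cabs w ^+ (K - j)) =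
    cabs (a K) * ('C(K, j)%:R * cabs w ^+ (K - j) * tau ^+ j) by ring.
  rewrite (le_trans (ler_wpM2l _ h1))//.
  have -> : (rho / 2) ^+ K = rho ^+ K * (1 / 2) ^+ K by rewrite -exprMn; congr (_ ^+ _); ring.
  by rewrite mulrA ler_wpM2r// exprn_ge0// divr_ge0.
have /choice[b hb] : forall j, exists l, forall K, cabs (s j K - l) <= tau ^- j * (4 * B) * (1 / 2) ^+ K.
  move=> j; have [|||l hl] := geo_cauchy_C (s := s j) (B := tau ^- j * (2 * B)) (q := 1 / 2).
  - by rewrite mulr_ge0 ?mulr_ge0// invr_ge0 exprn_ge0// ltW.
  - by apply/andP; split; lra.
  - by move=> n; exact: sS.
  exists l => K; apply: (le_trans (hl K)); rewrite le_eqVlt; apply/orP; left; apply/eqP.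
  by field; rewrite expf_neq0// gt_eqF.
have b_le j : cabs (b j) <= tau ^- j * (4 * B).
  by have := hb j 0%N; rewrite /s big_ord0 sub0r cabsN expr0 mulr1.
have s_le j K : cabs (s j K) <= tau ^- j * (8 * B).
  rewrite -(subrK (b j) (s j K)) (le_trans (cabsD _ _))//.
  rewrite (le_trans (lerD (hb j K) (b_le j)))//.
  have := exprn_ile1 K (_ : 0 <= 1 / 2 :> R) (_ : 1 / 2 <= 1 :> R).
  have : 0 <= tau ^- j by rewrite invr_ge0 exprn_ge0// ltW.
  move=> t0 h'; have {h'}h : (1 / 2) ^+ K <= 1 :> R by apply: h'; lra.
  have := mulr_ge0 t0 B0; nra.
exists b, (16 * B), (tau / 2); split; [by rewrite divr_gt0|by rewrite mulr_ge0|].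
move=> h n hh; set y := cabs h.
have yt : y / tau <= 1 / 2 by rewrite ler_pdivrMr// (le_trans hh)//; lra.
have yt0 : 0 <= y / tau by rewrite divr_ge0 ?(ltW tau0)// /y.
have expand K : psum a (w + h) K = \sum_(j < K) s j K * h ^+ j.
  rewrite /psum /s; under [RHS]eq_bigr do rewrite mulr_suml.
  rewrite exchange_big /=; apply: eq_bigr => k _.
  rewrite exprDn mulr_sumr (big_ord_widen_cond K xpredT (fun j => a k * (w ^+ (k - j) * h ^+ j *+ 'C(k, j))))//.
  rewrite [RHS](bigID (fun j : 'I_K => (j < k.+1)%N))/= [X in _ + X]big1 ?addr0; last first.
    by move=> j; rewrite -leqNgt => jk; rewrite bin_small// !mul0r.
  by apply: eq_bigr => j _; rewrite -mulr_natl; ring.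
suff main e : 0 < e -> cabs (f (z0 + w + h) - psum b h n) <= 16 * B * (y / tau) ^+ n + e.
  apply/ler_addgt0Pr => e e0; apply: (le_trans (main e e0)).
  rewrite lerD2r ler_wpM2l ?mulr_ge0// lerX// yt0/=.
  by rewrite ler_wpM2l /y// lef_pV2 ?posrE ?divr_gt0//; lra.
move=> e0; have [|N hN] := @exp_small _ (B + n%:R * (4 * B)) (1 / 2) e _ e0.
  by apply/andP; split; lra.
pose K := maxn n N; have nK : (n <= K)%N by rewrite leq_maxl.
have {hN}hN := hN K (leq_maxr _ _).
(* Three errors: the old remainder of order K, the new terms of index n to K - 1, and the truncation
   of the first n new coefficients. Only the middle one survives for large K. *)
have split1 : f (z0 + w + h) - psum b h n =
    (f (z0 + (w + h)) - psum a (w + h) K) + \sum_(n <= j < K) s j K * h ^+ j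
     + \sum_(j < n) (s j K - b j) * h ^+ j.
  rewrite expand -(big_mkord xpredT (fun j => s j K * h ^+ j)) (big_cat_nat (n := n))//= big_mkord.
  have -> : \sum_(j < n) (s j K - b j) * h ^+ j = \sum_(j < n) s j K * h ^+ j - psum b h n.
    by rewrite /psum -sumrB; apply: eq_bigr => j _; rewrite mulrBl.
  by rewrite -[z0 + w + h]addrA; ring.
have p1 : cabs (f (z0 + (w + h)) - psum a (w + h) K) <= B * (1 / 2) ^+ K.
  have whr : cabs (w + h) <= rho / 2.
    rewrite (le_trans (cabsD _ _))//; move: hh hw; rewrite /tau; lra.
  rewrite (le_trans (hf' _ _ _))//; first by rewrite (le_trans whr)//; lra.
  rewrite ler_wpM2l// lerX// divr_ge0 ?(ltW rho0)//=.
  by rewrite ler_pdivrMr//; lra.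
have p2 : cabs (\sum_(n <= j < K) s j K * h ^+ j) <= 16 * B * (y / tau) ^+ n.
  rewrite (le_trans (cabs_sum _ _ _))//.
  apply: (@le_trans _ _ (8 * B * \sum_(n <= j < K) (y / tau) ^+ j)).
    rewrite mulr_sumr ler_sum// => j _; rewrite cabsM cabsX expr_div_n.
    rewrite (le_trans (ler_wpM2r _ (s_le j K))) ?exprn_ge0//.
    by rewrite le_eqVlt; apply/orP; left; apply/eqP; rewrite /y; ring.
  rewrite (le_trans (ler_wpM2l _ (geo_sum _ nK)))//; [by rewrite mulr_ge0|by rewrite yt0|].
  by rewrite le_eqVlt; apply/orP; left; apply/eqP; ring.
have p3 : cabs (\sum_(j < n) (s j K - b j) * h ^+ j) <= n%:R * (4 * B) * (1 / 2) ^+ K.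
  rewrite (le_trans (cabs_sum _ _ _))//.
  have -> : n%:R * (4 * B) * (1 / 2) ^+ K = \sum_(j < n) (4 * B * (1 / 2) ^+ K).
    by rewrite sumr_const card_ord -mulr_natl; ring.
  apply: ler_sum => j _; rewrite cabsM cabsX.
  rewrite (le_trans (ler_wpM2r _ (hb j K))) ?exprn_ge0//.
  have -> : tau ^- j * (4 * B) * (1 / 2) ^+ K * cabs h ^+ j = (4 * B * (1 / 2) ^+ K) * (y / tau) ^+ j.
    by rewrite [(y / tau) ^+ j]expr_div_n /y; ring.
  rewrite ler_piMr// ?mulr_ge0 ?exprn_ge0//.
  by rewrite exprn_ile1// (le_trans yt)//; lra.
rewrite split1 (le_trans (cabsD _ _))// (le_trans (lerD (cabsD _ _) (lexx _)))//.
move: p1 p2 p3 hN; lra.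
Qed.

Lemma PS_X f z0 n : PSat f z0 -> PSat (fun z => f z ^+ n) z0.
Proof.
move=> hf; elim: n => [|n IH]; first exact: PS_cst.
have := PS_M hf IH; apply: PS_near ltr01 _ => h _; by rewrite exprS.
Qed.

Lemma PS_cont f z0 : PSat f z0 -> f z @[z --> z0] --> f z0.
Proof.
move=> [a [B [rho [rho0 B0 hf]]]]; have f0 : f z0 = a 0%N.
  have := hf 0 1%N; rewrite cabs0 mul0r expr1 mulr0 addr0 psumS /psum big_ord0 add0r expr0 mulr1.
  by move=> /(_ (ltW rho0)) h; apply/eqP; rewrite -subr_eq0 -cabs_eq0 eq_le h cabs_ge0.
apply/cvg_atC => e e0.
have K0 : 0 < B / rho + 1 by rewrite ltr_wpDl// divr_ge0// ltW.
exists (Num.min rho (e / (B / rho + 1))); first by rewrite lt_min rho0 divr_gt0.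
move=> z; rewrite lt_min => /andP[z1 z2].
have := hf (z - z0) 1%N (ltW z1); rewrite [z0 + _]addrC subrK psumS /psum big_ord0 add0r expr0 mulr1 expr1 -f0.
move=> /le_lt_trans; apply; rewrite ltr_pdivlMr// in z2.
apply: le_lt_trans z2; rewrite mulrDr mulr1.
have -> : B * (cabs (z - z0) / rho) = cabs (z - z0) * (B / rho) by ring.
by rewrite lerDl.
Qed.

Lemma PS_analytic f z0 : PSat f z0 -> analytic_at f z0.
Proof.
move=> [a [B [rho [rho0 B0 hf]]]]; exists a; apply/near_C; exists rho => // z zr.
apply/cvgn_C => e e0.
have [|N hN] := @exp_small _ B (cabs (z - z0) / rho) e _ e0.
  by rewrite divr_ge0 ?(ltW rho0)//= ltr_pdivrMr// mul1r.
exists N => n Nn; apply: le_lt_trans (hN n Nn).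
have := hf (z - z0) n (ltW zr); rewrite [z0 + _]addrC subrK cabsBC.
by rewrite seriesEord.
Qed.

(** The terms are bounded at distance d/2, hence geometric at distance d/4. The value at z0 is
    overwritten by a_0 because the hypothesis concerns only z != z0. *)
Lemma conv_PS (a : nat -> C) (d : R) f z0 : 0 < d ->
  (forall z, z != z0 -> cabs (z - z0) < d -> series (fun k => a k * (z - z0) ^+ k) @ \oo --> f z) ->
  PSat (fun z => if z == z0 then a 0%N else f z) z0.
Proof.
move=> d0 hf.
have ser z : series (fun k => a k * (z - z0) ^+ k) = psum a (z - z0).
  by apply/funext => n; rewrite seriesEord.
pose rho := d / 2; have rho0 : 0 < rho by rewrite divr_gt0.
have cr : cabs rho%:C = rho by rewrite cabs_real ger0_norm// ltW.
have [B B0 hB] : exists2 B, 0 <= B & forall k, cabs (a k) * rho ^+ k <= B.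
  have := hf (z0 + rho%:C); rewrite ser addrAC subrr add0r cr.
  have h1 : z0 + rho%:C != z0 by rewrite -subr_eq0 addrAC subrr add0r -cabs_gt0 cr.
  have h2 : rho < d by rewrite /rho; lra.
  move=> /(_ h1 h2)/cvgn_C/(_ 1 ltr01)[N hN].
  (* From N on, two consecutive partial sums at h = rho lie within 1 of the limit, so a term is
     below 2; the finitely many earlier terms are added. *)
  exists (2 + \sum_(k < N) cabs (a k) * rho ^+ k).
    by rewrite addr_ge0// sumr_ge0// => k _; rewrite mulr_ge0// exprn_ge0// ltW.
  move=> k; have pos j : 0 <= cabs (a j) * rho ^+ j by rewrite mulr_ge0// exprn_ge0// ltW.
  case: (ltnP k N) => kN.
    rewrite (bigD1 (Ordinal kN))//= addrCA lerDl addr_ge0// sumr_ge0//.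
  rewrite ler_wpDr//; first by rewrite sumr_ge0.
  have := ltrD (hN k.+1 (leqW kN)) (hN k kN).
  rewrite psumS -[rho in X in _ -> X]cr -cabsX -cabsM => h; apply: le_trans (ltW h).
  rewrite -[X in _ <= _ + X]cabsN (le_trans _ (cabsD _ _))// le_eqVlt.
  by apply/orP; left; apply/eqP; congr cabs; ring.
exists a, (2 * B), (rho / 2); split; [by rewrite divr_gt0|by rewrite mulr_ge0|].
move=> h n hh; have q1 : cabs h / rho <= 1 / 2 by rewrite ler_pdivrMr//; lra.
have q0 : 0 <= cabs h / rho by rewrite divr_ge0// ltW.
suff main : cabs ((if z0 + h == z0 then a 0%N else f (z0 + h)) - psum a h n) <= 2 * B * (cabs h / rho) ^+ n.
  apply: (le_trans main); rewrite ler_wpM2l ?mulr_ge0// lerXn2r ?nnegrE//.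
    by rewrite divr_ge0// divr_ge0// ltW.
  by rewrite ler_wpM2l// lef_pV2 ?posrE ?divr_gt0//; lra.
have diff K : (n <= K)%N -> cabs (psum a h K - psum a h n) <= 2 * B * (cabs h / rho) ^+ n.
  move=> nK; rewrite /psum -(big_mkord xpredT (fun j => a j * h ^+ j)) (big_cat_nat (n := n))//= big_mkord.
  rewrite addrAC subrr add0r (le_trans (cabs_sum _ _ _))//.
  apply: (@le_trans _ _ (B * \sum_(n <= j < K) (cabs h / rho) ^+ j)).
    rewrite mulr_sumr ler_sum// => j _; rewrite cabsM cabsX expr_div_n.
    have -> : cabs (a j) * cabs h ^+ j = (cabs (a j) * rho ^+ j) * (cabs h ^+ j / rho ^+ j).
      by field; rewrite expf_neq0// gt_eqF.
    by rewrite ler_wpM2r// divr_ge0 ?exprn_ge0// ltW.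
  have -> : 2 * B * (cabs h / rho) ^+ n = B * (2 * (cabs h / rho) ^+ n) by ring.
  by rewrite ler_wpM2l ?geo_sum ?q0.
case: eqP => [/eqP|/eqP hz].
  rewrite -subr_eq0 addrAC subrr add0r => /eqP h0; rewrite h0 cabs0 mul0r.
  case: n {diff} => [|n]; last first.
    rewrite /psum big_ord_recl big1 ?addr0 ?expr0 ?mulr1 ?subrr ?cabs0; last first.
      by move=> i _; rewrite /= exprS mul0r mulr0.
    by rewrite expr0n /= mulr0.
  rewrite /psum big_ord0 subr0 expr0 mulr1.
  by have := hB 0%N; rewrite expr0 mulr1; lra.
apply/ler_addgt0Pr => e e0.
have hd : cabs (z0 + h - z0) < d by rewrite addrAC subrr add0r (le_lt_trans hh)// /rho; lra.
have := hf _ hz hd; rewrite ser addrAC subrr add0r => /cvgn_C/(_ e e0)[N hN].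
pose K := maxn n N; have := hN K (leq_maxr _ _); have := diff K (leq_maxl _ _).
rewrite [in X in _ -> X -> _]cabsBC => k1 k2.
rewrite -(subrK (psum a h K) (f (z0 + h))) -addrA (le_trans (cabsD _ _))//.
by rewrite [leRHS]addrC lerD// ltW.
Qed.

Lemma analytic_PS f z0 : analytic_at f z0 -> PSat f z0.
Proof.
move=> [a /near_C[d d0 h]]; have := conv_PS d0 (fun z _ => h z).
apply: PS_near ltr01 _ => k _; case: eqP => // kz.
have := h z0; rewrite subrr cabs0 kz => /(_ d0)/cvgn_C hc.
apply/eqP; rewrite -subr_eq0 -cabs_eq0 eq_le cabs_ge0 andbT; apply/ler_addgt0Pr => e e0.
have [N hN] := hc e e0; have := hN N.+1 (leqnSn _).
rewrite seriesEord /= big_ord_recl big1 ?addr0 ?expr0 ?mulr1; last first.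
  by move=> i _; rewrite /= exprS mul0r mulr0.
by rewrite add0r => /ltW.
Qed.

(** Here [g] is analytic at z0 itself, while the value of [f] at z0 plays no part, in accordance
    with [meromorphic_at]. *)
Definition Mer f z0 := exists m g, PSat g z0 /\
  exists2 d : R, 0 < d & forall z, z != z0 -> cabs (z - z0) < d -> (z - z0) ^+ m * f z = g z.

Lemma meromorphic_Mer f z0 : meromorphic_at f z0 -> Mer f z0.
Proof.
move=> [m [a /near_C'[d d0 h]]]; exists m.
exists (fun z => if z == z0 then a 0%N else (z - z0) ^+ m * f z); split.
  exact: (conv_PS d0 h).
by exists d => // z zz0 _; rewrite (negbTE zz0).
Qed.

Lemma PS_Mer f z0 : PSat f z0 -> Mer f z0.
Proof. by move=> hf; exists 0%N, f; split=> //; exists 1 => // z _ _; rewrite mul1r. Qed.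

Lemma PS_subC z0 w : PSat (fun z => z - w) z0.
Proof. exact: PS_D (PS_id z0) (PS_cst (- w) z0). Qed.

Lemma Mer_D f g z0 : Mer f z0 -> Mer g z0 -> Mer (fun z => f z + g z) z0.
Proof.
move=> [m [f1 [hf [d d0 h]]]] [n [g1 [hg [e e0 k]]]].
exists (m + n)%N, (fun z => (z - z0) ^+ n * f1 z + (z - z0) ^+ m * g1 z); split.
  by apply: PS_D; apply: PS_M => //; apply: PS_X; exact: PS_subC.
exists (Num.min d e); first by rewrite lt_min d0.
by move=> z zz0; rewrite lt_min => /andP[zd ze]; rewrite -h// -k// exprD; ring.
Qed.

Lemma Mer_M f g z0 : Mer f z0 -> Mer g z0 -> Mer (fun z => f z * g z) z0.
Proof.
move=> [m [f1 [hf [d d0 h]]]] [n [g1 [hg [e e0 k]]]].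
exists (m + n)%N, (fun z => f1 z * g1 z); split; first exact: PS_M.
exists (Num.min d e); first by rewrite lt_min d0.
by move=> z zz0; rewrite lt_min => /andP[zd ze]; rewrite -h// -k// exprD; ring.
Qed.

Lemma Mer_sum I (s : seq I) (P : pred I) (F : I -> C -> C) z0 :
  (forall i, Mer (F i) z0) -> Mer (fun z => \sum_(i <- s | P i) F i z) z0.
Proof.
move=> hF; elim: s => [|i s IH].
  under eq_fun do rewrite big_nil; exact: PS_Mer (PS_cst 0 z0).
under eq_fun do rewrite big_cons; case: (P i) => //.
exact: Mer_D.
Qed.

Lemma Mer_prod I (s : seq I) (P : pred I) (F : I -> C -> C) z0 :
  (forall i, Mer (F i) z0) -> Mer (fun z => \prod_(i <- s | P i) F i z) z0.
Proof.
move=> hF; elim: s => [|i s IH].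
  under eq_fun do rewrite big_nil; exact: PS_Mer (PS_cst 1 z0).
under eq_fun do rewrite big_cons; case: (P i) => //.
exact: Mer_M.
Qed.

Lemma Mer_det n (A : C -> 'M[C]_n) z0 : (forall i j, Mer (fun z => A z i j) z0) ->
  Mer (fun z => \det (A z)) z0.
Proof.
move=> hA; apply: Mer_sum => s; apply: Mer_M; first exact: PS_Mer (PS_cst _ z0).
by apply: Mer_prod => i.
Qed.

Lemma Mer_adj n (A : C -> 'M[C]_n) z0 i j : (forall i j, Mer (fun z => A z i j) z0) ->
  Mer (fun z => (\adj (A z)) i j) z0.
Proof.
move=> hA; under eq_fun do rewrite mxE; apply: Mer_M; first exact: PS_Mer (PS_cst _ z0).
by apply: Mer_det => k l; under eq_fun do rewrite !mxE; exact: hA.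
Qed.

Lemma Mer_mulmx m n q (A : C -> 'M[C]_(m, n)) (B : C -> 'M[C]_(n, q)) z0 :
  (forall i j, Mer (fun z => A z i j) z0) -> (forall i j, Mer (fun z => B z i j) z0) ->
  forall i j, Mer (fun z => (A z *m B z) i j) z0.
Proof.
by move=> hA hB i j; under eq_fun do rewrite mxE; apply: Mer_sum => k; exact: Mer_M.
Qed.

(** Poles are isolated: off z0 the function is (z - z0)^{-m} g, a product of expansions at the
    nearby point. *)
Lemma Mer_PS_near f z0 : Mer f z0 ->
  exists2 d : R, 0 < d & forall z, z != z0 -> cabs (z - z0) < d -> PSat f z.
Proof.
move=> [m [g [[a [B [rho hg]]] [d d0 h]]]].
have rho0 : 0 < rho by case: hg.
exists (Num.min (rho / 4) d); first by rewrite lt_min d0 divr_gt0.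
move=> z zz0; rewrite lt_min => /andP[zr zd].
have hz : PSat (fun y => ((y - z0)^-1) ^+ m * g y) z.
  apply: PS_M; first by apply: PS_X; exact: PS_inv.
  by have := PS_shift hg (ltW zr); rewrite addrC subrK.
have zz : 0 < cabs (z - z0) by rewrite cabs_gt0 subr_eq0.
pose e := Num.min (cabs (z - z0) / 2) ((d - cabs (z - z0)) / 2).
have e0 : 0 < e by rewrite lt_min !divr_gt0// subr_gt0.
apply: PS_near e0 _ hz => k; rewrite le_min => /andP[k1 k2].
have n0 : z + k - z0 != 0.
  rewrite -cabs_gt0 addrAC (lt_le_trans _ (cabs_lower _ _))//; lra.
have n1 : cabs (z + k - z0) < d.
  rewrite addrAC (le_lt_trans (cabsD _ _))//; lra.
rewrite -h//; last by rewrite -subr_eq0.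
by rewrite exprVn mulrA mulVf ?mul1r// expf_neq0.
Qed.

(** Either all coefficients of the analytic factor vanish, or the first nonzero one, of index j, can
    be split off. The order of [f] is j - m; the two exponents are kept apart to stay within natural
    numbers. *)
Lemma Mer_factor f z0 : Mer f z0 ->
  (exists2 d : R, 0 < d & forall z, z != z0 -> cabs (z - z0) < d -> f z = 0) \/
  exists (m j : nat) (k0 : C) (k : C -> C), [/\ k0 != 0,
    k z @[z --> z0^'] --> k0
    & exists2 d : R, 0 < d & forall z, z != z0 -> cabs (z - z0) < d ->
       (z - z0) ^+ m * f z = (z - z0) ^+ j * k z].
Proof.
move=> [m [g [[a [B [rho [rho0 B0 hg]]]] [d d0 h]]]].
have [a0|] := pselect (forall k, a k = 0).
  left; exists (Num.min rho d); first by rewrite lt_min rho0.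
  move=> z zz0; rewrite lt_min => /andP[zr zd].
  have z0' : z - z0 != 0 by rewrite subr_eq0.
  suff g0 : g z = 0.
    by apply/eqP; have /eqP := h z zz0 zd; rewrite g0 mulf_eq0 expf_eq0 (negbTE z0') andbF.
  apply/eqP; rewrite -cabs_eq0 eq_le cabs_ge0 andbT; apply/ler_addgt0Pr => e e0.
  have [|N hN] := @exp_small _ B (cabs (z - z0) / rho) e _ e0.
    by rewrite divr_ge0 ?(ltW rho0)//= ltr_pdivrMr// mul1r.
  have := hg (z - z0) N (ltW zr); rewrite /psum big1 ?subr0; last by move=> i _; rewrite a0 mul0r.
  by rewrite addrC subrK add0r => /le_trans; apply; exact/ltW/hN.
move=> /existsNP[j1 /eqP aj1].
have exj : exists k, a k != 0 by exists j1.
right; case: (ex_minnP exj) => j aj jmin.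
have ps1 w : psum a w j.+1 = a j * w ^+ j.
  rewrite /psum big_ord_recr/= big1 ?add0r// => i _.
  have := jmin i; case: eqP => [-> _|_ /(_ isT)]; first by rewrite mul0r.
  by rewrite leqNgt ltn_ord.
exists m, j, (a j), (fun z => g z / (z - z0) ^+ j); split => //; last first.
  exists d => // z zz0 zd; rewrite h// mulrC divfK// expf_neq0// subr_eq0//.
apply/cvg_atC' => e e0; have K0 : 0 < B / rho ^+ j.+1 + 1 by rewrite ltr_wpDl// divr_ge0 ?exprn_ge0// ltW.
exists (Num.min rho (e / (B / rho ^+ j.+1 + 1))); first by rewrite lt_min rho0 divr_gt0.
move=> z zz0; rewrite lt_min => /andP[zr ze].
have zz : 0 < cabs (z - z0) by rewrite cabs_gt0 subr_eq0.
have := hg (z - z0) j.+1 (ltW zr); rewrite ps1 [z0 + _]addrC subrK => hb.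
have -> : g z / (z - z0) ^+ j - a j = (g z - a j * (z - z0) ^+ j) / (z - z0) ^+ j.
  by field; rewrite expf_neq0// subr_eq0.
rewrite cabsM cabsV cabsX ltr_pdivrMr ?exprn_gt0//; apply: (le_lt_trans hb).
have -> : B * (cabs (z - z0) / rho) ^+ j.+1 = B / rho ^+ j.+1 * cabs (z - z0) * cabs (z - z0) ^+ j.
  by rewrite expr_div_n [cabs _ ^+ j.+1]exprS; ring.
rewrite ltr_pM2r ?exprn_gt0//.
rewrite ltr_pdivlMr// in ze; apply: le_lt_trans ze.
by rewrite mulrDr mulr1 -[leLHS]addr0 lerD// mulrC.
Qed.

Lemma dnear_and z0 (P Q : C -> Prop) :
  (exists2 d : R, 0 < d & forall z, z != z0 -> cabs (z - z0) < d -> P z) ->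
  (exists2 d : R, 0 < d & forall z, z != z0 -> cabs (z - z0) < d -> Q z) ->
  exists2 d : R, 0 < d & forall z, z != z0 -> cabs (z - z0) < d -> P z /\ Q z.
Proof.
move=> [d d0 h] [e e0 k]; exists (Num.min d e); first by rewrite lt_min d0.
by move=> z zz0; rewrite lt_min => /andP[? ?]; split; [apply: h|apply: k].
Qed.

Lemma dnear_ex z0 (d : R) : 0 < d -> exists z, z != z0 /\ cabs (z - z0) < d.
Proof.
move=> d0; exists (z0 + (d / 2)%:C); rewrite -subr_eq0 addrAC subrr add0r.
have h : cabs (d / 2)%:C = d / 2 by rewrite cabs_real ger0_norm// divr_ge0// ltW.
by rewrite -cabs_gt0 h divr_gt0//; split=> //; lra.
Qed.

Lemma cvg_dnear_neq (k : C -> C) z0 k0 : k z @[z --> z0^'] --> k0 -> k0 != 0 ->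
  exists2 d : R, 0 < d & forall z, z != z0 -> cabs (z - z0) < d -> k z != 0.
Proof.
move=> /cvg_atC' h k00; have [|d d0 hd] := h (cabs k0); first by rewrite cabs_gt0.
exists d => // z zz0 /(hd z zz0); apply: contraTneq => ->.
by rewrite sub0r cabsN ltxx.
Qed.

Lemma Mer_dichotomy f z0 : Mer f z0 ->
  (exists2 d : R, 0 < d & forall z, z != z0 -> cabs (z - z0) < d -> f z = 0) \/
  (exists2 d : R, 0 < d & forall z, z != z0 -> cabs (z - z0) < d -> f z != 0).
Proof.
case/Mer_factor => [|[m [j [k0 [k [k00 kk hk]]]]]]; [by left|right].
have [d d0 h] := dnear_and hk (cvg_dnear_neq kk k00).
exists d => // z zz0 /(h z zz0)[E kz].
apply: contraNneq kz => fz; move/eqP : E.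
by rewrite fz mulr0 eq_sym mulf_eq0 expf_eq0 subr_eq0 (negbTE zz0) andbF.
Qed.

(** A removable singularity, by comparing orders: if the quotient had a pole, the bounded [f] times
    a positive power of z - z0 would force the leading factor of [N] to tend to 0. *)
Lemma Mer_quotient_lim f N D z0 (B : R) : Mer N z0 -> Mer D z0 ->
  (exists2 d : R, 0 < d & forall z, z != z0 -> cabs (z - z0) < d -> D z != 0) ->
  (exists2 d : R, 0 < d & forall z, z != z0 -> cabs (z - z0) < d ->
     f z * D z = N z /\ cabs (f z) <= B) ->
  exists L : C, f z @[z --> z0^'] --> L.
Proof.
move=> hN hD D0 hf.
have FF : ProperFilter (z0^' : set_system C).
  apply: Build_ProperFilter_ex => P /near_C'[e e0 hP].
  by have [z [z1 z2]] := dnear_ex z0 e0; exists z; exact: hP.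
have FF' : Filter (z0^' : set_system C) by case: FF.
case: (Mer_factor hD) => [hz|[m [j [k0 [k [k00 kk hk]]]]]].
  have [d d0 h] := dnear_and hz D0; have [z [zz0 zd]] := dnear_ex z0 d0.
  by case: (h z zz0 zd) => ->; rewrite eqxx.
case: (Mer_factor hN) => [hz|[m' [j' [k0' [k' [k00' kk' hk']]]]]].
  exists 0; apply/cvg_atC' => e e0.
  have [d d0 h] := dnear_and hz (dnear_and D0 hf).
  exists d => // z zz0 /(h z zz0)[N0 [Dz [E _]]]; move/eqP: E.
  by rewrite N0 mulf_eq0 (negbTE Dz) orbF => /eqP ->; rewrite subrr cabs0.
have [d d0 h] := dnear_and (dnear_and hk hk') (dnear_and (cvg_dnear_neq kk k00) hf).
have key z : z != z0 -> cabs (z - z0) < d -> f z * (z - z0) ^+ (m' + j) * k z = (z - z0) ^+ (m + j') * k' z.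
  move=> zz0 /(h z zz0)[[E1 E2] [kz [E3 _]]].
  rewrite !exprD -!mulrA -E2 -E3 -E1; ring.
pose c0 (e : nat) : C := if e is 0%N then 1 else 0.
have cvgpow e : (z - z0) ^+ e @[z --> z0^'] --> c0 e.
  apply/cvg_atC' => eps eps0; case: e => [|e].
    by exists 1 => // z _ _; rewrite expr0 subrr cabs0.
  exists (Num.min 1 eps); first by rewrite lt_min ltr01.
  move=> z _; rewrite lt_min subr0 cabsX => /andP[z1 ze].
  by rewrite exprS (le_lt_trans _ ze)// ler_piMr// exprn_ile1// ltW.
case: (leqP (m' + j) (m + j')) => hmj.
  have := @cvgM _ _ _ FF' _ _ _ _ (cvgpow (m + j' - (m' + j))%N) (@cvgM _ _ _ FF' _ _ _ _ kk' (@cvgV _ _ _ FF' _ _ k00 kk)).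
  set L := _ * _ => hL; exists L; move: hL; apply: cvg_trans; apply: near_eq_cvg.
  apply/near_C'; exists d => // z zz0 zd; have [[E1 E2] [kz _]] := h z zz0 zd.
  have hz : (z - z0) ^+ (m' + j) != 0 by rewrite expf_neq0// subr_eq0.
  apply: (mulIf hz); apply: (mulIf kz); rewrite key//.
  have -> : (z - z0) ^+ (m + j') = (z - z0) ^+ (m + j' - (m' + j)) * (z - z0) ^+ (m' + j) by rewrite -exprD subnK.
  by rewrite /=; field.
exfalso; have k'z : k' z @[z --> z0^'] --> (0 : C).
  have cv : f z * (z - z0) ^+ (m' + j - (m + j')) @[z --> z0^'] --> (0 : C).
    apply/cvg_atC' => e e0.
    have /cvg_atC' := cvgpow (m' + j - (m + j'))%N.
    rewrite -(prednK (n := m' + j - (m + j'))) ?subn_gt0// => hc.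
    have B1 : 0 < `|B| + 1 by rewrite ltr_wpDl.
    have [|d1 d10 h1] := hc (e / (`|B| + 1)); first by rewrite divr_gt0.
    exists (Num.min d d1); first by rewrite lt_min d0.
    move=> z zz0; rewrite lt_min => /andP[zd zd1].
    have := h1 z zz0 zd1; rewrite !subr0 cabsM ltr_pdivlMr// mulrC => h2.
    apply: le_lt_trans h2; rewrite ler_wpM2r//.
    have [_ [_ [_ fB]]] := h z zz0 zd.
    by rewrite (le_trans fB)// (le_trans (ler_norm _))// lerDl.
  have := @cvgM _ _ _ FF' _ _ _ _ cv kk; rewrite mul0r; apply: cvg_trans; apply: near_eq_cvg.
  apply/near_C'; exists d => // z zz0 zd.
  have hz : (z - z0) ^+ (m + j') != 0 by rewrite expf_neq0// subr_eq0.
  apply: (mulIf hz); rewrite [RHS]mulrC -key//=.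
  have -> : (z - z0) ^+ (m' + j) = (z - z0) ^+ (m' + j - (m + j')) * (z - z0) ^+ (m + j').
    by rewrite -exprD subnK// ltnW.
  ring.
by move/eqP : k00'; apply; apply: (cvg_unique _ kk' k'z).
Qed.

Lemma dnear_spread (z0 : C) (P : C -> Prop) (d : R) :
  (forall z, z != z0 -> cabs (z - z0) < d -> P z) ->
  forall w, cabs (w - z0) < d -> exists2 e : R, 0 < e & forall z, z != w -> cabs (z - w) < e -> P z.
Proof.
move=> h w wd; have [->|wz0] := eqVneq w z0.
  by exists d => //; exact: le_lt_trans wd.
have c0 : 0 < cabs (w - z0) by rewrite cabs_gt0 subr_eq0.
exists (Num.min (cabs (w - z0)) (d - cabs (w - z0))); first by rewrite lt_min c0 subr_gt0.
move=> z zw; rewrite lt_min => /andP[z1 z2]; apply: h.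
  by apply: contraTneq z1 => ->; rewrite cabsBC ltxx.
rewrite -(subrK w z) -addrA (le_lt_trans (cabsD _ _))//; lra.
Qed.

(** By [Mer_dichotomy] a meromorphic function near a point is either zero or nonzero off that point,
    and both alternatives are open. Along the segment from zs to z0 their indicator is a continuous
    function with values 0 and 1, and the intermediate value theorem keeps it constant. *)
Lemma Mer_nonvanishing D (zs : C) :
  (forall z0, upper_half_plane z0 -> Mer D z0) -> upper_half_plane zs ->
  (exists2 d : R, 0 < d & forall z, z != zs -> cabs (z - zs) < d -> D z != 0) ->
  forall z0, upper_half_plane z0 ->
  exists2 d : R, 0 < d & forall z, z != z0 -> cabs (z - z0) < d -> D z != 0.
Proof.
move=> hD zsU nz z0 z0U.
pose NZ w := exists2 d : R, 0 < d & forall z, z != w -> cabs (z - w) < d -> D z != 0.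
pose Zr w := exists2 d : R, 0 < d & forall z, z != w -> cabs (z - w) < d -> D z = 0.
have excl w : NZ w -> Zr w -> False.
  move=> h1 h2; have [d d0 h] := dnear_and h1 h2.
  by have [z [z1 z2]] := dnear_ex w d0; case: (h z z1 z2) => /eqP.
(* Clamping the parameter to [0, 1] makes the path Lipschitz on the whole line and keeps it in the
   half-plane. *)
pose cl (t : R) := Num.min 1 (Num.max 0 t).
have cl01 t : 0 <= cl t <= 1.
  by rewrite /cl ge_min lexx le_min ler01 le_max lexx.
have clL s t : `|cl s - cl t| <= `|s - t|.
  rewrite /cl; case: (leP 0 s) => s0; case: (leP 0 t) => t0;
   rewrite ?(min_r ler01); try case: (leP 1 s) => s1; try case: (leP 1 t) => t1;
   rewrite ler_norml; case: (ler0P (s - t)) => st; lra.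
pose g t := zs + (cl t)%:C * (z0 - zs).
have gU t : upper_half_plane (g t).
  rewrite /upper_half_plane /= /g !reimE /=; move: zsU z0U (cl01 t); rewrite /upper_half_plane/=.
  by move=> a b /andP[c d]; nra.
have gL s t : cabs (g s - g t) <= `|s - t| * cabs (z0 - zs).
  have -> : g s - g t = (cl s - cl t)%:C * (z0 - zs) by rewrite /g CB; ring.
  by rewrite cabsM cabs_real ler_wpM2r.
pose f (t : R) : R := if `[< NZ (g t) >] then 1 else 0.
have fc : continuous f.
  move=> t; have K0 : 0 < cabs (z0 - zs) + 1 by rewrite ltr_wpDl.
  have loc : exists2 d : R, 0 < d & forall s, `|s - t| < d -> f s = f t.
    case: (Mer_dichotomy (hD _ (gU t))) => -[d d0 h].
      have tN : f t = 0 by rewrite /f; case: asboolP => // /excl []; exists d.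
      exists (d / (cabs (z0 - zs) + 1)); first by rewrite divr_gt0.
      move=> s; rewrite ltr_pdivlMr// => sd; rewrite tN /f; case: asboolP => // /excl [].
      apply: (dnear_spread h); apply: (le_lt_trans (gL s t)); apply: le_lt_trans sd.
      by rewrite ler_wpM2l// lerDl.
    have tN : f t = 1 by rewrite /f; case: asboolP => // -[]; exists d.
    exists (d / (cabs (z0 - zs) + 1)); first by rewrite divr_gt0.
    move=> s; rewrite ltr_pdivlMr// => sd; rewrite tN /f; case: asboolP => // -[].
    apply: (dnear_spread h); apply: (le_lt_trans (gL s t)); apply: le_lt_trans sd.
    by rewrite ler_wpM2l// lerDl.
  have [d d0 h] := loc; apply/cvgrPdist_lt => e e0; near=> s.
  suff -> : f s = f t by rewrite subrr normr0.
  near: s; apply/nbhs_normP; exists d => // s.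
  by rewrite /ball_/= distrC => /h.
have f0 : f 0 = 1.
  by rewrite /f /g /cl maxxx min_r// C0E mul0r addr0; case: asboolP.
have f1 : f 1 = 1 \/ f 1 = 0 by rewrite /f; case: asboolP; [left|right].
case: f1 => f1.
  move: f1; rewrite /f; case: asboolP => [+ _|_ /eqP]; last by rewrite eq_sym oner_eq0.
  by rewrite /g /cl max_r// minxx C1E mul1r addrC subrK.
have [|c _ fc'] := @IVT _ f 0 1 (1 / 2) ler01 (continuous_subspaceT fc).
  by rewrite f0 f1 max_l ?min_r//; apply/andP; split; lra.
exfalso; move: fc'; rewrite /f; case: asboolP => _; lra.
Unshelve. all: by end_near.
Qed.

End PowerSeries.

(** * Matrix-valued absolutely continuous functions *)

Section MatrixTopology.
Context {R : realType}.
Local Notation C := (cplx R).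

Lemma cabs_mx_norm m n (A : 'M[C]_(m, n)) i j : (cabs (A i j))%:C <= `|A| :> C.
Proof.
have : (`|A i j|%:nng : {nonneg C}) <= (\big[Num.max/0%:nng]_ij `|A ij.1 ij.2|%:nng).
  exact: (le_bigmax _ (fun ij : 'I_m * 'I_n => `|A ij.1 ij.2|%:nng) (i, j)).
by rewrite -num_le /= normCE.
Qed.

Lemma mx_norm_mabs m n (A : 'M[C]_(m, n)) : `|A| <= (mabs A)%:C :> C.
Proof.
have [h|A0] := eqVneq (mx_norm A) 0; first by rewrite [leLHS]h leC.
by have [[i j] h] := mx_norm_neq0 A0; rewrite [leLHS]h normCE leC mabs_entry.
Qed.

Lemma cvg_mabs (T : Type) (F : set_system T) {FF : Filter F} m n (f : T -> 'M[C]_(m, n)) (L : 'M[C]_(m, n)) :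
  f @ F --> L <-> forall e : R, 0 < e -> \forall x \near F, mabs (f x - L) < e.
Proof.
split=> [/cvgrPdist_lt h e e0|h].
  have K0 : 0 < (m * n)%:R + 1 :> R by rewrite ltr_wpDl.
  have e0' : 0 < (e / ((m * n)%:R + 1))%:C :> C by rewrite ltC divr_gt0.
  have := h _ e0'; apply: filterS => x; rewrite distrC => hx.
  have hij i j : cabs ((f x - L) i j) <= e / ((m * n)%:R + 1).
    by rewrite -leC (le_trans (cabs_mx_norm _ i j))// ltW.
  apply: (@le_lt_trans _ _ (\sum_(i < m) \sum_(j < n) e / ((m * n)%:R + 1))).
    by apply: ler_sum => i _; apply: ler_sum => j _.
  rewrite !sumr_const !card_ord -mulrnA -[ltLHS]mulr_natl mulrA ltr_pdivrMr// mulrC.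
  by rewrite ltr_pM2l// mulnC ltrDl.
apply/cvgrPdist_lt => e /posC[e0 ->]; apply: filterS (h _ e0) => x.
by rewrite distrC => hx; rewrite (le_lt_trans (mx_norm_mabs _))// ltC.
Qed.

Lemma cvg_entry (T : Type) (F : set_system T) {FF : Filter F} m n (f : T -> 'M[C]_(m, n)) (L : 'M[C]_(m, n)) :
  (forall i j, f x i j @[x --> F] --> L i j) -> f @ F --> L.
Proof.
move=> h; apply/cvg_mabs => e e0.
have K0 : 0 < (m * n)%:R + 1 :> R by rewrite ltr_wpDl.
have h' (i : 'I_m) (j : 'I_n) : \forall x \near F, cabs (f x i j - L i j) < e / ((m * n)%:R + 1).
  by have /cvg_C := h i j; apply; rewrite divr_gt0.
have : \forall x \near F, forall i j, cabs (f x i j - L i j) < e / ((m * n)%:R + 1).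
  by apply: filter_forall => i; apply: filter_forall => j.
apply: filterS => x hx.
apply: (@le_lt_trans _ _ (\sum_(i < m) \sum_(j < n) e / ((m * n)%:R + 1))).
  by apply: ler_sum => i _; apply: ler_sum => j _; rewrite !mxE ltW.
rewrite !sumr_const !card_ord -mulrnA -[ltLHS]mulr_natl mulrA ltr_pdivrMr// mulrC.
by rewrite ltr_pM2l// mulnC ltrDl.
Qed.

Lemma cvg_entry_inv (T : Type) (F : set_system T) {FF : Filter F} m n (f : T -> 'M[C]_(m, n)) (L : 'M[C]_(m, n)) i j :
  f @ F --> L -> f x i j @[x --> F] --> L i j.
Proof.
move=> /cvg_mabs h; apply/cvg_C => e /h; apply: filterS => x.
by apply: le_lt_trans; have := mabs_entry (f x - L) i j; rewrite !mxE.
Qed.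

Lemma is_deriv_onP (r : R) m n (G : R -> 'M[C]_(m, n)) x D :
  is_deriv_on r G x D <-> forall i j, Cderiv r (fun t => G t i j) x (D i j).
Proof.
rewrite /is_deriv_on; split.
  move=> h i j e e0.
  have FF : Filter (within `[0, r] x^') by exact: within_filter.
  have /cvg_C/(_ _ e0) := @cvg_entry_inv _ _ FF _ _ _ _ i j h.
  rewrite near_withinE near_withinE => /nbhs_normP[d /= d0 hd]; exists d => // y yr yx yd.
  have := hd y; rewrite /ball_/= distrC => /(_ yd yx); rewrite in_itv/= !mxE.
  exact.
move=> h; apply: cvg_entry => i j; apply/cvg_C => e e0.
have [d d0 hd] := h i j e e0; rewrite near_withinE near_withinE; apply/nbhs_normP; exists d => // y.
rewrite /ball_/= distrC => yd yx; rewrite in_itv/= => yr.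
by rewrite !mxE; exact: hd.
Qed.

End MatrixTopology.

(** * The complex exponential and its Taylor remainder *)

Section ComplexExponential.
Context {R : realType}.
Local Notation C := (cplx R).

Lemma cexpD (z w : C) : cexp (z + w) = cexp z * cexp w.
Proof.
rewrite /cexp; apply: complex_ext; rewrite !reimE /= expRD ?cosD ?sinD; ring.
Qed.
Lemma cexp0 : cexp 0 = 1 :> C.
Proof. by rewrite /cexp /= expR0 cos0 sin0 mulr1 mulr0. Qed.
Lemma cabs_cexp (z : C) : cabs (cexp z) = expR (Rez z).
Proof.
rewrite /cabs /cexp /= !exprMn -mulrDr cos2Dsin2 mulr1 sqrtr_sqr ger0_norm// expR_ge0.
Qed.
Lemma cexp_neq0 (z : C) : cexp z != 0.
Proof. by rewrite -cabs_gt0 cabs_cexp expR_gt0. Qed.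
Lemma cexpN (z : C) : cexp (- z) = (cexp z)^-1.
Proof.
by apply: (mulfI (cexp_neq0 z)); rewrite -cexpD subrr cexp0 divff// cexp_neq0.
Qed.
Lemma cexpX (z : C) n : cexp z ^+ n = cexp (n%:R * z).
Proof.
elim: n => [|n IH]; first by rewrite mul0r cexp0.
by rewrite exprS IH -cexpD -[n.+1%:R]natr1 mulrDl mul1r addrC.
Qed.
Lemma cexp_real (x : R) : cexp x%:C = (expR x)%:C.
Proof. by rewrite /cexp /= cos0 sin0 mulr1 mulr0. Qed.

Lemma is_derive_rderiv (r : R) (F : R -> R) (x l : R) : is_derive x 1 F l -> rderiv r F x l.
Proof.
move=> /is_derive1_caratheodory[g [gE gc gx]] e e0.
move/cvgrPdist_lt : gc => /(_ _ e0)/nbhs_normP[d /= d0 hd]; exists d => // y _ yx yd.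
rewrite gE mulrCA mulVf ?subr_eq0// mulr1 -gx distrC; apply: hd.
by rewrite /ball_/= distrC.
Qed.

Lemma Cderiv_of_reim (r : R) (F : R -> C) x l :
  rderiv r (fun t => Rez (F t)) x (Rez l) -> rderiv r (fun t => Imz (F t)) x (Imz l) ->
  Cderiv r F x l.
Proof.
move=> h1 h2 e e0; have e2 : 0 < e / 2 by rewrite divr_gt0.
have [d d0 hd] := h1 _ e2; have [d' d0' hd'] := h2 _ e2.
exists (Num.min d d'); first by rewrite lt_min d0.
move=> y yr yx; rewrite lt_min => /andP[y1 y2].
rewrite (le_lt_trans (cabs_le _))// (splitr e) !reimE/= !mul0r subr0 addr0 ltrD//; [exact: hd|exact: hd'].
Qed.

Lemma cexp_Cderiv (r : R) (c : C) x : Cderiv r (fun t => cexp (c * t%:C)) x (c * cexp (c * x%:C)).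
Proof.
apply: Cderiv_of_reim; apply: is_derive_rderiv; rewrite /cexp.
- have -> : (fun t : R => complex.Re ((expR (Rez (c * t%:C)) * cos (Imz (c * t%:C))) +i* (expR (Rez (c * t%:C)) * sin (Imz (c * t%:C))))) =
     (fun t => expR (Rez c * t) * cos (Imz c * t)).
    by apply/funext => t; rewrite !reimE /= !mulr0 subr0 add0r.
  apply: is_derive_eq; rewrite !reimE /= !mulr0 subr0 add0r /GRing.scale /=; ring.
have -> : (fun t : R => complex.Im ((expR (Rez (c * t%:C)) * cos (Imz (c * t%:C))) +i* (expR (Rez (c * t%:C)) * sin (Imz (c * t%:C))))) =
   (fun t => expR (Rez c * t) * sin (Imz c * t)).
  by apply/funext => t; rewrite !reimE /= !mulr0 subr0 add0r.
apply: is_derive_eq; rewrite !reimE /= !mulr0 subr0 add0r /GRing.scale /=; ring.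
Qed.

Lemma Cderiv_Ccont (r : R) (F : R -> C) x l : Cderiv r F x l -> Ccont r F x.
Proof.
move=> /Cderiv_reim[/rderiv_rcont h1 /rderiv_rcont h2] e e0.
have e2 : 0 < e / 2 by rewrite divr_gt0.
have [d d0 hd] := h1 _ e2; have [d' d0' hd'] := h2 _ e2.
exists (Num.min d d'); first by rewrite lt_min d0.
move=> y yr; rewrite lt_min => /andP[y1 y2].
rewrite (le_lt_trans (cabs_le _))// (splitr e) !reimE ltrD//; [exact: hd|exact: hd'].
Qed.

Lemma Ccont_Z (r : R) (F : R -> C) c x : Ccont r F x -> Ccont r (fun t => c * F t) x.
Proof.
move=> h e e0; have K0 : 0 < cabs c + 1 by rewrite ltr_wpDl.
have [|d d0 hd] := h (e / (cabs c + 1)); first by rewrite divr_gt0.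
exists d => // y yr yd; rewrite -mulrBr cabsM.
have := hd y yr yd; rewrite ltr_pdivlMr// mulrC; apply: le_lt_trans.
by rewrite ler_wpM2r// lerDl.
Qed.

Lemma AC_cexp (r : R) (r0 : 0 < r) (c : C) :
  AC r (fun t => cexp (c * t%:C)) (fun t => c * cexp (c * t%:C)).
Proof.
apply: AC_deriv => // x xr; first exact: cexp_Cderiv.
by apply: Ccont_Z; exact: Cderiv_Ccont (cexp_Cderiv r c x).
Qed.

(** The equation (e^{zt})' = z e^{zt} is integrated three times over [0, 1]; each integration gains
    a factor |z|. *)
Lemma cexp_taylor (z : C) :
  cabs (cexp z - 1 - z - z ^+ 2 / 2) <= cabs z ^+ 3 * expR (cabs z).
Proof.
have hac := AC_cexp ltr01 z; have [_ h] := hac.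
have hB := AC_BM ltr01 hac; have hL := CBM_CL1 hB.
have I01 t : 0 <= t <= 1 -> t <= 1 :> R by case/andP.
have ex t : 0 <= t <= 1 -> cabs (cexp (z * t%:C)) <= expR (cabs z).
  move=> /andP[t0 t1]; rewrite cabs_cexp ler_expR (le_trans (ler_norm _))// (le_trans (cabs_Re _))//.
  by rewrite cabsM cabs_real ger0_norm// ler_piMr.
have x1 : 0 <= expR (cabs z) by exact: expR_ge0.
have hcst (c : C) : CL1 1 (fun=> c) by exact: CBM_CL1 (CBM_cst _ _).
have hid : CL1 1 (fun t : R => t%:C : C).
  apply/CBM_CL1/Ccont_CBM => // t _ e e0; exists e => // y _ yt.
  by rewrite -CB cabs_real.
have g1 t : 0 <= t <= 1 -> cexp (z * t%:C) - 1 = z * cint t (fun s => cexp (z * s%:C)).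
  move=> t01; rewrite h// C0E mulr0 cexp0 addrAC subrr add0r -(cintZ (r := 1))//; exact: I01.
have b1 t : 0 <= t <= 1 -> cabs (cexp (z * t%:C) - 1) <= cabs z * expR (cabs z).
  move=> t01; rewrite g1// cabsM ler_wpM2l//.
  have := @cint_le_cst _ 1 _ (expR (cabs z)) t t01 hL.
  have /andP[t0 t1] := t01 => hh; apply: le_trans (hh _) _.
    by move=> s /andP[s0 st]; apply: ex; rewrite s0 (le_trans st).
  by rewrite ler_piMr.
have l1 : CL1 1 (fun s => cexp (z * s%:C) - 1) by apply: CL1_D => //; exact: hcst.
have g2 t : 0 <= t <= 1 -> cexp (z * t%:C) - 1 - z * t%:C = z * cint t (fun s => cexp (z * s%:C) - 1).
  move=> t01; have /andP[t0 t1] := t01.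
  by rewrite g1// (cintD (r := 1))// cint_cst//; ring.
have b2 t : 0 <= t <= 1 -> cabs (cexp (z * t%:C) - 1 - z * t%:C) <= cabs z ^+ 2 * expR (cabs z).
  move=> t01; rewrite g2// cabsM expr2 -mulrA ler_wpM2l//.
  have /andP[t0 t1] := t01; apply: le_trans (@cint_le_cst _ 1 _ (cabs z * expR (cabs z)) t t01 l1 _) _.
    by move=> s /andP[s0 st]; apply: b1; rewrite s0 (le_trans st).
  by rewrite ler_piMr// mulr_ge0.
have l2 : CL1 1 (fun s => cexp (z * s%:C) - 1 - z * s%:C).
  by apply: CL1_D => //; apply: CL1_N; exact: CL1_Z.
have t11 : 0 <= (1 : R) <= 1 by rewrite ler01 lexx.
have idE : cint 1 (fun s : R => s%:C) = 1 / 2 :> C.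
  have hq : AC 1 (fun t : R => (t ^+ 2 / 2)%:C : C) (fun t : R => t%:C : C).
    apply: AC_deriv => // t _; last by move=> e e0; exists e => // y _ yt; rewrite -CB cabs_real.
    move=> e e0; exists e => // y _ yt hy; rewrite -CB -CM -CB cabs_real.
    have -> : (y - t)^-1 * (y ^+ 2 / 2 - t ^+ 2 / 2) - t = (y - t) / 2.
      by field; rewrite subr_eq0.
    rewrite normrM [`|2^-1|]ger0_norm ?invr_ge0//.
    by rewrite ltr_pdivrMr// (lt_le_trans hy)// ler_peMr ?ltW// ltr1n.
  have [_ /(_ 1 t11)] := hq; rewrite expr0n /= mul0r C0E add0r => <-.
  by rewrite expr1n CM CV -Cnat.
have g3 : cexp z - 1 - z - z ^+ 2 / 2 = z * cint 1 (fun s => cexp (z * s%:C) - 1 - z * s%:C).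
  have := g2 1 t11; rewrite C1E mulr1 => g2'.
  have hzn : CL1 1 (fun s => - (z * s%:C)) by apply: CL1_N; exact: CL1_Z.
  rewrite (cintD (r := 1))// mulrDr -g2'.
  by rewrite (cintN (r := 1)) ?(cintZ (r := 1))//; [rewrite idE; ring|exact: CL1_Z].
rewrite g3 cabsM exprS -mulrA ler_wpM2l//.
apply: le_trans (@cint_le_cst _ 1 _ (cabs z ^+ 2 * expR (cabs z)) 1 t11 l2 _) _.
  exact: b2.
by rewrite mulr1.
Qed.

End ComplexExponential.

(** * Integrals and products of matrix functions *)

Section MatrixIntegrals.
Context {R : realType}.
Variable r : R.
Hypothesis r0 : 0 < r.
Local Notation C := (cplx R).
Local Notation mu := (@lebesgue_measure R).

Definition mBM m n (G : R -> 'M[C]_(m, n)) := forall i j, CBM r (fun t => G t i j).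
Definition mL2 m n (G : R -> 'M[C]_(m, n)) := forall i j, CL2 r (fun t => G t i j).
Definition mL1 m n (G : R -> 'M[C]_(m, n)) := forall i j, CL1 r (fun t => G t i j).
Definition mAC m n (F f : R -> 'M[C]_(m, n)) := forall i j, AC r (fun t => F t i j) (fun t => f t i j).
Definition mint m n x (G : R -> 'M[C]_(m, n)) := mxintegral `[0, x] G.

Lemma mintE m n x (G : R -> 'M[C]_(m, n)) i j : mint x G i j = cint x (fun t => G t i j).
Proof. by rewrite mxE. Qed.

Lemma mBM_cst m n (A : 'M[C]_(m, n)) : mBM (fun=> A).
Proof. by move=> i j; exact: CBM_cst. Qed.
Lemma mBM_mul m n q (F : R -> 'M[C]_(m, n)) (G : R -> 'M[C]_(n, q)) :
  mBM F -> mBM G -> mBM (fun t => F t *m G t).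
Proof.
move=> hF hG i j; apply: (@eq_CBM _ _ (fun t => \sum_k F t i k * G t k j)).
  by move=> t _; rewrite mxE.
by apply: CBM_sum => k; exact: CBM_M.
Qed.
Lemma mBM_D m n (F G : R -> 'M[C]_(m, n)) : mBM F -> mBM G -> mBM (fun t => F t + G t).
Proof. by move=> hF hG i j; apply: eq_CBM (CBM_D (hF i j) (hG i j)) => t _; rewrite mxE. Qed.
Lemma mBM_Z m n (f : R -> C) (G : R -> 'M[C]_(m, n)) : CBM r f -> mBM G -> mBM (fun t => f t *: G t).
Proof. by move=> hF hG i j; apply: eq_CBM (CBM_M hF (hG i j)) => t _; rewrite mxE. Qed.
Lemma mBM_N m n (G : R -> 'M[C]_(m, n)) : mBM G -> mBM (fun t => - G t).
Proof. by move=> hG i j; apply: eq_CBM (CBM_N (hG i j)) => t _; rewrite mxE. Qed.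
Lemma mBM_J m n (G : R -> 'M[C]_(m, n)) : mBM G -> mBM (fun t => (G t)^t*).
Proof. by move=> hG i j; apply: eq_CBM (CBM_J (hG j i)) => t _; rewrite !mxE. Qed.
Lemma mBM_L2 m n (G : R -> 'M[C]_(m, n)) : mBM G -> mL2 G.
Proof. by move=> h i j; exact: CBM_CL2. Qed.
Lemma mL2_L1 m n (G : R -> 'M[C]_(m, n)) : mL2 G -> mL1 G.
Proof. by move=> h i j; exact: CL2_CL1. Qed.
Lemma mBM_L1 m n (G : R -> 'M[C]_(m, n)) : mBM G -> mL1 G.
Proof. by move=> h i j; exact: CBM_CL1. Qed.
Lemma mL2_D m n (F G : R -> 'M[C]_(m, n)) : mL2 F -> mL2 G -> mL2 (fun t => F t + G t).
Proof. by move=> hF hG i j; apply: eq_CL2 (CL2_D (hF i j) (hG i j)) => t _; rewrite mxE. Qed.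
Lemma mL2_N m n (F : R -> 'M[C]_(m, n)) : mL2 F -> mL2 (fun t => - F t).
Proof. by move=> hF i j; apply: eq_CL2 (CL2_N (hF i j)) => t _; rewrite mxE. Qed.
Lemma mL2_Z m n (f : R -> C) (G : R -> 'M[C]_(m, n)) : CBM r f -> mL2 G -> mL2 (fun t => f t *: G t).
Proof. by move=> hF hG i j; apply: eq_CL2 (CL2_BM (hG i j) hF) => t _; rewrite mxE mulrC. Qed.
Lemma mL2_mulr m n q (F : R -> 'M[C]_(m, n)) (G : R -> 'M[C]_(n, q)) :
  mL2 F -> mBM G -> mL2 (fun t => F t *m G t).
Proof.
move=> hF hG i j; apply: (@eq_CL2 _ _ (fun t => \sum_k F t i k * G t k j)).
  by move=> t _; rewrite mxE.
by apply: CL2_sum => // k; exact: CL2_BM.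
Qed.
Lemma mL2_mull m n q (F : R -> 'M[C]_(m, n)) (G : R -> 'M[C]_(n, q)) :
  mBM F -> mL2 G -> mL2 (fun t => F t *m G t).
Proof.
move=> hF hG i j; apply: (@eq_CL2 _ _ (fun t => \sum_k F t i k * G t k j)).
  by move=> t _; rewrite mxE.
by apply: CL2_sum => // k; apply: eq_CL2 (CL2_BM (hG k j) (hF i k)) => t _; rewrite mulrC.
Qed.
Lemma mL1_mull m n q (A : 'M[C]_(m, n)) (G : R -> 'M[C]_(n, q)) x : x <= r ->
  mL1 G -> mL1 (fun t => A *m G t) /\ mint x (fun t => A *m G t) = A *m mint x G.
Proof.
move=> xr hG; have h i j : CL1 r (fun t => \sum_k A i k * G t k j) /\
   cint x (fun t => \sum_k A i k * G t k j) = \sum_k A i k * cint x (fun t => G t k j).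
  have hk k : CL1 r (fun t => A i k * G t k j) by exact: CL1_Z.
  split; last by rewrite (cint_sum (r := r))//; apply: eq_bigr => k _; rewrite (cintZ (r := r)).
  elim: (index_enum _) => [|k s IH].
    by apply: eq_CL1 (CBM_CL1 (CBM_cst r 0)) => t _; rewrite big_nil.
  by apply: eq_CL1 (CL1_D (hk k) IH) => t _; rewrite big_cons.
split; first by move=> i j; apply: eq_CL1 (h i j).1 => t _; rewrite mxE.
apply/matrixP => i j; rewrite mintE [RHS]mxE (eq_bigr (fun k => A i k * cint x (fun t => G t k j))); last by move=> k _; rewrite mintE.
by rewrite -(h i j).2; apply: cint_eq => t _; rewrite mxE.
Qed.
Lemma mint_mull m n q (A : 'M[C]_(m, n)) (G : R -> 'M[C]_(n, q)) x : x <= r ->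
  mL1 G -> mint x (fun t => A *m G t) = A *m mint x G.
Proof. by move=> xr hG; case: (mL1_mull A xr hG). Qed.
Lemma mint_eq m n (F G : R -> 'M[C]_(m, n)) x : (forall t, 0 <= t <= x -> F t = G t) ->
  mint x F = mint x G.
Proof.
by move=> h; apply/matrixP => i j; rewrite !mintE; apply: cint_eq => t /h ->.
Qed.
Lemma mint_tr m n (G : R -> 'M[C]_(m, n)) x : mint x (fun t => (G t)^T) = (mint x G)^T.
Proof. by apply/matrixP => i j; rewrite [RHS]mxE !mintE; apply: cint_eq => t _; rewrite mxE. Qed.
Lemma mint_mulr m n q (A : 'M[C]_(n, q)) (G : R -> 'M[C]_(m, n)) x : x <= r ->
  mL1 G -> mint x (fun t => G t *m A) = mint x G *m A.
Proof.
move=> xr hG; apply: trmx_inj; rewrite -mint_tr trmx_mul -mint_tr -mint_mull//.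
  by apply: mint_eq => t _; rewrite trmx_mul.
by move=> i j; apply: eq_CL1 (hG j i) => t _; rewrite mxE.
Qed.
Lemma mintD m n (F G : R -> 'M[C]_(m, n)) x : x <= r -> mL1 F -> mL1 G ->
  mint x (fun t => F t + G t) = mint x F + mint x G.
Proof.
move=> xr hF hG; apply/matrixP => i j; rewrite [RHS]mxE !mintE -(cintD xr)//.
by apply: cint_eq => t _; rewrite mxE.
Qed.
Lemma mintZ m n c (G : R -> 'M[C]_(m, n)) x : x <= r -> mL1 G ->
  mint x (fun t => c *: G t) = c *: mint x G.
Proof.
move=> xr hG; apply/matrixP => i j; rewrite [RHS]mxE !mintE -(cintZ _ xr)//.
by apply: cint_eq => t _; rewrite mxE.
Qed.
Lemma mintN m n (G : R -> 'M[C]_(m, n)) x : x <= r -> mL1 G ->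
  mint x (fun t => - G t) = - mint x G.
Proof. by move=> xr hG; rewrite -scaleN1r -mintZ//; apply: mint_eq => t _; rewrite scaleN1r. Qed.
Lemma mint0 m n (G : R -> 'M[C]_(m, n)) : mint 0 G = 0.
Proof. by apply/matrixP => i j; rewrite mintE cint0 mxE. Qed.
Lemma mint_ae m n (F G : R -> 'M[C]_(m, n)) x : x <= r -> mL1 F -> mL1 G ->
  {ae mu, forall t, 0 < t < r -> F t = G t} -> mint x F = mint x G.
Proof.
move=> xr hF hG h; apply/matrixP => i j; rewrite !mintE; apply: (cint_ae xr (hF i j) (hG i j)).
by apply: (aeS h) => t ht /ht ->.
Qed.
Lemma L1r_sum I (s : seq I) (P : pred I) (f : I -> R -> R) :
  (forall i, L1r r (f i)) -> L1r r (fun t => \sum_(i <- s | P i) f i t).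
Proof.
move=> hf; elim: s => [|i s IH].
  by apply: eq_L1r (BMr_L1 (BMr_cst r 0)) => t _; rewrite big_nil.
case Pi: (P i); first by apply: eq_L1r (L1rD (hf i) IH) => t _; rewrite big_cons Pi.
by apply: eq_L1r IH => t _; rewrite big_cons Pi.
Qed.
Lemma Ir_sum I (s : seq I) (P : pred I) (f : I -> R -> R) x : x <= r ->
  (forall i, L1r r (f i)) ->
  Ir x (fun t => \sum_(i <- s | P i) f i t) = \sum_(i <- s | P i) Ir x (f i).
Proof.
move=> xr hf; elim: s => [|i s IH].
  rewrite big_nil (@Ir_eq _ _ (fun=> 0)); last by move=> t _; rewrite big_nil.
  by rewrite /Ir /Rintegral integral0.
rewrite big_cons; case Pi: (P i).
  rewrite -IH -(IrD xr)//; last exact: L1r_sum.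
  by apply: Ir_eq => t _; rewrite big_cons Pi.
by rewrite -IH; apply: Ir_eq => t _; rewrite big_cons Pi.
Qed.
Lemma L1r_mabs m n (G : R -> 'M[C]_(m, n)) : mL1 G -> L1r r (fun t => mabs (G t)).
Proof. by move=> hG; apply: L1r_sum => i; apply: L1r_sum => j; exact: L1r_cabs. Qed.
Lemma mint_abs m n (G : R -> 'M[C]_(m, n)) x : x <= r -> mL1 G ->
  mabs (mint x G) <= Ir x (fun t => mabs (G t)).
Proof.
move=> xr hG; rewrite /mabs Ir_sum//; last by move=> i; apply: L1r_sum => j; exact: L1r_cabs.
apply: ler_sum => i _; rewrite Ir_sum//; last by move=> j; exact: L1r_cabs.
by apply: ler_sum => j _; rewrite mintE; exact: (cint_abs xr).
Qed.
Lemma mint_le m n (G : R -> 'M[C]_(m, n)) (g : R -> R) x : x <= r -> mL1 G -> L1r r g ->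
  (forall t, 0 <= t <= x -> mabs (G t) <= g t) -> mabs (mint x G) <= Ir x g.
Proof.
move=> xr hG hg h; apply: (le_trans (mint_abs xr hG)).
by apply: (Ir_le xr) => //; exact: L1r_mabs.
Qed.
Lemma mBM_mint m n (G : R -> 'M[C]_(m, n)) : mL1 G -> mBM (fun x => mint x G).
Proof. by move=> hG i j; apply: eq_CBM (CBM_cint r0 (hG i j)) => x _; rewrite mintE. Qed.
Lemma mBM_bound m n (G : R -> 'M[C]_(m, n)) : mBM G ->
  exists2 B : R, 0 <= B & forall x, 0 <= x <= r -> mabs (G x) <= B.
Proof.
move=> hG; have /choice[B hB] : forall ij : 'I_m * 'I_n, exists B : R, 0 <= B /\
    forall x, 0 <= x <= r -> cabs (G x ij.1 ij.2) <= B.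
  by move=> [i j]; have [B B0 hB] := CBM_bound r0 (hG i j); exists B.
exists (\sum_i \sum_j B (i, j)).
  by apply: sumr_ge0 => i _; apply: sumr_ge0 => j _; case: (hB (i, j)).
by move=> x xr; apply: ler_sum => i _; apply: ler_sum => j _; case: (hB (i, j)) => _ /(_ x xr).
Qed.

Lemma mAC_L2 m n (F f : R -> 'M[C]_(m, n)) : mAC F f -> mL2 f.
Proof. by move=> h i j; case: (h i j). Qed.
Lemma mAC_L1 m n (F f : R -> 'M[C]_(m, n)) : mAC F f -> mL1 f.
Proof. by move=> /mAC_L2/mL2_L1. Qed.
Lemma mAC_BM m n (F f : R -> 'M[C]_(m, n)) : mAC F f -> mBM F.
Proof. by move=> h i j; exact: AC_BM (h i j). Qed.
Lemma mAC_E m n (F f : R -> 'M[C]_(m, n)) x : mAC F f -> 0 <= x <= r -> F x = F 0 + mint x f.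
Proof. by move=> h xr; apply/matrixP => i j; rewrite [RHS]mxE mintE; case: (h i j) => _ ->. Qed.
Lemma mACP m n (F f : R -> 'M[C]_(m, n)) : mL2 f -> (forall x, 0 <= x <= r -> F x = F 0 + mint x f) ->
  mAC F f.
Proof. by move=> hf h i j; split=> // x xr; rewrite h// mxE mintE. Qed.
Lemma mAC_ext m n (F f G g : R -> 'M[C]_(m, n)) : (forall x, 0 <= x <= r -> F x = G x) ->
  (forall x, 0 <= x <= r -> f x = g x) -> mAC F f -> mAC G g.
Proof. by move=> h1 h2 h i j; apply: (AC_ext r0 _ _ (h i j)) => x xr; rewrite ?h1 ?h2. Qed.
Lemma mAC_ext_ae m n (F f g : R -> 'M[C]_(m, n)) : mL2 g ->
  {ae mu, forall x, 0 < x < r -> f x = g x} -> mAC F f -> mAC F g.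
Proof.
move=> hg fg h i j; apply: (AC_ext_ae (hg i j) _ (h i j)).
by apply: (aeS fg) => t ht /ht ->.
Qed.
Lemma mAC_cst m n (A : 'M[C]_(m, n)) : mAC (fun=> A) (fun=> 0).
Proof. by move=> i j; apply: (AC_ext r0 _ _ (AC_cst r (A i j))) => x _ //; rewrite mxE. Qed.
Lemma mAC_mint m n (A : 'M[C]_(m, n)) (f : R -> 'M[C]_(m, n)) : mL2 f ->
  mAC (fun x => A + mint x f) f.
Proof. by move=> hf; apply: mACP => // x xr; rewrite mint0 addr0. Qed.
Lemma mAC_D m n (F f G g : R -> 'M[C]_(m, n)) : mAC F f -> mAC G g ->
  mAC (fun x => F x + G x) (fun x => f x + g x).
Proof. by move=> h k i j; apply: (AC_ext r0 _ _ (AC_D (h i j) (k i j))) => x _; rewrite mxE. Qed.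
Lemma mAC_N m n (F f : R -> 'M[C]_(m, n)) : mAC F f -> mAC (fun x => - F x) (fun x => - f x).
Proof. by move=> h i j; apply: (AC_ext r0 _ _ (AC_N r0 (h i j))) => x _; rewrite mxE. Qed.
Lemma mAC_J m n (F f : R -> 'M[C]_(m, n)) : mAC F f -> mAC (fun x => (F x)^t*) (fun x => (f x)^t*).
Proof. by move=> h i j; apply: (AC_ext r0 _ _ (AC_J (h j i))) => x _; rewrite !mxE. Qed.
Lemma mAC_Z m n (f g : R -> C) (F G : R -> 'M[C]_(m, n)) : AC r f g -> mAC F G ->
  mAC (fun x => f x *: F x) (fun x => g x *: F x + f x *: G x).
Proof. by move=> h k i j; apply: (AC_ext r0 _ _ (AC_M r0 h (k i j))) => x _; rewrite !mxE. Qed.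
Lemma mAC_M m n q (F f : R -> 'M[C]_(m, n)) (G g : R -> 'M[C]_(n, q)) :
  mAC F f -> mAC G g -> mAC (fun x => F x *m G x) (fun x => f x *m G x + F x *m g x).
Proof.
move=> h k i j.
have := AC_sum (index_enum 'I_n) xpredT (fun l => AC_M r0 (h i l) (k l j)).
apply: (AC_ext r0) => x _; first by rewrite mxE.
by rewrite !mxE big_split.
Qed.
Lemma mAC_Mr m n q (A : 'M[C]_(n, q)) (G g : R -> 'M[C]_(m, n)) :
  mAC G g -> mAC (fun x => G x *m A) (fun x => g x *m A).
Proof.
by move=> hG; apply: (mAC_ext _ _ (mAC_M hG (mAC_cst A))) => // x _; rewrite mulmx0 addr0.
Qed.
Lemma mAC_Zc m n c (G g : R -> 'M[C]_(m, n)) :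
  mAC G g -> mAC (fun x => c *: G x) (fun x => c *: g x).
Proof.
by move=> hG; apply: (mAC_ext _ _ (mAC_Z (AC_cst r c) hG)) => // x _; rewrite scale0r add0r.
Qed.

Lemma mAC_deriv m n (F f g : R -> 'M[C]_(m, n)) :
  (forall x, 0 <= x <= r -> is_deriv_on r F x (f x)) -> mAC f g -> mAC F f.
Proof.
move=> dF hf i j; apply: AC_deriv => // x xr.
  by have /is_deriv_onP := dF x xr.
exact: AC_Ccont (hf i j) x xr.
Qed.
Lemma mAC_is_deriv m n (F f g : R -> 'M[C]_(m, n)) : mAC F f -> mAC f g ->
  forall x, 0 <= x <= r -> is_deriv_on r F x (f x).
Proof.
move=> hF hf x xr; apply/is_deriv_onP => i j; apply: AC_Cderiv (hF i j) _ x xr => y yr.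
exact: AC_Ccont (hf i j) y yr.
Qed.

(** The squared Hilbert-Schmidt norm, which is the integrand of [l2normsq]. *)
Definition mnormsq m n (A : 'M[C]_(m, n)) : R := \sum_i \sum_j cabs (A i j) ^+ 2.

Lemma L1r_mnormsq m n (G : R -> 'M[C]_(m, n)) : mL2 G -> L1r r (fun t => mnormsq (G t)).
Proof.
move=> hG; apply: L1r_sum => i; apply: L1r_sum => j; have [[_ h1] [_ h2]] := hG i j.
have := L1rD (f := fun t => Rez (G t i j) ^+ 2) (g := fun t => Imz (G t i j) ^+ 2) h1 h2.
by apply: eq_L1r => t _; rewrite cabs_sqr.
Qed.

Lemma l2normsqE m n (G : R -> 'M[C]_(m, n)) : mL2 G ->
  l2normsq r G = (Ir r (fun t => mnormsq (G t)))%:E.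
Proof.
move=> hG; have h := L1r_mnormsq hG; rewrite /l2normsq.
have h' : mu.-integrable `]0%R, r[ (EFin \o (fun t => mnormsq (G t))).
  by apply: integrableS h => // t /=; rewrite !in_itv/= => /andP[/ltW -> /ltW ->].
rewrite /Ir -[in RHS]Rintegral_itv_bndo_bndc; last first.
  by apply: integrableS h => // t /=; rewrite !in_itv/= => /andP[-> /ltW ->].
rewrite -[in RHS]Rintegral_itv_obnd_cbnd// /Rintegral fineK; last exact: integrable_fin_num.
apply: eq_integral => t _; congr (_%:E); apply: eq_bigr => i _; apply: eq_bigr => j _.
by rewrite cabs_sqr.
Qed.

Lemma mL2_isL2 m n (G : R -> 'M[C]_(m, n)) : mL2 G -> isL2 r G.
Proof.
move=> hG; split; last by rewrite l2normsqE// ltry.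
have sub : `]0, r[ `<=` `[0, r]%classic by move=> t /=; rewrite !in_itv/= => /andP[/ltW -> /ltW ->].
by move=> i j; have [[h1 _] [h2 _]] := hG i j; split; apply: measurable_funS sub _.
Qed.

Lemma isL2_mL2 m n (G : R -> 'M[C]_(m, n)) : isL2 r G -> mL2 G.
Proof.
move=> [mG fG].
have me (u : R -> R) : measurable_fun `]0, r[ u -> measurable_fun `[0, r] u.
  by move=> h; apply: measurable_fun_itv_cc; exact: h.
have nonneg (t : R) : 0 <= \sum_i \sum_j (Rez (G t i j) ^+ 2 + Imz (G t i j) ^+ 2).
  by apply: sumr_ge0 => i _; apply: sumr_ge0 => j _; rewrite addr_ge0 ?sqr_ge0.
have hs : mu.-integrable `]0%R, r[ (fun t => (\sum_i \sum_j (Rez (G t i j) ^+ 2 + Imz (G t i j) ^+ 2))%:E).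
  apply/integrableP; split.
    apply/measurable_EFinP; apply: measurable_sum => i; apply: measurable_sum => j.
    by have [h1 h2] := mG i j; apply: measurable_funD; exact: measurable_funX.
  rewrite (_ : (\int[_]_(_ in _) _)%E = l2normsq r G)//.
  by apply: eq_integral => t _; rewrite gee0_abs// lee_fin.
have key (u : R -> R) : measurable_fun `]0, r[ u ->
   (forall t, u t ^+ 2 <= \sum_i \sum_j (Rez (G t i j) ^+ 2 + Imz (G t i j) ^+ 2)) -> L2r r u.
  move=> mu' hu; split; first exact: me.
  have : mu.-integrable `]0%R, r[ (fun t => (u t ^+ 2)%:E).
    apply: (le_integrable _ _ _ hs) => //.
      by apply/measurable_EFinP; exact: measurable_funX.
    by move=> t _; rewrite lee_fin !ger0_norm ?sqr_ge0.
  move=> h; apply/integrableP; split; first by apply/measurable_EFinP; apply: measurable_funX; exact: me.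
  have /integrableP[_] := h.
  rewrite integral_itv_obnd_cbnd; last first.
    do 2 apply: measurableT_comp => //; apply: measurable_funX => //.
  rewrite integral_itv_bndo_bndc//.
  do 2 apply: measurableT_comp => //; apply: measurable_funX.
  apply: measurable_funS (me u mu') => //.
  by move=> t /=; rewrite !in_itv/= => /andP[-> /ltW ->].
move=> i j; have [h1 h2] := mG i j.
have tot (t : R) : Rez (G t i j) ^+ 2 + Imz (G t i j) ^+ 2 <= \sum_i \sum_j (Rez (G t i j) ^+ 2 + Imz (G t i j) ^+ 2).
  rewrite [leRHS](bigD1 i)//= (bigD1 j)//= -addrA lerDl addr_ge0//.
    by apply: sumr_ge0 => k _; rewrite addr_ge0 ?sqr_ge0.
  by apply: sumr_ge0 => k _; apply: sumr_ge0 => l _; rewrite addr_ge0 ?sqr_ge0.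
split; apply: key => // t; apply: le_trans (tot t); rewrite ?lerDl ?lerDr sqr_ge0//.
Qed.

Lemma ae_equalP m n (F G : R -> 'M[C]_(m, n)) :
  ae_equal r F G <-> {ae mu, forall x, 0 < x < r -> F x = G x}.
Proof.
split=> h; apply: (aeS h) => x hx; first by move=> xr; apply: hx; rewrite inE.
by rewrite inE; exact: hx.
Qed.

End MatrixIntegrals.

(** * Linear differential equations and the fundamental solution *)

Section LinearODE.
Context {R : realType} (r : R) (r0 : 0 < r).
Local Notation C := (cplx R).

Lemma expR_rderiv (kap x : R) : rderiv r (fun t => expR (kap * t)) x (kap * expR (kap * x)).
Proof.
apply: is_derive_rderiv; rewrite mulrC.
have h1 : is_derive x 1 (fun t : R => kap * t) kap.
  have := @is_deriveZ _ _ _ id kap x 1 1 (is_derive_id _ _).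
  by rewrite /= [kap *: _]mulr1.
by have := @is_derive1_comp _ expR (fun t : R => kap * t) x _ _ (is_derive_expR _) h1.
Qed.

Lemma expR_BMr (kap : R) : BMr r (fun t => expR (kap * t)).
Proof.
apply: within_cont_BM; apply: (within_rcont r0) => x xr.
exact: rderiv_rcont (expR_rderiv kap x).
Qed.

Lemma Ir_expR (kap x : R) : 0 < kap -> 0 <= x <= r ->
  Ir x (fun t => expR (kap * t)) <= kap^-1 * expR (kap * x).
Proof.
move=> k0 xr.
have h : forall y, 0 <= y <= r -> rderiv r (fun t => kap^-1 * expR (kap * t)) y (expR (kap * y)).
  move=> y yr e e0; have ke : 0 < kap * e by exact: mulr_gt0.
  have [d d0 hd] := expR_rderiv kap y ke; exists d => // z zr zy zd.
  rewrite -mulrBr mulrCA -{2}[expR (kap * y)](mulKf (lt0r_neq0 k0)) -mulrBr normrM gtr0_norm ?invr_gt0//.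
  by rewrite mulrC ltr_pdivrMr// [e * _]mulrC hd.
rewrite (Ir_FTC2 r0 xr h); last by move=> y yr; exact: rderiv_rcont (expR_rderiv kap y).
by rewrite lerDr mulr_ge0 ?expR_ge0// invr_ge0 ltW.
Qed.

(** * Solutions by Picard iteration *)

Section Picard.
Variables m n : nat.
Variable A0 : R -> 'M[C]_m.
Hypothesis hA : mBM r A0.

(** In the sup norm weighted by e^{-kap x} the Volterra operator contracts by c/kap. The lemma takes
    any sequence obeying the recursion because it serves both the iterates and the remainders of a
    given solution. *)
Lemma picard_bound (D : nat -> R -> 'M[C]_(m, n)) (c B kap : R) :
  (forall x, 0 <= x <= r -> mabs (A0 x) <= c) -> 0 < kap -> 0 <= c -> 0 <= B ->
  (forall k, mBM r (D k)) -> (forall x, 0 <= x <= r -> mabs (D 0%N x) <= B) ->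
  (forall k x, 0 <= x <= r -> D k.+1 x = mint x (fun t => A0 t *m D k t)) ->
  forall k x, 0 <= x <= r -> mabs (D k x) <= B * (c / kap) ^+ k * expR (kap * x).
Proof.
move=> hc k0 c0 B0 hD h0 hS; elim=> [|k IH] x xr.
  rewrite expr0 mulr1 (le_trans (h0 x xr))// ler_peMr// -[leLHS]expR0 ler_expR mulr_ge0 ?(ltW k0)//.
  by case/andP: xr.
have xr' : x <= r by case/andP: xr.
have hL := BMr_L1 (expR_BMr kap).
rewrite hS//; apply: (@le_trans _ _ (Ir x (fun t => c * (B * (c / kap) ^+ k) * expR (kap * t)))).
  apply: (mint_le xr'); [exact: mBM_L1 (mBM_mul hA (hD k))|exact: L1rZ|].
  move=> t /andP[t0 tx]; have tr : 0 <= t <= r by rewrite t0 (le_trans tx).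
  by rewrite (le_trans (mabsM _ _))// -mulrA ler_pM ?mabs_ge0 ?hc ?IH.
rewrite (IrZ _ xr')// (le_trans (ler_wpM2l _ (Ir_expR k0 xr)))//.
  by rewrite !mulr_ge0// exprn_ge0// divr_ge0// ltW.
by rewrite exprS le_eqVlt; apply/orP; left; apply/eqP; ring.
Qed.

(** The k-th term of the Neumann series; the approximate solutions are its partial sums. *)
Fixpoint picard (V0 : 'M[C]_(m, n)) k x : 'M[C]_(m, n) :=
  if k is k'.+1 then mint x (fun t => A0 t *m picard V0 k' t) else V0.

Lemma picard_BM V0 k : mBM r (picard V0 k).
Proof.
elim: k => [|k IH]; first exact: mBM_cst.
by apply: (mBM_mint r0); exact: mBM_L1 (mBM_mul hA IH).
Qed.

Lemma mabs_le_cst (M : 'M[C]_(m, n)) e : (forall i j, cabs (M i j) <= e) -> mabs M <= m%:R * (n%:R * e).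
Proof.
move=> h; apply: (@le_trans _ _ (\sum_(i < m) \sum_(j < n) e)).
  by apply: ler_sum => i _; apply: ler_sum.
by rewrite !sumr_const !card_ord !mulr_natl.
Qed.

Lemma ODE_exists (V0 : 'M[C]_(m, n)) : exists X : R -> 'M[C]_(m, n),
  mAC r X (fun x => A0 x *m X x) /\ X 0 = V0.
Proof.
have r0' := ltW r0.
have [c c0 hc] := mBM_bound r0 hA.
(* Makes the ratio q = c/kap smaller than 1/2, the summand 1 covering c = 0. *)
pose kap := 2 * c + 1; have k0 : 0 < kap by rewrite ltr_wpDl// mulr_ge0.
pose q := c / kap; have q1 : 0 <= q < 1.
  by rewrite divr_ge0 ?(ltW k0)//= ltr_pdivrMr// mul1r /kap; lra.
have q1' : 0 < 1 - q by rewrite subr_gt0; case/andP: q1.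
pose B := mabs V0 * expR (kap * r).
have B0 : 0 <= B by rewrite mulr_ge0 ?mabs_ge0 ?expR_ge0.
have pb k x : 0 <= x <= r -> mabs (picard V0 k x) <= B * q ^+ k.
  move=> xr; have := @picard_bound (picard V0) c (mabs V0) kap hc k0 c0 (mabs_ge0 _) (picard_BM V0) _ _ k x xr.
  move=> h; apply: (le_trans (h _ _)) => //.
  rewrite /B -mulrA [leRHS]mulrAC -mulrA; apply: ler_wpM2l; first exact: mabs_ge0.
  apply: ler_wpM2l; first by rewrite exprn_ge0//; case/andP: q1.
  by rewrite ler_expR ler_wpM2l ?(ltW k0)//; case/andP: xr.
pose s k x := \sum_(j < k) picard V0 j x.
have sBM k : mBM r (s k).
  elim: k => [|k IH]; first by rewrite /s => i j; under eq_fun do rewrite big_ord0; exact: (mBM_cst r 0).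
  by rewrite /s => i j; under eq_fun do rewrite big_ord_recr; exact: (mBM_D IH (picard_BM V0 k)).
have sS k x : 0 <= x <= r -> s k.+1 x = V0 + mint x (fun t => A0 t *m s k t).
  move=> /andP[x0 xr]; elim: k => [|k IH].
    rewrite /s big_ord1; apply/matrixP => i j; rewrite [RHS]mxE mintE.
    rewrite (@cint_eq _ _ (fun=> 0)) ?cint_cst// ?mul0r ?addr0// => t _.
    by rewrite big_ord0 mulmx0 mxE.
  rewrite {1}/s big_ord_recr /= -/(s k.+1 x) IH -addrA; congr (_ + _).
  rewrite -(mintD xr); do ?[apply: mBM_L1 => //; exact: mBM_mul|exact: (mBM_L1 (mBM_mul hA (picard_BM V0 k)))].
  by apply: mint_eq => t _; rewrite /s big_ord_recr mulmxDr.
(* The limits are taken entry by entry and point by point, but with one geometric rate on [0, r];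
   this uniformity gives continuity of [X] and the passage to the limit under the integral. *)
have /choice[X hX] : forall x, exists Y : 'M[C]_(m, n), 0 <= x <= r ->
    forall i j k, cabs (s k x i j - Y i j) <= B / (1 - q) * q ^+ k.
  move=> x; case xr : (0 <= x <= r); last by exists 0.
  have /choice[Y hY] : forall ij : 'I_m * 'I_n, exists y : C,
      forall k, cabs (s k x ij.1 ij.2 - y) <= B / (1 - q) * q ^+ k.
    move=> [i j]; apply: geo_cauchy_C => // k /=.
    rewrite /s big_ord_recr /= mxE addrAC subrr add0r.
    exact: le_trans (mabs_entry _ i j) (pb k x xr).
  by exists (\matrix_(i, j) Y (i, j)) => _ i j k; rewrite mxE; exact: (hY (i, j)).
pose K := B / (1 - q); have K0 : 0 <= K by rewrite divr_ge0// ltW.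
have q0 : 0 <= q by case/andP: q1.
have Xc i j x : 0 <= x <= r -> Ccont r (fun t => X t i j) x.
  move=> xr e e0; have e3 : 0 < e / 3 by rewrite divr_gt0.
  have [N hN] := exp_small K q1 e3.
  have hm := mAC_mint V0 (mBM_L2 (mBM_mul hA (sBM N))).
  have [d d0 hd] := AC_Ccont r0 (hm i j) xr e3.
  exists d => // y yr yd; have := hd y yr yd; rewrite -!sS// => h1.
  have h2 := le_lt_trans (hX x xr i j N.+1) (hN _ (leqnSn N)).
  have h3 := le_lt_trans (hX y yr i j N.+1) (hN _ (leqnSn N)).
  have -> : X y i j - X x i j = (s N.+1 y i j - s N.+1 x i j) + ((s N.+1 x i j - X x i j) - (s N.+1 y i j - X y i j)) by ring.
  apply: (le_lt_trans (cabsD _ _)).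
  have := cabsB (s N.+1 x i j - X x i j) (s N.+1 y i j - X y i j); lra.
have XB : mBM r X by move=> i j; apply: (Ccont_CBM r0) => x; exact: Xc.
have XE x : 0 <= x <= r -> X x = V0 + mint x (fun t => A0 t *m X t).
  move=> xr; have /andP[x0 xr'] := xr; apply/matrixP => i j.
  apply/eqP; rewrite -subr_eq0 -cabs_eq0 eq_le cabs_ge0 andbT; apply/ler_addgt0Pr => e e0; rewrite add0r.
  have e2 : 0 < e / 2 by rewrite divr_gt0.
  have [N1 h1] := exp_small K q1 e2.
  have [N2 h2] := exp_small (c * (m%:R * (n%:R * K)) * r) q1 e2.
  pose N := maxn N1 N2.
  have b1 := hX x xr i j N.+1.
  have b2 : cabs (mint x (fun t => A0 t *m (s N t - X t)) i j) <= c * (m%:R * (n%:R * K)) * r * q ^+ N.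
    apply: (le_trans (mabs_entry _ i j)).
    have LM : mL1 r (fun t => A0 t *m (s N t - X t)).
      by apply: mBM_L1; apply: mBM_mul => //; apply: mBM_D => //; exact: mBM_N.
    apply: (le_trans (mint_le xr' LM (BMr_L1 (BMr_cst r (c * (m%:R * (n%:R * (K * q ^+ N)))))) _)).
      move=> t /andP[t0 tx]; have tr : 0 <= t <= r by rewrite t0 (le_trans tx).
      rewrite (le_trans (mabsM _ _))// ler_pM ?mabs_ge0 ?hc//.
      by apply: mabs_le_cst => k l; have := hX t tr k l N; rewrite !mxE.
    rewrite Ir_cst// [leRHS]mulrAC; apply: (@le_trans _ _ (c * (m%:R * (n%:R * (K * q ^+ N))) * r)).
      have KN : 0 <= K * q ^+ N by rewrite mulr_ge0// exprn_ge0.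
      have KK : 0 <= c * (m%:R * (n%:R * (K * q ^+ N))) by rewrite mulr_ge0// mulr_ge0// mulr_ge0.
      exact: (ler_wpM2l KK xr').
    by rewrite le_eqVlt; apply/orP; left; apply/eqP; ring.
  have hE : s N.+1 x i j = V0 i j + mint x (fun t => A0 t *m X t) i j + mint x (fun t => A0 t *m (s N t - X t)) i j.
    rewrite sS// -addrA mxE; congr (_ + _).
    have -> : mint x (fun t => A0 t *m s N t) = mint x (fun t => A0 t *m X t) + mint x (fun t => A0 t *m (s N t - X t)).
      rewrite -(mintD xr'); last 2 first.
      - by apply: mBM_L1; exact: mBM_mul.
      - by apply: mBM_L1; apply: mBM_mul => //; apply: mBM_D => //; exact: mBM_N.
      by apply: mint_eq => t _; rewrite -mulmxDr addrC subrK.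
    by rewrite mxE.
  rewrite [X in _ - X]mxE.
  set u := mint x (fun t => A0 t *m X t) i j in hE *; set w := mint x _ i j in b2 hE.
  have -> : X x i j - (V0 i j + u) = w - (s N.+1 x i j - X x i j) by rewrite hE; ring.
  have := cabsB w (s N.+1 x i j - X x i j).
  have := h1 N.+1 (leq_trans (leq_maxl _ _) (leqnSn _)); have := h2 N (leq_maxr _ _).
  by move: b1; rewrite -/K; lra.
exists X; have X0 : X 0 = V0 by rewrite XE ?mint0 ?addr0// lexx.
split=> //; apply: mACP; first exact: mBM_L2 (mBM_mul hA XB).
by move=> x xr; rewrite X0 XE.
Qed.

End Picard.

Lemma Ccont_D (F G : R -> C) x : Ccont r F x -> Ccont r G x -> Ccont r (fun t => F t + G t) x.
Proof.
move=> hF hG e e0; have e2 : 0 < e / 2 by rewrite divr_gt0.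
have [d d0 hd] := hF _ e2; have [d' d0' hd'] := hG _ e2.
exists (Num.min d d'); first by rewrite lt_min d0.
move=> y yr; rewrite lt_min => /andP[/(hd y yr) h1 /(hd' y yr) h2].
rewrite opprD addrACA (le_lt_trans (cabsD _ _))//; lra.
Qed.

Lemma Ccont_M (F G : R -> C) x : Ccont r F x -> Ccont r G x -> Ccont r (fun t => F t * G t) x.
Proof.
move=> hF hG e e0; pose K := cabs (F x) + cabs (G x) + 1.
have K0 : 0 < K by rewrite ltr_wpDl// addr_ge0.
have eK : 0 < Num.min 1 (e / K) by rewrite lt_min ltr01 divr_gt0.
have [d d0 hd] := hF _ eK; have [d' d0' hd'] := hG _ eK.
exists (Num.min d d'); first by rewrite lt_min d0.
move=> y yr; rewrite lt_min => /andP[/(hd y yr) h1 /(hd' y yr) h2].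
move: h1 h2; rewrite !lt_min => /andP[h1 h1'] /andP[h2 h2'].
have -> : F y * G y - F x * G x = (F y - F x) * (G y - G x) + (F x * (G y - G x) + (F y - F x) * G x) by ring.
set m := e / K in h1' h2'; have mK : m * K = e by rewrite /m divfK// gt_eqF.
have m0 : 0 < m by exact: divr_gt0.
have q1 : cabs ((F y - F x) * (G y - G x)) <= cabs (F y - F x).
  by rewrite cabsM ler_piMr// ltW.
have q2 : cabs (F x * (G y - G x) + (F y - F x) * G x) <= cabs (F x) * m + m * cabs (G x).
  by apply: (le_trans (cabsD _ _)); rewrite !cabsM lerD// ?ler_wpM2l ?ler_wpM2r// ltW.
apply: (le_lt_trans (cabsD _ _)); apply: (@le_lt_trans _ _ (cabs (F y - F x) + (cabs (F x) * m + m * cabs (G x)))); first by rewrite lerD.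
by rewrite -mK /K; move: h1'; lra.
Qed.

Lemma Ccont_cst (c : C) x : Ccont r (fun=> c) x.
Proof. by move=> e e0; exists 1 => // y _ _; rewrite subrr cabs0. Qed.

Lemma Ccont_eq (F G : R -> C) x : F =1 G -> Ccont r F x -> Ccont r G x.
Proof. by move=> /funext ->. Qed.

Lemma Ccont_sum I (s : seq I) (F : I -> R -> C) x : (forall i, Ccont r (F i) x) ->
  Ccont r (fun t => \sum_(i <- s) F i t) x.
Proof.
move=> hF; elim: s => [|i s IH].
  by apply: Ccont_eq (Ccont_cst 0 x) => t; rewrite big_nil.
by apply: Ccont_eq (Ccont_D (hF i) IH) => t; rewrite big_cons.
Qed.

Definition mCcont m n (F : R -> 'M[C]_(m, n)) := forall x, 0 <= x <= r -> forall i j, Ccont r (fun t => F t i j) x.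

Lemma mCcont_mul m n q (F : R -> 'M[C]_(m, n)) (G : R -> 'M[C]_(n, q)) :
  mCcont F -> mCcont G -> mCcont (fun t => F t *m G t).
Proof.
move=> hF hG x xr i j; apply: (@Ccont_eq (fun t => \sum_k F t i k * G t k j)); first by move=> t; rewrite mxE.
by apply: Ccont_sum => k; apply: Ccont_M; [exact: hF|exact: hG].
Qed.

Lemma mCcont_BM m n (F : R -> 'M[C]_(m, n)) : mCcont F -> mBM r F.
Proof. by move=> h i j; apply: (Ccont_CBM r0) => x xr; exact: h. Qed.

Lemma mAC_Ccont m n (F f : R -> 'M[C]_(m, n)) : mAC r F f -> mCcont F.
Proof. by move=> h x xr i j; exact: (AC_Ccont r0 (h i j) xr). Qed.

Lemma ODE_mAC m n (A0 : R -> 'M[C]_m) (W : R -> 'M[C]_(m, n)) : mCcont A0 ->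
  (forall x, 0 <= x <= r -> is_deriv_on r W x (A0 x *m W x)) ->
  mAC r W (fun x => A0 x *m W x).
Proof.
move=> hA dW; have cW : mCcont W.
  by move=> x xr i j; have /is_deriv_onP/(_ i j) := dW x xr; exact: Cderiv_Ccont.
move=> i j; apply: (AC_deriv r0) => x xr; first by have /is_deriv_onP := dW x xr.
exact: (mCcont_mul hA cW).
Qed.

(** * Analytic dependence on the spectral parameter *)

Section PowerSeries.
Variables m n : nat.
Variable A0 : R -> 'M[C]_m.
Hypothesis hA : mBM r A0.
Variable V0 : 'M[C]_(m, n).
Variable W : R -> C -> 'M[C]_(m, n).
Hypothesis W0 : forall lam, W 0 lam = V0.
Hypothesis hW : forall lam, mAC r (W^~ lam) (fun x => lam *: (A0 x *m W x lam)).

Let rem lam k x := W x lam - \sum_(j < k) lam ^+ j *: picard A0 V0 j x.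

Lemma picard_rem_BM lam k : mBM r (rem lam k).
Proof.
rewrite /rem; apply: mBM_D; first exact: (mAC_BM r0 (hW lam)).
elim: k => [|k IH].
  by apply: mBM_N => i j; under eq_fun do rewrite big_ord0; exact: (mBM_cst r 0).
have := mBM_D IH (mBM_N (mBM_Z (CBM_cst r (lam ^+ k)) (picard_BM hA V0 k))).
by congr (mBM r _); apply/funext => x; rewrite big_ord_recr /= opprD.
Qed.

(** The given solution minus a partial Neumann sum obeys the recursion of the iterates and therefore
    tends to 0. This identifies every solution with a power series in lambda whose coefficients are
    the [picard] terms. *)
Lemma picard_remS lam k x : 0 <= x <= r ->
  rem lam k.+1 x = mint x (fun t => (lam *: A0 t) *m rem lam k t).
Proof.
move=> /andP[x0 xr].
have h1 : mL1 r (fun t => lam *: (A0 t *m W t lam)).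
  by apply: mL2_L1; exact: mAC_L2 (hW lam).
have h2 j : mL1 r (fun t => A0 t *m picard A0 V0 j t) by exact: (mBM_L1 (mBM_mul hA (picard_BM hA V0 j))).
have sumL (k' : nat) : mL1 r (fun t => \sum_(j < k') lam ^+ j.+1 *: (A0 t *m picard A0 V0 j t)) /\
    mint x (fun t => \sum_(j < k') lam ^+ j.+1 *: (A0 t *m picard A0 V0 j t)) =
    \sum_(j < k') lam ^+ j.+1 *: mint x (fun t => A0 t *m picard A0 V0 j t).
  elim: k' => [|k' [IH1 IH2]].
    split; first by move=> i j; under eq_fun do rewrite big_ord0; exact: (mBM_L1 (mBM_cst r 0)).
    rewrite big_ord0; apply/matrixP => i j; rewrite mintE (@cint_eq _ _ (fun=> 0)) ?cint_cst ?mul0r ?mxE// => t _.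
    by rewrite big_ord0 mxE.
  have h3 : mL1 r (fun t => lam ^+ k'.+1 *: (A0 t *m picard A0 V0 k' t)).
    by apply: mBM_L1; apply: mBM_Z; [exact: CBM_cst|exact: (mBM_mul hA (picard_BM hA V0 k'))].
  split.
    move=> i j; apply: eq_CL1 (CL1_D (IH1 i j) (h3 i j)) => t _.
    by rewrite big_ord_recr /= [RHS]mxE.
  rewrite big_ord_recr /= -IH2 -(mintZ _ xr (h2 k')) -(mintD xr IH1 h3).
  by apply: mint_eq => t _; rewrite big_ord_recr.
have [s1 s2] := sumL k.
rewrite /rem big_ord_recl /= expr0 scale1r.
have -> : W x lam = V0 + mint x (fun t => lam *: (A0 t *m W t lam)).
  by rewrite -(W0 lam); apply: (mAC_E (hW lam)); rewrite x0.
rewrite addrAC opprD addrA subrr sub0r addrC -s2 -(mintN xr s1) -(mintD xr h1); last first.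
  by move=> i j; apply: eq_CL1 (CL1_N (s1 i j)) => t _; rewrite [RHS]mxE.
apply: mint_eq => t _; rewrite mulmxBr -scalemxAl; congr (_ - _).
rewrite mulmx_sumr; apply: eq_bigr => j _.
by rewrite -scalemxAr -!scalemxAl scalerA -exprSr.
Qed.

Lemma picard_rem_le (c B rho kap : R) lam : (forall x, 0 <= x <= r -> mabs (A0 x) <= c) -> 0 <= c ->
  cabs lam <= rho -> 0 <= B -> 0 < kap ->
  (forall x, 0 <= x <= r -> mabs (W x lam) <= B) ->
  forall k x, 0 <= x <= r -> mabs (rem lam k x) <= B * (cabs lam * c / kap) ^+ k * expR (kap * x).
Proof.
move=> hc c0 lr B0 k0 hB; apply: (picard_bound (A0 := fun t => lam *: A0 t)) => //.
- by apply: mBM_Z => //; exact: CBM_cst.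
- by move=> x xr; rewrite mabsZ ler_wpM2l// hc.
- exact: mulr_ge0.
- exact: picard_rem_BM.
- by move=> x xr; rewrite /rem big_ord0 subr0 hB.
- by move=> k x xr; exact: picard_remS.
Qed.

(** The sup norm [BW] of the given solution may depend on lambda, but it enters only through a
    remainder that tends to 0; what is left is the bound of the Neumann series, which depends on rho
    alone. *)
Lemma ODE_uniform_bound (rho : R) : 0 <= rho ->
  exists2 B : R, 0 <= B & forall lam x, cabs lam <= rho -> 0 <= x <= r -> mabs (W x lam) <= B.
Proof.
move=> rho0; have [c c0 hc] := mBM_bound r0 hA; have r0' := ltW r0.
pose kap := 2 * (rho * c) + 1; have k0 : 0 < kap by rewrite ltr_wpDl// !mulr_ge0.
pose B := 2 * (mabs V0 * expR (kap * r)).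
have B0 : 0 <= B by rewrite !mulr_ge0 ?mabs_ge0 ?expR_ge0.
exists B => // lam x lr xr.
have [BW BW0 hBW] := mBM_bound r0 (mAC_BM r0 (hW lam)).
have hq : 0 <= cabs lam * c / kap <= 1 / 2.
  rewrite divr_ge0 ?mulr_ge0 ?(ltW k0)//= ler_pdivrMr//.
  have : cabs lam * c <= rho * c by rewrite ler_wpM2r.
  by rewrite /kap; lra.
have ekx : expR (kap * x) <= expR (kap * r) by rewrite ler_expR ler_wpM2l ?(ltW k0)//; case/andP: xr.
have pS k : mabs (lam ^+ k *: picard A0 V0 k x) <= (mabs V0 * expR (kap * r)) * (cabs lam * c / kap) ^+ k.
  have pb := @picard_bound m n A0 hA (picard A0 V0) c (mabs V0) kap hc k0 c0 (mabs_ge0 _) (picard_BM hA V0) _ _ k x xr.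
  rewrite mabsZ cabsX; apply: (@le_trans _ _ (cabs lam ^+ k * (mabs V0 * (c / kap) ^+ k * expR (kap * x)))).
    by rewrite ler_wpM2l ?exprn_ge0// pb.
  have -> : cabs lam ^+ k * (mabs V0 * (c / kap) ^+ k * expR (kap * x)) = mabs V0 * (cabs lam * c / kap) ^+ k * expR (kap * x).
    rewrite -[cabs lam * c / kap]mulrA [in RHS]exprMn; move: (cabs lam ^+ k) ((c / kap) ^+ k) (expR _) (mabs V0) => a1 a2 a3 a4; ring.
  rewrite mulrAC; apply: ler_wpM2r; first by rewrite exprn_ge0//; case/andP: hq.
  by rewrite ler_wpM2l// mabs_ge0.
apply/ler_addgt0Pr => e e0.
have [|N hN] := @exp_small _ (BW * expR (kap * r)) (cabs lam * c / kap) e _ e0.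
  by case/andP: hq => -> /=; lra.
have h1 := picard_rem_le hc c0 lr BW0 k0 hBW N xr.
have -> : W x lam = (\sum_(j < N) lam ^+ j *: picard A0 V0 j x) + rem lam N x by rewrite /rem addrC subrK.
apply: (le_trans (mabsD _ _)); rewrite lerD//.
  apply: (le_trans (mabs_sum _ _ _)).
  apply: (@le_trans _ _ (\sum_(j < N) (mabs V0 * expR (kap * r)) * (cabs lam * c / kap) ^+ j)).
    by apply: ler_sum => j _; exact: pS.
  rewrite -mulr_sumr /B [leRHS]mulrC; apply: ler_wpM2l; first by rewrite mulr_ge0 ?mabs_ge0 ?expR_ge0.
  have := geo_sum hq (leq0n N); rewrite big_mkord expr0 mulr1; apply.
apply: (le_trans h1); apply: ltW; apply: le_lt_trans (hN N (leqnn N)).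
rewrite [leRHS]mulrAC; apply: ler_wpM2l => //.
by rewrite mulr_ge0// exprn_ge0//; case/andP: hq.
Qed.

Lemma ODE_PSdata (rho : R) x i j : 0 < rho -> 0 <= x <= r ->
  exists a B, PSdata a B rho (fun lam => W x lam i j) 0.
Proof.
move=> rho0 xr; have [c c0 hc] := mBM_bound r0 hA; have r0' := ltW r0.
have [B B0 hB] := ODE_uniform_bound (ltW rho0).
(* With this weight the ratio |h| c/kap is at most |h|/rho, the form that [PSdata] demands. *)
pose kap := rho * c + 1; have k0 : 0 < kap by rewrite ltr_wpDl// mulr_ge0// ltW.
exists (fun k => picard A0 V0 k x i j), (B * expR (kap * x)); split=> //.
  by rewrite mulr_ge0// expR_ge0.
move=> h n' hr; rewrite add0r.
have := picard_rem_le hc c0 hr B0 k0 (fun y yr => hB h y hr yr) n' xr.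
have -> : W x h i j - psum (fun k => picard A0 V0 k x i j) h n' = rem h n' x i j.
  by rewrite /rem !mxE summxE; congr (_ - _); apply: eq_bigr => k _; rewrite mxE mulrC.
move=> h1; apply: (le_trans (mabs_entry _ i j)); apply: (le_trans h1).
rewrite mulrAC; apply: ler_wpM2l; first by rewrite mulr_ge0// expR_ge0.
apply: lerX; rewrite divr_ge0 ?mulr_ge0 ?(ltW k0)//=.
rewrite ler_pdivrMr// [leRHS]mulrAC ler_pdivlMr// -mulrA; apply: ler_wpM2l => //.
by rewrite /kap mulrC lerDl.
Qed.

Lemma ODE_PSat lam x i j : 0 <= x <= r -> PSat (fun lam => W x lam i j) lam.
Proof.
move=> xr; pose rho := 4 * (cabs lam + 1).
have rho0 : 0 < rho by rewrite mulr_gt0// ltr_wpDl.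
have [a [B hP]] := ODE_PSdata i j rho0 xr.
have := PS_shift (w := lam) hP; rewrite add0r; apply.
by rewrite /rho mulrAC divff// mul1r lerDl.
Qed.

End PowerSeries.

(** * The energy identity and the inverse of the fundamental solution *)

Section Energy.
Variables (p : nat) (beta : R -> 'M[C]_(p, p + p)).
Hypothesis bC : mCcont beta.
Local Notation J := (Jmx (R := R) p).

Lemma JmxK : J *m J = 1%:M.
Proof. by rewrite /Jmx mulmx_block !mul0mx !mulmx0 !mul1mx !add0r !addr0 -scalar_mx_block. Qed.

Lemma JmxJ : J^t* = J.
Proof.
by rewrite /Jmx tr_block_mx map_block_mx !raddf0 !tr_scalar_mx !map_scalar_mx !rmorph1.
Qed.

Lemma mulmx_tJ m n q (A : 'M[C]_(m, n)) (B : 'M[C]_(n, q)) : (A *m B)^t* = B^t* *m A^t*.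
Proof. by rewrite trmx_mul map_mxM. Qed.

Lemma mx_tJK m n (A : 'M[C]_(m, n)) : (A^t*)^t* = A.
Proof. by apply/matrixP => i j; rewrite !mxE conjCK. Qed.

Lemma mx_tJZ m n c (A : 'M[C]_(m, n)) : (c *: A)^t* = c^* *: A^t*.
Proof. by apply/matrixP => i j; rewrite !mxE rmorphM. Qed.

Lemma mx_tJD m n (A B : 'M[C]_(m, n)) : (A + B)^t* = A^t* + B^t*.
Proof. by apply/matrixP => i j; rewrite !mxE rmorphD. Qed.

Let A0 (x : R) : 'M[C]_(p + p) := imag_unit *: (J *m Hmx beta x).

Lemma Hmx_Ccont : mCcont (Hmx beta).
Proof.
apply: mCcont_mul => // x xr i j.
have := bC xr j i => h e /h [d d0 hd]; exists d => // y yr yd.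
by rewrite !mxE -rmorphB cabsJ; exact: hd.
Qed.

Lemma A0_Ccont : mCcont A0.
Proof.
move=> x xr i j; apply: (@Ccont_eq (fun t => imag_unit * (J *m Hmx beta t) i j)).
  by move=> t; rewrite [RHS]mxE.
apply: Ccont_M; first exact: Ccont_cst.
apply: mCcont_mul => //; last exact: Hmx_Ccont.
by move=> *; exact: Ccont_cst.
Qed.

Variable W : R -> C -> 'M[C]_(p + p).
Hypothesis hW : fundamental_solution r beta W.

Lemma fundamental_mAC lam : mAC r (W^~ lam) (fun x => lam *: (A0 x *m W x lam)).
Proof.
have h : mAC r (W^~ lam) (fun x => (lam *: A0 x) *m W x lam).
  apply: ODE_mAC.
    move=> x xr i j; apply: (@Ccont_eq (fun t => lam * A0 t i j)); first by move=> t; rewrite [RHS]mxE.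
    by apply: Ccont_M; [exact: Ccont_cst|exact: A0_Ccont].
  move=> x xr; have [_ h] := hW lam; have := h x; rewrite in_itv /= => /(_ xr).
  by rewrite /A0 scalerA -scalemxAl [lam * _]mulrC.
by apply: mAC_ext h => // x _; rewrite scalemxAl.
Qed.

Lemma fundamental_PSat lam i j : PSat (fun z => W r z i j) lam.
Proof.
apply: (ODE_PSat (mCcont_BM A0_Ccont) (V0 := 1%:M)).
- by move=> l; case: (hW l).
- exact: fundamental_mAC.
- by rewrite (ltW r0) lexx.
Qed.

Lemma energy_alg (A B H : 'M[C]_(p + p)) mu lam : H^t* = H ->
  (mu *: ((imag_unit *: (J *m H)) *m A))^t* *m J *m B + A^t* *m J *m (lam *: ((imag_unit *: (J *m H)) *m B)) =
  (imag_unit * (lam - mu^*)) *: (A^t* *m H *m B).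
Proof.
move=> Hs.
have e1 : (mu *: ((imag_unit *: (J *m H)) *m A))^t* *m J = (mu^* * - imag_unit) *: (A^t* *m H).
  rewrite mx_tJZ mulmx_tJ mx_tJZ mulmx_tJ JmxJ Hs conjC_i.
  by rewrite -scalemxAr scalerA -scalemxAl -!mulmxA JmxK mulmx1.
have e2 : J *m (lam *: ((imag_unit *: (J *m H)) *m B)) = (lam * imag_unit) *: (H *m B).
  by rewrite -scalemxAl scalerA -scalemxAr !mulmxA JmxK mul1mx.
rewrite e1 -[A^t* *m J *m _]mulmxA e2 -scalemxAl -scalemxAr mulmxA -scalerDl; congr (_ *: _); ring.
Qed.

(** Lagrange's identity for two spectral parameters. The case mu = lambda is the energy balance; for
    mu conjugate to lambda the right-hand side vanishes, which yields the inverse matrix. *)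
Lemma energy lam mu x : 0 <= x <= r -> (W x mu)^t* *m J *m W x lam - J =
  (imag_unit * (lam - mu^*)) *: mint x (fun t => (W t mu)^t* *m Hmx beta t *m W t lam).
Proof.
move=> xr; have /andP[x0 xr'] := xr.
have h := mAC_M r0 (mAC_Mr r0 J (mAC_J r0 (fundamental_mAC mu))) (fundamental_mAC lam).
have e1 := mAC_E h xr.
rewrite /= in e1; have [W0m _] := hW mu; have [W0l _] := hW lam.
rewrite W0m W0l in e1.
have e2 : (1%:M : 'M[C]_(p + p))^t* *m J *m 1%:M = J.
  by rewrite mulmx1 tr_scalar_mx map_scalar_mx rmorph1 mul1mx.
rewrite e2 in e1; rewrite e1 addrC addKr -(mintZ _ xr').
  by apply: mint_eq => t _; apply: energy_alg; rewrite /Hmx mulmx_tJ mx_tJK.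
apply: mBM_L1; apply: mBM_mul; first apply: mBM_mul.
- exact: (mBM_J (mAC_BM r0 (fundamental_mAC mu))).
- exact: (mCcont_BM Hmx_Ccont).
- exact: (mAC_BM r0 (fundamental_mAC lam)).
Qed.

Lemma fundamental_inv lam : J *m (W r lam^*)^t* *m J *m W r lam = 1%:M.
Proof.
have rr : 0 <= (r : R) <= r by rewrite (ltW r0) lexx.
have := energy lam lam^* rr; rewrite conjCK subrr mulr0 scale0r => /eqP.
by rewrite subr_eq0 => /eqP h; rewrite -!mulmxA [_ *m (J *m _)]mulmxA h JmxK.
Qed.

Lemma fundamental_unit lam : W r lam \in unitmx.
Proof. by case/mulmx1_unit: (fundamental_inv lam). Qed.

(** The inverse expressed by the fundamental solution at the conjugate point, so that it is analytic
    in lambda as well. *)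
Lemma fundamental_invmx lam : invmx (W r lam) = J *m (W r lam^*)^t* *m J.
Proof. by rewrite -[RHS]mulmx1 -(mulmxV (fundamental_unit lam)) mulmxA fundamental_inv mul1mx. Qed.

End Energy.

End LinearODE.

(** * Uniqueness of the finite Laplace transform *)

Section MaximumPrinciple.
Context {R : realType}.
Local Notation C := (cplx R).

(** The local information on which the maximum principle runs: a quadratic expansion in the complex
    increment with a cubic error. It is stable under products and composition. *)
Definition taylor2 (F : C -> C) (z : C) := exists (a b c : C) (K rho : R),
  [/\ 0 < rho, 0 <= K & forall h, cabs h <= rho ->
     cabs (F (z + h) - (a + b * h + c * h ^+ 2)) <= K * cabs h ^+ 3].

Lemma taylor2_poly (a b c d : C) z : taylor2 (fun w => a + b * w + c * w ^+ 2 + d * w ^+ 3) z.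
Proof.
exists (a + b * z + c * z ^+ 2 + d * z ^+ 3), (b + c * z *+ 2 + d * z ^+ 2 *+ 3), (c + d * z *+ 3), (cabs d), 1.
split=> // h _; rewrite -cabsX -cabsM le_eqVlt; apply/orP; left; apply/eqP; congr cabs.
ring.
Qed.

Lemma taylor2_val F z a b c (K rho : R) : 0 < rho -> (forall h, cabs h <= rho ->
     cabs (F (z + h) - (a + b * h + c * h ^+ 2)) <= K * cabs h ^+ 3) -> a = F z.
Proof.
move=> rho0 /(_ 0); rewrite cabs0 !expr0n /= !mulr0 !addr0 => /(_ (ltW rho0)) h.
by apply/esym/eqP; rewrite -subr_eq0 -cabs_eq0 eq_le h cabs_ge0.
Qed.

Lemma taylor2_comp (F g : C -> C) z : taylor2 F (g z) -> taylor2 g z ->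
  taylor2 (fun w => F (g w)) z.
Proof.
move=> [a [b [c [K [rho [rho0 K0 hF]]]]]] [a' [b' [c' [K' [rho' [rho0' K0' hg]]]]]].
have ag := taylor2_val rho0' hg; subst a'.
pose L := cabs b' + cabs c' + K'.
have L0 : 0 <= L by rewrite !addr_ge0.
pose d := Num.min (Num.min 1 rho') (rho / (L + 1)).
have L1 : 0 < L + 1 by rewrite ltr_wpDl.
have d0 : 0 < d by rewrite !lt_min ltr01 rho0' divr_gt0.
exists a, (b * b'), (b * c' + c * b' ^+ 2), (cabs b * K' + cabs c * ((cabs c' + K') * (L + cabs b')) + K * L ^+ 3), d.
split=> //; first by rewrite !addr_ge0 ?mulr_ge0 ?addr_ge0 ?exprn_ge0.
move=> h; rewrite !le_min => /andP[/andP[h1 hr'] hr].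
set k := g (z + h) - g z.
set y := cabs h in h1 hr' hr *.
have y0 : 0 <= y by exact: cabs_ge0.
have y2 : y ^+ 2 <= y by rewrite expr2 ler_piMr.
have y3 : y ^+ 3 <= y ^+ 2 by rewrite exprS ler_piMl// exprn_ge0.
have e1 : cabs (k - b' * h - c' * h ^+ 2) <= K' * y ^+ 3.
  by have := hg h hr'; congr (_ <= _); congr cabs; rewrite /k; ring.
have e2 : cabs (k - b' * h) <= (cabs c' + K') * y ^+ 2.
  have -> : k - b' * h = (k - b' * h - c' * h ^+ 2) + c' * h ^+ 2 by ring.
  rewrite (le_trans (cabsD _ _))// mulrDl addrC lerD// ?cabsM ?cabsX//.
  by rewrite (le_trans e1)// ler_wpM2l.
have e3 : cabs k <= L * y.
  have := cabsD (k - b' * h) (b' * h); rewrite subrK cabsM -/y => h2.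
  have : (cabs c' + K') * y ^+ 2 <= (cabs c' + K') * y by rewrite ler_wpM2l// addr_ge0.
  by rewrite /L; lra.
have kr : cabs k <= rho.
  rewrite (le_trans e3)//; move: hr; rewrite ler_pdivlMr// mulrC; apply: le_trans.
  by rewrite ler_wpM2r// lerDl.
have b1 : cabs (b * (k - b' * h - c' * h ^+ 2)) <= cabs b * K' * y ^+ 3.
  by rewrite cabsM -mulrA ler_wpM2l.
have b2 : cabs (c * ((k - b' * h) * (k + b' * h))) <= cabs c * ((cabs c' + K') * (L + cabs b')) * y ^+ 3.
  have -> : cabs c * ((cabs c' + K') * (L + cabs b')) * y ^+ 3 = cabs c * (((cabs c' + K') * y ^+ 2) * ((L + cabs b') * y)) by ring.
  rewrite cabsM [cabs (_ * (k + _))]cabsM ler_wpM2l// ler_pM//.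
  have := cabsD k (b' * h); rewrite [cabs (b' * h)]cabsM -/y => h2.
  by rewrite mulrDl (le_trans h2)// lerD2r.
have b3 : cabs (F (g z + k) - (a + b * k + c * k ^+ 2)) <= K * L ^+ 3 * y ^+ 3.
  by rewrite (le_trans (hF _ kr))// -mulrA -exprMn ler_wpM2l// lerX// cabs_ge0.
have -> : F (g (z + h)) - (a + b * b' * h + (b * c' + c * b' ^+ 2) * h ^+ 2) =
   (F (g z + k) - (a + b * k + c * k ^+ 2)) + (b * (k - b' * h - c' * h ^+ 2) + c * ((k - b' * h) * (k + b' * h))).
  rewrite /k [g z + _]addrC subrK; ring.
apply: (le_trans (cabsD _ _)); rewrite [leRHS]mulrDl [leRHS]addrC lerD//.
by apply: (le_trans (cabsD _ _)); rewrite [leRHS]mulrDl lerD.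
Qed.

Lemma taylor2_M (F G : C -> C) z : taylor2 F z -> taylor2 G z -> taylor2 (fun w => F w * G w) z.
Proof.
move=> [a [b [c [K [rho [rho0 K0 hF]]]]]] [a' [b' [c' [K' [rho' [rho0' K0' hG]]]]]].
pose d := Num.min (Num.min 1 rho') rho.
have d0 : 0 < d by rewrite !lt_min ltr01 rho0' rho0.
pose P := cabs a + cabs b + cabs c; pose P' := cabs a' + cabs b' + cabs c'.
exists (a * a'), (a * b' + b * a'), (a * c' + b * b' + c * a'),
  (cabs (b * c' + c * b') + cabs (c * c') + P * K' + K * (P' + K')), d.
split=> //; first by rewrite /P /P' !addr_ge0 ?mulr_ge0 ?addr_ge0.
move=> h; rewrite !le_min => /andP[/andP[h1 hr'] hr].
set y := cabs h in h1 hr' hr *.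
have y0 : 0 <= y by exact: cabs_ge0.
have y2 : y ^+ 2 <= 1 by rewrite exprn_ile1.
have y3 : y ^+ 3 <= 1 by rewrite exprn_ile1.
set p := a + b * h + c * h ^+ 2; set p' := a' + b' * h + c' * h ^+ 2.
have pb : cabs p <= P.
  rewrite /p (le_trans (cabsD _ _))// lerD//.
    by rewrite (le_trans (cabsD _ _))// lerD// cabsM ler_piMr.
  by rewrite cabsM cabsX ler_piMr.
have pb' : cabs p' <= P'.
  rewrite /p' (le_trans (cabsD _ _))// lerD//.
    by rewrite (le_trans (cabsD _ _))// lerD// cabsM ler_piMr.
  by rewrite cabsM cabsX ler_piMr.
have eF := hF h hr; have eG := hG h hr'; rewrite -/p -/p' -/y in eF eG.
have Gb : cabs (G (z + h)) <= P' + K'.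
  rewrite -(subrK p' (G _)) (le_trans (cabsD _ _))// addrC lerD//.
  by rewrite (le_trans eG)// ler_piMr.
have -> : F (z + h) * G (z + h) - (a * a' + (a * b' + b * a') * h + (a * c' + b * b' + c * a') * h ^+ 2) =
   (b * c' + c * b') * h ^+ 3 + (c * c') * h ^+ 4 + p * (G (z + h) - p') + (F (z + h) - p) * G (z + h).
  by rewrite /p /p'; ring.
rewrite (le_trans (cabsD _ _))// [leRHS]mulrDl lerD//; last by rewrite cabsM mulrAC ler_pM.
rewrite (le_trans (cabsD _ _))// [leRHS]mulrDl lerD//; last by rewrite cabsM -mulrA ler_pM.
rewrite (le_trans (cabsD _ _))// [leRHS]mulrDl lerD//; first by rewrite cabsM cabsX.
by rewrite cabsM cabsX ler_wpM2l// exprS ler_piMl// exprn_ge0.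
Qed.

Lemma taylor2_cexp (z : C) : taylor2 cexp z.
Proof.
exists (cexp z), (cexp z), (cexp z / 2), (cabs (cexp z) * expR 1), 1.
split=> //; first by rewrite mulr_ge0// expR_ge0.
move=> h h1; rewrite cexpD.
have -> : cexp z * cexp h - (cexp z + cexp z * h + cexp z / 2 * h ^+ 2) =
  cexp z * (cexp h - 1 - h - h ^+ 2 / 2) by ring.
rewrite cabsM -mulrA ler_wpM2l// (le_trans (cexp_taylor h))// mulrC ler_wpM2r ?exprn_ge0//.
by rewrite ler_expR.
Qed.

Lemma taylor2_cont F z : taylor2 F z -> forall e : R, 0 < e -> exists2 d : R, 0 < d &
  forall w, cabs (w - z) < d -> cabs (F w - F z) < e.
Proof.
move=> [a [b [c [K [rho [rho0 K0 hF]]]]]] e e0; have aF := taylor2_val rho0 hF; subst a.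
have L0 : 0 < cabs b + cabs c + K + 1 by rewrite ltr_wpDl// !addr_ge0.
exists (Num.min (Num.min 1 rho) (e / (cabs b + cabs c + K + 1))).
  by rewrite !lt_min ltr01 rho0 divr_gt0.
move=> w; rewrite !lt_min => /andP[/andP[h1 hr] he].
have := hF (w - z) (ltW hr); rewrite [z + _]addrC subrK.
set h := w - z in h1 hr he *; set y := cabs h in h1 hr he * => hh.
have y0 : 0 <= y by exact: cabs_ge0.
have y2 : y ^+ 2 <= y by rewrite expr2 ler_piMr// ltW.
have y3 : y ^+ 3 <= y ^+ 2 by rewrite exprS ler_piMl ?exprn_ge0// ltW.
have -> : F w - F z = (F w - (F z + b * h + c * h ^+ 2)) + (b * h + c * h ^+ 2) by ring.
have hb : cabs (b * h + c * h ^+ 2) <= cabs b * y + cabs c * y.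
  by rewrite (le_trans (cabsD _ _))// cabsM [cabs (c * _)]cabsM cabsX lerD// ler_wpM2l.
rewrite ltr_pdivlMr// in he.
apply: (le_lt_trans (cabsD _ _)); apply: (le_lt_trans (lerD hh hb)); apply: le_lt_trans he.
have : K * y ^+ 3 <= K * y by rewrite ler_wpM2l// (le_trans y3).
by nra.
Qed.

(* The average of |a + b h + c h^2|^2 over h = t, -t, it, -it is at least |a|^2. *)
Lemma four_point (a b c : C) (t : R) : 4 * cabs a ^+ 2 <=
  cabs (a + b * t%:C + c * t%:C ^+ 2) ^+ 2 + cabs (a + b * (- t%:C) + c * (- t%:C) ^+ 2) ^+ 2 +
  cabs (a + b * (imag_unit * t%:C) + c * (imag_unit * t%:C) ^+ 2) ^+ 2 +
  cabs (a + b * (- (imag_unit * t%:C)) + c * (- (imag_unit * t%:C)) ^+ 2) ^+ 2.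
Proof.
rewrite !cabs_sqr !expr2 !reimE /=; case: a => a1 a2; case: b => b1 b2; case: c => c1 c2 /=.
rewrite -subr_ge0.
set X := _ - _.
have -> : X = 4 * t ^+ 2 * (b1 ^+ 2 + b2 ^+ 2) + 4 * t ^+ 4 * (c1 ^+ 2 + c2 ^+ 2).
  by rewrite /X; ring.
by rewrite addr_ge0// mulr_ge0 ?addr_ge0 ?sqr_ge0// mulr_ge0// exprn_even_ge0.
Qed.

(* Points of the sector -x/10 <= y <= x are written x + i s x. *)
Definition sector_pt (x s : R) : C := x +i* (s * x).

(** An interior maximum of |F|^2 + k |z|^2 contradicts [four_point]: averaging over four points at
    distance t raises k |z|^2 by k t^2, while the expansion of F costs only O(t^3). *)
Lemma sector_max (F : C -> C) (X M : R) : 0 < X -> 0 <= M -> (forall z, taylor2 F z) ->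
  (forall x, 0 <= x <= X -> cabs (F (sector_pt x 1)) <= M /\ cabs (F (sector_pt x (- 1 / 10))) <= M) ->
  (forall s, - 1 / 10 <= s <= 1 -> cabs (F (sector_pt 0 s)) <= M /\ cabs (F (sector_pt X s)) <= M) ->
  forall x s, 0 <= x <= X -> - 1 / 10 <= s <= 1 -> cabs (F (sector_pt x s)) <= M.
Proof.
move=> X0 M0 hT hb1 hb2 x1 s1 x1X s1b; rewrite leNgt; apply/negP => bad.
pose gap := cabs (F (sector_pt x1 s1)) ^+ 2 - M ^+ 2.
have gap0 : 0 < gap by rewrite subr_gt0 ltrXn2r// ?nnegrE.
(* Since |z|^2 <= 2 X^2 on the region, the added term stays within half of [gap], and the maximum
   cannot lie on the boundary, where |F| <= M. *)
pose k := gap / (4 * X ^+ 2).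
have X20 : 0 < X ^+ 2 by rewrite exprn_gt0.
have k0 : 0 < k by rewrite divr_gt0// mulr_gt0.
have kX : k * (2 * X ^+ 2) < gap.
  by rewrite /k mulrAC ltr_pdivrMr ?mulr_gt0//; nra.
pose w z : R := cabs (F z) ^+ 2 + k * cabs z ^+ 2.
pose v (p : R * R) := w (sector_pt p.1 p.2).
have sqb x s : 0 <= x <= X -> - 1 / 10 <= s <= 1 -> cabs (sector_pt x s) ^+ 2 <= 2 * X ^+ 2.
  move=> /andP[a b] /andP[c d]; rewrite cabs_sqr /=.
  have h1 : x ^+ 2 <= X ^+ 2 by rewrite lerX// a.
  have h2 : s ^+ 2 <= 1 by nra.
  have h3 : s ^+ 2 * x ^+ 2 <= 1 * X ^+ 2 by rewrite ler_pM// ?sqr_ge0.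
  by rewrite exprMn; lra.
have cv : continuous v.
  move=> p; apply/cvgrPdist_lt => e e0.
  have e2 : 0 < e / 2 by rewrite divr_gt0.
  have wc : exists2 d : R, 0 < d & forall z, cabs (z - sector_pt p.1 p.2) < d -> `|w (sector_pt p.1 p.2) - w z| < e.
    set z0 := sector_pt p.1 p.2.
    have sq (u1 u2 : C) (A : R) : cabs u1 <= A -> cabs u2 <= A -> `|cabs u1 ^+ 2 - cabs u2 ^+ 2| <= 2 * A * cabs (u1 - u2).
      move=> h1 h2; rewrite subr_sqr normrM mulrC ler_pM//.
        by rewrite ger0_norm ?addr_ge0//; lra.
      rewrite ler_norml; apply/andP.
      have := cabs_lowerB u2 u1; have := cabs_lowerB u1 u2; rewrite [cabs (u2 - u1)]cabsBC.
      by split; lra.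
    pose A := cabs (F z0) + 1; pose A' := cabs z0 + 1.
    have A0 : 0 < A by rewrite ltr_wpDl.
    have A0' : 0 < A' by rewrite ltr_wpDl.
    have [|d d0 hd] := taylor2_cont (hT z0) (e := Num.min 1 (e / 2 / (2 * A))).
      by rewrite lt_min ltr01 divr_gt0// mulr_gt0.
    have kA : 0 < k * (2 * A') by rewrite mulr_gt0// mulr_gt0.
    exists (Num.min d (Num.min 1 (e / 2 / (k * (2 * A'))))).
      by rewrite !lt_min d0 ltr01 divr_gt0.
    move=> z; rewrite !lt_min => /andP[zd /andP[z1 z2]].
    have := hd z zd; rewrite lt_min => /andP[f1 f2].
    have b1 : cabs (F z) <= A.
      by rewrite -(subrK (F z0) (F z)) (le_trans (cabsD _ _))// addrC lerD2l ltW.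
    have b2 : cabs z <= A'.
      by rewrite -(subrK z0 z) (le_trans (cabsD _ _))// addrC lerD2l ltW.
    have q1 : `|cabs (F z0) ^+ 2 - cabs (F z) ^+ 2| < e / 2.
      apply: le_lt_trans (sq _ _ A _ b1) _; first by rewrite /A lerDl.
      by rewrite cabsBC mulrC -ltr_pdivlMr// mulr_gt0.
    have q2 : `|k * (cabs z0 ^+ 2 - cabs z ^+ 2)| < e / 2.
      rewrite normrM gtr0_norm//; apply: le_lt_trans (ler_wpM2l (ltW k0) (sq _ _ A' _ b2)) _; first by rewrite /A' lerDl.
      by rewrite cabsBC mulrA mulrC -ltr_pdivlMr.
    have -> : w z0 - w z = (cabs (F z0) ^+ 2 - cabs (F z) ^+ 2) + k * (cabs z0 ^+ 2 - cabs z ^+ 2).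
      by rewrite /w; ring.
    by rewrite (le_lt_trans (ler_normD _ _))// (splitr e) ltrD.
  have [d d0 hd] := wc.
  have c1 : (fun q : R * R => q.1) q @[q --> p] --> p.1 by exact: cvg_fst.
  have c2 : (fun q : R * R => q.2 * q.1) q @[q --> p] --> p.2 * p.1.
    by apply: cvgM; [exact: cvg_snd|exact: cvg_fst].
  have d2 : 0 < d / 2 by rewrite divr_gt0.
  move/cvgrPdist_lt : c1 => /(_ _ d2) c1; move/cvgrPdist_lt : c2 => /(_ _ d2) c2.
  near=> q; apply: hd.
  rewrite (le_lt_trans (cabs_le _))// !reimE /= (splitr d) ltrD// distrC; near: q; [exact: c1|exact: c2].
(* The region is the image of a rectangle in the coordinates (x, s), which supplies compactness. *)
pose A := (`[0, X] `*` `[- 1 / 10, 1])%classic : set (R * R).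
have cA : compact A by apply: compact_setX; exact: segment_compact.
have A0 : A !=set0 by exists (x1, s1); split; rewrite /= in_itv.
have [[x s]] := compact_EVT_max A0 cA (continuous_subspaceT cv).
rewrite inE /A /= !in_itv /= => -[xX ss] vmax.
have vmax' z t : 0 <= z <= X -> - 1 / 10 <= t <= 1 -> w (sector_pt z t) <= w (sector_pt x s).
  by move=> h1 h2; apply: (vmax (z, t)); rewrite inE; split; rewrite /= in_itv.
have big : M ^+ 2 + k * (2 * X ^+ 2) < w (sector_pt x s).
  apply: lt_le_trans (vmax' _ _ x1X s1b).
  have : 0 <= k * cabs (sector_pt x1 s1) ^+ 2 by rewrite mulr_ge0 ?exprn_ge0// ltW.
  by move: kX; rewrite /gap /w; lra.
have nb z t : 0 <= z <= X -> - 1 / 10 <= t <= 1 -> cabs (F (sector_pt z t)) <= M ->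
   w (sector_pt z t) <= M ^+ 2 + k * (2 * X ^+ 2).
  move=> h1 h2 h3; rewrite /w lerD//; first by rewrite lerX// cabs_ge0.
  by rewrite ler_pM2l//; exact: sqb.
have xn0 : x != 0.
  apply/eqP => xe; move: big; rewrite xe ltNge nb//; last by case: (hb2 s ss).
  by rewrite lexx ltW.
have xnX : x != X.
  apply/eqP => xe; move: big; rewrite xe ltNge nb//; last by case: (hb2 s ss).
  by rewrite lexx ltW.
have s11 : - 1 / 10 <= (1 : R) <= 1 by apply/andP; split; lra.
have s12 : - 1 / 10 <= (- 1 / 10 : R) <= 1 by apply/andP; split; lra.
have sn1 : s != 1.
  by apply/eqP => se; move: big; rewrite se ltNge nb//; case: (hb1 x xX).
have sn2 : s != - 1 / 10.
  by apply/eqP => se; move: big; rewrite se ltNge nb//; case: (hb1 x xX).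
have x0 : 0 < x by rewrite lt_neqAle eq_sym xn0; case/andP: xX.
have xlX : x < X by rewrite lt_neqAle xnX; case/andP: xX.
have sl1 : s < 1 by rewrite lt_neqAle sn1; case/andP: ss.
have sg : - 1 / 10 < s by rewrite lt_neqAle eq_sym sn2; case/andP: ss.
have [a [b [c [K [rho [rho0 K0 hF]]]]]] := hT (sector_pt x s).
have aF := taylor2_val rho0 hF.
have inreg (u y : R) : `|u| < Num.min x (X - x) -> `|u| + `|y| < x * (1 - s) -> `|u| + `|y| < x * (s + 1 / 10) ->
   w (sector_pt x s + (u +i* y)) <= w (sector_pt x s).
  rewrite lt_min => /andP[u1 u2] y1 y2.
  have xu : 0 < x + u by have := ler_norm (- u); rewrite normrN; lra.
  have xuX : x + u <= X by have := ler_norm u; lra.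
  have -> : sector_pt x s + (u +i* y) = sector_pt (x + u) ((s * x + y) / (x + u)).
    by apply: complex_ext; rewrite !reimE //= divfK// gt_eqF.
  apply: vmax'; first by rewrite (ltW xu).
  have := ler_norm u; have := ler_norm y; have := ler_norm (- u); have := ler_norm (- y); rewrite !normrN => ? ? ? ?.
  apply/andP; split; first by rewrite ler_pdivlMr//; nra.
  by rewrite ler_pdivrMr//; nra.
pose P := cabs a + cabs b + cabs c.
have P0 : 0 <= P by rewrite !addr_ge0.
pose m1 := Num.min (Num.min 1 rho) (Num.min (Num.min x (X - x)) (Num.min (x * (1 - s)) (x * (s + 1 / 10)))).
have m10 : 0 < m1.
  by rewrite !lt_min ltr01 rho0 x0 subr_gt0 xlX !mulr_gt0//; lra.
(* Below [m1] the four points stay in the region and in the disc of the expansion; the second bound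
   makes the cubic error 2 P K t^3 smaller than k t^2. *)
pose t := Num.min m1 (k / (2 * P * K + 1)) / 2.
have PK : 0 < 2 * P * K + 1 by rewrite ltr_wpDl// !mulr_ge0.
have t0 : 0 < t by rewrite divr_gt0// lt_min m10 divr_gt0.
have tm : t < m1.
  rewrite /t ltr_pdivrMr//; have : Num.min m1 (k / (2 * P * K + 1)) <= m1 by rewrite ge_min lexx.
  by lra.
have tk : t * (2 * P * K + 1) < k.
  rewrite -ltr_pdivlMr// /t ltr_pdivrMr//.
  have : Num.min m1 (k / (2 * P * K + 1)) <= k / (2 * P * K + 1) by rewrite ge_min lexx orbT.
  have : 0 < k / (2 * P * K + 1) by rewrite divr_gt0.
  by lra.
move: tm; rewrite !lt_min => /and3P[/andP[t1 tr] /andP[tx tX] /andP[ts1 ts2]].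
have low (h : C) : cabs h = t -> cabs (a + b * h + c * h ^+ 2) ^+ 2 - 2 * P * K * t ^+ 3 <= cabs (F (sector_pt x s + h)) ^+ 2.
  move=> ht; have := hF h; rewrite ht => /(_ (ltW tr)).
  set p := a + b * h + c * h ^+ 2; set f := F _ => hfp.
  have pP : cabs p <= P.
    rewrite /p (le_trans (cabsD _ _))// lerD//.
      by rewrite (le_trans (cabsD _ _))// lerD// cabsM ht ler_piMr// ltW.
    by rewrite cabsM cabsX ht ler_piMr// exprn_ile1 ?ltW.
  have h1 : cabs p - K * t ^+ 3 <= cabs f.
    by rewrite lerBlDr addrC -lerBlDr (le_trans (cabs_lowerB _ _))// cabsBC.
  have t30 : 0 <= K * t ^+ 3 by rewrite mulr_ge0// exprn_ge0// ltW.
  have := cabs_ge0 p; have := cabs_ge0 f; set cp := cabs p in pP h1 *; set cf := cabs f in h1 *.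
  move=> f0 p0; case: (leP (cp - K * t ^+ 3) 0) => hs.
    have : cp * cp <= P * (K * t ^+ 3) by rewrite ler_pM//; lra.
    by have := sqr_ge0 cf; have := mulr_ge0 P0 t30; rewrite -expr2; lra.
  have : (cp - K * t ^+ 3) ^+ 2 <= cf ^+ 2 by rewrite lerX// ltW.
  have : cp * (K * t ^+ 3) <= P * (K * t ^+ 3) by rewrite ler_wpM2r.
  by have := sqr_ge0 (K * t ^+ 3); nra.
have ct : cabs t%:C = t by rewrite cabs_real gtr0_norm.
have n1 := low t%:C ct.
have n2 : _ := low (- t%:C); rewrite cabsN in n2; have {}n2 := n2 ct.
have n3 : _ := low (imag_unit * t%:C); rewrite cabsM cabs_i mul1r in n3; have {}n3 := n3 ct.
have n4 : _ := low (- (imag_unit * t%:C)); rewrite cabsN cabsM cabs_i mul1r in n4; have {}n4 := n4 ct.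
have := four_point a b c t.
have tn : `|t| = t by rewrite gtr0_norm.
have q1 := inreg t 0; have q2 := inreg (- t) 0; have q3 := inreg 0 t; have q4 := inreg 0 (- t).
have e1 : t%:C = t +i* 0 :> C by [].
have e2 : - t%:C = (- t) +i* 0 :> C by apply: complex_ext; rewrite !reimE //= oppr0.
have e3 : imag_unit * t%:C = 0 +i* t :> C by apply: complex_ext; rewrite !reimE /=; ring.
have e4 : - (imag_unit * t%:C) = 0 +i* (- t) :> C by apply: complex_ext; rewrite !reimE /=; ring.
rewrite normr0 ?normrN tn addr0 in q1; rewrite normr0 normrN tn addr0 in q2.
rewrite normr0 tn add0r in q3; rewrite normr0 normrN tn add0r in q4.
have xXm : t < Num.min x (X - x) by rewrite lt_min tx.
have z0m : 0 < Num.min x (X - x) by rewrite lt_min x0 subr_gt0.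
have {}q1 := q1 xXm ts1 ts2; have {}q2 := q2 xXm ts1 ts2.
have {}q3 := q3 z0m ts1 ts2; have {}q4 := q4 z0m ts1 ts2.
rewrite -e1 in q1; rewrite -e2 in q2; rewrite -e3 in q3; rewrite -e4 in q4.
have mods : cabs (sector_pt x s + t%:C) ^+ 2 + cabs (sector_pt x s - t%:C) ^+ 2 +
  cabs (sector_pt x s + imag_unit * t%:C) ^+ 2 + cabs (sector_pt x s - imag_unit * t%:C) ^+ 2 = 4 * cabs (sector_pt x s) ^+ 2 + 4 * t ^+ 2.
  by rewrite !cabs_sqr !reimE /=; ring.
have t3 : 2 * P * K * t ^+ 3 < k * t ^+ 2.
  rewrite exprSr [t ^+ 2 * t]mulrC mulrA ltr_pM2r ?exprn_gt0//.
  by move: tk; rewrite mulrDr mulr1 [t * _]mulrC; lra.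
move: q1 q2 q3 q4 n1 n2 n3 n4 mods; rewrite /w -aF.
set f1 := cabs (F (_ + t%:C)) ^+ 2; set f2 := cabs (F (_ - t%:C)) ^+ 2.
set f3 := cabs (F (_ + imag_unit * _)) ^+ 2; set f4 := cabs (F (_ - imag_unit * _)) ^+ 2.
set g1 := cabs (_ + t%:C) ^+ 2; set g2 := cabs (_ - t%:C) ^+ 2.
set g3 := cabs (_ + imag_unit * _) ^+ 2; set g4 := cabs (_ - imag_unit * _) ^+ 2.
set p1 := cabs (_ + _ + c * t%:C ^+ 2) ^+ 2; set p2 := cabs (_ + _ + c * (- t%:C) ^+ 2) ^+ 2.
set p3 := cabs (_ + _ + c * (imag_unit * t%:C) ^+ 2) ^+ 2; set p4 := cabs (_ + _ + c * (- _) ^+ 2) ^+ 2.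
move=> q1 q2 q3 q4 n1 n2 n3 n4 mods fp.
have kk : k * g1 + k * g2 + k * g3 + k * g4 = 4 * (k * cabs (sector_pt x s) ^+ 2) + 4 * (k * t ^+ 2).
  by rewrite -!mulrDr mods; ring.
by lra.
Unshelve. all: by end_near.
Qed.

End MaximumPrinciple.

(** * Phragmen-Lindelof and Mikusinski arguments *)

Section Uniqueness.
Context {R : realType} (r : R) (r0 : 0 < r).
Local Notation C := (cplx R).

Lemma CBM_real (f : R -> R) : (forall x, 0 <= x <= r -> rcont r f x) -> CBM r (fun t => (f t)%:C).
Proof.
move=> h; apply: (Ccont_CBM r0) => x xr e e0; have [d d0 hd] := h x xr e e0.
by exists d => // y yr yd; rewrite -CB cabs_real hd.
Qed.

Lemma CBM_id : CBM r (fun t : R => t%:C).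
Proof. by apply: CBM_real => x xr e e0; exists e. Qed.

Lemma CBM_cexp (c : C) : CBM r (fun t : R => cexp (c * t%:C)).
Proof. exact: (AC_BM r0 (AC_cexp r0 c)). Qed.

Definition laplace (f : R -> C) (c : C) : C := cint r (fun t : R => cexp (c * t%:C) * f t).

Lemma laplace_taylor2 f c : CBM r f -> taylor2 (laplace f) c.
Proof.
move=> hf; have hE := CBM_cexp c; have hid := CBM_id.
pose g := fun t : R => cexp (c * t%:C) * f t.
have hg : CBM r g by exact: CBM_M.
have hg1 : CBM r (fun t : R => t%:C * g t) by exact: CBM_M.
have hg2 : CBM r (fun t : R => t%:C * (t%:C * g t)) by exact: CBM_M.
have [B B0 hB] := CBM_bound r0 hg.
have r0' := ltW r0.
have rr : 0 <= (r : R) <= r by rewrite r0' lexx.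
exists (cint r g), (cint r (fun t : R => t%:C * g t)), (2^-1 * cint r (fun t : R => t%:C * (t%:C * g t))),
  (r ^+ 3 * expR r * B * r), 1.
split=> //; first by rewrite !mulr_ge0// ?exprn_ge0 ?expR_ge0.
move=> h h1; set y := cabs h in h1 *; have y0 : 0 <= y by exact: cabs_ge0.
pose rem := fun t : R => (cexp (h * t%:C) - 1 - h * t%:C - (h * t%:C) ^+ 2 / 2) * g t.
have hrem : CBM r rem.
  have k1 := CBM_cexp h; have k2 := CBM_Z h hid; have k3 := CBM_M k2 k2.
  have k4 := CBM_D (CBM_D (CBM_D k1 (CBM_cst r (-1))) (CBM_N k2)) (CBM_Z (- 2^-1) k3).
  apply: eq_CBM (CBM_M k4 hg) => t _; rewrite /rem expr2; congr (_ * _); ring.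
have bnd t : 0 <= t <= r -> cabs (rem t) <= r ^+ 3 * expR r * B * y ^+ 3.
  move=> tr; have /andP[t0 t1] := tr.
  have yt : y * t <= r by rewrite -[leRHS]mul1r ler_pM.
  have ct : cabs (h * t%:C) = y * t by rewrite cabsM cabs_real ger0_norm.
  have := cexp_taylor (h * t%:C); rewrite ct => k.
  have e1 : expR (y * t) <= expR r by rewrite ler_expR.
  have e2 : (y * t) ^+ 3 <= y ^+ 3 * r ^+ 3.
    by rewrite exprMn ler_wpM2l ?exprn_ge0// lerX// t0.
  rewrite /rem cabsM [leRHS]mulrAC; apply: ler_pM => //; last exact: (hB t tr).
  have e3 : (y * t) ^+ 3 * expR (y * t) <= (y ^+ 3 * r ^+ 3) * expR r.
    by apply: ler_pM => //; rewrite ?expR_ge0// exprn_ge0// mulr_ge0.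
  by rewrite [leRHS]mulrC mulrA; exact: le_trans k e3.
have L1g := CBM_CL1 hg; have L1g1 := CBM_CL1 hg1; have L1g2 := CBM_CL1 hg2.
have -> : laplace f (c + h) = cint r g + h * cint r (fun t : R => t%:C * g t) +
   h ^+ 2 / 2 * cint r (fun t : R => t%:C * (t%:C * g t)) + cint r rem.
  have rr' : r <= r by [].
  rewrite -!(cintZ _ rr')// -!(cintD rr'); do ?[by []|exact: CL1_Z|exact: CBM_CL1|apply: CL1_D].
  apply: cint_eq => t _; rewrite /rem /g mulrDl cexpD expr2; by field.
set a := cint r g; set b := cint r _; set d := cint r (fun t : R => t%:C * (t%:C * g t)).
have -> : a + h * b + h ^+ 2 / 2 * d + cint r rem - (a + b * h + 2^-1 * d * h ^+ 2) = cint r rem by ring.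
have := cint_le_cst rr (CBM_CL1 hrem) bnd.
by rewrite [leRHS]mulrAC.
Qed.

(* Damping by exp(-eps (1 - 2i) eta^3) makes the maximum principle applicable to
   G(eta^2) on the sector -1/10 <= arg <= pi/4 cut at a large radius. *)
Lemma phragmen_lindelof (G : C -> C) (M : R) : 0 <= M -> (forall z, taylor2 G z) ->
  (forall z, Rez z <= 0 -> cabs (G z) <= M) ->
  (forall z, 0 <= Rez z -> cabs (G z) <= M * expR (r * Rez z)) ->
  (forall x, 0 <= x -> cabs (G ((x * (99 / 100)) +i* (- (x * (1 / 5))))) <= M) ->
  forall x : R, 0 <= x -> cabs (G x%:C) <= M.
Proof.
move=> M0 hT hl hr hray y y0.
pose x := Num.sqrt y; have xx : y = x ^+ 2 by rewrite sqr_sqrtr.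
have x0 : 0 <= x by exact: sqrtr_ge0.
rewrite leNgt; apply/negP => bad; set g := cabs _ in bad.
have x30 : 0 <= x ^+ 3 by exact: exprn_ge0.
have g0 : 0 < g by rewrite (le_lt_trans _ bad).
have gx0 : 0 < 2 * (g * x ^+ 3 + 1) by rewrite mulr_gt0// ltr_wpDl// mulr_ge0// ltW.
(* So small that the damping at eta = x costs less than half of the supposed excess g - M. *)
pose e := (g - M) / (2 * (g * x ^+ 3 + 1)).
have e0 : 0 < e by rewrite divr_gt0// subr_gt0.
pose H (eta : C) : C := G (eta ^+ 2) * cexp (- (e%:C * (1 +i* (-2)) * eta ^+ 3)).
have HT z : taylor2 H z.
  apply: taylor2_M; apply: taylor2_comp.
  - exact: hT.
  - have := taylor2_poly 0 0 1 0 z; congr (taylor2 _ z); apply/funext => w; ring.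
  - exact: taylor2_cexp.
  - have := taylor2_poly 0 0 0 (- (e%:C * (1 +i* (-2)))) z; congr (taylor2 _ z); apply/funext => w; ring.
have HE u s : cabs (H (sector_pt u s)) = cabs (G ((u ^+ 2 * (1 - s ^+ 2)) +i* (u ^+ 2 * (2 * s)))) *
    expR (- (e * u ^+ 3 * (1 + 6 * s - 3 * s ^+ 2 - 2 * s ^+ 3))).
  rewrite /H cabsM cabs_cexp; congr (cabs (G _) * expR _).
    by apply: complex_ext; rewrite !expr2 !reimE /=; ring.
  by rewrite exprS expr2 !reimE /=; ring.
(* The real part of (1 - 2i)(1 + i s)^3, the rate of decay along the ray of slope s. The identity
   below writes it as a product that is nonnegative on the interval plus an affine function that is
   at least 372/1000 there. *)
have damp (s : R) : - 1 / 10 <= s <= 1 -> 3 / 10 <= 1 + 6 * s - 3 * s ^+ 2 - 2 * s ^+ 3.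
  move=> /andP[s1 s2].
  have h1 : 0 <= (s + 1 / 10) * (1 - s) * (2 * s + 24 / 5).
    by rewrite !mulr_ge0//; lra.
  have : 1 + 6 * s - 3 * s ^+ 2 - 2 * s ^+ 3 = (s + 1 / 10) * (1 - s) * (2 * s + 24 / 5) +
     (372 / 1000 + (s + 1 / 10) * (148 / 100)) by field.
  by lra.
have dle1 (u s : R) : 0 <= u -> - 1 / 10 <= s <= 1 -> expR (- (e * u ^+ 3 * (1 + 6 * s - 3 * s ^+ 2 - 2 * s ^+ 3))) <= 1.
  move=> u0 /damp hs; rewrite -[leRHS]expR0 ler_expR oppr_le0; apply: mulr_ge0; last by lra.
  by apply: mulr_ge0; [exact: ltW|exact: exprn_ge0].
have mulM (A a : R) : 0 <= A -> A <= M -> 0 <= a -> a <= 1 -> A * a <= M.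
  by move=> ? ? ? ?; rewrite -[leRHS]mulr1 ler_pM.
have s11 : - 1 / 10 <= (1 : R) <= 1 by apply/andP; split; lra.
have s12 : - 1 / 10 <= (- 1 / 10 : R) <= 1 by apply/andP; split; lra.
have s10 : - 1 / 10 <= (0 : R) <= 1 by apply/andP; split; lra.
(* On the far edge the damping e X^3 3/10 then outweighs the growth r X^2. *)
pose X := Num.max (x + 1) (r / (e * (3 / 10))).
have X0 : 0 < X by rewrite lt_max ltr_wpDl.
have xX : x <= X by rewrite le_max lerDl ler01.
have bad2 : cabs (H (sector_pt x 0)) <= M.
  apply: (@sector_max _ H X M X0 M0 HT _ _ x 0 _ s10); last by rewrite x0.
    (* Squaring sends the edge s = 1 to the imaginary axis and the edge s = -1/10 to the given ray,
       since (1 - i/10)^2 = 99/100 - i/5. *)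
    move=> u /andP[u0 _]; rewrite !HE; split; apply: mulM; rewrite ?expR_ge0 ?dle1//.
      by apply: hl; rewrite /= expr1n subrr mulr0.
    have := hray _ (sqr_ge0 u); congr (cabs (G (_ +i* _)) <= M); by field.
  move=> s ss; rewrite !HE; split.
    apply: mulM; rewrite ?expR_ge0 ?dle1//.
    by apply: hl; rewrite /= expr0n /= mul0r.
  have s21 : 0 <= 1 - s ^+ 2 <= 1 by case/andP: ss => a b; rewrite subr_ge0 gerBl sqr_ge0 andbT; nra.
  have ReX : 0 <= X ^+ 2 * (1 - s ^+ 2) <= X ^+ 2.
    by case/andP: s21 => a b; rewrite mulr_ge0 ?sqr_ge0//= ler_piMr ?sqr_ge0.
  case/andP: ReX => ReX0 ReX1.
  apply: (le_trans (ler_wpM2r (expR_ge0 _) (hr ((X ^+ 2 * (1 - s ^+ 2)) +i* (X ^+ 2 * (2 * s))) ReX0))).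
  rewrite -[leLHS]mulrA -expRD ler_piMr// -[leRHS]expR0 ler_expR /=.
  have := damp s ss; set q := 1 + _ - _ - _ => hq.
  have hX : r <= X * (e * (3 / 10)).
    have e3 : 0 < e * (3 / 10) by apply: mulr_gt0 => //; lra.
    by rewrite -ler_pdivrMr// /X le_max lexx orbT.
  have h1 : r * (X ^+ 2 * (1 - s ^+ 2)) <= r * X ^+ 2 by rewrite ler_wpM2l ?(ltW r0).
  have h2 : r * X ^+ 2 <= X * (e * (3 / 10)) * X ^+ 2 by rewrite ler_wpM2r ?sqr_ge0.
  have h3 : e * X ^+ 3 * (3 / 10) <= e * X ^+ 3 * q by rewrite ler_wpM2l// mulr_ge0 ?(ltW e0)// exprn_ge0// ltW.
  have h4 : X * (e * (3 / 10)) * X ^+ 2 = e * X ^+ 3 * (3 / 10) by ring.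
  by lra.
move: bad2; rewrite HE !expr0n /= !mulr0 !subr0 !addr0 !mulr1 -xx -/g => bad2.
have := expR_ge1Dx (- (e * x ^+ 3)) => e1.
have h1 : g * (1 - e * x ^+ 3) <= M by apply: le_trans bad2; rewrite ler_wpM2l// ltW.
have h2 : e * (2 * (g * x ^+ 3 + 1)) = g - M by rewrite /e divfK// gt_eqF.
have h3 : e * (g * x ^+ 3) = g * (e * x ^+ 3) by ring.
by move: h1 h2 h3; rewrite !mulrDr; lra.
Qed.

(* The Mikusinski kernel (1 - e^(n(x-t))/N)^N tends to the indicator of t > x. *)
Lemma mikusinski_kernel (w : R) (N : nat) : 0 < w -> w <= N%:R ->
  let Q := (1 - w / N%:R) ^+ N in [/\ 0 <= Q, Q <= 1, Q <= w^-1 & 1 - Q <= w].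
Proof.
move=> w0 wN Q; have N0 : 0 < N%:R :> R by exact: lt_le_trans wN.
have q0 : 0 <= 1 - w / N%:R by rewrite subr_ge0 ler_pdivrMr// mul1r.
have wN0 : 0 <= w / N%:R by rewrite divr_ge0// ltW.
have qe : 1 - w / N%:R <= expR (- (w / N%:R)) by apply: le_trans (expR_ge1Dx _).
split.
- exact: exprn_ge0.
- by rewrite exprn_ile1// gerBl.
- apply: (@le_trans _ _ (expR (- (w / N%:R)) ^+ N)); first by rewrite lerX// q0.
  rewrite -expRM_natl mulrN mulrC divfK ?gt_eqF// expRN lef_pV2 ?posrE ?expR_gt0//.
  by apply: le_trans (expR_ge1Dx _); rewrite lerDr.
- have bern (a : R) n : 0 <= a <= 1 -> 1 - n%:R * a <= (1 - a) ^+ n.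
    move=> /andP[a0 a1]; elim: n => [|n IH]; first by rewrite mul0r subr0 expr0.
    rewrite exprS; apply: le_trans (ler_wpM2l _ IH); last by rewrite subr_ge0.
    rewrite -natr1; have : 0 <= n%:R * a ^+ 2 by rewrite mulr_ge0// sqr_ge0.
    by nra.
  have := bern (w / N%:R) N; rewrite wN0 -subr_ge0 q0 => /(_ isT).
  rewrite mulrC divfK ?gt_eqF// -/Q; lra.
Qed.

Lemma cexp_natM (n k : nat) (t : R) : cexp (n%:R * t%:C) ^+ k = cexp ((k * n)%:R * t%:C) :> C.
Proof. by rewrite cexpX mulrA -natrM. Qed.

(** In the binomial expansion of the kernel the term k = 0 is the full integral of f, and the terms
    k >= 1 are Laplace transforms at -kn, which add up to at most M (e^q - 1) with q = e^{-n(r-x)}.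
    The integral over (x, r] is thus close to the full one, so the primitive of f vanishes at every
    x. *)
Lemma mikusinski (f : R -> C) (M : R) : (forall x, 0 <= x <= r -> Ccont r f x) -> 0 <= M ->
  (forall n : nat, cabs (cexp (n%:R * r%:C) * laplace f (- n%:R)) <= M) ->
  forall x, 0 <= x <= r -> f x = 0.
Proof.
move=> cf M0 hM; have hf := Ccont_CBM r0 cf; have [B B0 hB] := CBM_bound r0 hf.
have hL := CBM_CL1 hf; have r0' := ltW r0.
have key x (n : nat) (eta : R) : 0 < eta -> eta < x < r - eta ->
  cabs (cint x f) <= M * (expR (expR (- (n%:R * (r - x)))) - 1) + 4 * B * r * expR (- (n%:R * eta)) + 4 * B * eta.
  move=> eta0 /andP[x1 x2]; have x0 : 0 < x by exact: lt_trans x1.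
  pose u := r - x; pose q := expR (- (n%:R * u)).
  have q0 : 0 < q := expR_gt0 _.
  (* Exceeds e^{nr}, hence every value of [w] on t >= 0, so that the base of the kernel lies in
     [0, 1]. *)
  pose N := (Num.truncn (expR (n%:R * r))).+1.
  have hN : expR (n%:R * r) < N%:R by exact: truncnS_gt.
  have N0 : 0 < N%:R :> R by rewrite ltr0n.
  pose w t := expR (n%:R * (x - t)).
  have w0 t : 0 < w t := expR_gt0 _.
  have wN t : 0 <= t -> w t <= N%:R.
    move=> t0; apply: le_trans (ltW hN); rewrite ler_expR ler_wpM2l//; lra.
  pose Q t := (1 - w t / N%:R) ^+ N.
  have hQ t (t0 : 0 <= t) := mikusinski_kernel (w0 t) (wN t t0).
  have wE t : w t = q * expR (n%:R * r) * expR (- (n%:R * t)).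
    by rewrite /w /q -!expRD; congr expR; rewrite /u; ring.
  pose c : C := - (q / N%:R)%:C.
  have QE t : (Q t)%:C = \sum_(k < N.+1) ('C(N, k)%:R * c ^+ k * cexp ((k * n)%:R * r%:C)) * cexp (- (k * n)%:R * t%:C) :> C.
    rewrite CX CB -[_ - _]/(1 + - _) exprDn; apply: eq_bigr => k _.
    rewrite expr1n mul1r -mulr_natl -!mulrA; congr (_ * _).
    rewrite mulNr cexpN -!cexp_natM -exprVn -!exprMn -cexpN; congr (_ ^+ _).
    have e1 : cexp (n%:R * r%:C) = (expR (n%:R * r))%:C :> C by rewrite -Cnat -CM cexp_real.
    have e2 : cexp (- (n%:R * t%:C)) = (expR (- (n%:R * t)))%:C :> C by rewrite -Cnat -CM -CN cexp_real.
    rewrite e1 e2 wE /c mulNr -!CM; congr (- _%:C); ring.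
  have mE k : CBM r (fun t : R => cexp (- (k * n)%:R * t%:C) * f t) by apply: CBM_M => //; exact: CBM_cexp.
  have rr : (r : R) <= r by [].
  have QBM : CBM r (fun t => (Q t)%:C * f t).
    apply: CBM_M => //; apply: (@eq_CBM _ _ (fun t : R => \sum_(k < N.+1) ('C(N, k)%:R * c ^+ k * cexp ((k * n)%:R * r%:C)) * cexp (- (k * n)%:R * t%:C))).
      by move=> t _; rewrite QE.
    by apply: CBM_sum => k; apply: CBM_Z; exact: CBM_cexp.
  have intQ : cint r (fun t => (Q t)%:C * f t) = \sum_(k < N.+1) 'C(N, k)%:R * c ^+ k * (cexp ((k * n)%:R * r%:C) * laplace f (- (k * n)%:R)).
    rewrite (@cint_eq _ _ (fun t : R => \sum_(k < N.+1) ('C(N, k)%:R * c ^+ k * cexp ((k * n)%:R * r%:C)) * (cexp (- (k * n)%:R * t%:C) * f t))); last first.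
      by move=> t _; rewrite QE mulr_suml; apply: eq_bigr => k _; rewrite !mulrA.
    rewrite (cint_sum _ _ rr); last by move=> k; apply: CL1_Z; exact: CBM_CL1.
    by apply: eq_bigr => k _; rewrite (cintZ _ rr) ?mulrA//; exact: CBM_CL1.
  have b1 : cabs (cint r (fun t => (Q t)%:C * f t) - cint r f) <= M * (expR q - 1).
    rewrite intQ big_ord_recl /= bin0 expr0 !mul1r mul0n oppr0 mul0r cexp0 mul1r.
    have -> : laplace f 0 = cint r f by apply: cint_eq => t _; rewrite mul0r cexp0 mul1r.
    rewrite addrAC subrr add0r (le_trans (cabs_sum _ _ _))//.
    apply: (@le_trans _ _ (\sum_(i < N) M * ('C(N, i.+1)%:R * (q / N%:R) ^+ i.+1))).
      apply: ler_sum => i _; rewrite cabsM mulrC ler_pM//.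
      by rewrite cabsM cabs_nat cabsX cabsN cabs_real ger0_norm ?divr_ge0 ?(ltW q0).
    rewrite -mulr_sumr ler_wpM2l// lerBrDl.
    have <- : (1 + q / N%:R) ^+ N = 1 + \sum_(i < N) 'C(N, i.+1)%:R * (q / N%:R) ^+ i.+1.
      rewrite exprDn big_ord_recl /= bin0 expr1n mul1r expr0 mulr1n; congr (_ + _).
      by apply: eq_bigr => i _; rewrite expr1n mul1r mulr_natl.
    apply: (@le_trans _ _ (expR (q / N%:R) ^+ N)).
      by rewrite lerX// expR_ge1Dx andbT addr_ge0// divr_ge0// ltW.
    by rewrite -expRM_natl mulrC divfK// gt_eqF.
  pose D t : C := (Q t)%:C * f t - f t.
  have DBM : CBM r D by apply: CBM_D => //; exact: CBM_N.
  have b2 : cabs (cint x (fun t => (Q t)%:C * f t) + (cint r D - cint x D)) <= 4 * B * r * expR (- (n%:R * eta)) + 4 * B * eta.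
    have e0 := expR_gt0 (- (n%:R * eta)); set ee := expR _ in e0 *.
    have Q1 t : 0 <= t <= x -> cabs ((Q t)%:C * f t) <= B.
      move=> /andP[t0 tx]; have [h1 h2 _ _] := hQ t t0; rewrite cabsM cabs_real ger0_norm// -[leRHS]mul1r ler_pM//.
      by apply: hB; lra.
    have Q2 t : 0 <= t <= x - eta -> cabs ((Q t)%:C * f t) <= B * ee.
      move=> /andP[t0 tx]; have [h1 _ h2 _] := hQ t t0; rewrite cabsM cabs_real ger0_norm// mulrC ler_pM//.
        by apply: hB; lra.
      by apply: (le_trans h2); rewrite /w -expRN ler_expR lerN2 ler_wpM2l//; lra.
    have Q3 t : 0 <= t <= r -> cabs (D t) <= B.
      move=> /andP[t0 tr]; have [h1 h2 _ _] := hQ t t0.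
      have -> : D t = (Q t - 1)%:C * f t by rewrite /D CB mulrBl mul1r.
      rewrite cabsM cabs_real distrC ger0_norm ?subr_ge0// -[leRHS]mul1r ler_pM ?subr_ge0//; last by apply: hB; lra.
      by rewrite lerBlDr lerDl.
    have Q4 t : x + eta <= t <= r -> cabs (D t) <= B * ee.
      move=> /andP[tx tr]; have t0 : 0 <= t by lra.
      have [h1 h2 _ h3] := hQ t t0.
      have -> : D t = (Q t - 1)%:C * f t by rewrite /D CB mulrBl mul1r.
      rewrite cabsM cabs_real distrC ger0_norm ?subr_ge0// mulrC ler_pM ?subr_ge0//; first by apply: hB; lra.
      by apply: (le_trans h3); rewrite /w ler_expR -mulrN ler_wpM2l//; lra.
    have L1Q := CBM_CL1 QBM; have L1D := CBM_CL1 DBM.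
    have s1 : cabs (cint (x - eta) (fun t => (Q t)%:C * f t) - cint 0 (fun t => (Q t)%:C * f t)) <= 2 * (B * ee) * (x - eta - 0).
      by apply: (@cint_split _ r) => //; [lra|lra|move=> t h; apply: Q2; lra].
    have s2 : cabs (cint x (fun t => (Q t)%:C * f t) - cint (x - eta) (fun t => (Q t)%:C * f t)) <= 2 * B * (x - (x - eta)).
      by apply: (@cint_split _ r) => //; [lra|lra|move=> t h; apply: Q1; lra].
    have s3 : cabs (cint (x + eta) D - cint x D) <= 2 * B * (x + eta - x).
      by apply: (@cint_split _ r) => //; [lra|lra|move=> t h; apply: Q3; lra].
    have s4 : cabs (cint r D - cint (x + eta) D) <= 2 * (B * ee) * (r - (x + eta)).
      by apply: (@cint_split _ r) => //; [lra|move=> t h; apply: Q4; lra].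
    rewrite cint0 subr0 in s1.
    set I1 := cint x _; set I2 := cint (x - eta) _ in s1 s2 *; set I3 := cint (x + eta) D in s3 s4 *.
    have -> : I1 + (cint r D - cint x D) = I2 + (I1 - I2) + ((I3 - cint x D) + (cint r D - I3)) by ring.
    apply: (le_trans (cabsD _ _)); have k1 := cabsD I2 (I1 - I2); have k2 := cabsD (I3 - cint x D) (cint r D - I3).
    have BE : 0 <= B * ee by rewrite mulr_ge0// ltW.
    by nra.
  have L1Q := CBM_CL1 QBM.
  have xr : x <= r by lra.
  have cD y : y <= r -> cint y D = cint y (fun t => (Q t)%:C * f t) - cint y f.
    by move=> yr; rewrite /D (cintD yr) ?(cintN yr)//; exact: CL1_N.
  rewrite !cD// in b2.
  set I1 := cint r _ in b1 b2; set I2 := cint x (fun t => _ * _) in b2.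
  have -> : cint x f = (I2 + (I1 - cint r f - (I2 - cint x f))) - (I1 - cint r f) by ring.
  apply: (le_trans (cabsB _ _)); move: b1; rewrite /q /u => b1.
  by rewrite -[leRHS]addrA [leRHS]addrC lerD.
have F0 x : 0 < x < r -> cint x f = 0.
  move=> /andP[x0 xr]; apply/eqP; rewrite -cabs_eq0 eq_le cabs_ge0 andbT.
  apply/ler_addgt0Pr => e e0; rewrite add0r.
  have K0 : 0 < 16 * (B + 1) by rewrite mulr_gt0// ltr_wpDl.
  pose eta := Num.min (Num.min (x / 2) ((r - x) / 2)) (e / (16 * (B + 1))).
  have eta0 : 0 < eta by rewrite !lt_min !divr_gt0// subr_gt0.
  have [et1 et2 et3] : [/\ eta <= x / 2, eta <= (r - x) / 2 & eta * (16 * (B + 1)) <= e].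
    by split; rewrite -?ler_pdivlMr// /eta !ge_min lexx ?orbT.
  (* A common bound for both exponentials in [key]; a <= 1/2 gives e^a <= 2 and so e^a - 1 <= 2a. *)
  pose a := Num.min 2^-1 (e / (4 * (M + 4 * B * r + 1))).
  have L0 : 0 < M + 4 * B * r + 1 by rewrite ltr_wpDl// addr_ge0// !mulr_ge0.
  have a0 : 0 < a by rewrite lt_min invr_gt0 ltr0n divr_gt0// mulr_gt0.
  have a1 : a <= 2^-1 by rewrite /a ge_min lexx.
  have ae : a * (4 * (M + 4 * B * r + 1)) <= e by rewrite -ler_pdivlMr ?mulr_gt0// /a ge_min lexx orbT.
  pose n := (Num.truncn (a^-1 / eta)).+1.
  have hn : a^-1 / eta < n%:R by exact: truncnS_gt.
  have ex (y : R) : eta <= y -> expR (- (n%:R * y)) <= a.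
    move=> ey; rewrite expRN -[leRHS]invrK lef_pV2 ?posrE ?invr_gt0 ?expR_gt0//.
    have h1 : a^-1 <= n%:R * y.
      apply: (@le_trans _ _ (n%:R * eta)); first by rewrite -ler_pdivrMr// ltW.
      by rewrite ler_wpM2l.
    by apply: (le_trans h1); apply: le_trans (expR_ge1Dx _); rewrite lerDr.
  have etx : eta < x < r - eta by apply/andP; split; lra.
  have k1 := key x n eta eta0 etx.
  have h1 := ex eta (lexx _); have h2 : expR (- (n%:R * (r - x))) <= a by apply: ex; lra.
  have h3 : expR (expR (- (n%:R * (r - x)))) - 1 <= 2 * a.
    have : expR (expR (- (n%:R * (r - x)))) <= expR a by rewrite ler_expR.
    have h4 : 1 - a <= (expR a)^-1 by rewrite -expRN expR_ge1Dx.
    move=> h5.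
    have {}h4 : (1 - a) * expR a <= 1 by rewrite -ler_pdivlMr ?expR_gt0// div1r.
    have := expR_gt0 a => E0.
    have h6 : 2^-1 * expR a <= (1 - a) * expR a by rewrite ler_wpM2r ?(ltW E0)//; lra.
    have h7 : a * expR a <= a * 2 by rewrite ler_wpM2l ?(ltW a0)//; lra.
    by move: h4 h6 h7; rewrite mulrBl mul1r; lra.
  have h4 : M * (expR (expR (- (n%:R * (r - x)))) - 1) <= M * (2 * a) by rewrite ler_wpM2l.
  have h5 : 4 * B * r * expR (- (n%:R * eta)) <= 4 * B * r * a by rewrite ler_wpM2l ?mulr_ge0.
  have Ma : 0 <= M * a by rewrite mulr_ge0// ltW.
  have Ba : 0 <= B * r * a by rewrite !mulr_ge0// ltW.
  have Be : 0 <= B * eta by rewrite mulr_ge0// ltW.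
  have ae' : 4 * (M * a) + 16 * (B * r * a) + 4 * a <= e by apply: le_trans ae; rewrite le_eqVlt; apply/orP; left; apply/eqP; ring.
  have et3' : 16 * (B * eta) + 16 * eta <= e by apply: le_trans et3; rewrite le_eqVlt; apply/orP; left; apply/eqP; ring.
  have q1 : M * (2 * a) = 2 * (M * a) by ring.
  have q2 : 4 * B * r * a = 4 * (B * r * a) by ring.
  have q3 : 4 * B * eta = 4 * (B * eta) by ring.
  by apply: (le_trans k1); move: h4 h5; rewrite q1 q2 q3; lra.
pose F (x : R) := cint x f.
have hA : AC r F f by split; [exact: CBM_CL2|move=> x xr; rewrite /F cint0 add0r].
have FE x : 0 <= x <= r -> F x = 0.
  move=> /andP[]; rewrite le_eqVlt => /predU1P[<- _|x0]; first exact: cint0.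
  rewrite le_eqVlt => /predU1P[->|xr]; last by apply: F0; rewrite x0.
  have rr : 0 <= (r : R) <= r by rewrite r0' lexx.
  apply/eqP; rewrite -cabs_eq0 eq_le cabs_ge0 andbT leNgt; apply/negP => bad.
  have [d d0 hd] := AC_Ccont r0 hA rr bad.
  pose y := Num.max (r / 2) (r - d / 2).
  have y1 : r / 2 <= y by rewrite /y le_max lexx.
  have y2 : r - d / 2 <= y by rewrite /y le_max lexx orbT.
  have y3 : y < r by rewrite /y gt_max ltr_pdivrMr// ltr_pMr// ltr1n gtrDl oppr_lt0 divr_gt0.
  have := hd y; rewrite /F F0; last by apply/andP; split; lra.
  rewrite sub0r cabsN ltxx => h; suff : false by [].
  by apply: h; [apply/andP; split; lra|rewrite distrC ger0_norm; lra].
move=> x xr; have hD := AC_Cderiv hA cf xr.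
apply/eqP; rewrite -cabs_eq0 eq_le cabs_ge0 andbT leNgt; apply/negP => bad.
have [d d0 hd] := hD _ bad.
pose m := Num.min (d / 2) (r / 2).
have m0 : 0 < m by rewrite lt_min !divr_gt0.
have m1 : m <= d / 2 by rewrite /m ge_min lexx.
have m2 : m <= r / 2 by rewrite /m ge_min lexx orbT.
have [y [yr yx yd]] : exists y, [/\ 0 <= y <= r, y != x & `|y - x| < d].
  case/andP: xr => x0 x1; case: (lerP x (r / 2)) => hx.
    exists (x + m); split; first by apply/andP; split; lra.
      by rewrite gt_eqF// ltrDl.
    by rewrite addrAC subrr add0r gtr0_norm//; lra.
  exists (x - m); split; first by apply/andP; split; lra.
    by rewrite lt_eqF// ltrBlDr ltrDl.
  by rewrite addrAC subrr add0r normrN gtr0_norm//; lra.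
have := hd y yr yx yd; rewrite !FE// subrr mulr0 sub0r cabsN ltxx//.
Qed.

(* z = i zeta with zeta = x (99/100 - i/5), a ray inside the first quadrant. *)
Lemma laplace_uniqueness (f : R -> C) (K : R) : (forall x, 0 <= x <= r -> Ccont r f x) ->
  (forall x : R, 0 <= x -> let zeta : C := (x * (99 / 100)) +i* (- (x * (1 / 5))) in
     cabs (laplace f (- zeta)) <= K * expR (- (r * Rez zeta))) ->
  forall x, 0 <= x <= r -> f x = 0.
Proof.
move=> cf hK; have hf := Ccont_CBM r0 cf; have [B B0 hB] := CBM_bound r0 hf.
have r0' := ltW r0; have rr : 0 <= (r : R) <= r by rewrite r0' lexx.
(* This is the integral of e^{zeta(r-t)} f(t): bounded in the left half-plane, of growth e^{r Re
   zeta} in the right one, and bounded on the given ray by hypothesis. *)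
pose G (zeta : C) := cexp (zeta * r%:C) * laplace f (- zeta).
pose M := Num.max K (B * r).
have M0 : 0 <= M by rewrite le_max [X in _ || X]mulr_ge0 ?orbT.
have GT z : taylor2 G z.
  apply: taylor2_M; first apply: taylor2_comp.
  - exact: taylor2_cexp.
  - have := taylor2_poly 0 r%:C 0 0 z; congr (taylor2 _ z); apply/funext => w; ring.
  - apply: (@taylor2_comp _ (laplace f) (fun w => - w)); first exact: laplace_taylor2.
    have := taylor2_poly 0 (-1) 0 0 z; congr (taylor2 _ z); apply/funext => w; ring.
have GE z (m : R) : (forall t, 0 <= t <= r -> Rez z * (r - t) <= m) -> cabs (G z) <= B * r * expR m.
  move=> hm; rewrite /G /laplace -(cintZ _ (lexx r)); last by apply: CBM_CL1; apply: CBM_M => //; exact: CBM_cexp.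
  rewrite mulrAC; apply: (@cint_le_cst _ r) => //.
    by apply: CBM_CL1; apply: CBM_Z; apply: CBM_M => //; exact: CBM_cexp.
  move=> t tr; rewrite mulrA -cexpD cabsM cabs_cexp mulrC ler_pM ?expR_ge0//; first exact: hB.
  rewrite ler_expR; apply: le_trans (hm t tr); rewrite !reimE /=; lra.
have := phragmen_lindelof (G := G) M0 GT _ _ _.
move=> PL; apply: (mikusinski cf M0) => n.
have := PL _ _ _ n%:R (ler0n _ n); rewrite Cnat /G; apply.
- move=> z z0; have := GE z 0; rewrite expR0 mulr1 => h; apply: (@le_trans _ _ (B * r)); last by rewrite le_max lexx orbT.
  apply: h => t /andP[_ tr]; rewrite mulr_le0_ge0// subr_ge0//.
- move=> z z0; have h := GE z (r * Rez z); apply: (@le_trans _ _ (B * r * expR (r * Rez z))).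
    by apply: h => t /andP[t0 tr]; rewrite mulrC ler_wpM2r// gerBl.
  by rewrite ler_wpM2r ?expR_ge0// le_max lexx orbT.
- move=> x x0; have := hK x x0; set z := _ +i* _ => /= h.
  rewrite /G cabsM cabs_cexp.
  apply: (@le_trans _ _ (expR (Rez (z * r%:C)) * (K * expR (- (r * (x * (99 / 100))))))); first by rewrite ler_wpM2l ?expR_ge0.
  rewrite mulrCA -expRD; have -> : Rez (z * r%:C) + - (r * (x * (99 / 100))) = 0 by rewrite !reimE /=; ring.
  by rewrite expR0 mulr1 le_max lexx.
Qed.

End Uniqueness.

(** * Pointwise limits under the integral sign *)

Section Convergence.
Context {R : realType}.
Local Notation C := (cplx R).
Local Notation mu := (@lebesgue_measure R).

Lemma cauchy_real (u : nat -> R) : (forall e : R, 0 < e -> exists N, forall n, (N <= n)%N -> `|u n - u N| < e) ->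
  exists l : R, u @ \oo --> l.
Proof.
move=> h; exists (limn u); apply/cauchy_cvgP; apply: cauchy_exP => e e0.
have [N hN] := h e e0; exists (u N); exists N => // n /hN /=.
by rewrite distrC.
Qed.

Definition mcvg m n (s : nat -> 'M[C]_(m, n)) (l : 'M[C]_(m, n)) := forall e : R, 0 < e ->
  exists N, forall k, (N <= k)%N -> mabs (s k - l) < e.

Lemma mcvg_uniq m n (s : nat -> 'M[C]_(m, n)) l l' : mcvg s l -> mcvg s l' -> l = l'.
Proof.
move=> h h'; apply/eqP; rewrite -subr_eq0; apply/eqP/mabs_eq0/eqP; rewrite eq_le mabs_ge0 andbT.
apply/ler_addgt0Pr => e e0; rewrite add0r; have e2 : 0 < e / 2 by rewrite divr_gt0.
have [N hN] := h _ e2; have [N' hN'] := h' _ e2.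
have -> : l - l' = (s (maxn N N') - l') - (s (maxn N N') - l) by rewrite opprB [RHS]addrC addrA subrK.
apply: (le_trans (mabsB _ _)); have := hN _ (leq_maxl N N'); have := hN' _ (leq_maxr N N'); lra.
Qed.

Lemma mcvg_eq m n (s s' : nat -> 'M[C]_(m, n)) l : s =1 s' -> mcvg s l -> mcvg s' l.
Proof. by move=> /funext ->. Qed.

Lemma mcvg_cst m n (l : 'M[C]_(m, n)) : mcvg (fun=> l) l.
Proof. by move=> e e0; exists 0%N => k _; rewrite subrr mabs0. Qed.

Lemma mcvg_D m n (s s' : nat -> 'M[C]_(m, n)) l l' : mcvg s l -> mcvg s' l' -> mcvg (fun k => s k + s' k) (l + l').
Proof.
move=> h h' e e0; have e2 : 0 < e / 2 by rewrite divr_gt0.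
have [N hN] := h _ e2; have [N' hN'] := h' _ e2.
exists (maxn N N') => k; rewrite geq_max => /andP[/hN k1 /hN' k2].
by rewrite opprD addrACA (le_lt_trans (mabsD _ _))//; lra.
Qed.

Lemma mcvg_Ml m n q (A : 'M[C]_(q, m)) (s : nat -> 'M[C]_(m, n)) l : mcvg s l -> mcvg (fun k => A *m s k) (A *m l).
Proof.
move=> h e e0; have K0 : 0 < mabs A + 1 by rewrite ltr_wpDl ?mabs_ge0.
have [|N hN] := h (e / (mabs A + 1)); first by rewrite divr_gt0.
exists N => k /hN; rewrite -mulmxBr ltr_pdivlMr// => hk.
apply: (le_lt_trans (mabsM _ _)); apply: le_lt_trans hk; rewrite mulrC ler_wpM2l ?mabs_ge0//.
by rewrite lerDl.
Qed.

Lemma mcvg_Zl m n (f : nat -> C) (c : C) (A : 'M[C]_(m, n)) :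
  (forall e : R, 0 < e -> exists N, forall k, (N <= k)%N -> cabs (f k - c) < e) ->
  mcvg (fun k => f k *: A) (c *: A).
Proof.
move=> h e e0; have K0 : 0 < mabs A + 1 by rewrite ltr_wpDl ?mabs_ge0.
have [|N hN] := h (e / (mabs A + 1)); first by rewrite divr_gt0.
exists N => k /hN; rewrite -scalerBl mabsZ ltr_pdivlMr// => hk.
by apply: le_lt_trans hk; rewrite ler_wpM2l// lerDl.
Qed.

Lemma mcvg_bound m n (s : nat -> 'M[C]_(m, n)) l (B : R) : mcvg s l -> (forall k, mabs (s k) <= B) -> mabs l <= B.
Proof.
move=> h hB; apply/ler_addgt0Pr => e e0; have [N hN] := h e e0.
have -> : l = s N - (s N - l) by rewrite opprB addrC subrK.
apply: (le_trans (mabsB _ _)); have := hN N (leqnn N); have := hB N; lra.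
Qed.

Lemma ReB (z w : C) : Rez (z - w) = Rez z - Rez w. Proof. by rewrite !reimE. Qed.
Lemma ImB (z w : C) : Imz (z - w) = Imz z - Imz w. Proof. by rewrite !reimE. Qed.

Lemma mcvg_reim m n (s : nat -> 'M[C]_(m, n)) (l : 'M[C]_(m, n)) :
  (forall i j, (fun k => Rez (s k i j)) @ \oo --> Rez (l i j)) ->
  (forall i j, (fun k => Imz (s k i j)) @ \oo --> Imz (l i j)) -> mcvg s l.
Proof.
move=> hr hi e e0.
have K0 : 0 < m%:R * n%:R + 1 :> R by rewrite ltr_wpDl// mulr_ge0.
set ek := e / (m%:R * n%:R + 1).
have ek2 : 0 < ek / 2 by rewrite !divr_gt0.
have /choice[N hN] : forall ij : 'I_m * 'I_n, exists N, forall k, (N <= k)%N -> cabs (s k ij.1 ij.2 - l ij.1 ij.2) < ek.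
  move=> [i j]; move/cvgrPdist_lt : (hr i j) => /(_ _ ek2)[N _ hN]; move/cvgrPdist_lt : (hi i j) => /(_ _ ek2)[N' _ hN'].
  exists (maxn N N') => k; rewrite geq_max => /andP[/hN /= k1 /hN' /= k2].
  by apply: (le_lt_trans (cabs_le _)); rewrite ReB ImB distrC [X in _ + X]distrC; lra.
exists (\max_ij N ij)%N => k hk; rewrite /mabs.
apply: (@le_lt_trans _ _ (\sum_(i < m) \sum_(j < n) ek)).
  apply: ler_sum => i _; apply: ler_sum => j _; rewrite !mxE ltW// (hN (i, j))//.
  exact: leq_trans (leq_bigmax (i, j)) hk.
rewrite !sumr_const !card_ord -mulrnA -mulr_natl natrM mulrA ltr_pdivrMr// mulrC ltr_pM2l//.
by rewrite mulrC ltrDl.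
Qed.

Lemma mcauchy m n (s : nat -> 'M[C]_(m, n)) :
  (forall e : R, 0 < e -> exists N, forall k, (N <= k)%N -> mabs (s k - s N) < e) -> exists l, mcvg s l.
Proof.
move=> h.
have hr (f : C -> R) : (forall z, `|f z| <= cabs z) -> (forall z w, f (z - w) = f z - f w) ->
    forall ij : 'I_m * 'I_n, exists l : R, (fun k => f (s k ij.1 ij.2)) @ \oo --> l.
  move=> f1 f2 [i j]; apply: cauchy_real => e /h[N hN]; exists N => k /hN hk.
  rewrite -f2; apply: (le_lt_trans (f1 _)); apply: le_lt_trans hk.
  by have := mabs_entry (s k - s N) i j; rewrite !mxE.
have /choice[a ha] := hr _ (@cabs_Re R) ReB.
have /choice[b hb] := hr _ (@cabs_Im R) ImB.
exists (\matrix_(i, j) (a (i, j) +i* b (i, j))); apply: mcvg_reim => i j; rewrite mxE.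
  exact: (ha (i, j)).
exact: (hb (i, j)).
Qed.

Variables (r : R) (r0 : 0 < r).

Lemma Ir_DCT (f_ : nat -> R -> R) (f g : R -> R) : (forall k, L1r r (f_ k)) -> L1r r g ->
  (forall k t, 0 <= t <= r -> `|f_ k t| <= g t) ->
  (forall t, 0 <= t <= r -> f_ ^~ t @ \oo --> f t) ->
  L1r r f /\ forall x, 0 <= x <= r -> (fun k => Ir x (f_ k)) @ \oo --> Ir x f.
Proof.
move=> h1 hg hb hc.
have main x : 0 <= x <= r -> mu.-integrable `[0, x] (EFin \o f) /\ (fun k => Ir x (f_ k)) @ \oo --> Ir x f.
  move=> /andP[x0 xr].
  have L k := L1r_sub xr (h1 k).
  have hc' t : `[0, x]%classic t -> (fun k => (EFin \o f_ k) t) @ \oo --> (EFin \o f) t.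
    rewrite /= in_itv /= => /andP[t0 tx]; apply: cvg_EFin; last by apply: hc; rewrite t0 (le_trans tx).
    exact: nearW.
  have mf_ k : measurable_fun `[0, x] (EFin \o f_ k) by exact: measurable_int (L k).
  have mf : measurable_fun `[0, x] (EFin \o f) by exact: (emeasurable_fun_cvg _ _ mf_ hc').
  have [] := @dominated_convergence _ _ _ mu `[0, x]%classic (measurable_itv _) (fun k => EFin \o f_ k) (EFin \o f) (EFin \o g) mf_ mf.
  - by apply: aeW => t; exact: hc'.
  - exact: L1r_sub xr hg.
  - apply: aeW => t k /=; rewrite in_itv /= => /andP[t0 tx]; rewrite lee_fin; apply: hb.
    by rewrite t0 (le_trans tx).
  move=> i1 _ i2; split=> //; rewrite /Ir /Rintegral.
  by apply: fine_cvg; rewrite fineK//; exact: integrable_fin_num.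
split; first by have [] := main r; rewrite ?lexx ?ltW.
by move=> x xr; have [] := main x xr.
Qed.

Lemma mint_DCT m n (F : nat -> R -> 'M[C]_(m, n)) (G : R -> 'M[C]_(m, n)) (g : R -> R) :
  (forall k, mL1 r (F k)) -> L1r r g -> (forall k t, 0 <= t <= r -> mabs (F k t) <= g t) ->
  (forall t, 0 <= t <= r -> mcvg (F^~ t) (G t)) ->
  mL1 r G /\ forall x, 0 <= x <= r -> mcvg (fun k => mint x (F k)) (mint x G).
Proof.
move=> hF hg hb hc.
have key (f : C -> R) i j : (forall z, `|f z| <= cabs z) -> (forall z w, f (z - w) = f z - f w) ->
   (forall k, L1r r (fun t => f (F k t i j))) -> L1r r (fun t => f (G t i j)) /\
   forall x, 0 <= x <= r -> (fun k => Ir x (fun t => f (F k t i j))) @ \oo --> Ir x (fun t => f (G t i j)).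
  move=> f1 f2 fL; apply: (Ir_DCT fL hg).
    by move=> k t tr; apply: (le_trans (f1 _)); apply: (le_trans (mabs_entry _ _ _)); exact: hb.
  move=> t tr; apply/cvgrPdist_lt => e e0; have [N hN] := hc t tr e e0; exists N => // k /hN hk /=.
  rewrite distrC -f2; apply: (le_lt_trans (f1 _)); apply: le_lt_trans hk.
  by have := mabs_entry (F k t - G t) i j; rewrite !mxE.
have kR i j := key (fun z => Rez z) i j (@cabs_Re R)  ReB (fun k => proj1 (hF k i j)).
have kI i j := key (fun z => Imz z) i j (@cabs_Im R)  ImB (fun k => proj2 (hF k i j)).
split; first by move=> i j; split; [exact: (kR i j).1|exact: (kI i j).1].
move=> x xr.
apply: mcvg_reim => i j.
  rewrite (_ : (fun k => Rez (mint x (F k) i j)) = (fun k => Ir x (fun t => Rez (F k t i j)))); last first.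
    by apply/funext => k; rewrite mintE cintE.
  by rewrite mintE cintE; exact: (kR i j).2.
rewrite (_ : (fun k => Imz (mint x (F k) i j)) = (fun k => Ir x (fun t => Imz (F k t i j)))); last first.
  by apply/funext => k; rewrite mintE cintE.
by rewrite mintE cintE; exact: (kI i j).2.
Qed.

End Convergence.

(** * Functions determined almost everywhere by their primitives *)

Section AeUnique.
Context {R : realType} (r : R) (r0 : 0 < r).
Local Notation C := (cplx R).
Local Notation mu := (@lebesgue_measure R).

(** Lebesgue's differentiation theorem for f extended by 0, whose primitive from 0 vanishes on the
    whole line. *)
Lemma Ir_ae0 (f : R -> R) : L1r r f -> (forall x, 0 <= x <= r -> Ir x f = 0) ->
  {ae mu, forall x, 0 < x < r -> f x = 0}.
Proof.
move=> hf h0; pose h := f \_ `[0, r].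
have iT : mu.-integrable setT (EFin \o h).
  by have := (@integrable_mkcond _ _ R mu `[0, r]%classic (EFin \o f) (measurable_itv _)).1 hf; rewrite restrict_EFin.
have hF y : (\int[mu]_(t in [set` Interval (BLeft 0) (BRight y)]) h t = 0)%R.
  have [y0|y0] := ltP y 0.
    by rewrite set_itv_ge ?Rintegral_set0// bnd_simp -ltNge.
  have mr : 0 <= Num.min y r <= r by rewrite le_min y0 (ltW r0) ge_min lexx orbT.
  rewrite -[RHS](h0 _ mr) /Ir /h -Rintegral_mkcondr; congr (Rintegral mu _ _).
  apply/seteqP; split => t /=; rewrite !in_itv /=.
    by move=> [/andP[a b] /andP[_ c]]; rewrite a le_min b.
  by rewrite le_min => /andP[-> /andP[-> ->]].
have loc : locally_integrable [set: R] h by exact: open_integrable_locally openT iT.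
have iy y : mu.-integrable [set` Interval (BLeft 0) (BRight y)] (EFin \o h) by apply: integrableS iT.
have ftc := FTC1 iy loc.
apply: (aeS ftc) => x hx /andP[x0 xr]; have [_] := hx x0.
rewrite (_ : (fun y => _) = cst 0); last by apply/funext => y; rewrite hF.
by rewrite derive1_cst /h patchE mem_set//= in_itv /= !ltW.
Qed.

Lemma cint_ae0 (f : R -> C) : CL1 r f -> (forall x, 0 <= x <= r -> cint x f = 0) ->
  {ae mu, forall x, 0 < x < r -> f x = 0}.
Proof.
move=> [h1 h2] h0.
have k1 := Ir_ae0 h1 (fun x xr => ltac:(by have := h0 x xr; rewrite cintE => -[])).
have k2 := Ir_ae0 h2 (fun x xr => ltac:(by have := h0 x xr; rewrite cintE => -[])).
by apply: (aeS2 k1 k2) => x e1 e2 xr; apply: complex_ext; [exact: e1|exact: e2].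
Qed.

Lemma ae_forall_fin (I : finType) (P : I -> R -> Prop) : (forall i, {ae mu, forall x, P i x}) ->
  {ae mu, forall x, forall i, P i x}.
Proof. by move=> h; apply: filter_forall. Qed.

Lemma mint_ae0 m n (f : R -> 'M[C]_(m, n)) : mL1 r f -> (forall x, 0 <= x <= r -> mint x f = 0) ->
  {ae mu, forall x, 0 < x < r -> f x = 0}.
Proof.
move=> hf h0; have h : forall ij : 'I_m * 'I_n, {ae mu, forall x, 0 < x < r -> f x ij.1 ij.2 = 0}.
  by move=> [i j]; apply: cint_ae0 => // x xr; have := h0 x xr => /matrixP/(_ i j); rewrite mintE mxE.
apply: (aeS (ae_forall_fin h)) => x hx xr; apply/matrixP => i j; rewrite mxE; exact: (hx (i, j)).
Qed.

Lemma mAC_unique m n (F f g : R -> 'M[C]_(m, n)) : mAC r F f -> mAC r F g ->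
  {ae mu, forall x, 0 < x < r -> f x = g x}.
Proof.
move=> hf hg; have Lf := mAC_L1 hf; have Lg := mAC_L1 hg.
have Lh : mL1 r (fun x => f x - g x).
  by move=> i j; apply: eq_CL1 (CL1_D (Lf i j) (CL1_N (Lg i j))) => t _; rewrite !mxE.
have h0 : forall x, 0 <= x <= r -> mint x (fun x => f x - g x) = 0.
  move=> x xr; have /andP[_ xr'] := xr.
  have LN : mL1 r (fun x => - g x) by move=> i j; apply: eq_CL1 (CL1_N (Lg i j)) => t _; rewrite !mxE.
  rewrite (mintD xr' Lf LN) (mintN xr' Lg); apply/eqP; rewrite subr_eq0; apply/eqP.
  by apply: (addrI (F 0)); rewrite -(mAC_E hf xr) -(mAC_E hg xr).
by apply: (aeS (mint_ae0 Lh h0)) => x hx /hx /eqP; rewrite subr_eq0 => /eqP.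
Qed.

Lemma mnormsq_ae0 m n (f : R -> 'M[C]_(m, n)) : mL2 r f -> Ir r (fun t => mnormsq (f t)) = 0 ->
  {ae mu, forall x, 0 < x < r -> f x = 0}.
Proof.
move=> hf h0; have L := L1r_mnormsq hf.
have nn t : 0 <= mnormsq (f t) by apply: sumr_ge0 => i _; apply: sumr_ge0 => j _; exact: sqr_ge0.
have h : forall x, 0 <= x <= r -> Ir x (fun t => mnormsq (f t)) = 0.
  move=> x /andP[x0 xr]; apply/eqP; rewrite eq_le Ir_ge0// andbT -h0; apply: (@Ir_mono _ r) => //; rewrite x0 xr//.
apply: (aeS (Ir_ae0 L h)) => x hx /hx e; apply/matrixP => i j; rewrite mxE.
apply/eqP; rewrite -cabs_eq0 -sqrf_eq0; move/eqP: e.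
rewrite psumr_eq0; last by move=> k _; apply: sumr_ge0 => l _; exact: sqr_ge0.
move=> /allP/(_ i (mem_index_enum _))/implyP/(_ isT); rewrite psumr_eq0; last by move=> k _; exact: sqr_ge0.
by move=> /allP/(_ j (mem_index_enum _))/implyP/(_ isT).
Qed.

End AeUnique.

(** * Transmutation of even polynomials *)

Section PolyCalculus.
Context {R : realType} (r : R) (r0 : 0 < r).
Local Notation C := (cplx R).

Lemma AC_id : AC r (fun s : R => s%:C : C) (fun=> 1).
Proof.
split; first exact: CBM_CL2 (CBM_cst r 1).
by move=> x /andP[x0 _]; rewrite cint_cst// mul1r add0r.
Qed.

Lemma AC_affine (a b : R) : AC r (fun s : R => (a + b * s)%:C : C) (fun=> b%:C).
Proof.
have := AC_D (AC_cst r a%:C) (AC_Z b%:C AC_id).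
by apply: (AC_ext r0) => x _; rewrite ?CD ?CM ?mulr1 ?add0r.
Qed.

Lemma AC_poly (P : {poly R}) (g g' : R -> R) : AC r (fun s => (g s)%:C : C) (fun s => (g' s)%:C) ->
  AC r (fun s => (P.[g s])%:C : C) (fun s => (P^`().[g s] * g' s)%:C).
Proof.
move=> hg; elim/poly_ind: P => [|P c IH].
  by apply: (AC_ext r0 _ _ (AC_cst r 0)) => x _; rewrite ?deriv0 horner0 ?mul0r.
have := AC_D (AC_M r0 IH hg) (AC_cst r c%:C).
apply: (AC_ext r0) => x _; first by rewrite hornerMXaddC CD CM.
rewrite addr0 derivD derivM derivX derivC addr0 mulr1 hornerD hornerMX.
by rewrite -!CM -CD; congr (_%:C); ring.
Qed.

Lemma poly_FTC (P : {poly R}) x : 0 <= x <= r -> (P.[x])%:C = (P.[0])%:C + cint x (fun s => (P^`().[s])%:C) :> C.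
Proof.
move=> xr; have := AC_poly P AC_id; case=> _ /(_ x xr) ->; congr (_ + _).
by apply: cint_eq => t _; rewrite mulr1.
Qed.

Lemma CBM_poly (P : {poly R}) (a b : R) : CBM r (fun s : R => (P.[a + b * s])%:C : C).
Proof. by have := AC_BM r0 (AC_poly P (AC_affine a b)). Qed.

Lemma poly_bounded (P : {poly R}) (b : R) : exists2 B : R, 0 <= B & forall t, `|t| <= b -> `|P.[t]| <= B.
Proof.
elim/poly_ind: P => [|P c [B B0 hB]]; first by exists 0 => // t _; rewrite horner0 normr0.
exists (B * `|b| + `|c|); first by rewrite addr_ge0// mulr_ge0.
move=> t tb; rewrite hornerMXaddC (le_trans (ler_normD _ _))// lerD2r normrM ler_pM ?hB//.
exact: le_trans tb (ler_norm b).
Qed.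

End PolyCalculus.

Section Lipschitz.
Context {R : realType}.
Local Notation C := (cplx R).

Lemma poly_lip (P : {poly R}) (a b K : R) : a <= b -> (forall t, a <= t <= b -> `|P^`().[t]| <= K) ->
  `|P.[b] - P.[a]| <= K * (b - a).
Proof.
rewrite le_eqVlt => /predU1P[->|ab] hK; first by rewrite !subrr mulr0 normr0.
have l0 : 0 < b - a by rewrite subr_gt0.
have lr : 0 <= b - a <= b - a by rewrite (ltW l0) lexx.
have h := AC_poly l0 P (AC_affine l0 a 1); have [_ /(_ _ lr)] := h.
rewrite mulr0 addr0 mul1r [a + _]addrC subrK => e.
rewrite -cabs_real CB e addrC addKr; apply: (cint_le_cst lr (AC_L1 h)).
move=> t /andP[t0 tb]; rewrite cabs_real mulr1; apply: hK; rewrite mul1r lerDl t0 /= -lerBrDl//.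
Qed.

End Lipschitz.

(** * Exponential weights for square-integrable kernels *)

Section Weights.
Context {R : realType} (r : R) (r0 : 0 < r).
Local Notation C := (cplx R).

Lemma L2r_cabs (f : R -> C) : CL2 r f -> L2r r (fun t => cabs (f t)).
Proof.
move=> hf; have [[_ h1] [_ h2]] := hf; split; first exact: L1r_meas (L1r_cabs (CL2_CL1 hf)).
have := L1rD (f := fun t => Rez (f t) ^+ 2) (g := fun t => Imz (f t) ^+ 2) h1 h2.
by apply: eq_L1r => t _; rewrite cabs_sqr.
Qed.

Lemma L2r_sum (I : Type) (s : seq I) (f : I -> R -> R) : (forall i, L2r r (f i)) ->
  L2r r (fun t => \sum_(i <- s) f i t).
Proof.
move=> hf; elim: s => [|i s IH]; first by apply: eq_L2r (BMr_L2 (BMr_cst r 0)) => t _; rewrite big_nil.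
by apply: eq_L2r (L2rD (hf i) IH) => t _; rewrite big_cons.
Qed.

Lemma L2r_mabs m n (G : R -> 'M[C]_(m, n)) : mL2 r G -> L2r r (fun t => mabs (G t)).
Proof. by move=> hG; apply: L2r_sum => i; apply: L2r_sum => j; apply: L2r_cabs. Qed.

(** Young's inequality g E <= a g^2 + b E^2 with 4ab = 1 and E = e^{kap s}. With [a] proportional to
    e^{kap x}, both terms become multiples of e^{kap x}, and one weight serves all x. *)
Lemma exp_weight (g : R -> R) (e : R) : L2r r g -> 0 < e ->
  exists2 kap : R, 0 < kap & forall x, 0 <= x <= r -> Ir x (fun s => g s * expR (kap * s)) <= e * expR (kap * x).
Proof.
move=> hg e0; have [mg Lg2] := hg; pose G := Ir r (fun s => g s ^+ 2).
have G0 : 0 <= G by apply: Ir_ge0 => t _; exact: sqr_ge0.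
pose eta := e / (2 * (G + 1)); have G1 : 0 < G + 1 by rewrite ltr_wpDl.
have eta0 : 0 < eta by rewrite divr_gt0// mulr_gt0.
have etaE : eta * (G + 1) = e / 2 by rewrite /eta invfM mulrA mulfVK ?gt_eqF.
clearbody eta.
(* The value for which b times the integral of e^{2 kap s} is at most e X/2. *)
pose kap := (4 * eta * e)^-1; have k0 : 0 < kap by rewrite invr_gt0 !mulr_gt0.
exists kap => // x xr; have /andP[x0 xr'] := xr.
set X := expR (kap * x); have X0 : 0 < X := expR_gt0 _.
pose a := eta * X; have a0 : 0 < a by exact: mulr_gt0.
pose b := (4 * a)^-1; have b0 : 0 < b by rewrite invr_gt0 mulr_gt0.
have ab : 4 * a * b = 1 by rewrite divff// gt_eqF// mulr_gt0.
have LE := BMr_L1 (expR_BMr r0 (2 * kap)).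
have LgE := L1r_BM (L2r_L1 hg) (expR_BMr r0 kap).
apply: (@le_trans _ _ (Ir x (fun s => a * g s ^+ 2 + b * expR ((2 * kap) * s)))).
  apply: (Ir_le xr') => //; first by apply: L1rD; exact: L1rZ.
  move=> t _; have -> : expR (2 * kap * t) = expR (kap * t) ^+ 2 by rewrite -expRM_natl -mulrA.
  set E := expR _; rewrite -subr_ge0.
  have -> : a * g t ^+ 2 + b * E ^+ 2 - g t * E = b * (2 * a * g t - E) ^+ 2.
    have -> : b * (2 * a * g t - E) ^+ 2 = (4 * a * b) * (a * g t ^+ 2) - (4 * a * b) * (g t * E) + b * E ^+ 2 by ring.
    by rewrite ab; ring.
  by rewrite mulr_ge0 ?sqr_ge0// ltW.
rewrite (IrD xr'); [|exact: L1rZ..]; rewrite !(IrZ _ xr')//.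
have h1 : a * Ir x (fun s => g s ^+ 2) <= e / 2 * X.
  have h : Ir x (fun s => g s ^+ 2) <= G by apply: (@Ir_mono _ r) => //; rewrite ?x0// => t _; exact: sqr_ge0.
  apply: (le_trans (ler_wpM2l (ltW a0) h)).
  rewrite /a mulrAC; apply: ler_wpM2r; first exact: ltW.
  by rewrite -etaE ler_wpM2l ?(ltW eta0)// lerDl.
have h2 : b * Ir x (fun s => expR (2 * kap * s)) <= e / 2 * X.
  have k20 : 0 < 2 * kap by rewrite mulr_gt0.
  apply: (le_trans (ler_wpM2l (ltW b0) (Ir_expR r0 k20 xr))).
  have -> : expR (2 * kap * x) = X ^+ 2 by rewrite /X -expRM_natl -mulrA.
  rewrite le_eqVlt; apply/orP; left; apply/eqP; rewrite /b /a /kap.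
  by field; rewrite !gt_eqF.
by apply: (le_trans (lerD h1 h2)); rewrite -mulrDl -splitr.
Qed.

End Weights.

Section MatrixSums.
Context {R : realType} (r : R) (r0 : 0 < r).
Local Notation C := (cplx R).

Lemma mAC_sum m n (k : nat) (F f : 'I_k -> R -> 'M[C]_(m, n)) : (forall i, mAC r (F i) (f i)) ->
  mAC r (fun x => \sum_i F i x) (fun x => \sum_i f i x).
Proof.
move=> h a b; have := AC_sum (index_enum 'I_k) xpredT (fun i => h i a b).
by apply: (AC_ext r0) => x _; rewrite summxE.
Qed.

End MatrixSums.

(** * The wave equation with polynomial data *)

Section Transmutation.
Context {R : realType} (r : R) (r0 : 0 < r).
Local Notation C := (cplx R).
Variables p m : nat.
Variable Q : R -> 'M[C]_p.
Hypothesis QL2 : mL2 r Q.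
Variables y dy : nat -> R -> 'M[C]_(p, m).
Let ypred j x := if j is j'.+1 then y j' x else 0.
Hypothesis yAC : forall j, mAC r (y j) (dy j).
Hypothesis dyAC : forall j, mAC r (dy j) (fun x => Q x *m y j x + ypred j x).
Hypothesis y0 : forall j, y j.+1 0 = 0.
Hypothesis dy0 : forall j, dy j.+1 0 = 0.
Let B0 := y 0%N 0.
Let B1 := dy 0%N 0.

(** The Cauchy data at x = 0 are P(t) y_0(0) and P(t) y_0'(0). The length n is a parameter so that
    data of different degrees can be compared at a common one; the sum is complete once the size of
    P is at most 2n. *)
Definition trans n (P : {poly R}) (x t : R) : 'M[C]_(p, m) := \sum_(j < n) (P^`(j.*2).[t])%:C *: y j x.

Lemma trans_BM n P (a b : R) : mBM r (fun s => trans n P s (a + b * s)).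
Proof.
elim: n => [|n IH].
  by move=> i j; apply: eq_CBM (CBM_cst r 0) => x _; rewrite /trans big_ord0 mxE.
have := mBM_D IH (mBM_Z (CBM_poly r0 P^`(n.*2) a b) (mAC_BM r0 (yAC n))).
by congr (mBM r _); apply/funext => x; rewrite /trans big_ord_recr.
Qed.

Lemma trans_widen n n' (P : {poly R}) x t : (size P <= n.*2)%N -> (n <= n')%N -> trans n' P x t = trans n P x t.
Proof.
move=> sP /subnK <-; elim: (n' - n)%N => [//|k IH]; rewrite addSn -[RHS]IH /trans big_ord_recr /=.
rewrite [X in X.[t]]derivn_poly0 ?horner0 ?scale0r ?addr0//.
by apply: leq_trans sP _; rewrite leq_double leq_addl.
Qed.

Lemma transB n P P' x t : trans n (P - P') x t = trans n P x t - trans n P' x t.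
Proof.
rewrite /trans -sumrB; apply: eq_bigr => j _.
by rewrite derivnB hornerD hornerN CB scalerBl.
Qed.

Lemma trans_lip n P s (a b K : R) : a <= b -> (forall t, a <= t <= b -> mabs (trans n P^`() s t) <= K) ->
  mabs (trans n P s b - trans n P s a) <= K * (b - a).
Proof.
rewrite le_eqVlt => /predU1P[->|ab] hK; first by rewrite !subrr mulr0 mabs0.
have l0 : 0 < b - a by rewrite subr_gt0.
have h : mAC (b - a) (fun t => trans n P s (a + 1 * t)) (fun t => trans n P^`() s (a + 1 * t)).
  have := mAC_sum l0 (fun j : 'I_n => mAC_Z l0 (AC_poly l0 P^`(j.*2) (AC_affine l0 a 1)) (mAC_cst l0 (y j s))).
  apply: (mAC_ext l0) => x _ //; apply: eq_bigr => j _.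
  by rewrite scaler0 addr0 mulr1 -derivnS derivSn.
have lr : 0 <= b - a <= b - a by rewrite (ltW l0) lexx.
have := mAC_E h lr; rewrite mulr0 addr0 mul1r [a + _]addrC subrK => ->.
rewrite addrC addKr; apply: (le_trans (mint_le (lexx _) (mAC_L1 h) (BMr_L1 (BMr_cst _ K)) _)).
  by move=> t /andP[t0 tb]; apply: hK; rewrite mul1r lerDl t0/= -lerBrDl.
by rewrite Ir_cst// ltW.
Qed.

(** Stated for the datum P': the solution with datum P is then a t-primitive, and the usual double
    integral of Q u over the characteristic triangle collapses to one integral in s of differences
    of that primitive. *)
Lemma dalembert n (P : {poly R}) x t : (size P <= n.*2)%N -> 0 <= x <= r ->
  trans n P^`() x t = 2^-1 *: ((P^`().[t + x] + P^`().[t - x])%:C *: B0 + (P.[t + x] - P.[t - x])%:C *: B1 +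
    mint x (fun s => Q s *m (trans n P s (t + x - s) - trans n P s (t - x + s)))).
Proof.
move=> sP xr.
(* Let v be the solution with datum P. [D] and [S] are the coefficients that make [Psi] the
   difference of v_x plus the sum of v_t at the two points where the characteristics through (x, t)
   meet the level s. *)
pose D j (s : R) : C := (P^`(j.*2).[(t + x) + (-1) * s] - P^`(j.*2).[(t - x) + 1 * s])%:C.
pose S j (s : R) : C := (P^`((j.*2).+1).[(t + x) + (-1) * s] + P^`((j.*2).+1).[(t - x) + 1 * s])%:C.
have hA1 := AC_affine r0 (t + x) (-1); have hA2 := AC_affine r0 (t - x) 1.
have hD j : AC r (D j) (fun s => - S j s).
  have := AC_D (AC_poly r0 P^`(j.*2) hA1) (AC_N r0 (AC_poly r0 P^`(j.*2) hA2)).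
  apply: (AC_ext r0) => s _; first by rewrite /D CB.
  by rewrite /S !derivnS -CN -CN -CD; congr (_%:C); ring.
have hS j : AC r (S j) (fun s => - D j.+1 s).
  have := AC_D (AC_poly r0 P^`((j.*2).+1) hA1) (AC_poly r0 P^`((j.*2).+1) hA2).
  apply: (AC_ext r0) => s _; first by rewrite /S CD.
  by rewrite /D doubleS !derivnS -CN -CD; congr (_%:C); ring.
pose Psi s := \sum_(j < n) (D j s *: dy j s + S j s *: y j s).
(* The terms y_{j-1} of the equations for y_j cancel the second t-derivatives along the
   characteristics; the boundary term of the telescope disappears because P^(2n) = 0. *)
have tele k s : \sum_(j < k) (D j s *: ypred j s - D j.+1 s *: y j s) = - (D k s *: ypred k s).
  elim: k => [|k IH]; first by rewrite big_ord0 scaler0 oppr0.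
  by rewrite big_ord_recr /= IH addrA addNr add0r.
have h : mAC r Psi (fun s => Q s *m (trans n P s (t + x - s) - trans n P s (t - x + s))).
  have := mAC_sum r0 (fun j : 'I_n => mAC_D r0 (mAC_Z r0 (hD j) (dyAC j)) (mAC_Z r0 (hS j) (yAC j))).
  apply: (mAC_ext r0) => s _ //.
  transitivity (\sum_(j < n) D j s *: (Q s *m y j s) + \sum_(j < n) (D j s *: ypred j s - D j.+1 s *: y j s)).
    rewrite -big_split /=; apply: eq_bigr => j _.
    rewrite scalerDr !scaleNr; move: (S j s *: dy j s) (D j s *: (_ *m _)) (D j s *: ypred j s) (D j.+1 s *: y j s) => a1 a2 a3 a4.
    by rewrite [- a1 + _]addrC addrACA addNr addr0 addrA.
  rewrite tele; have -> : D n s = 0 by rewrite /D derivn_poly0 // !horner0 subrr.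
  rewrite scale0r oppr0 addr0 /trans -sumrB mulmx_sumr; apply: eq_bigr => j _.
  rewrite -scalerBl -scalemxAr /D CB mulN1r mul1r //.
have := mAC_E h xr => e.
have ex : Psi x = 2 *: trans n P^`() x t.
  rewrite /Psi /trans scaler_sumr; apply: eq_bigr => j _.
  have -> : D j x = 0 by rewrite /D mulN1r mul1r addrK subrK subrr.
  rewrite scale0r add0r scalerA; congr (_ *: _).
  rewrite /S mulN1r mul1r addrK subrK derivSn; apply: complex_ext; rewrite !reimE /=; ring.
have e0 : Psi 0 = (P^`().[t + x] + P^`().[t - x])%:C *: B0 + (P.[t + x] - P.[t - x])%:C *: B1.
  rewrite /Psi; case: n sP {ex e h tele Psi} => [|n'] sP.
    by move: sP; rewrite leqn0 size_poly_eq0 => /eqP ->; rewrite big_ord0 deriv0 !horner0 subrr addr0 !scale0r addr0.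
  rewrite big_ord_recl /= big1 => [|j _]; last by rewrite /= y0 dy0 !scaler0 addr0.
  by rewrite addr0 /D /S /= !mulr0 !addr0 addrC.
by rewrite -e0 -e ex scalerA mulVf ?scale1r// pnatr_eq0.
Qed.

Lemma trans_bounded n (P : {poly R}) : exists2 N : R, 0 <= N &
  forall x t, 0 <= x <= r -> `|t| <= r -> mabs (trans n P x t) <= N.
Proof.
elim: n => [|n [N N0 hN]].
  by exists 0 => // x t _ _; rewrite /trans big_ord0 mabs0.
have [B B0' hB] := poly_bounded P^`(n.*2) r; have [D D0 hD] := mBM_bound r0 (mAC_BM r0 (yAC n)).
exists (N + B * D); first by rewrite addr_ge0// mulr_ge0.
move=> x t xr tr; rewrite /trans big_ord_recr /=; apply: (le_trans (mabsD _ _)).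
by rewrite lerD ?hN// mabsZ cabs_real ler_pM ?mabs_ge0 ?hB ?hD.
Qed.

(** The constant must not depend on the degree. A bound N e^{kap x} on the triangle |t| <= r - x
    improves to (c M + N/2) e^{kap x}; iterating from the degree-dependent bound of [trans_bounded]
    leads down to 2 c M. *)
Lemma trans_apriori : exists2 C1 : R, 0 <= C1 & forall n (P : {poly R}) (M x t : R),
  (size P <= n.*2)%N -> 0 <= M -> (forall s, `|s| <= r -> `|P^`().[s]| <= M) ->
  0 <= x <= r -> `|t| <= r - x -> mabs (trans n P^`() x t) <= C1 * M.
Proof.
(* The characteristics are at most 2r apart, so this weight bounds the integral term by N e^{kap x},
   which the factor 1/2 of d'Alembert's formula halves. *)
have r2 : 0 < (2 * r)^-1 by rewrite invr_gt0 mulr_gt0.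
have [kap k0 hk] := exp_weight r0 (L2r_mabs QL2) r2.
pose c := mabs B0 + r * mabs B1; have c0 : 0 <= c by rewrite addr_ge0 ?mabs_ge0// mulr_ge0 ?mabs_ge0// ltW.
exists (2 * c * expR (kap * r)); first by rewrite !mulr_ge0 ?expR_ge0.
move=> n P M x0 t0 sP M0 hM.
pose H (N : R) := forall x t, 0 <= x <= r -> `|t| <= r - x -> mabs (trans n P^`() x t) <= N * expR (kap * x).
have eX x : 0 <= x -> 1 <= expR (kap * x) by move=> x0'; rewrite -[leLHS]expR0 ler_expR mulr_ge0// ltW.
have step N : 0 <= N -> H N -> H (c * M + N / 2).
  move=> N0 hN x t xr tr; have /andP[x0' xr'] := xr.
  have [tr1 tr2] : - (r - x) <= t /\ t <= r - x by apply/andP; rewrite -ler_norml.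
  have Lg : L1r r (fun s => (2 * r * N) * (mabs (Q s) * expR (kap * s))).
    by apply: L1rZ; apply: L1r_BM; [exact: L2r_L1 (L2r_mabs QL2)|exact: expR_BMr].
  have LQ : mL1 r (fun s => Q s *m (trans n P s (t + x - s) - trans n P s (t - x + s))).
    apply: mL2_L1; apply: mL2_mulr => //.
    have := mBM_D (trans_BM n P (t + x) (-1)) (mBM_N (trans_BM n P (t - x) 1)).
    by congr (mBM r _); apply/funext => s; rewrite mulN1r mul1r.
  have hI : mabs (mint x (fun s => Q s *m (trans n P s (t + x - s) - trans n P s (t - x + s)))) <= N * expR (kap * x).
    apply: (le_trans (mint_le xr' LQ Lg _)).
      move=> s /andP[s0 sx]; apply: (le_trans (mabsM _ _)).
      have ab : t - x + s <= t + x - s by lra.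
      have := @trans_lip n P s (t - x + s) (t + x - s) (N * expR (kap * s)) ab => h.
      have {}h : mabs (trans n P s (t + x - s) - trans n P s (t - x + s)) <= N * expR (kap * s) * (t + x - s - (t - x + s)).
        by apply: h => u /andP[u1 u2]; apply: hN; [apply/andP; split; lra|rewrite ler_norml; apply/andP; split; lra].
      have -> : 2 * r * N * (mabs (Q s) * expR (kap * s)) = mabs (Q s) * (N * expR (kap * s) * (2 * r)) by ring.
      apply: ler_wpM2l; first exact: mabs_ge0.
      apply: (le_trans h); apply: ler_wpM2l; first by rewrite mulr_ge0// expR_ge0.
      by lra.
    rewrite (IrZ _ xr'); last by apply: L1r_BM; [exact: L2r_L1 (L2r_mabs QL2)|exact: expR_BMr].
    apply: (le_trans (ler_wpM2l _ (hk x xr))); first by rewrite !mulr_ge0// ltW.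
    by rewrite le_eqVlt; apply/orP; left; apply/eqP; field; rewrite gt_eqF.
  rewrite dalembert// mabsZ.
  have -> : cabs (2^-1 : C) = 2^-1 by rewrite cabsV (@cabs_nat R 2).
  have q1 : mabs ((P^`().[t + x] + P^`().[t - x])%:C *: B0) <= 2 * M * mabs B0.
    rewrite mabsZ cabs_real; apply: ler_wpM2r; first exact: mabs_ge0.
    apply: (le_trans (ler_normD _ _)).
    have := hM (t + x); have := hM (t - x) => a1 a2.
    have {}a1 : `|P^`().[t - x]| <= M by apply: a1; rewrite ler_norml; apply/andP; split; lra.
    have {}a2 : `|P^`().[t + x]| <= M by apply: a2; rewrite ler_norml; apply/andP; split; lra.
    by lra.
  have q2 : mabs ((P.[t + x] - P.[t - x])%:C *: B1) <= 2 * M * (r * mabs B1).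
    rewrite mabsZ cabs_real mulrA; apply: ler_wpM2r; first exact: mabs_ge0.
    have ab : t - x <= t + x by lra.
    have h : `|P.[t + x] - P.[t - x]| <= M * (t + x - (t - x)).
      apply: poly_lip => // u /andP[u1 u2]; apply: hM; rewrite ler_norml; apply/andP; split; lra.
    apply: (le_trans h); rewrite [2 * M]mulrC -mulrA; apply: ler_wpM2l => //; lra.
  have q3 := mabsD ((P^`().[t + x] + P^`().[t - x])%:C *: B0 + (P.[t + x] - P.[t - x])%:C *: B1) (mint x (fun s => Q s *m (trans n P s (t + x - s) - trans n P s (t - x + s)))).
  have q4 := mabsD ((P^`().[t + x] + P^`().[t - x])%:C *: B0) ((P.[t + x] - P.[t - x])%:C *: B1).
  have q5 : c * M <= c * M * expR (kap * x) by rewrite ler_peMr ?eX// mulr_ge0.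
  have q6 : c * M = M * mabs B0 + M * (r * mabs B1) by rewrite /c; ring.
  rewrite mulrDl; apply: (@le_trans _ _ (c * M + N / 2 * expR (kap * x))); last by rewrite lerD2r.
  by move: hI q1 q2 q3 q4; rewrite q6; lra.
have [N N0 hN] := trans_bounded n P^`().
have HN k : H (2 * (c * M) + N * (1 / 2) ^+ k).
  elim: k => [|k IH].
    move=> x t xr tr; have /andP[x0' xr'] := xr; rewrite expr0 mulr1.
    have tr' : `|t| <= r by lra.
    apply: (le_trans (hN x t xr tr')); apply: (@le_trans _ _ (2 * (c * M) + N)).
      by rewrite lerDr !mulr_ge0.
    by rewrite ler_peMr ?eX// addr_ge0// !mulr_ge0.
  have := step _ _ IH; have -> : c * M + (2 * (c * M) + N * (1 / 2) ^+ k) / 2 = 2 * (c * M) + N * (1 / 2) ^+ k.+1.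
    by rewrite exprS; field.
  by apply; rewrite addr_ge0 ?mulr_ge0 ?exprn_ge0.
move=> x0r t0r; have /andP[x0' xr'] := x0r.
have kr : expR (kap * x0) <= expR (kap * r) by rewrite ler_expR ler_wpM2l// ltW.
apply: (@le_trans _ _ (2 * (c * M) * expR (kap * x0))); last first.
  have -> : 2 * c * expR (kap * r) * M = 2 * (c * M) * expR (kap * r) by ring.
  by apply: ler_wpM2l => //; rewrite !mulr_ge0.
apply/ler_addgt0Pr => e e0.
have [|k hk'] := @exp_small _ (N * expR (kap * x0)) (1 / 2) e _ e0; first by apply/andP; split; lra.
have := HN k x0 t0 x0r t0r; have := hk' k (leqnn k); rewrite mulrDl [N * _ * _]mulrAC; lra.
Qed.

End Transmutation.

Section Primitive.
Context {R : realType}.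

Definition prim (P : {poly R}) : {poly R} :=
  \poly_(i < (size P).+1) (if i is k.+1 then P`_k / k.+1%:R else 0).

Lemma prim_deriv P : (prim P)^`() = P.
Proof.
apply/polyP => i; rewrite coef_deriv coef_poly ltnS.
case: ltnP => h; first by rewrite -[LHS]mulr_natr divfK// pnatr_eq0.
by rewrite mul0rn nth_default.
Qed.

Lemma prim0 P : (prim P).[0] = 0.
Proof. by rewrite horner_coef0 coef_poly. Qed.

Lemma Ir_poly (r : R) (P : {poly R}) x : 0 < r -> 0 <= x <= r -> Ir x (fun s => P^`().[s]) = P.[x] - P.[0].
Proof.
move=> r0 xr; have := poly_FTC r0 P xr; rewrite cintE => /(congr1 (fun z : cplx R => Rez z)).
by rewrite reimE /= => ->; rewrite addrC addKr.
Qed.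

Lemma L1r_poly (r : R) (P : {poly R}) : 0 < r -> L1r r (fun s => P.[s]).
Proof.
move=> r0; have [h _] := CBM_CL1 (CBM_poly r0 P 0 1).
by apply: eq_L1r h => t _ /=; rewrite add0r mul1r.
Qed.

End Primitive.

(** * Even polynomials approximating the absolute value *)

Section SignApproximation.
Context {R : realType} (r : R) (r0 : 0 < r).

(* sgnp N is odd and approximates the sign on [-r, r]: it is the N-th iterate of
   q |-> (3 q - q^3) / 2 started at t / r; absp N is its even primitive. *)
Fixpoint sgnh N : {poly R} :=
  if N is N'.+1 then (3 / 2) *: sgnh N' - (1 / 2) *: ('X * sgnh N' ^+ 3) else (r^-1)%:P.

Definition absh N : {poly R} := (1 / 2) *: prim (sgnh N).
Definition absp N : {poly R} := absh N \Po 'X^2.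
Definition sgnp N : {poly R} := (absp N)^`().

Lemma sgnpE N t : (sgnp N).[t] = t * (sgnh N).[t ^+ 2].
Proof.
rewrite /sgnp /absp /absh comp_polyZ derivZ deriv_comp prim_deriv derivXn hornerZ hornerM horner_comp.
by rewrite !hornerE /=; field.
Qed.

Lemma sgnpS N t : (sgnp N.+1).[t] = (3 * (sgnp N).[t] - (sgnp N).[t] ^+ 3) / 2.
Proof.
rewrite !sgnpE /= hornerD hornerN !hornerZ hornerM hornerX horner_exp; move: ((sgnh N).[t ^+ 2]) => a.
by field.
Qed.

Lemma sgnp0 t : (sgnp 0).[t] = t / r.
Proof. by rewrite sgnpE hornerC. Qed.

Lemma sgnpN N t : (sgnp N).[- t] = - (sgnp N).[t].
Proof. by rewrite !sgnpE sqrrN mulNr. Qed.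

Lemma abspN N t : (absp N).[- t] = (absp N).[t].
Proof. by rewrite /absp !horner_comp !hornerXn sqrrN. Qed.

Lemma absp_at0 N : (absp N).[0] = 0.
Proof. by rewrite /absp horner_comp hornerXn expr0n /= /absh hornerZ prim0 mulr0. Qed.

(** For q' = (3q - q^3)/2 one has 1 - q' = (1 - q) (1 - q)(2 + q)/2, the last factor (1 - q)(2 +
    q)/2 is at most 1 - q/2, and q stays above its initial value t/r. *)
Lemma sgnp_bounds N t : 0 <= t <= r ->
  [/\ t / r <= (sgnp N).[t], (sgnp N).[t] <= 1 & 1 - (sgnp N).[t] <= (1 - t / (2 * r)) ^+ N].
Proof.
move=> /andP[t0 tr]; have tr0 : 0 <= t / r by rewrite divr_ge0// ltW.
have tr1 : t / r <= 1 by rewrite ler_pdivrMr// mul1r.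
have e2 : t / (2 * r) = t / r / 2 by rewrite invfM mulrA mulrAC.
elim: N => [|N [h1 h2 h3]]; first by rewrite sgnp0 expr0 lerBlDr lerDl.
rewrite sgnpS; set q := (sgnp N).[t] in h1 h2 h3 *.
have q0 : 0 <= q by exact: le_trans h1.
have q3 : q ^+ 3 <= q by rewrite exprS ler_piMr// exprn_ile1.
have e1 : 1 - (3 * q - q ^+ 3) / 2 = (1 - q) * ((1 - q) * (2 + q) / 2) by field.
have f0 : 0 <= (1 - q) * (2 + q) / 2 by rewrite divr_ge0// mulr_ge0//; lra.
have f1 : (1 - q) * (2 + q) / 2 <= 1 - t / (2 * r).
  have -> : (1 - q) * (2 + q) / 2 = 1 - q / 2 - q ^+ 2 / 2 by field.
  by have := sqr_ge0 q; rewrite e2; lra.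
split; first by lra.
  by rewrite -subr_ge0 e1 mulr_ge0// subr_ge0.
rewrite e1 exprS mulrC; apply: ler_pM => //; first by rewrite subr_ge0.
Qed.

Lemma sgnp_le1 N t : `|t| <= r -> `|(sgnp N).[t]| <= 1.
Proof.
move=> tr; have h u : 0 <= u <= r -> `|(sgnp N).[u]| <= 1.
  move=> ur; have [h1 h2 _] := sgnp_bounds N ur; rewrite ger0_norm//; apply: le_trans h1.
  by rewrite divr_ge0// ?(ltW r0)//; case/andP: ur.
case: (leP 0 t) => t0; first by apply: h; rewrite t0 -(ger0_norm t0).
by rewrite -normrN -sgnpN; apply: h; rewrite oppr_ge0 ltW//= -(ler0_norm (ltW t0)).
Qed.

(** Integrating the rate (1 - s/(2r))^N gives 2r/(N + 1): the primitives converge uniformly although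
    the approximate signs converge only pointwise. *)
Lemma absp_approx N t : `|t| <= r -> `|(absp N).[t] - `|t| | <= 2 * r / N.+1%:R.
Proof.
have h u : 0 <= u <= r -> `|(absp N).[u] - u| <= 2 * r / N.+1%:R.
  move=> ur; have /andP[u0 ur'] := ur.
  pose W : {poly R} := (- (2 * r / N.+1%:R)) *: (1 - (2 * r)^-1 *: 'X) ^+ N.+1.
  have dW s : W^`().[s] = (1 - s / (2 * r)) ^+ N.
    rewrite /W derivZ deriv_exp derivB derivC derivZ derivX sub0r hornerZ hornerMn hornerM !hornerE /=.
    rewrite -[X in _ * X]mulr_natr [(2 * r)^-1 * s]mulrC.
    by move: ((1 - _) ^+ N) => B; field; rewrite gt_eqF//= pnatr_eq0.
  have dG s : ('X - absp N)^`().[s] = 1 - (sgnp N).[s] by rewrite derivB derivX hornerD hornerN hornerC.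
  have e1 : u - (absp N).[u] = Ir u (fun s => ('X - absp N)^`().[s]).
    by rewrite (Ir_poly _ r0 ur) !hornerD !hornerN !hornerX absp_at0 subrr subr0.
  rewrite distrC e1; apply: (@le_trans _ _ (Ir u (fun s => W^`().[s]))).
    have LG := L1r_poly ('X - absp N)^`() r0.
    apply: (le_trans (Ir_abs ur' LG)); apply: (Ir_le ur'); [exact: L1r_abs|exact: L1r_poly|].
    move=> s /andP[s0 su]; have sr : 0 <= s <= r by rewrite s0 (le_trans su).
    by have [_ b1 b2] := sgnp_bounds N sr; rewrite dG dW ger0_norm// subr_ge0.
  rewrite (Ir_poly _ r0 ur) /W !hornerZ !horner_exp !hornerE ?mulr0 ?subr0 ?expr1n ?mulr1.
  rewrite opprK gerDr mulNr oppr_le0 mulr_ge0//; first by rewrite divr_ge0// mulr_ge0// ltW.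
  by rewrite exprn_ge0// subr_ge0 mulrC ler_pdivrMr ?mulr_gt0//; lra.
move=> tr; case: (leP 0 t) => t0.
  by rewrite (ger0_norm t0); apply: h; rewrite t0 -(ger0_norm t0).
by rewrite -abspN (ltr0_norm t0); apply: h; rewrite oppr_ge0 ltW//= -(ltr0_norm t0).
Qed.

Lemma sgnp_cvg t : `|t| <= r -> forall e : R, 0 < e -> exists N, forall k, (N <= k)%N -> `|(sgnp k).[t] - Num.sg t| < e.
Proof.
have h u : 0 < u <= r -> forall e : R, 0 < e -> exists N, forall k, (N <= k)%N -> `|(sgnp k).[u] - 1| < e.
  move=> /andP[u0 ur] e e0; have u0r : 0 <= u <= r by rewrite ltW.
  have [|N hN] := @exp_small _ 1 (1 - u / (2 * r)) e _ e0.
    rewrite subr_ge0 ltrBlDr ltrDl divr_gt0 ?mulr_gt0// andbT ler_pdivrMr ?mulr_gt0//; lra.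
  exists N => k /hN; rewrite mul1r; have [_ h1 h2] := sgnp_bounds k u0r.
  by rewrite distrC ger0_norm ?subr_ge0//; exact: le_lt_trans.
move=> tr e e0; case: (ltgtP t 0) => [t0|t0|->].
- have [|N hN] := h (- t) _ e e0; first by rewrite oppr_gt0 t0 -(ltr0_norm t0).
  exists N => k /hN; rewrite ltr0_sg// sgnpN opprK -normrN opprD !opprK => h'; exact: h'.
- have [|N hN] := h t _ e e0; first by rewrite t0 -(gtr0_norm t0).
  by exists N => k /hN; rewrite gtr0_sg.
- by exists 0%N => k _; rewrite sgr0 subr0 sgnpE mul0r normr0.
Qed.

End SignApproximation.

(** * The limit of the wave solutions for the datum |t| *)

Section TransmutationLimit.
Context {R : realType} (r : R) (r0 : 0 < r).
Local Notation C := (cplx R).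
Variables p m : nat.
Variable Q : R -> 'M[C]_p.
Hypothesis QL2 : mL2 r Q.
Variables y dy : nat -> R -> 'M[C]_(p, m).
Let ypred j x := if j is j'.+1 then y j' x else 0.
Hypothesis yAC : forall j, mAC r (y j) (dy j).
Hypothesis dyAC : forall j, mAC r (dy j) (fun x => Q x *m y j x + ypred j x).
Hypothesis y0 : forall j, y j.+1 0 = 0.
Hypothesis dy0 : forall j, dy j.+1 0 = 0.
Let B0 := y 0%N 0.
Let B1 := dy 0%N 0.
(** One length that is sufficient for [absp], for its derivative and for its primitive. *)
Let n N := size (prim (absp r N)).

Let size_deriv_le (P : {poly R}) : (size P^`() <= size P)%N.
Proof. by apply: (leq_trans (size_poly _ _)); exact: leq_pred. Qed.

Let pp_size N M k : (maxn (n N) (n M) <= k)%N -> (size (prim (absp r N) - prim (absp r M))%R <= k.*2)%N.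
Proof.
move=> h; apply: (leq_trans (size_polyD _ _)); rewrite size_polyN; apply: (leq_trans h).
by rewrite -addnn leq_addr.
Qed.

Let p_size N k : (n N <= k)%N -> (size (absp r N) <= k.*2)%N.
Proof.
move=> h; have := size_deriv_le (prim (absp r N)); rewrite prim_deriv => h'.
by apply: (leq_trans h'); apply: (leq_trans h); rewrite -addnn leq_addr.
Qed.

(** [absp] differences are derivatives of differences of primitives, so [trans_apriori] needs only
    their uniform smallness, given by [absp_approx]. *)
Lemma trans_cauchy (e : R) : 0 < e -> exists N0, forall N M k x t, (N0 <= N)%N -> (N0 <= M)%N ->
  (maxn (n N) (n M) <= k)%N -> 0 <= x <= r -> `|t| <= r - x ->
  mabs (trans y k (absp r N - absp r M) x t) <= e.
Proof.
have [C1 C10 hC] := trans_apriori r0 QL2 yAC dyAC y0 dy0.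
move=> e0; have K0 : 0 < C1 * (4 * r) + 1 by rewrite ltr_wpDl// !mulr_ge0// ltW.
pose N0 := Num.truncn ((C1 * (4 * r) + 1) / e); exists N0 => N M k x t hN hM hk xr tr.
have hN0 : (C1 * (4 * r) + 1) / e < N0.+1%:R by exact: truncnS_gt.
have N00 : 0 < N0.+1%:R :> R by rewrite ltr0n.
have app N' s : (N0 <= N')%N -> `|s| <= r -> `|(absp r N').[s] - `|s| | <= 2 * r / N0.+1%:R.
  move=> h sr; apply: (le_trans (absp_approx r0 N' sr)); apply: ler_wpM2l; first by rewrite mulr_ge0// ltW.
  by rewrite lef_pV2 ?posrE ?ltr0n// ler_nat ltnS.
have -> : absp r N - absp r M = (prim (absp r N) - prim (absp r M))^`() by rewrite derivB !prim_deriv.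
apply: (@le_trans _ _ (C1 * (4 * r / N0.+1%:R))).
  apply: hC => //; first exact: pp_size.
    by rewrite divr_ge0// mulr_ge0// ltW.
  move=> s sr; rewrite derivB !prim_deriv hornerD hornerN.
  have := app N s hN sr; have := app M s hM sr.
  set a := (absp r N).[s]; set b := (absp r M).[s] => h1 h2.
  have := ler_normB (a - `|s|) (b - `|s|); rewrite opprB addrA subrK.
  have -> : 4 * r / N0.+1%:R = 2 * r / N0.+1%:R + 2 * r / N0.+1%:R by field; rewrite gt_eqF.
  by move=> h3; apply: (le_trans h3); exact: lerD.
rewrite ltr_pdivrMr// in hN0.
by rewrite mulrA ler_pdivrMr//; lra.
Qed.

(** [uq] below is the t-derivative of [u]; its data [sgnp] converge boundedly but not uniformly. *)
Let u N x t := trans y (n N) (absp r N) x t.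
Let uq N x t := trans y (n N) (sgnp r N) x t.

Lemma u_cauchy (e : R) : 0 < e -> exists N0, forall N M x t, (N0 <= N)%N -> (N0 <= M)%N ->
  0 <= x <= r -> `|t| <= r - x -> mabs (u N x t - u M x t) <= e.
Proof.
move=> /trans_cauchy[N0 h]; exists N0 => N M x t hN hM xr tr.
have := h N M (maxn (n N) (n M)) x t hN hM (leqnn _) xr tr.
by rewrite transB (trans_widen y x t (p_size (leqnn (n N))) (leq_maxl _ (n M))) (trans_widen y x t (p_size (leqnn (n M))) (leq_maxr (n N) _)).
Qed.

Lemma u_bounded : exists2 C2 : R, 0 <= C2 & forall N x t, 0 <= x <= r -> `|t| <= r - x ->
  mabs (u N x t) <= C2 /\ mabs (uq N x t) <= C2.
Proof.
have [C1 C10 hC] := trans_apriori r0 QL2 yAC dyAC y0 dy0.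
exists (C1 * (3 * r + 1)); first by rewrite mulr_ge0// addr_ge0// mulr_ge0// ltW.
move=> N x t xr tr; split.
  have -> : u N x t = trans y (n N) (prim (absp r N))^`() x t by rewrite prim_deriv.
  apply: hC => //.
  - by rewrite -addnn leq_addr.
  - by rewrite addr_ge0// mulr_ge0// ltW.
  move=> s sr; rewrite prim_deriv; have := absp_approx r0 N sr => h.
  have h1 : 2 * r / N.+1%:R <= 2 * r by rewrite ler_pdivrMr ?ltr0n// ler_peMr ?mulr_ge0// ?(ltW r0)// ler1n.
  have := ler_normD ((absp r N).[s] - `|s|) (`|s|); rewrite subrK normr_id.
  by move: h h1; set c := 2 * r / _; lra.
apply: (@le_trans _ _ (C1 * 1)).
  rewrite /uq /sgnp; apply: hC => //; first exact: p_size.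
  by move=> s sr; exact: sgnp_le1.
by apply: ler_wpM2l => //; have := r0; lra.
Qed.

(** In d'Alembert's formula for a difference, the approximate signs enter only at the two points t +
    x and t - x, where they converge; the B1 term and the integrand involve [absp] and are uniformly
    small. *)
Lemma uq_cvg x t : 0 <= x <= r -> `|t| <= r - x -> exists l, mcvg (fun N => uq N x t) l.
Proof.
move=> xr tr; have /andP[x0 xr'] := xr; apply: mcauchy => e e0.
pose qN := Ir r (fun s => mabs (Q s)).
have LQ : L1r r (fun s => mabs (Q s)) by exact: L2r_L1 (L2r_mabs QL2).
have q0 : 0 <= qN by apply: Ir_ge0 => s _; exact: mabs_ge0.
pose K := mabs B0 + mabs B1 + qN + 1.
have K0 : 0 < K by rewrite ltr_wpDl// !addr_ge0 ?mabs_ge0.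
pose d := e / (4 * K); have d0 : 0 < d by rewrite divr_gt0// mulr_gt0.
have dK : d * K = e / 4 by rewrite /d; field; rewrite gt_eqF.
have [N1 h1] := trans_cauchy d0.
have [tr1 tr2] : - (r - x) <= t /\ t <= r - x by apply/andP; rewrite -ler_norml.
have tp : `|t + x| <= r by rewrite ler_norml; apply/andP; split; lra.
have tm : `|t - x| <= r by rewrite ler_norml; apply/andP; split; lra.
have d2 : 0 < d / 2 by rewrite divr_gt0.
have [N2 h2] := sgnp_cvg r0 tp d2; have [N3 h3] := sgnp_cvg r0 tm d2.
have K1 : 0 < d / (4 * r + 1) by rewrite divr_gt0// ltr_wpDl// mulr_ge0// ltW.
pose N4 := Num.truncn ((4 * r + 1) / d).
have hN4 : (4 * r + 1) / d < N4.+1%:R by exact: truncnS_gt.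
have papp N s : (N4 <= N)%N -> `|s| <= r -> `|(absp r N).[s] - `|s| | <= d / 2.
  move=> h sr; apply: (le_trans (absp_approx r0 N sr)).
  have N00 : 0 < N.+1%:R :> R by rewrite ltr0n.
  rewrite ler_pdivrMr//; rewrite ltr_pdivrMr// in hN4.
  have : N4.+1%:R * d <= N.+1%:R * d by rewrite ler_pM2r// ler_nat ltnS.
  lra.
pose N0 := maxn (maxn N1 N2) (maxn N3 N4); exists N0 => N hN.
have [g1 g2 g3 g4] : [/\ (N1 <= N0)%N, (N2 <= N0)%N, (N3 <= N0)%N & (N4 <= N0)%N].
  by rewrite /N0 !leq_max !leqnn !orbT.
pose k := maxn (n N) (n N0).
have sdq N' : (size (sgnp r N') <= (n N').*2)%N.
  apply: (leq_trans (size_deriv_le _)); exact: p_size.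
have -> : uq N x t - uq N0 x t = trans y k (absp r N - absp r N0)^`() x t.
  rewrite derivB transB -/(sgnp r N) -/(sgnp r N0).
  by rewrite (trans_widen y x t (sdq N) (leq_maxl _ _)) (trans_widen y x t (sdq N0) (leq_maxr _ _)).
have sk : (size (absp r N - absp r N0)%R <= k.*2)%N.
  apply: (leq_trans (size_polyD _ _)); rewrite size_polyN geq_max.
  by rewrite (p_size (leq_maxl _ _)) (p_size (leq_maxr _ _)).
rewrite (dalembert r0 yAC dyAC y0 dy0 t sk xr) mabsZ -/B0 -/B1.
have -> : cabs (2^-1 : C) = 2^-1 by rewrite cabsV (@cabs_nat R 2).
set D := absp r N - absp r N0.
have dq s : `|s| <= r -> (forall j, (N0 <= j)%N -> `|(sgnp r j).[s] - Num.sg s| < d / 2) -> `|D^`().[s]| <= d.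
  move=> sr h; rewrite /D derivB hornerD hornerN.
  have := h N hN; have := h N0 (leqnn _); have := ler_normB ((sgnp r N).[s] - Num.sg s) ((sgnp r N0).[s] - Num.sg s).
  by rewrite opprB addrA subrK; lra.
have dp s : `|s| <= r -> `|D.[s]| <= d.
  move=> sr; rewrite /D hornerD hornerN.
  have := papp N s (leq_trans g4 hN) sr; have := papp N0 s g4 sr; have := ler_normB ((absp r N).[s] - `|s|) ((absp r N0).[s] - `|s|).
  by rewrite opprB addrA subrK; lra.
have a1 : mabs ((D^`().[t + x] + D^`().[t - x])%:C *: B0) <= 2 * d * mabs B0.
  rewrite mabsZ cabs_real; apply: ler_wpM2r; first exact: mabs_ge0.
  have := dq _ tp (fun j hj => h2 j (leq_trans g2 hj)); have := dq _ tm (fun j hj => h3 j (leq_trans g3 hj)).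
  have := ler_normD D^`().[t + x] D^`().[t - x]; lra.
have a2 : mabs ((D.[t + x] - D.[t - x])%:C *: B1) <= 2 * d * mabs B1.
  rewrite mabsZ cabs_real; apply: ler_wpM2r; first exact: mabs_ge0.
  have := dp _ tp; have := dp _ tm; have := ler_normB D.[t + x] D.[t - x]; lra.
have LF : mL1 r (fun s => Q s *m (trans y k D s (t + x - s) - trans y k D s (t - x + s))).
  apply: mL2_L1; apply: mL2_mulr => //.
  have := mBM_D (trans_BM r0 yAC k D (t + x) (-1)) (mBM_N (trans_BM r0 yAC k D (t - x) 1)).
  by congr (mBM r _); apply/funext => s; rewrite mulN1r mul1r.
have a3 : mabs (mint x (fun s => Q s *m (trans y k D s (t + x - s) - trans y k D s (t - x + s)))) <= 2 * d * qN.
  apply: (le_trans (mint_le xr' LF (L1rZ (2 * d) LQ) _)).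
    move=> s /andP[s0 sx]; apply: (le_trans (mabsM _ _)); rewrite mulrC; apply: ler_wpM2r; first exact: mabs_ge0.
    apply: (le_trans (mabsB _ _)).
    have sr : 0 <= s <= r by apply/andP; split; lra.
    have b1 : mabs (trans y k D s (t + x - s)) <= d.
      apply: h1 => //; [exact: leq_trans g1 hN|rewrite ler_norml; apply/andP; split; lra].
    have b2 : mabs (trans y k D s (t - x + s)) <= d.
      apply: h1 => //; [exact: leq_trans g1 hN|rewrite ler_norml; apply/andP; split; lra].
    by lra.
  rewrite (IrZ _ xr')//; apply: ler_wpM2l; first by rewrite mulr_ge0// ltW.
  by apply: (@Ir_mono _ r) => //; rewrite ?x0// => s _; exact: mabs_ge0.
set T1 := _ *: B0 in a1 *; set T2 := _ *: B1 in a2 *; set T3 := mint x _ in a3 *.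
have q3 := mabsD (T1 + T2) T3; have q4 := mabsD T1 T2.
have := dK; rewrite /K !mulrDr mulr1; lra.
Qed.

(** [uqq] is u_tt(x, 0), and d'Alembert's formula splits it into [dqq] B0, [qq] B1 and the integral
    [k]. As the derivative of [qq], which vanishes at 0 and tends to 1 on (0, r], [dqq] concentrates
    at x = 0. *)
Let qq N (x : R) : R := ((sgnp r N).[x] - (sgnp r N).[- x]) / 2.
Let dqq N (x : R) : R := ((sgnp r N)^`().[x] + (sgnp r N)^`().[- x]) / 2.
Let k N x : 'M[C]_(p, m) := 2^-1 *: mint x (fun s => Q s *m (uq N s (x - s) - uq N s (s - x))).
Let uqq N x := trans y (n N) (sgnp r N)^`() x 0.
Let qN := Ir r (fun s => mabs (Q s)).

Let mabsQ_L1 : L1r r (fun s => mabs (Q s)).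
Proof. exact: L2r_L1 (L2r_mabs QL2). Qed.

Let qN_ge0 : 0 <= qN.
Proof. by apply: Ir_ge0 => s _; exact: mabs_ge0. Qed.

Let qq_AC N : AC r (fun x : R => (qq N x)%:C : C) (fun x => (dqq N x)%:C).
Proof.
have h1 := AC_poly r0 (sgnp r N) (AC_affine r0 0 1).
have h2 := AC_poly r0 (sgnp r N) (AC_affine r0 0 (-1)).
have := AC_Z (2^-1) (AC_D h1 (AC_N r0 h2)).
apply: (AC_ext r0) => x _.
  rewrite /qq !add0r mul1r mulN1r CM CB CV mulrC; congr (_ * _).
  by congr (_^-1); apply: complex_ext; rewrite /= ?addr0 // ?mulr1n.
rewrite /dqq !add0r mul1r mulN1r mulr1 mulrN1 CM CD CV mulrC -CN opprK; congr (_ * _).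
by congr (_^-1); apply: complex_ext; rewrite /= ?addr0 // ?mulr1n.
Qed.

Let qq_le1 N x : 0 <= x <= r -> `|qq N x| <= 1.
Proof.
move=> /andP[x0 xr]; have hx : `|x| <= r by rewrite ger0_norm.
have := sgnp_le1 r0 N hx; have := ler_normB (sgnp r N).[x] (sgnp r N).[- x].
rewrite /qq normrM sgnpN normrN (ger0_norm (x := 2^-1)) ?invr_ge0// ler_pdivrMr//; lra.
Qed.

Let qq_cvg x : 0 <= x <= r -> forall e : R, 0 < e -> exists N, forall j, (N <= j)%N -> cabs ((qq j x)%:C - (Num.sg x)%:C) < e.
Proof.
move=> /andP[x0 xr] e e0; have hx : `|x| <= r by rewrite ger0_norm.
have [N hN] := sgnp_cvg r0 hx e0; exists N => j /hN.
have -> : qq j x = (sgnp r j).[x] by rewrite /qq sgnpN opprK; field.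
by rewrite -CB cabs_real.
Qed.

Let uqqE N x : 0 <= x <= r -> uqq N x = (dqq N x)%:C *: B0 + (qq N x)%:C *: B1 + k N x.
Proof.
move=> xr; have sq : (size (sgnp r N) <= (n N).*2)%N.
  by apply: (leq_trans (size_deriv_le _)); exact: p_size.
have h2 (a : R) : (a / 2)%:C = 2^-1 * a%:C :> C.
  by rewrite CM CV mulrC; congr (_^-1 * _); apply: complex_ext; rewrite /= ?addr0 // ?mulr1n.
have e3 : mint x (fun s => Q s *m (trans y (n N) (sgnp r N) s (0 + x - s) - trans y (n N) (sgnp r N) s (0 - x + s))) =
  mint x (fun s => Q s *m (uq N s (x - s) - uq N s (s - x))).
  by apply: mint_eq => s _; rewrite /uq add0r sub0r [- x + s]addrC.
rewrite /uqq (dalembert r0 yAC dyAC y0 dy0 0 sq xr) e3 -/B0 -/B1 !scalerDr !scalerA -!h2.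
by rewrite add0r sub0r.
Qed.

Let k_BM N : mBM r (k N).
Proof.
have h1 := trans_BM r0 yAC (n N) (sgnp r N)^`() 0 0.
have [h2 _] := qq_AC N; have h3 := AC_BM r0 (qq_AC N).
have h4 : CBM r (fun x : R => (dqq N x)%:C : C).
  have a1 := CBM_poly r0 (sgnp r N)^`() 0 1; have a2 := CBM_poly r0 (sgnp r N)^`() 0 (-1).
  apply: eq_CBM (CBM_Z (2^-1) (CBM_D a1 a2)) => x _.
  rewrite !add0r mul1r mulN1r /dqq CM CD CV mulrC; congr (_ * _).
  by congr (_^-1); apply: complex_ext; rewrite /= ?addr0 // ?mulr1n.
have h5 := mBM_D (mBM_D h1 (mBM_N (mBM_Z h4 (mBM_cst r B0)))) (mBM_N (mBM_Z h3 (mBM_cst r B1))).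
move=> i j; apply: eq_CBM (h5 i j) => x xr; congr (fun_of_matrix _ i j).
have := uqqE N xr; rewrite /uqq mul0r addr0 => ->.
by rewrite -addrA -opprD addrAC subrr add0r.
Qed.

Let uqD_BM N x : mBM r (fun s => uq N s (x - s) - uq N s (s - x)).
Proof.
have := mBM_D (trans_BM r0 yAC (n N) (sgnp r N) x (-1)) (mBM_N (trans_BM r0 yAC (n N) (sgnp r N) (- x) 1)).
by congr (mBM r _); apply/funext => s; rewrite mulN1r mul1r /uq [s - x]addrC.
Qed.

Let mL1_sub a b (F : R -> 'M[C]_(a, b)) x : x <= r -> mL1 r F -> mL1 x F.
Proof. by move=> xr h i j; have [h1 h2] := h i j; split; [exact: (L1r_sub xr h1)|exact: (L1r_sub xr h2)]. Qed.

Let reg1 x s : 0 <= x <= r -> 0 <= s <= x -> `|x - s| <= r - s /\ `|s - x| <= r - s.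
Proof.
move=> /andP[? ?] /andP[? sx]; have e : `|x - s| = x - s by rewrite ger0_norm ?subr_ge0.
by rewrite (distrC s x) e; split; lra.
Qed.

Let CBM_of_L1 a b (F : R -> 'M[C]_(a, b)) B : mL1 r F -> (forall x, 0 <= x <= r -> mabs (F x) <= B) -> mBM r F.
Proof.
move=> h hB i j; have [h1 h2] := h i j; split.
  split; first exact: L1r_meas h1.
  by exists B => x xr; apply: (le_trans (cabs_Re _)); apply: (le_trans (mabs_entry _ i j)); exact: hB.
split; first exact: L1r_meas h2.
by exists B => x xr; apply: (le_trans (cabs_Im _)); apply: (le_trans (mabs_entry _ i j)); exact: hB.
Qed.

(** The equation of the limit is obtained by dominated convergence in integrated form. Every
    approximation has zero slope at 0; the slope B0 of the limit is the mass of the concentrating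
    term [dqq] B0. *)
Lemma trans_limit : exists Y dY gY : R -> 'M[C]_(p, m), [/\ mAC r Y dY, mAC r dY gY, Y 0 = 0, dY 0 = B0 &
  forall e : R, 0 < e -> exists N0, forall N x, (N0 <= N)%N -> 0 <= x <= r ->
    mabs (trans y (n N) (absp r N) x 0 - Y x) <= e].
Proof.
have [C2 C20 hC2] := u_bounded; have r0' := ltW r0.
have reg0 x : 0 <= x <= r -> `|0 : R| <= r - x by move=> /andP[_ xr]; rewrite normr0 subr_ge0.
have k_bound N x : 0 <= x <= r -> mabs (k N x) <= C2 * qN.
  move=> xr; have /andP[x0 xr'] := xr; rewrite /k mabsZ cabsV (@cabs_nat R 2) mulrC ler_pdivrMr//.
  have LF : mL1 r (fun s => Q s *m (uq N s (x - s) - uq N s (s - x))).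
    by apply: mL2_L1; apply: mL2_mulr => //; exact: uqD_BM.
  apply: (le_trans (mint_le xr' LF (L1rZ (C2 * 2) mabsQ_L1) _)).
    move=> s sx; apply: (le_trans (mabsM _ _)); rewrite mulrC; apply: ler_wpM2r; first exact: mabs_ge0.
    have sr : 0 <= s <= r by case/andP: sx => ? ?; apply/andP; split; lra.
    have [g1 g2] := reg1 xr sx; apply: (le_trans (mabsB _ _)).
    by have [_ b1] := hC2 N s _ sr g1; have [_ b2] := hC2 N s _ sr g2; lra.
  rewrite (IrZ _ xr')// mulrAC; apply: ler_wpM2r => //; apply: ler_wpM2l => //.
  by apply: (@Ir_mono _ r) => //; rewrite ?x0// => s _; exact: mabs_ge0.
have k_cvg x : 0 <= x <= r -> exists l, mcvg (fun N => k N x) l.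
  move=> xr; have /andP[] := xr; rewrite le_eqVlt => /predU1P[<- _|x0 xr'].
    by exists 0; apply: mcvg_eq (mcvg_cst 0) => N; rewrite /k mint0 scaler0.
  have /choice[L hL] : forall s, exists l, 0 <= s <= x -> mcvg (fun N => uq N s (x - s) - uq N s (s - x)) l.
    move=> s; case sx : (0 <= s <= x); last by exists 0.
    have sr : 0 <= s <= r by case/andP: sx => ? ?; apply/andP; split; lra.
    have [g1 g2] := reg1 xr sx; have [l1 h1] := uq_cvg sr g1; have [l2 h2] := uq_cvg sr g2.
    exists (l1 + (-1)%:M *m l2) => _.
    have := mcvg_D h1 (mcvg_Ml (-1)%:M h2).
    by apply: mcvg_eq => N; rewrite mul_scalar_mx scaleN1r.
  have [||||_ h] := @mint_DCT _ x x0 _ _ (fun N s => Q s *m (uq N s (x - s) - uq N s (s - x))) (fun s => Q s *m L s) (fun s => C2 * 2 * mabs (Q s)).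
  - move=> N; apply: (mL1_sub xr'); apply: mL2_L1; apply: mL2_mulr => //; exact: uqD_BM.
  - exact: L1r_sub xr' (L1rZ (C2 * 2) mabsQ_L1).
  - move=> N s sx; apply: (le_trans (mabsM _ _)); rewrite mulrC; apply: ler_wpM2r; first exact: mabs_ge0.
    have sr : 0 <= s <= r by case/andP: sx => ? ?; apply/andP; split; lra.
    have [g1 g2] := reg1 xr sx; apply: (le_trans (mabsB _ _)).
    by have [_ b1] := hC2 N s _ sr g1; have [_ b2] := hC2 N s _ sr g2; lra.
  - by move=> s sx; apply: mcvg_Ml; exact: hL.
  have xx : 0 <= x <= x by rewrite ltW// lexx.
  exists ((2^-1)%:M *m mint x (fun s => Q s *m L s)).
  by have := mcvg_Ml (2^-1)%:M (h x xx); apply: mcvg_eq => N; rewrite mul_scalar_mx.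
have /choice[kk hkk] : forall x, exists l, 0 <= x <= r -> mcvg (fun N => k N x) l.
  by move=> x; case xr : (0 <= x <= r); [have [l hl] := k_cvg x xr; exists l|exists 0].
have kkBM : mBM r kk.
  have cst_L1 : L1r r (fun=> C2 * qN) by exact: BMr_L1 (BMr_cst r _).
  have [L _] := mint_DCT r0 (fun N => mBM_L1 (k_BM N)) cst_L1 k_bound hkk.
  apply: (CBM_of_L1 (B := C2 * qN) L) => x xr.
  by apply: (mcvg_bound (hkk x xr)) => N; exact: k_bound.
have /choice[Y hY] : forall x, exists l, 0 <= x <= r -> mcvg (fun N => u N x 0) l.
  move=> x; case xr : (0 <= x <= r); last by exists 0.
  have [l hl] : exists l, mcvg (fun N => u N x 0) l.
    apply: mcauchy => e e0; have e2 : 0 < e / 2 by rewrite divr_gt0.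
    have [N0 h] := u_cauchy e2; exists N0 => N hN.
    by apply: (le_lt_trans (h N N0 x 0 hN (leqnn _) xr (reg0 x xr))); lra.
  by exists l.
have uBM N : mBM r (fun x => u N x 0).
  by have := trans_BM r0 yAC (n N) (absp r N) 0 0; congr (mBM r _); apply/funext => s; rewrite mul0r addr0.
have YBM : mBM r Y.
  have cst_L1 : L1r r (fun=> C2) by exact: BMr_L1 (BMr_cst r _).
  have bnd N x : 0 <= x <= r -> mabs (u N x 0) <= C2 by move=> xr; have [] := hC2 N x 0 xr (reg0 x xr).
  have [L _] := mint_DCT r0 (fun N => mBM_L1 (uBM N)) cst_L1 bnd hY.
  apply: (CBM_of_L1 (B := C2) L) => x xr; apply: (mcvg_bound (hY x xr)) => N; exact: bnd.
pose du N x := \sum_(j < n N) ((absp r N)^`(j.*2).[0])%:C *: dy j x.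
have uAC N : mAC r (fun x => u N x 0) (du N).
  exact: (mAC_sum r0 (fun j : 'I_(n N) => mAC_Zc r0 ((absp r N)^`(j.*2).[0])%:C (yAC j))).
have duAC N : mAC r (du N) (fun x => Q x *m u N x 0 + uqq N x).
  have := mAC_sum r0 (fun j : 'I_(n N) => mAC_Zc r0 ((absp r N)^`(j.*2).[0])%:C (dyAC j)).
  apply: (mAC_ext r0) => x _ //; rewrite /u /uqq /trans mulmx_sumr.
  under eq_bigr do rewrite scalerDr scalemxAr.
  rewrite big_split /=; congr (_ + _).
  (* Shifting the index turns the terms y_{j-1} into u_tt at t = 0; the surplus last term vanishes
     for reasons of degree. *)
  have sp := p_size (leqnn (n N)); move: sp; case: (n N) => [|n'] sp; first by rewrite !big_ord0.
  rewrite big_ord_recl /= scaler0 add0r [RHS]big_ord_recr /=.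
  have dd j : (sgnp r N)^`()^`(j.*2) = (absp r N)^`((j.+1).*2) by rewrite doubleS !derivSn.
  rewrite [X in _ = _ + X](_ : _ = 0); last by rewrite dd derivn_poly0 // horner0 scale0r.
  by rewrite addr0; apply: eq_bigr => j _; rewrite dd.
have u00 N : u N 0 0 = 0.
  rewrite /u /trans big1 // => j _; case: (nat_of_ord j) => [|j']; last by rewrite y0 scaler0.
  by rewrite /= absp_at0 scale0r.
have du00 N : du N 0 = 0.
  rewrite /du big1 // => j _; case: (nat_of_ord j) => [|j']; last by rewrite dy0 scaler0.
  by rewrite /= absp_at0 scale0r.
(* Subtracting [qq] B0 removes from the second derivative the one term without a uniform bound; what
   remains, [f], is dominated by [g] below and converges pointwise. *)
pose z N x := du N x - (qq N x)%:C *: B0.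
pose f N x := Q x *m u N x 0 + (qq N x)%:C *: B1 + k N x.
have qq0 N : qq N 0 = 0 by rewrite /qq oppr0 subrr mul0r.
have zAC N : mAC r (z N) (f N).
  have := mAC_D r0 (duAC N) (mAC_N r0 (mAC_Z r0 (qq_AC N) (mAC_cst r0 B0))).
  apply: (mAC_ext r0) => x xr //.
  rewrite scaler0 addr0 (uqqE N xr) /f -!addrA; congr (_ + _).
  by rewrite [X in _ + X]addrA addrCA subrr addr0.
have zE N x : 0 <= x <= r -> z N x = mint x (f N).
  by move=> xr; rewrite (mAC_E (zAC N) xr) /z du00 qq0 scale0r subr0 add0r.
pose g (s : R) := C2 * mabs (Q s) + (mabs B1 + C2 * qN).
have Lg : L1r r g by apply: L1rD; [exact: L1rZ|exact: BMr_L1 (BMr_cst r _)].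
have fL1 N : mL1 r (f N) by exact: mAC_L1 (zAC N).
have fle N x : 0 <= x <= r -> mabs (f N x) <= g x.
  move=> xr; have b1 := mabsD (Q x *m u N x 0 + (qq N x)%:C *: B1) (k N x).
  have b2 := mabsD (Q x *m u N x 0) ((qq N x)%:C *: B1).
  have b3 := k_bound N x xr; have [b4 _] := hC2 N x 0 xr (reg0 x xr).
  have b5 : mabs (Q x *m u N x 0) <= C2 * mabs (Q x).
    by apply: (le_trans (mabsM _ _)); rewrite mulrC; apply: ler_wpM2r; first exact: mabs_ge0.
  have b6 : mabs ((qq N x)%:C *: B1) <= mabs B1.
    by rewrite mabsZ cabs_real ler_piMl ?mabs_ge0// qq_le1.
  by rewrite /f /g; lra.
pose f' x := Q x *m Y x + (Num.sg x)%:C *: B1 + kk x.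
have fcvg x : 0 <= x <= r -> mcvg (f^~ x) (f' x).
  move=> xr; apply: mcvg_D (hkk x xr); apply: mcvg_D; first exact: mcvg_Ml (hY x xr).
  by apply: mcvg_Zl; exact: qq_cvg.
have [Lf' zcvg] := mint_DCT r0 fL1 Lg fle fcvg.
pose G := Ir r g.
have zle N x : 0 <= x <= r -> mabs (z N x) <= G.
  move=> xr; have /andP[x0 xr'] := xr; rewrite (zE N x xr).
  apply: (le_trans (mint_le xr' (fL1 N) Lg _)).
    by move=> t /andP[t0 tx]; apply: fle; rewrite t0 (le_trans tx).
  apply: (@Ir_mono _ r) => //; rewrite ?x0// => s _.
  by rewrite /g !addr_ge0 ?mulr_ge0 ?mabs_ge0.
have uE N x : 0 <= x <= r -> u N x 0 = mint x (fun s => z N s + (qq N s)%:C *: B0).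
  move=> xr; rewrite (mAC_E (uAC N) xr) u00 add0r; apply: mint_eq => t _.
  by rewrite /z subrK.
have duL1 N : mL1 r (fun s => z N s + (qq N s)%:C *: B0).
  by have := mAC_L1 (uAC N); congr (mL1 r _); apply/funext => s; rewrite /z subrK.
pose h' s := mint s f' + (Num.sg s)%:C *: B0.
have hcvg s : 0 <= s <= r -> mcvg (fun N => z N s + (qq N s)%:C *: B0) (h' s).
  move=> sr; apply: mcvg_D; last by apply: mcvg_Zl; exact: qq_cvg.
  by have := zcvg s sr; apply: mcvg_eq => N; rewrite zE.
have hle N s : 0 <= s <= r -> mabs (z N s + (qq N s)%:C *: B0) <= G + mabs B0.
  move=> sr; apply: (le_trans (mabsD _ _)); apply: lerD; first exact: zle.
  by rewrite mabsZ cabs_real ler_piMl ?mabs_ge0// qq_le1.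
have [Lh' ucvg] := mint_DCT r0 duL1 (BMr_L1 (BMr_cst r (G + mabs B0))) hle hcvg.
pose gY x := Q x *m Y x + B1 + kk x.
have gYL2 : mL2 r gY.
  by apply: mL2_D; [apply: mL2_D; [exact: mL2_mulr|exact: mBM_L2 (mBM_cst r B1)]|exact: mBM_L2].
pose dY x := B0 + mint x gY.
have dYAC : mAC r dY gY by exact: mAC_mint.
have fg : {ae (@lebesgue_measure R), forall x, 0 < x < r -> f' x = gY x}.
  by apply: aeW => x /andP[x0 _]; rewrite /f' gtr0_sg// scale1r.
have YE x : 0 <= x <= r -> Y x = mint x dY.
  move=> xr; have /andP[x0 xr'] := xr.
  have e1 : mcvg (fun N => u N x 0) (mint x h').
    by have := ucvg x xr; apply: mcvg_eq => N; rewrite uE.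
  rewrite (mcvg_uniq (hY x xr) e1); apply: (mint_ae xr' Lh' (mBM_L1 (mAC_BM r0 dYAC))).
  apply: aeW => s /andP[s0 sr]; rewrite /h' /dY gtr0_sg// scale1r addrC; congr (_ + _).
  by apply: (mint_ae (ltW sr) Lf' (mL2_L1 gYL2)).
have Y0 : Y 0 = 0 by rewrite YE ?mint0// lexx.
exists Y, dY, gY; split=> //.
- apply: mACP; first exact: mBM_L2 (mAC_BM r0 dYAC).
  by move=> x xr; rewrite Y0 add0r YE.
- by rewrite /dY mint0 addr0.
move=> e e0; have e2 : 0 < e / 2 by rewrite divr_gt0.
have [N0 h] := u_cauchy e2; exists N0 => N x hN xr.
have [N1 h1] := hY x xr _ e2; pose M := maxn N0 N1.
have -> : trans y (n N) (absp r N) x 0 - Y x = (u N x 0 - u M x 0) + (u M x 0 - Y x) by rewrite addrA subrK.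
apply: (le_trans (mabsD _ _)).
have := h N M x 0 hN (leq_maxl _ _) xr (reg0 x xr); have := h1 M (leq_maxr _ _); lra.
Qed.

End TransmutationLimit.

(** * The similarity operator and the regularity of Phi1 *)

Section BoundedOperators.
Context {R : realType} (r : R) (r0 : 0 < r).
Local Notation C := (cplx R).
Local Notation mu := (@lebesgue_measure R).

Lemma mnormsq_ge0 m n (A : 'M[C]_(m, n)) : 0 <= mnormsq A.
Proof. by apply: sumr_ge0 => i _; apply: sumr_ge0 => j _; exact: sqr_ge0. Qed.

Lemma mnormsq_le m n (A : 'M[C]_(m, n)) : mnormsq A <= mabs A ^+ 2.
Proof.
rewrite expr2 {2}/mabs mulr_sumr; apply: ler_sum => i _; rewrite mulr_sumr; apply: ler_sum => j _.
by rewrite expr2 ler_wpM2r// mabs_entry.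
Qed.

Lemma mnormsqD m n (A B : 'M[C]_(m, n)) : mnormsq (A + B) <= 2 * mnormsq A + 2 * mnormsq B.
Proof.
rewrite /mnormsq !mulr_sumr -big_split /=; apply: ler_sum => i _.
rewrite !mulr_sumr -big_split /=; apply: ler_sum => j _; rewrite mxE.
apply: (@le_trans _ _ ((cabs (A i j) + cabs (B i j)) ^+ 2)); first by rewrite lerX// cabs_ge0 cabsD.
have := sqr_ge0 (cabs (A i j) - cabs (B i j)); set a := cabs _; set b := cabs _ => h.
rewrite -subr_ge0; have -> : 2 * a ^+ 2 + 2 * b ^+ 2 - (a + b) ^+ 2 = (a - b) ^+ 2 by ring.
exact: h.
Qed.

Definition aeq m n (F G : R -> 'M[C]_(m, n)) := {ae mu, forall x, 0 < x < r -> F x = G x}.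

Lemma aeq_sym m n (F G : R -> 'M[C]_(m, n)) : aeq F G -> aeq G F.
Proof. by move=> h; apply: (aeS h) => x e xr; rewrite e. Qed.
Lemma aeq_trans m n (F G H : R -> 'M[C]_(m, n)) : aeq F G -> aeq G H -> aeq F H.
Proof. by move=> h1 h2; apply: (aeS2 h1 h2) => x e1 e2 xr; rewrite e1// e2. Qed.
Lemma aeq_on m n (F G : R -> 'M[C]_(m, n)) : (forall x, 0 <= x <= r -> F x = G x) -> aeq F G.
Proof. by move=> h; apply: aeW => x /andP[x0 xr]; rewrite h// !ltW. Qed.

Variables (n : nat) (T : (R -> 'cV[C]_n) -> (R -> 'cV[C]_n)).
Hypothesis hT : bounded_operator r T.

Lemma op_L2 f : mL2 r f -> mL2 r (T f).
Proof. by case: hT => h _ _ hf; apply: isL2_mL2; apply: h; exact: mL2_isL2. Qed.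

Lemma op_lin a f g : mL2 r f -> mL2 r g -> aeq (T (fun x => a *: f x + g x)) (fun x => a *: T f x + T g x).
Proof. by case: hT => _ h _ hf hg; apply/ae_equalP; apply: h; exact: mL2_isL2. Qed.

Lemma op_bound : exists M : R, forall f, mL2 r f ->
  Ir r (fun t => mnormsq (T f t)) <= M ^+ 2 * Ir r (fun t => mnormsq (f t)).
Proof.
case: hT => _ _ [M hM]; exists M => f hf; have := hM f (mL2_isL2 hf).
by rewrite !l2normsqE// ?lee_fin//; exact: op_L2.
Qed.

Lemma mL2_lc (a : C) (f g : R -> 'cV[C]_n) : mL2 r f -> mL2 r g -> mL2 r (fun x => a *: f x + g x).
Proof. by move=> hf hg; apply: mL2_D => //; apply: mL2_Z => //; exact: CBM_cst. Qed.

Lemma op_aeq f g : mL2 r f -> mL2 r g -> aeq f g -> aeq (T f) (T g).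
Proof.
move=> hf hg fg; have [M hM] := op_bound.
have hd := mL2_lc (-1) hf hg.
have e0 : Ir r (fun t => mnormsq (-1 *: f t + g t)) = 0.
  have L := L1r_mnormsq hd; rewrite (@Ir_ae _ r _ (fun=> 0) r)//; first by rewrite Ir_cst ?mul0r// ltW.
    exact: BMr_L1 (BMr_cst r 0).
  apply: (aeS fg) => t e tr; rewrite e// scaleN1r addNr /mnormsq big1 // => i _; rewrite big1 // => j _.
  by rewrite mxE cabs0 expr0n.
have e1 : Ir r (fun t => mnormsq (T (fun t => -1 *: f t + g t) t)) = 0.
  apply/eqP; rewrite eq_le Ir_ge0 ?andbT; last by move=> t _; exact: mnormsq_ge0.
  by have := hM _ hd; rewrite e0 mulr0.
have e2 := mnormsq_ae0 r0 (op_L2 hd) e1.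
apply: (aeS2 e2 (op_lin (-1) hf hg)) => x h1 h2 xr.
have := h2 xr; rewrite h1// scaleN1r addrC => /esym/eqP; rewrite subr_eq0 => /eqP ->//.
Qed.

(** Linearity is given for a f + g, so T 0 = 0 has to be derived first, from 0 = -1 0 + 0. *)
Lemma op_Z a f : mL2 r f -> aeq (T (fun x => a *: f x)) (fun x => a *: T f x).
Proof.
move=> hf; have h0 : mL2 r (fun=> 0 : 'cV[C]_n) by exact: mBM_L2 (mBM_cst r 0).
have haf : mL2 r (fun x => a *: f x) by apply: mL2_Z => //; exact: CBM_cst.
have t0 : aeq (T (fun=> 0)) (fun=> 0).
  have := op_lin (-1) h0 h0.
  have e : aeq (T (fun x => -1 *: (0 : 'cV[C]_n) + 0)) (T (fun=> 0)).
    by apply: op_aeq => //; [exact: mL2_lc|apply: aeq_on => x _; rewrite scaler0 addr0].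
  move=> h; apply: (aeS2 h e) => x h1 h2 xr; rewrite -h2// h1// scaleN1r addNr//.
have e : aeq (T (fun x => a *: f x)) (T (fun x => a *: f x + 0)).
  by apply: op_aeq => //; [exact: mL2_lc|apply: aeq_on => x _; rewrite addr0].
apply: aeq_trans e _; apply: (aeq_trans (op_lin a hf h0)).
by apply: (aeS t0) => x h xr; rewrite h// addr0.
Qed.

Lemma op_sum k (a : 'I_k -> C) (f : 'I_k -> R -> 'cV[C]_n) : (forall i, mL2 r (f i)) ->
  mL2 r (fun x => \sum_i a i *: f i x) /\
  aeq (T (fun x => \sum_i a i *: f i x)) (fun x => \sum_i a i *: T (f i) x).
Proof.
elim: k a f => [|k IH] a f hf.
  have h0 : mL2 r (fun=> 0 : 'cV[C]_n) by exact: mBM_L2 (mBM_cst r 0).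
  have hs : mL2 r (fun x => \sum_i a i *: f i x) by have := h0; congr (mL2 r _); apply/funext => x; rewrite big_ord0.
  split=> //; have := op_Z 0 h0 => h.
  have e : aeq (T (fun x => \sum_i a i *: f i x)) (T (fun x => 0 *: (0 : 'cV[C]_n))).
    by apply: op_aeq => //; [apply: mL2_Z => //; exact: CBM_cst|apply: aeq_on => x _; rewrite big_ord0 scaler0].
  apply: (aeq_trans e); apply: (aeS h) => x e' xr; rewrite e'// big_ord0 scale0r//.
have [h1 h2] := IH (fun i => a (lift ord0 i)) (fun i => f (lift ord0 i)) (fun i => hf _).
have hs : mL2 r (fun x => \sum_i a i *: f i x).
  by have := mL2_lc (a ord0) (hf ord0) h1; congr (mL2 r _); apply/funext => x; rewrite big_ord_recl.
split=> //.
have e : aeq (T (fun x => \sum_i a i *: f i x)) (T (fun x => a ord0 *: f ord0 x + \sum_(i < k) a (lift ord0 i) *: f (lift ord0 i) x)).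
  by apply: op_aeq => //; [exact: mL2_lc|apply: aeq_on => x _; rewrite big_ord_recl].
apply: (aeq_trans e); apply: (aeS2 (op_lin (a ord0) (hf ord0) h1) h2) => x e1 e2 xr.
by rewrite e1// e2// big_ord_recl.
Qed.

End BoundedOperators.

Section Polynomials.
Context {R : realType} (r : R) (r0 : 0 < r).

(** Taylor's formula with even monomials only, normalized as in [sim_E_monomial], where the action
    of [E] is known. *)
Lemma absp_expand N t :
  (absp r N).[t] = \sum_(j < size (prim (absp r N))) (absp r N)^`(j.*2).[0] * (t ^+ j.*2 / (j.*2)`!%:R).
Proof.
have cE j : (absp r N)`_(j.*2) = (absh r N)`_j.
  by rewrite /absp coef_comp_poly_Xn// -muln2 dvdn_mull// mulnK.
have sz : (size (absh r N) <= size (prim (absp r N)))%N.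
  have h : (size (absp r N) <= size (prim (absp r N)))%N.
    by rewrite -{1}(prim_deriv (absp r N)); apply: (leq_trans (size_poly _ _)); exact: leq_pred.
  apply: leq_trans h; apply/leq_sizeP => j hj; rewrite -cE nth_default//.
  by apply: (leq_trans hj); rewrite -addnn leq_addr.
rewrite {1}/absp horner_comp hornerXn (horner_coef_wide _ sz); apply: eq_bigr => j _.
rewrite horner_coef0 coef_derivn addn0 ffactnn cE -exprM mul2n -mulr_natr; field.
by rewrite pnatr_eq0 -lt0n fact_gt0.
Qed.

Lemma Ir_moment x k : 0 <= x <= r -> Ir x (fun t => (t - x) * t ^+ k) = - (x ^+ k.+2 / (k.+1 * k.+2)%:R).
Proof.
move=> xr.
pose P : {poly R} := (k.+2%:R)^-1 *: 'X^(k.+2) - (x / k.+1%:R) *: 'X^(k.+1).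
have e : (fun t : R => (t - x) * t ^+ k) = (fun t => P^`().[t]).
  apply/funext => t; rewrite /P derivB !derivZ !derivXn hornerD hornerN !hornerZ !hornerMn !hornerXn /=.
  rewrite -[_ *+ k.+2]mulr_natr -[_ *+ k.+1]mulr_natr exprS; field.
  by rewrite !gt_eqF// ltr_pwDl.
rewrite e (Ir_poly _ r0 xr) /P !hornerD !hornerN !hornerZ !hornerXn !expr0n /= !mulr0 subrr subr0 natrM.
rewrite exprS [x ^+ k.+1]exprS; field.
by rewrite !gt_eqF// ltr_pwDl.
Qed.

End Polynomials.

(** * Frames for the indefinite form J *)

Section Frames.
Context {R : realType}.
Local Notation C := (cplx R).
Variable p : nat.
Local Notation J := (Jmx (R := R) p).
Local Notation "'i" := (imag_unit : C).

Lemma sandwich a b c d (A : 'M[C]_(a, b)) (X : 'M[C]_(b, p + p)) (Y : 'M[C]_(c, p + p)) (B : 'M[C]_(d, c)) :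
  (A *m X) *m J *m (B *m Y)^t* = A *m (X *m J *m Y^t*) *m B^t*.
Proof. by rewrite mulmx_tJ !mulmxA. Qed.

Lemma form_tJ a b (X : 'M[C]_(a, p + p)) (Y : 'M[C]_(b, p + p)) : (X *m J *m Y^t*)^t* = Y *m J *m X^t*.
Proof. by rewrite !mulmx_tJ mx_tJK JmxJ mulmxA. Qed.

Lemma scalar_tJ (c : C) : ((c%:M : 'M[C]_p)^t*) = (c^*)%:M.
Proof. by rewrite tr_scalar_mx map_scalar_mx. Qed.

Variables b d : 'M[C]_(p, p + p).
Hypothesis bb : b *m J *m b^t* = 0.
Hypothesis db : d *m J *m b^t* = 'i%:M.
Hypothesis dd : d *m J *m d^t* = 0.

Lemma frame_bd : b *m J *m d^t* = (- 'i)%:M.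
Proof. by rewrite -form_tJ db scalar_tJ conjC_i. Qed.

(** The Gram matrix of the rows of b and d with respect to J is block-antidiagonal with entries -i
    and i; its inverse gives the inverse of the frame, so these rows form a basis. *)
Lemma frame_inv : row_mx ('i *: (J *m d^t*)) (- 'i *: (J *m b^t*)) *m col_mx b d = 1%:M.
Proof.
apply: mulmx1C; rewrite mul_col_row -!scalemxAr !mulmxA bb db dd frame_bd.
rewrite !scaler0 !scale_scalar_mx mulrN sqr_i opprK mulNr sqr_i opprK.
by rewrite -scalar_mx_block.
Qed.

Lemma frame_expand a (X : 'M[C]_(a, p + p)) :
  X = 'i *: ((X *m J *m d^t*) *m b) - 'i *: ((X *m J *m b^t*) *m d).
Proof.
rewrite -[LHS]mulmx1 -frame_inv mul_row_col mulmxDr -!scalemxAl -!scalemxAr scaleNr !mulmxA.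
by [].
Qed.

End Frames.

(** * Unitary gauge and reduction to a Schroedinger equation *)

Section Gauge.
Context {R : realType} (r : R) (r0 : 0 < r).
Local Notation C := (cplx R).
Variable p : nat.
Local Notation J := (Jmx (R := R) p).
Local Notation "'i" := (imag_unit : C).
Variables beta db ddb : R -> 'M[C]_(p, p + p).
Hypothesis bAC : mAC r beta db.
Hypothesis dbAC : mAC r db ddb.
Hypothesis H0 : forall x, 0 <= x <= r -> beta x *m J *m (beta x)^t* = 0.
Hypothesis H1 : forall x, 0 <= x <= r -> db x *m J *m (beta x)^t* = 'i%:M.

Lemma mint0_eq m n (F : R -> 'M[C]_(m, n)) x : 0 <= x -> (forall t, 0 <= t <= x -> F t = 0) -> mint x F = 0.
Proof.
move=> x0 h; apply/matrixP => i j; rewrite mintE (@cint_eq _ _ (fun=> 0)) ?cint_cst ?mul0r ?mxE//.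
by move=> t /h ->; rewrite mxE.
Qed.

Lemma mAC_constant m n (F f : R -> 'M[C]_(m, n)) : mAC r F f -> (forall x, 0 <= x <= r -> f x = 0) ->
  forall x, 0 <= x <= r -> F x = F 0.
Proof.
move=> h f0 x xr; have /andP[x0 xr'] := xr; rewrite (mAC_E h xr) mint0_eq ?addr0// => t /andP[t0 tx].
by apply: f0; rewrite t0 (le_trans tx).
Qed.

(* Multiplying beta from the left by a unitary u0^* makes the form b' J b'^*
   vanish; the second derivative then satisfies a Schroedinger equation. *)
Lemma gauge : exists (u0 : R -> 'M[C]_p) (bt dbt ddbt : R -> 'M[C]_(p, p + p)) (Q : R -> 'M[C]_p),
  (forall x, 0 <= x <= r -> (u0 x)^t* *m u0 x = 1%:M) /\
  [/\ mBM r u0, bt 0 = beta 0, (forall x, 0 <= x <= r -> beta x = u0 x *m bt x),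
      mAC r bt dbt & mAC r dbt ddbt] /\
  [/\ forall x, 0 <= x <= r -> bt x *m J *m (bt x)^t* = 0,
      forall x, 0 <= x <= r -> dbt x *m J *m (bt x)^t* = 'i%:M,
      mL2 r Q, aeq r ddbt (fun x => Q x *m bt x) & aeq r (fun x => (Q x)^t*) Q].
Proof.
have r0' := ltW r0.
pose th x := db x *m J *m (db x)^t*.
have thAC := mAC_M r0 (mAC_Mr r0 J dbAC) (mAC_J r0 dbAC).
have thJ x : (th x)^t* = th x by rewrite /th form_tJ.
(* Each of the two cross terms in the transformed b' J b'^* contributes i u0^* A0 u0, and 2 i (i/2)
   = -1 cancels the term with [th]. Being skew-Hermitian, [A0] generates a unitary [u0]. *)
pose A0 x := ('i / 2) *: th x.
have := mAC_Zc r0 ('i / 2) thAC; set dA0 := (X in mAC r _ X) => A0AC'.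
have A0AC : mAC r A0 dA0 := A0AC'.
have hA : mBM r A0 := mAC_BM r0 A0AC.
have two : (2 : C) = (2 : R)%:C by apply: complex_ext; rewrite /= ?mulr1n ?addr0.
have i2J : ('i / 2)^* = - ('i / 2) :> C.
  transitivity ('i^* * (2^-1)^* : C); first exact: rmorphM.
  rewrite conjC_i two -CV. rewrite conjC_real. by rewrite mulNr.
have A0J x : (A0 x)^t* = - A0 x by rewrite /A0 mx_tJZ thJ i2J scaleNr.
have [u0 [u0AC u00]] := ODE_exists r0 hA 1%:M.
pose du0 x := A0 x *m u0 x.
have du0AC := mAC_M r0 A0AC u0AC.
have du0J x : (du0 x)^t* = - ((u0 x)^t* *m A0 x) by rewrite /du0 mulmx_tJ A0J mulmxN.
have uu x : 0 <= x <= r -> (u0 x)^t* *m u0 x = 1%:M.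
  move=> xr; have h := mAC_M r0 (mAC_J r0 u0AC) u0AC.
  have e := mAC_constant h _ xr; rewrite e ?u00 ?scalar_tJ ?rmorph1 ?mulmx1//.
  by move=> t _; rewrite -/(du0 t) du0J mulNmx mulmxA addNr.
pose bt x := (u0 x)^t* *m beta x.
pose dbt x := (du0 x)^t* *m beta x + (u0 x)^t* *m db x.
have btAC : mAC r bt dbt := mAC_M r0 (mAC_J r0 u0AC) bAC.
have dbtAC := mAC_D r0 (mAC_M r0 (mAC_J r0 du0AC) bAC) (mAC_M r0 (mAC_J r0 u0AC) dbAC).
set ddbt := (X in mAC r _ X) in dbtAC.
have H1' x : 0 <= x <= r -> beta x *m J *m (db x)^t* = (- 'i)%:M.
  by move=> xr; rewrite -form_tJ H1// scalar_tJ conjC_i.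
have F0 x : 0 <= x <= r -> bt x *m J *m (bt x)^t* = 0.
  by move=> xr; rewrite /bt sandwich H0// mulmx0 mul0mx.
have F1 x : 0 <= x <= r -> dbt x *m J *m (bt x)^t* = 'i%:M.
  move=> xr; rewrite /dbt !mulmxDl !sandwich H0// H1// mulmx0 mul0mx add0r mx_tJK.
  by rewrite mul_mx_scalar -scalemxAl uu// scalemx1.
have F2 x : 0 <= x <= r -> dbt x *m J *m (dbt x)^t* = 0.
  move=> xr; rewrite /dbt mx_tJD !mulmxDl !mulmxDr !sandwich H0// H1// H1'// -/(th x).
  rewrite mulmx0 mul0mx add0r !mx_tJK !mul_mx_scalar -!scalemxAl du0J mulNmx -/(du0 x) scalerN scaleNr opprK.
  have e : (u0 x)^t* *m A0 x *m u0 x = ('i / 2) *: ((u0 x)^t* *m th x *m u0 x).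
    by rewrite /A0 -scalemxAr -scalemxAl.
  rewrite /du0 mulmxA e scalerA addrA -scalerDl -[X in _ + X]scale1r -scalerDl -mulrDl.
  have -> : ('i + 'i) * ('i / 2) + 1 = 0 :> C.
    have -> : ('i + 'i) * ('i / 2) = 'i * 'i :> C by field.
    by rewrite sqr_i addNr.
  by rewrite scale0r.
(* The coefficient of bt in the expansion of bt'' in the frame (bt, bt'). Differentiating bt' J bt^*
   = i removes the coefficient of bt', and differentiating bt' J bt'^* = 0 gives Q = Q^*. *)
pose Q x := 'i *: (ddbt x *m J *m (dbt x)^t*).
have L2dd : mL2 r ddbt := mAC_L2 dbtAC.
have dbtBM : mBM r dbt := mAC_BM r0 dbtAC.
have QL2 : mL2 r Q.
  apply: mL2_Z; first exact: CBM_cst.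
  by apply: mL2_mulr; [apply: mL2_mulr => //; exact: mBM_cst|exact: mBM_J].
have z0 : mAC r (fun x => dbt x *m J *m (dbt x)^t*) (fun=> 0 : 'M[C]_p).
  by apply: (mAC_ext r0) (mAC_cst r0 0) => x xr //; rewrite F2.
have z1 : mAC r (fun x => dbt x *m J *m (bt x)^t*) (fun=> 0 : 'M[C]_p).
  by apply: (mAC_ext r0) (mAC_cst r0 'i%:M) => x xr //; rewrite F1.
(* Both forms are constant, so the densities supplied by the product rule vanish almost
   everywhere. *)
have a0 := mAC_unique r0 (mAC_M r0 (mAC_Mr r0 J dbtAC) (mAC_J r0 dbtAC)) z0.
have a1 := mAC_unique r0 (mAC_M r0 (mAC_Mr r0 J dbtAC) (mAC_J r0 btAC)) z1.
exists u0, bt, dbt, ddbt, Q; split; [exact: uu|split; split=> //].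
- by have := mAC_BM r0 u0AC.
- by rewrite /bt u00 scalar_tJ rmorph1 mul1mx.
- by move=> x xr; rewrite /bt mulmxA (mulmx1C (uu x xr)) mul1mx.
- apply: (aeS a1) => x h xr; have xr' : 0 <= x <= r by case/andP: xr => ? ?; rewrite !ltW.
  have := h xr; rewrite F2// addr0 => e.
  by rewrite [LHS](frame_expand (F0 x xr') (F1 x xr') (F2 x xr')) e mul0mx scaler0 subr0 /Q scalemxAl.
- apply: (aeS a0) => x h xr; have /eqP := h xr; rewrite addr_eq0 => /eqP e.
  rewrite /Q mx_tJZ form_tJ conjC_i e scalerN scaleNr//.
Qed.

End Gauge.

(** * The Volterra operators K and A on matrix functions *)

Section Operators.
Context {R : realType} (r : R) (r0 : 0 < r).
Local Notation C := (cplx R).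
Variable p : nat.
Local Notation J := (Jmx (R := R) p).
Local Notation "'i" := (imag_unit : C).

Definition Kmx m (b : R -> 'M[C]_(p, p + p)) (g : R -> 'M[C]_(p, m)) x : 'M[C]_(p, m) :=
  'i *: (b x *m J *m mint x (fun t => (b t)^t* *m g t)).

Definition Amx m (g : R -> 'M[C]_(p, m)) x : 'M[C]_(p, m) := mint x (fun t => (t - x)%:C *: g t).

Lemma form_L2 m (b : R -> 'M[C]_(p, p + p)) (g : R -> 'M[C]_(p, m)) : mBM r b -> mL2 r g -> mL2 r (fun t => (b t)^t* *m g t).
Proof. by move=> hb hg; apply: mL2_mull => //; exact: mBM_J. Qed.

Lemma Kmx_aeq m b (f g : R -> 'M[C]_(p, m)) : mBM r b -> mL2 r f -> mL2 r g -> aeq r f g ->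
  forall x, 0 <= x <= r -> Kmx b f x = Kmx b g x.
Proof.
move=> hb hf hg fg x /andP[_ xr]; rewrite /Kmx; congr (_ *: (_ *m _)).
apply: (mint_ae xr (mL2_L1 (form_L2 hb hf)) (mL2_L1 (form_L2 hb hg))).
by apply: (aeS fg) => t h tr; rewrite h.
Qed.

Lemma Kmx_mul m (b : R -> 'M[C]_(p, p + p)) (g : R -> 'M[C]_(p, m)) k (c : 'M[C]_(m, k)) : mBM r b -> mL2 r g ->
  forall x, 0 <= x <= r -> Kmx b (fun t => g t *m c) x = Kmx b g x *m c.
Proof.
move=> hb hg x /andP[_ xr]; rewrite /Kmx -scalemxAl; congr (_ *: _).
rewrite -[RHS]mulmxA -(mint_mulr c xr (mL2_L1 (form_L2 hb hg))); congr (_ *m _).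
by apply: mint_eq => t _; rewrite mulmxA.
Qed.

(** The unitary factor cancels under the integral, so multiplication by [u0] intertwines the
    operators built from [bt] and from [b]. *)
Lemma Kmx_gauge m (b bt : R -> 'M[C]_(p, p + p)) (u0 : R -> 'M[C]_p) (g : R -> 'M[C]_(p, m)) :
  (forall x, 0 <= x <= r -> (u0 x)^t* *m u0 x = 1%:M) -> (forall x, 0 <= x <= r -> b x = u0 x *m bt x) ->
  forall x, 0 <= x <= r -> Kmx b (fun t => u0 t *m g t) x = u0 x *m Kmx bt g x.
Proof.
move=> uu e x xr; have /andP[x0 xr'] := xr; rewrite /Kmx e// -scalemxAr !mulmxA; congr (_ *: (_ *m _)).
apply: mint_eq => t /andP[t0 tx]; have tr : 0 <= t <= r by rewrite t0 (le_trans tx).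
by rewrite e// mulmx_tJ !mulmxA -[_ *m u0 t]mulmxA uu// mulmx1.
Qed.

Lemma weight_L2 m (g : R -> 'M[C]_(p, m)) x : mL2 r g -> mL2 r (fun t => (t - x)%:C *: g t).
Proof.
move=> hg; apply: mL2_Z => //; have := AC_BM r0 (AC_affine r0 (- x) 1); congr (CBM r _).
by apply/funext => t; rewrite mul1r addrC.
Qed.

Lemma Amx_aeq m (f g : R -> 'M[C]_(p, m)) : mL2 r f -> mL2 r g -> aeq r f g ->
  forall x, 0 <= x <= r -> Amx f x = Amx g x.
Proof.
move=> hf hg fg x /andP[_ xr]; apply: (mint_ae xr (mL2_L1 (weight_L2 x hf)) (mL2_L1 (weight_L2 x hg))).
by apply: (aeS fg) => t h tr; rewrite h.
Qed.

(** A is minus twofold integration from 0, the weight t - x being the result of exchanging the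
    integrals. *)
Lemma Amx_AC m (f : R -> 'M[C]_(p, m)) : mL2 r f -> mAC r (Amx f) (fun x => - mint x f).
Proof.
move=> hf; have tf : mL2 r (fun t => t%:C *: f t).
  by have := weight_L2 0 hf; congr (mL2 r _); apply/funext => t; rewrite subr0.
have := mAC_D r0 (mAC_mint 0 tf) (mAC_N r0 (mAC_Z r0 (AC_id r) (mAC_mint 0 hf))).
apply: (mAC_ext r0) => x xr; rewrite !add0r; last by rewrite scale1r opprD addrCA subrr addr0.
have /andP[_ xr'] := xr; rewrite /Amx -(mintZ _ xr' (mL2_L1 hf)) -(mintN xr'); last first.
  by apply: mL2_L1; apply: mL2_Z => //; exact: CBM_cst.
rewrite -(mintD xr'); last 2 first.
- exact: mL2_L1.
- by apply: mL2_L1; apply: mL2_N; apply: mL2_Z => //; exact: CBM_cst.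
by apply: mint_eq => t _; rewrite CB scalerBl.
Qed.

Lemma Amx_L2 m (f : R -> 'M[C]_(p, m)) : mL2 r f -> mL2 r (Amx f).
Proof. by move=> hf; have := mBM_L2 (mAC_BM r0 (Amx_AC hf)). Qed.

Lemma cint_real (f : R -> R) x : 0 <= x -> cint x (fun t => (f t)%:C) = (Ir x f)%:C.
Proof. by move=> x0; rewrite cintE; apply: complex_ext => //=; rewrite Ir_cst ?mul0r. Qed.

Lemma Amx_poly m (c : 'M[C]_(p, m)) k x : 0 <= x <= r ->
  Amx (fun t => (t ^+ k / k`!%:R)%:C *: c) x = - ((x ^+ k.+2 / (k.+2)`!%:R)%:C *: c).
Proof.
move=> xr; have /andP[x0 xr'] := xr; apply/matrixP => i j; rewrite mintE [RHS]mxE [in RHS]mxE.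
have L0 : CBM r (fun t : R => ((t - x) * t ^+ k)%:C : C).
  have := CBM_poly r0 (('X - x%:P) * 'X^k) 0 1; congr (CBM r _); apply/funext => t.
  by rewrite add0r mul1r hornerM hornerXsubC hornerXn.
rewrite (cint_eq (g := fun t => (c i j / k`!%:R%:C) * ((t - x) * t ^+ k)%:C)); last first.
  by move=> t _; rewrite !mxE !CM CV; ring.
rewrite (cintZ _ xr' (CBM_CL1 L0)) cint_real// (Ir_moment r0 k xr); set X := x ^+ k.+2; clearbody X.
rewrite !CN !CM !CV !factS !natrM !CM.
have /andP[k0 /andP[k1 k2]] : [&& (k`!%:R%:C : C) != 0, (k.+1%:R%:C : C) != 0 & (k.+2%:R%:C : C) != 0].
  by rewrite !C_eq0 !pnatr_eq0 -!lt0n fact_gt0.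
move: k0 k1 k2; set a := (k`!%:R)%:C; set a1 := (k.+1%:R)%:C; set a2 := (k.+2%:R)%:C => k0 k1 k2.
by clearbody a a1 a2; field; rewrite k0 k1 k2.
Qed.

End Operators.

(** * Range and iterates of K in the gauge *)

Section Iterates.
Context {R : realType} (r : R) (r0 : 0 < r).
Local Notation C := (cplx R).
Variable p : nat.
Local Notation J := (Jmx (R := R) p).
Local Notation "'i" := (imag_unit : C).
Variables (bt dbt ddbt : R -> 'M[C]_(p, p + p)) (Q : R -> 'M[C]_p).
Hypothesis btAC : mAC r bt dbt.
Hypothesis dbtAC : mAC r dbt ddbt.
Hypothesis F0 : forall x, 0 <= x <= r -> bt x *m J *m (bt x)^t* = 0.
Hypothesis F1 : forall x, 0 <= x <= r -> dbt x *m J *m (bt x)^t* = 'i%:M.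
Hypothesis QL2 : mL2 r Q.
Hypothesis ddQ : aeq r ddbt (fun x => Q x *m bt x).
Hypothesis QJ : aeq r (fun x => (Q x)^t*) Q.

Lemma mAC_rsub m n q (F f : R -> 'M[C]_(m, n + q)) : mAC r F f ->
  mAC r (fun x => rsubmx (F x)) (fun x => rsubmx (f x)).
Proof.
by move=> h i j; have := h i (rshift n j); congr AC; apply/funext => x; rewrite mxE.
Qed.

Lemma mAC_lsub m n q (F f : R -> 'M[C]_(m, n + q)) : mAC r F f ->
  mAC r (fun x => lsubmx (F x)) (fun x => lsubmx (f x)).
Proof.
by move=> h i j; have := h i (lshift q j); congr AC; apply/funext => x; rewrite mxE.
Qed.

Let F1' x : 0 <= x <= r -> bt x *m J *m (dbt x)^t* = (- 'i)%:M.
Proof. by move=> xr; rewrite -form_tJ F1// scalar_tJ conjC_i. Qed.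

Let btBM : mBM r bt. Proof. by have := mAC_BM r0 btAC. Qed.

Definition dKmx m (g : R -> 'M[C]_(p, m)) x := 'i *: (dbt x *m J *m mint x (fun t => (bt t)^t* *m g t)).

(** bt J bt^* = 0 removes the boundary term of the first derivative, and bt' J bt^* = i turns that
    of the second into -g. *)
Lemma Kmx_AC m (g : R -> 'M[C]_(p, m)) : mL2 r g ->
  mAC r (Kmx bt g) (dKmx g) /\ mAC r (dKmx g) (fun x => Q x *m Kmx bt g x - g x).
Proof.
move=> hg; have hI := mAC_mint 0 (form_L2 btBM hg).
have h1 := mAC_Zc r0 'i (mAC_M r0 (mAC_Mr r0 J btAC) hI).
have h2 := mAC_Zc r0 'i (mAC_M r0 (mAC_Mr r0 J dbtAC) hI).
have h1' : mAC r (Kmx bt g) (dKmx g).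
  by apply: (mAC_ext r0) h1 => x xr; rewrite !add0r// mulmxA F0// mul0mx addr0.
split; first exact: h1'.
have h2' : mAC r (dKmx g) (fun x => 'i *: (ddbt x *m J *m mint x (fun t => (bt t)^t* *m g t)) - g x).
  apply: (mAC_ext r0) h2 => x xr; rewrite !add0r// mulmxA F1// mul_scalar_mx scalerDr scalerA sqr_i scaleN1r//.
apply: mAC_ext_ae h2'.
  by apply: mL2_D; [apply: mL2_mulr => //; have := mAC_BM r0 h1'|exact: mL2_N].
by apply: (aeS ddQ) => x e xr; rewrite e// /Kmx -scalemxAr !mulmxA.
Qed.

Lemma Kmx_at0 m (g : R -> 'M[C]_(p, m)) : Kmx bt g 0 = 0 /\ dKmx g 0 = 0.
Proof. by rewrite /Kmx /dKmx mint0 !mulmx0 scaler0. Qed.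

(** Lagrange's identity: by Q = Q^* the function bt'^* F - bt^* F' has derivative bt^* (Q F - F''),
    and it vanishes at 0. Applying i bt J to it returns F, because bt J bt'^* = -i and bt J bt^* =
    0. *)
Lemma Kmx_solve m (F dF ddF : R -> 'M[C]_(p, m)) : mAC r F dF -> mAC r dF ddF -> F 0 = 0 -> dF 0 = 0 ->
  mL2 r (fun x => Q x *m F x - ddF x) /\
  forall x, 0 <= x <= r -> F x = Kmx bt (fun x => Q x *m F x - ddF x) x.
Proof.
move=> FAC dFAC F00 dF00; have FBM := mAC_BM r0 FAC.
have L : mL2 r (fun x => Q x *m F x - ddF x).
  by apply: mL2_D; [exact: mL2_mulr|apply: mL2_N; exact: mAC_L2 dFAC].
split=> // x xr; have /andP[_ xr'] := xr.
have h := mAC_D r0 (mAC_M r0 (mAC_J r0 dbtAC) FAC) (mAC_N r0 (mAC_M r0 (mAC_J r0 btAC) dFAC)).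
have e : mint x (fun t => (bt t)^t* *m (Q t *m F t - ddF t)) = (dbt x)^t* *m F x - (bt x)^t* *m dF x.
  rewrite [RHS](mAC_E h xr) F00 dF00 !mulmx0 subrr add0r.
  apply: (mint_ae xr' (mL2_L1 (form_L2 btBM L)) (mAC_L1 h)).
  apply: (aeS2 ddQ QJ) => t e1 e2 tr.
  rewrite e1// mulmx_tJ e2// mulmxBr mulmxA opprD addrA addrK//.
rewrite /Kmx e mulmxBr !mulmxA F1'// F0// mul0mx subr0 mul_scalar_mx scalerA mulrN sqr_i opprK scale1r//.
Qed.

Fixpoint iter_K j : R -> 'M[C]_p := if j is k.+1 then fun x => - Kmx bt (iter_K k) x else fun x => rsubmx (bt x).
Definition iter_dK j : R -> 'M[C]_p := if j is k.+1 then fun x => - dKmx (iter_K k) x else fun x => rsubmx (dbt x).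

Lemma iter_K_AC j : mAC r (iter_K j) (iter_dK j) /\
  mAC r (iter_dK j) (fun x => Q x *m iter_K j x + (if j is k.+1 then iter_K k x else 0)).
Proof.
elim: j => [|j [IH _]] /=.
  split; first exact: mAC_rsub.
  apply: mAC_ext_ae (mAC_rsub dbtAC).
    apply: mL2_D; last exact: mBM_L2 (mBM_cst r _).
    by apply: mL2_mulr => //; have := mAC_BM r0 (mAC_rsub btAC).
  by apply: (aeS ddQ) => x e xr; rewrite e// addr0 mulmx_rsub.
have [h1 h2] := Kmx_AC (mBM_L2 (mAC_BM r0 IH)); split; first exact: mAC_N.
apply: (mAC_ext r0) (mAC_N r0 h2) => x xr //; by rewrite opprB addrC mulmxN.
Qed.

End Iterates.

(** * Action of E and regularity of Phi1 *)

Section Similarity.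
Context {R : realType} (r : R) (r0 : 0 < r).
Local Notation C := (cplx R).
Variable p : nat.
Local Notation J := (Jmx (R := R) p).
Local Notation "'i" := (imag_unit : C).
Variables beta db ddb : R -> 'M[C]_(p, p + p).
Hypothesis bAC : mAC r beta db.
Hypothesis dbAC : mAC r db ddb.
Hypothesis H0 : forall x, 0 <= x <= r -> beta x *m J *m (beta x)^t* = 0.
Hypothesis H1 : forall x, 0 <= x <= r -> db x *m J *m (beta x)^t* = 'i%:M.
Variables E Einv : (R -> 'cV[C]_p) -> (R -> 'cV[C]_p).
Hypothesis hS : similarity_operator r beta E Einv.

Let hE : bounded_operator r E. Proof. by case: hS => -[]. Qed.
Let hEi : bounded_operator r Einv. Proof. by case: hS => -[]. Qed.
Let bBM : mBM r beta. Proof. by have := mAC_BM r0 bAC. Qed.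
Let cstL2 (c : 'cV[C]_p) : mL2 r (fun=> c). Proof. exact: mBM_L2 (mBM_cst r c). Qed.

Lemma sim_EEinv f : mL2 r f -> aeq r (E (Einv f)) f.
Proof. by case: hS => _ h _ _ hf; apply/ae_equalP; case: (h _ (mL2_isL2 hf)). Qed.

Lemma sim_EinvE f : mL2 r f -> aeq r (Einv (E f)) f.
Proof. by case: hS => _ h _ _ hf; apply/ae_equalP; case: (h _ (mL2_isL2 hf)). Qed.

Lemma sim_K g : mL2 r g -> aeq r (Kmx beta (E g)) (E (Amx g)).
Proof.
move=> hg; have hEg := op_L2 hE hg; case: hS => _ _ h _.
have {}h : aeq r (Kmx beta (E g)) (E (Amx (Einv (E g)))).
  by apply/ae_equalP; exact: h (mL2_isL2 hEg).
apply: (aeq_trans h); have hi := op_L2 hEi hEg.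
apply: (op_aeq r0 hE); [exact: Amx_L2|exact: Amx_L2|].
by apply: aeq_on => x xr; apply: (Amx_aeq r0 hi hg _ xr); exact: sim_EinvE.
Qed.

(** [columnwise] treats the columns separately; linearity of [Einv] reassembles combinations of them
    with constant coefficients. *)
Lemma sim_Einv_col (B P : R -> 'M[C]_p) (c : 'cV[C]_p) : mBM r B -> aeq r P (columnwise Einv B) ->
  aeq r (Einv (fun x => B x *m c)) (fun x => P x *m c).
Proof.
move=> BBM h2; have hcol j : mL2 r (fun t => col j (B t)).
  by move=> i k; apply: eq_CL2 (CBM_CL2 (BBM i j)) => t _; rewrite !mxE.
have [hs h] := op_sum r0 hEi (fun j => c j 0) hcol.
have e x : \sum_j c j 0 *: col j (B x) = B x *m c.
  by apply/matrixP => i k; rewrite ord1 mxE summxE; apply: eq_bigr => j _; rewrite !mxE mulrC.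
have hb : mL2 r (fun x => B x *m c).
  by have := hs; congr (mL2 r _); apply/funext => x; exact: e.
apply: aeq_trans (op_aeq r0 hEi hb hs (aeq_on (fun x _ => esym (e x)))) _.
apply: (aeS2 h h2) => x e1 e2 xr; rewrite e1// e2//; apply/matrixP => i k; rewrite ord1 summxE mxE.
by apply: eq_bigr => j _; rewrite !mxE mulrC.
Qed.

Lemma sim_Einv_beta2 (c : 'cV[C]_p) : aeq r (Einv (fun x => beta2 beta x *m c)) (fun=> c).
Proof.
have b2 : mBM r (beta2 beta) by have := mAC_BM r0 (mAC_rsub bAC).
have /ae_equalP h2 : ae_equal r (columnwise Einv (beta2 beta)) (fun=> 1%:M) by case: hS.
apply: aeq_trans (sim_Einv_col c b2 (aeq_sym h2)) _.
by apply: aeq_on => x _; rewrite mul1mx.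
Qed.

Lemma sim_E_cst (c : 'cV[C]_p) : aeq r (E (fun=> c)) (fun x => beta2 beta x *m c).
Proof.
have hb : mL2 r (fun x => beta2 beta x *m c).
  by apply: mBM_L2; apply: mBM_mul; [have := mAC_BM r0 (mAC_rsub bAC)|exact: mBM_cst].
apply: aeq_trans (sim_EEinv hb); apply: (op_aeq r0 hE) => //; first exact: op_L2.
by apply: aeq_sym; exact: sim_Einv_beta2.
Qed.

Variables (u0 : R -> 'M[C]_p) (bt dbt ddbt : R -> 'M[C]_(p, p + p)) (Q : R -> 'M[C]_p).
Hypothesis u0BM : mBM r u0.
Hypothesis uu : forall x, 0 <= x <= r -> (u0 x)^t* *m u0 x = 1%:M.
Hypothesis bE : forall x, 0 <= x <= r -> beta x = u0 x *m bt x.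
Hypothesis btAC : mAC r bt dbt.
Hypothesis dbtAC : mAC r dbt ddbt.
Hypothesis F0 : forall x, 0 <= x <= r -> bt x *m J *m (bt x)^t* = 0.
Hypothesis F1 : forall x, 0 <= x <= r -> dbt x *m J *m (bt x)^t* = 'i%:M.
Hypothesis QL2 : mL2 r Q.
Hypothesis ddQ : aeq r ddbt (fun x => Q x *m bt x).
Hypothesis QJ : aeq r (fun x => (Q x)^t*) Q.

Let y := iter_K bt.
Let btBM : mBM r bt. Proof. by have := mAC_BM r0 btAC. Qed.
Let yAC j := iter_K_AC r0 btAC dbtAC F0 F1 QL2 ddQ j.
Let yBM j : mBM r (y j). Proof. by have := mAC_BM r0 (yAC j).1. Qed.

Let idBM : CBM r (fun t : R => t%:C : C). Proof. by have := AC_BM r0 (AC_id r). Qed.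
Let monL2 (c : 'cV[C]_p) k : mL2 r (fun t : R => (t ^+ k / k`!%:R)%:C *: c).
Proof.
apply: mL2_Z => //; have := CBM_poly r0 ((k`!%:R)^-1 *: 'X^k) 0 1; congr (CBM r _); apply/funext => t.
by rewrite add0r mul1r hornerZ hornerXn mulrC.
Qed.

Lemma sim_E_monomial (c : 'cV[C]_p) j :
  aeq r (E (fun t => (t ^+ j.*2 / (j.*2)`!%:R)%:C *: c)) (fun x => u0 x *m (y j x *m c)).
Proof.
have ycL2 k : mL2 r (fun t => u0 t *m (y k t *m c)).
  by apply: mBM_L2; apply: mBM_mul => //; apply: mBM_mul => //; exact: mBM_cst.
elim: j => [|j IH].
  apply: aeq_trans (op_aeq r0 hE (monL2 c 0%N) (cstL2 c) _) _.
    by apply: aeq_on => x _; rewrite expr0 fact0 divr1 scale1r.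
  apply: (aeq_trans (sim_E_cst c)); apply: aeq_on => x xr.
  by rewrite /beta2 bE// -mulmx_rsub mulmxA.
pose f t : 'cV[C]_p := (t ^+ j.*2 / (j.*2)`!%:R)%:C *: c.
have AfL2 : mL2 r (Amx f) by apply: (Amx_L2 r0); exact: monL2.
have e1 : aeq r (E (fun t => (t ^+ (j.+1).*2 / ((j.+1).*2)`!%:R)%:C *: c)) (E (fun t => -1 *: Amx f t)).
  apply: (op_aeq r0 hE) => //; first by apply: mL2_Z; [exact: CBM_cst|].
  by apply: aeq_on => x xr; rewrite (Amx_poly r0 c (j.*2) xr) scaleN1r opprK.
apply: (aeq_trans e1); apply: (aeq_trans (op_Z r0 hE (-1) (Amx_L2 r0 (monL2 c _)))).
apply: (aeS (sim_K (monL2 c (j.*2)))) => x e2 xr; rewrite -/f -e2//.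
have xr' : 0 <= x <= r by case/andP: xr => ? ?; rewrite !ltW.
rewrite (Kmx_aeq bBM (op_L2 hE (monL2 c _)) (ycL2 j) IH xr') (Kmx_gauge _ uu bE xr').
by rewrite (Kmx_mul c btBM (mBM_L2 (yBM j)) xr') /= scaleN1r mulNmx mulmxN.
Qed.

Lemma sim_E_absp (c : 'cV[C]_p) N :
  mL2 r (fun t => ((absp r N).[t])%:C *: c) /\
  aeq r (E (fun t => ((absp r N).[t])%:C *: c))
    (fun x => u0 x *m (trans y (size (prim (absp r N))) (absp r N) x 0 *m c)).
Proof.
set n := size _.
have [L h] := op_sum r0 hE (fun j : 'I_n => ((absp r N)^`(j.*2).[0])%:C) (fun j => monL2 c (j.*2)).
have e t : \sum_(j < n) ((absp r N)^`(j.*2).[0])%:C *: ((t ^+ j.*2 / (j.*2)`!%:R)%:C *: c) = ((absp r N).[t])%:C *: c.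
  rewrite (absp_expand r N t) -/n (_ : (\sum_j _)%:C = \sum_(j < n) ((absp r N)^`(j.*2).[0] * (t ^+ j.*2 / (j.*2)`!%:R))%:C :> C).
    by rewrite scaler_suml; apply: eq_bigr => j _; rewrite scalerA -CM.
  by elim/big_rec2: _ => // j a b _ <-; rewrite CD.
have L' : mL2 r (fun t => ((absp r N).[t])%:C *: c).
  by have := L; congr (mL2 r _); apply/funext => t; exact: e.
split=> //; apply: aeq_trans (op_aeq r0 hE L' L (aeq_on (fun x _ => esym (e x)))) _.
apply: (aeq_trans h).
apply: (aeS (ae_forall_fin (fun j : 'I_n => sim_E_monomial c j))) => x h1 xr.
rewrite /trans mulmx_suml mulmx_sumr; apply: eq_bigr => j _.
by rewrite h1// -scalemxAl -scalemxAr.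
Qed.

(** The difference of E(t c) and u0 Y c is one fixed L2 function. Replacing t by [absp] changes the
    first by the operator bound of [E] and the second by the uniform convergence of [trans_limit],
    so its norm is arbitrarily small. *)
Lemma sim_E_linear : exists Y dY gY : R -> 'M[C]_p, [/\ mAC r Y dY, mAC r dY gY, Y 0 = 0,
  dY 0 = rsubmx (bt 0) & forall c : 'cV[C]_p, aeq r (E (fun t => t%:C *: c)) (fun x => u0 x *m (Y x *m c))].
Proof.
have y00 j : y j.+1 0 = 0 by rewrite /y /= (Kmx_at0 bt dbt (y j)).1 oppr0.
have dy00 j : iter_dK bt dbt j.+1 0 = 0 by rewrite /= (Kmx_at0 bt dbt (y j)).2 oppr0.
have [Y [dY [gY [h1 h2 h3 h4 h5]]]] := trans_limit r0 QL2 (fun j => (yAC j).1) (fun j => (yAC j).2) y00 dy00.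
exists Y, dY, gY; split=> // c.
have YBM : mBM r Y := mAC_BM r0 h1.
have idL2 : mL2 r (fun t : R => t%:C *: c).
  exact: (mL2_Z idBM (cstL2 _)).
have YcL2 : mL2 r (fun x => u0 x *m (Y x *m c)).
  by apply: mBM_L2; apply: mBM_mul => //; apply: mBM_mul => //; exact: mBM_cst.
pose w x := E (fun t => t%:C *: c) x - u0 x *m (Y x *m c).
have wL2 : mL2 r w by apply: mL2_D; [exact: op_L2|exact: mL2_N].
suff : Ir r (fun t => mnormsq (w t)) = 0.
  move=> /(mnormsq_ae0 r0 wL2) h; apply: (aeS h) => x e xr.
  by apply/eqP; rewrite -subr_eq0; apply/eqP; exact: e.
have [M hM] := op_bound hE.
have [B B0 hB] := mBM_bound r0 u0BM.
(* From |a + b|^2 <= 2|a|^2 + 2|b|^2: the first summand collects the operator bound of [E], the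
   second the sup norm of [u0]. *)
pose K := 2 * M ^+ 2 * r * mabs c ^+ 2 + 2 * r * (B * mabs c) ^+ 2.
have K0 : 0 <= K.
  have -> : K = (2 * r) * ((M * mabs c) ^+ 2 + (B * mabs c) ^+ 2) by rewrite /K; ring.
  apply: mulr_ge0; first by rewrite mulr_ge0// ltW.
  by apply: addr_ge0; exact: sqr_ge0.
suff key e : 0 < e -> Ir r (fun t => mnormsq (w t)) <= K * e ^+ 2.
  set I := Ir _ _ in key *; have I0 : 0 <= I by apply: Ir_ge0 => t _; exact: mnormsq_ge0.
  apply/eqP; rewrite eq_le I0 andbT leNgt; apply/negP => Ip.
  (* For e = I/(I + K + 1), which is at most 1, one has K e^2 <= K e < I, contrary to [key]. *)
  have D0 : 0 < I + K + 1 by lra.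
  have e1 : I / (I + K + 1) <= 1 by rewrite ler_pdivrMr//; lra.
  have e0 : 0 < I / (I + K + 1) by rewrite divr_gt0.
  have := key _ e0; set e := I / _ in e0 e1 *.
  have he : e * (I + K + 1) = I by rewrite /e divfK// gt_eqF.
  clearbody e K I; nra.
move=> e0.
have [N0 hN] := h5 e e0.
have [N1 hN1] : exists N1, forall N, (N1 <= N)%N -> 2 * r / N.+1%:R <= e.
  exists (Num.truncn (2 * r / e)) => N NN; rewrite ler_pdivrMr// [leRHS]mulrC -ler_pdivrMr//.
  by apply: (le_trans (ltW (truncnS_gt _))); rewrite ler_nat.
pose N := maxn N0 N1.
pose a t : 'cV[C]_p := ((absp r N).[t])%:C *: c.
have [aL2 aE] := sim_E_absp c N.
pose d t := (-1) *: a t + t%:C *: c.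
have dL2 : mL2 r d by exact: mL2_lc.
set tr := fun x => trans y (size (prim (absp r N))) (absp r N) x 0 in aE.
have trBM : mBM r tr.
  by have := trans_BM r0 (fun j => (yAC j).1) (size (prim (absp r N))) (absp r N) 0 0; congr (mBM r _); apply/funext => s; rewrite mul0r addr0.
pose w2 x := u0 x *m ((tr x - Y x) *m c).
have w2BM : mBM r w2.
  by apply: mBM_mul => //; apply: mBM_mul; [apply: mBM_D => //; exact: mBM_N|exact: mBM_cst].
have w2L2 := mBM_L2 w2BM.
have EdL2 := op_L2 hE dL2.
have ww : aeq r w (fun x => E d x + w2 x).
  apply: (aeS2 aE (op_lin hE (-1) aL2 idL2)) => x e1 e2 xr; rewrite /w -/(d) e2// e1// /w2.
  by rewrite scaleN1r mulmxBl mulmxBr -/(tr x) [- _ + _]addrC addrA subrK.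
have LEd := L1r_mnormsq EdL2; have Lw2 := L1r_mnormsq w2L2.
rewrite (@Ir_ae _ r _ (fun t => mnormsq (E d t + w2 t)) r)//; first last.
- by apply: (aeS ww) => x ex xr; rewrite ex.
- by apply: L1r_mnormsq; exact: mL2_D.
- exact: L1r_mnormsq.
have rr : r <= r by [].
apply: (@le_trans _ _ (Ir r (fun t => 2 * mnormsq (E d t) + 2 * mnormsq (w2 t)))).
  apply: Ir_le => //; first by apply: L1r_mnormsq; exact: mL2_D.
    by apply: L1rD; exact: L1rZ.
  by move=> t _; exact: mnormsqD.
rewrite (IrD rr (L1rZ 2 LEd) (L1rZ 2 Lw2)) (IrZ 2 rr LEd) (IrZ 2 rr Lw2).
have b1 : Ir r (fun t => mnormsq (d t)) <= (e * mabs c) ^+ 2 * r.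
  rewrite -(Ir_cst _ (ltW r0)); apply: Ir_le => //; [exact: L1r_mnormsq|exact: BMr_L1 (BMr_cst r _)|].
  move=> t tr0; apply: (le_trans (mnormsq_le _)); rewrite lerXn2r ?nnegrE ?mabs_ge0 ?mulr_ge0 ?mabs_ge0 ?(ltW e0)//.
  rewrite /d /a scalerA -scalerDl mabsZ ler_wpM2r ?mabs_ge0// mulN1r addrC -CB cabs_real distrC.
  have /andP[t0 tr1] := tr0; rewrite -{2}(ger0_norm t0).
  apply: le_trans (absp_approx r0 _ _) (hN1 N (leq_maxr _ _)).
  by rewrite ger0_norm.
have b2 : Ir r (fun t => mnormsq (w2 t)) <= (B * (e * mabs c)) ^+ 2 * r.
  rewrite -(Ir_cst _ (ltW r0)); apply: Ir_le => //; first exact: BMr_L1 (BMr_cst r _).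
  move=> t tr0; apply: (le_trans (mnormsq_le _)); rewrite lerXn2r ?nnegrE ?mabs_ge0 ?mulr_ge0 ?mabs_ge0 ?(ltW e0)//.
  apply: (le_trans (mabsM _ _)); apply: ler_pM; rewrite ?mabs_ge0 ?hB//.
  apply: (le_trans (mabsM _ _)); rewrite ler_wpM2r ?mabs_ge0//.
  exact: (hN N t (leq_maxl _ _) tr0).
have b3 := hM d dL2.
have b4 : M ^+ 2 * Ir r (fun t => mnormsq (d t)) <= M ^+ 2 * ((e * mabs c) ^+ 2 * r) by rewrite ler_wpM2l ?sqr_ge0.
have -> : K * e ^+ 2 = 2 * (M ^+ 2 * ((e * mabs c) ^+ 2 * r)) + 2 * ((B * (e * mabs c)) ^+ 2 * r) by rewrite /K; ring.
lra.
Qed.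

(* The function F = bt1 - bt2 C - Y Dm vanishes to second order at 0, so that
   it lies in the range of the Volterra operator K. *)
Lemma sim_regular : \det (rsubmx (bt 0)) != 0 -> exists Phi1 dPhi g : R -> 'M[C]_p,
  [/\ mAC r Phi1 dPhi, mAC r dPhi g & aeq r Phi1 (columnwise Einv (beta1 beta))].
Proof.
move=> d0; have [Y [dY [gY [YAC dYAC Y0 dY0 hY]]]] := sim_E_linear.
pose B0 := rsubmx (bt 0).
have uB : B0 \in unitmx by rewrite unitmxE unitfE.
(* [Cm] and [Dm] solve F(0) = 0 and F'(0) = 0; the coefficient is B0 both times, because Y has value
   0 and slope B0 at 0. *)
pose Cm := invmx B0 *m lsubmx (bt 0).
pose Dm := invmx B0 *m (lsubmx (dbt 0) - rsubmx (dbt 0) *m Cm).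
pose F x := lsubmx (bt x) - rsubmx (bt x) *m Cm - Y x *m Dm.
pose dF x := lsubmx (dbt x) - rsubmx (dbt x) *m Cm - dY x *m Dm.
pose ddF x := lsubmx (ddbt x) - rsubmx (ddbt x) *m Cm - gY x *m Dm.
have FAC : mAC r F dF.
  exact: (mAC_D r0 (mAC_D r0 (mAC_lsub btAC) (mAC_N r0 (mAC_Mr r0 Cm (mAC_rsub btAC)))) (mAC_N r0 (mAC_Mr r0 Dm YAC))).
have dFAC : mAC r dF ddF.
  exact: (mAC_D r0 (mAC_D r0 (mAC_lsub dbtAC) (mAC_N r0 (mAC_Mr r0 Cm (mAC_rsub dbtAC)))) (mAC_N r0 (mAC_Mr r0 Dm dYAC))).
have F00 : F 0 = 0 by rewrite /F Y0 mul0mx subr0 /Cm mulKVmx// subrr.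
have dF00 : dF 0 = 0 by rewrite /dF dY0 /Dm mulKVmx// subrr.
clearbody Cm Dm; have [fL2 hF] := Kmx_solve r0 btAC dbtAC F0 F1 QL2 ddQ QJ FAC dFAC F00 dF00.
set f := fun x => _ in fL2 hF.
pose uf j t : 'cV[C]_p := u0 t *m (f t *m delta_mx j 0).
have fjL2 j : mL2 r (fun t => f t *m delta_mx j 0 : 'cV[C]_p) by apply: mL2_mulr => //; exact: mBM_cst.
have ufL2 j : mL2 r (uf j) by apply: mL2_mull.
(* The preimage of u0 f under [E], column by column; the identity F = K f of the gauge then reads u0
   F = E A G. *)
pose G t : 'M[C]_p := \matrix_(i, j) Einv (uf j) t i 0.
have Gcol j t : G t *m delta_mx j 0 = Einv (uf j) t.
  by rewrite -colE; apply/matrixP => i k; rewrite !mxE ord1.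
have gL2 j : mL2 r (Einv (uf j)) by exact: op_L2.
have GL2 : mL2 r G by move=> i j; apply: eq_CL2 (gL2 j i 0) => t _; rewrite mxE.
(* The image under E^{-1} of the decomposition beta1 = beta2 C + E(t D) + E A G, as a function
   defined at every point. *)
pose Phi1 x : 'M[C]_p := Cm + x%:C *: Dm + Amx G x.
pose dPhi x : 'M[C]_p := Dm + - mint x G.
have PAC : mAC r Phi1 dPhi.
  have := mAC_D r0 (mAC_D r0 (mAC_cst r0 Cm) (mAC_Z r0 (AC_id r) (mAC_cst r0 Dm))) (Amx_AC r0 GL2).
  by apply: (mAC_ext r0) => x xr //; rewrite add0r scaler0 addr0 scale1r.
have dPAC : mAC r dPhi (fun x => - G x).
  have := mAC_D r0 (mAC_cst r0 Dm) (mAC_N r0 (mAC_mint 0 GL2)).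
  by apply: (mAC_ext r0) => x xr; rewrite ?add0r.
exists Phi1, dPhi, (fun x => - G x); split=> //.
have b1col j x : col j (beta1 beta x) = beta1 beta x *m delta_mx j 0 by rewrite colE.
have colh j : aeq r (Einv (fun t => col j (beta1 beta t))) (fun x => Phi1 x *m delta_mx j 0).
  pose e : 'cV[C]_p := delta_mx j 0.
  have hcL2 : mL2 r (fun x => beta2 beta x *m (Cm *m e)).
    by apply: mBM_L2; apply: mBM_mul; [have := mAC_BM r0 (mAC_rsub bAC)|exact: mBM_cst].
  have YBM : mBM r Y := mAC_BM r0 YAC.
  have yL2 : mL2 r (fun x => u0 x *m (Y x *m (Dm *m e))).
    by apply: mBM_L2; apply: mBM_mul => //; apply: mBM_mul => //; exact: mBM_cst.
  have idL2 : mL2 r (fun t : R => t%:C *: (Dm *m e)).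
    exact: (mL2_Z idBM (cstL2 _)).
  have KL2 : mL2 r (E (Amx (Einv (uf j)))) by apply: op_L2 => //; exact: Amx_L2.
  pose s1 x := 1 *: (beta2 beta x *m (Cm *m e)) + u0 x *m (Y x *m (Dm *m e)).
  pose s2 x := 1 *: s1 x + E (Amx (Einv (uf j))) x.
  have s1L2 : mL2 r s1 by exact: mL2_lc.
  have s2L2 : mL2 r s2 by exact: mL2_lc.
  have colL2 : mL2 r (fun t => col j (beta1 beta t)).
    by move=> i k; apply: eq_CL2 (CBM_CL2 (mAC_BM r0 (mAC_lsub bAC) i j)) => t _; rewrite !mxE.
  have e1 : aeq r (fun t => col j (beta1 beta t)) s2.
    have hK := sim_K (gL2 j).
    apply: (aeS hK) => x ex xr; rewrite /s2 -ex// /s1 !scale1r b1col.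
    have xr' : 0 <= x <= r by case/andP: xr => ? ?; rewrite !ltW.
    have -> : Kmx beta (E (Einv (uf j))) x = u0 x *m (F x *m e).
      rewrite (Kmx_aeq bBM (op_L2 hE (gL2 j)) (ufL2 j) (sim_EEinv (ufL2 j)) xr').
      by rewrite (Kmx_gauge _ uu bE xr') (Kmx_mul _ btBM fL2 xr') hF.
    rewrite /beta1 /beta2 bE// -mulmx_lsub -mulmx_rsub -!mulmxA -!mulmxDr; congr (_ *m _).
    rewrite /F !mulmxBl -!mulmxA -/e; set a := _ *m e; set b := _ *m (Cm *m e); set c := _ *m (Dm *m e).
    by rewrite -[a - b - c]addrA -opprD [RHS]addrC subrK.
  have e2 := op_aeq r0 hEi colL2 s2L2 e1.
  apply: (aeq_trans e2); have l2 := op_lin hEi 1 s1L2 KL2; have l1 := op_lin hEi 1 hcL2 yL2.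
  have t1 := sim_Einv_beta2 (Cm *m e).
  have t2 : aeq r (Einv (fun x => u0 x *m (Y x *m (Dm *m e)))) (fun t => t%:C *: (Dm *m e)).
    apply: aeq_trans (op_aeq r0 hEi yL2 (op_L2 hE idL2) (aeq_sym (hY _))) _; exact: sim_EinvE.
  have t3 := sim_EinvE (Amx_L2 r0 (gL2 j)).
  have l1' : aeq r (Einv s1) (fun x => Cm *m e + x%:C *: (Dm *m e)).
    apply: (aeq_trans l1); apply: (aeS2 t1 t2) => x ex1 ex2 xr.
    by rewrite ex1// ex2// scale1r.
  apply: (aeq_trans l2); apply: (aeS2 l1' t3) => x ex1 ex2 xr.
  have xr' : 0 <= x <= r by case/andP: xr => ? ?; rewrite !ltW.
  rewrite ex1// ex2// scale1r /Phi1 !mulmxDl -scalemxAl; congr (_ + _).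
  have /andP[_ xr2] := xr'; rewrite /Amx -(mint_mulr (delta_mx j 0) xr2 (mL2_L1 (weight_L2 r0 x GL2))).
  by apply: mint_eq => t _; rewrite -scalemxAl Gcol.
apply: (aeS (ae_forall_fin colh)) => x h xr; apply/matrixP => i j; rewrite [RHS]mxE h//.
by rewrite -colE [RHS]mxE.
Qed.

End Similarity.

(** * Weyl functions *)

Section WeylBound.
Context {R : realType} (r : R) (r0 : 0 < r).
Local Notation C := (cplx R).
Variable p : nat.
Local Notation J := (Jmx (R := R) p).
Local Notation "'i" := (imag_unit : C).
Variables beta db : R -> 'M[C]_(p, p + p).
Hypothesis bAC : mAC r beta db.
Variables E Einv : (R -> 'cV[C]_p) -> (R -> 'cV[C]_p).
Hypothesis hS : similarity_operator r beta E Einv.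
Variables Phi1 dPhi : R -> 'M[C]_p.
Hypothesis PAC : mAC r Phi1 dPhi.
Hypothesis hP : aeq r Phi1 (columnwise Einv (beta1 beta)).
Variable W : R -> C -> 'M[C]_(p + p).
Hypothesis hW : fundamental_solution r beta W.

Let bBM : mBM r beta. Proof. by have := mAC_BM r0 bAC. Qed.
Let bC : mCcont r beta. Proof. exact: mAC_Ccont bAC. Qed.
Let rr : 0 <= (r : R) <= r. Proof. by rewrite (ltW r0) lexx. Qed.

Let W0 lam : W 0 lam = 1%:M. Proof. by case: (hW lam). Qed.
Let WAC lam := fundamental_mAC r0 bC hW lam.
Let WBM lam : mBM r (W^~ lam). Proof. by have := mAC_BM r0 (WAC lam). Qed.

Let gW lam x := beta x *m W x lam.
Let gWBM lam : mBM r (gW lam). Proof. exact: mBM_mul. Qed.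

Lemma fundamental_integral lam x : 0 <= x <= r ->
  W x lam = 1%:M + (lam * 'i) *: (J *m mint x (fun t => (beta t)^t* *m gW lam t)).
Proof.
move=> xr; have /andP[x0 xr'] := xr; rewrite (mAC_E (WAC lam) xr) W0; congr (_ + _).
have L : mL1 r (fun t => (beta t)^t* *m gW lam t) by apply: mBM_L1; apply: mBM_mul => //; exact: mBM_J.
rewrite -(mint_mull J xr' L) -(mintZ _ xr'); last by apply: mBM_L1; apply: mBM_mul; [exact: mBM_cst|]; apply: mBM_mul => //; exact: mBM_J.
by apply: mint_eq => t _; rewrite /gW -scalemxAl scalerA /Hmx !mulmxA.
Qed.

Let form_trace n (g : 'cV[C]_n) : (g^t* *m g) 0 0 = (mnormsq g)%:C.
Proof.
rewrite /mnormsq mxE (eq_bigr (fun i => (\sum_j cabs (g i j) ^+ 2)%:C)).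
  by elim/big_rec2: _ => // j a b _ ->; rewrite CD.
move=> i _; rewrite big_ord1 !mxE; apply: complex_ext; rewrite !reimE /= ?cabs_sqr; ring.
Qed.

Lemma J_form_split (v w : 'cV[C]_p) : Rez (((col_mx v w)^t* *m J *m col_mx v w) 0 0) = 2 * Rez ((v^t* *m w) 0 0).
Proof.
rewrite tr_col_mx map_row_mx mul_row_block !mulmx0 !mulmx1 add0r addr0 mul_row_col mxE.
have -> : (w^t* *m v) 0 0 = ((v^t* *m w) 0 0)^*.
  have <- : (v^t* *m w)^t* = w^t* *m v by rewrite mulmx_tJ mx_tJK.
  by rewrite !mxE.
by rewrite !reimE /=; ring.
Qed.

Lemma energy_balance lam (u : 'cV[C]_(p + p)) :
  Rez (((W r lam *m u)^t* *m J *m (W r lam *m u)) 0 0) =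
  Rez ((u^t* *m J *m u) 0 0) - 2 * Imz lam * Ir r (fun t => mnormsq (gW lam t *m u)).
Proof.
have e := energy r0 bC hW lam lam rr.
have L : mL1 r (fun t => (W t lam)^t* *m Hmx beta t *m W t lam).
  apply: mBM_L1; apply: mBM_mul => //; apply: mBM_mul; first exact: mBM_J.
  by apply: mBM_mul => //; exact: mBM_J.
have e2 : (W r lam *m u)^t* *m J *m (W r lam *m u) =
   u^t* *m J *m u + ('i * (lam - lam^*)) *: (u^t* *m mint r (fun t => (W t lam)^t* *m Hmx beta t *m W t lam) *m u).
  rewrite scalemxAl scalemxAr -e mulmxBr mulmxBl addrC subrK mulmx_tJ !mulmxA//.
have Lr : mL1 r (fun t => u^t* *m ((W t lam)^t* *m Hmx beta t *m W t lam)) by case: (mL1_mull (u^t*) (lexx r) L).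
have e3 : (u^t* *m mint r (fun t => (W t lam)^t* *m Hmx beta t *m W t lam) *m u) 0 0 =
   (Ir r (fun t => mnormsq (gW lam t *m u)))%:C.
  rewrite -(mint_mull _ (lexx r) L) -(mint_mulr u (lexx r) Lr) mintE -(cint_real _ (ltW r0)).
  apply: cint_eq => t _; rewrite -form_trace /gW /Hmx !mulmx_tJ !mulmxA//.
have e4 (A B : 'M[C]_1) c : (A + c *: B) 0 0 = A 0 0 + c * B 0 0 by rewrite !mxE.
rewrite e2 e4 e3; set a := (u^t* *m J *m u) 0 0; set b := Ir r _; clearbody a b.
by rewrite !reimE /=; ring.
Qed.

(** The energy balance leaves Im lambda times the norm of beta W u below Re v^* w, and the
    boundedness of [Einv] passes this on to h. The constant is the same for all lambda. *)
Lemma weyl_bound : exists2 M : R, 0 <= M & forall lam (v w : 'cV[C]_p), 0 < Imz lam ->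
  0 <= Rez (((W r lam *m col_mx v w)^t* *m J *m (W r lam *m col_mx v w)) 0 0) ->
  exists h : R -> 'cV[C]_p, [/\ mL2 r h,
    (forall x, 0 <= x <= r -> h x = Phi1 x *m v + w + lam *: Amx h x) &
    Ir r (fun t => mnormsq (h t)) * Imz lam <= M * Rez ((v^t* *m w) 0 0)].
Proof.
have hEi : bounded_operator r Einv by case: hS => -[].
have hE : bounded_operator r E by case: hS => -[].
have [M hM] := op_bound hEi; exists (M ^+ 2); first exact: sqr_ge0.
move=> lam v w lam0; rewrite energy_balance J_form_split => hJ.
set u := col_mx v w in hJ; pose g x : 'cV[C]_p := gW lam x *m u.
have gBM : mBM r g by apply: mBM_mul => //; exact: mBM_cst.
have gL2 := mBM_L2 gBM.
pose h0 := Einv g.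
have h0L2 : mL2 r h0 by exact: op_L2.
have AhL2 := Amx_L2 r0 h0L2.
have KgL2 : mL2 r (Kmx beta g).
  apply: mBM_L2; apply: mBM_Z; first exact: CBM_cst.
  apply: mBM_mul; first by apply: mBM_mul => //; exact: mBM_cst.
  by have := mBM_mint r0 (mL2_L1 (form_L2 bBM gL2)).
have b1BM : mBM r (beta1 beta) by have := mAC_BM r0 (mAC_lsub bAC).
have b2BM : mBM r (beta2 beta) by have := mAC_BM r0 (mAC_rsub bAC).
have b1L2 : mL2 r (fun x => beta1 beta x *m v) by apply: mBM_L2; apply: mBM_mul => //; exact: mBM_cst.
have b2L2 : mL2 r (fun x => beta2 beta x *m w) by apply: mBM_L2; apply: mBM_mul => //; exact: mBM_cst.
pose s1 x := 1 *: (beta1 beta x *m v) + beta2 beta x *m w.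
pose s x := lam *: Kmx beta g x + s1 x.
have s1L2 : mL2 r s1 by exact: mL2_lc.
have sL2 : mL2 r s by exact: mL2_lc.
(* Multiplying the integral equation of W by beta gives g = beta1 v + beta2 w + lambda K g. *)
have gs : aeq r g s.
  apply: aeq_on => x xr; have /andP[_ xr'] := xr.
  have L : mL1 r (fun t => (beta t)^t* *m gW lam t) by apply: mBM_L1; apply: mBM_mul => //; exact: mBM_J.
  rewrite /g /gW (fundamental_integral lam xr) mulmxDr mulmx1 mulmxDl addrC; congr (_ + _).
    rewrite /Kmx scalerA -scalemxAr -scalemxAl; congr (_ *: _).
    rewrite mulmxA -[LHS]mulmxA -(mint_mulr u xr' L); congr (_ *m _).
    by apply: mint_eq => t _; rewrite /g !mulmxA.
  by rewrite /s1 scale1r /u -[X in X *m _](hsubmxK (beta x)) mul_row_col.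
have Kh : aeq r (Einv (Kmx beta g)) (Amx h0).
  have k1 : aeq r (Kmx beta g) (E (Amx h0)).
    have k0 := sim_K r0 hS h0L2; apply: aeq_trans k0; apply: aeq_on => x xr.
    by apply: (Kmx_aeq bBM gL2 (op_L2 hE h0L2) _ xr); apply: aeq_sym; exact: (sim_EEinv hS).
  apply: aeq_trans (op_aeq r0 hEi KgL2 (op_L2 hE AhL2) k1) _; exact: (sim_EinvE hS).
(* [h0] satisfies the Volterra equation almost everywhere; [h] is the representative satisfying it
   at every point, because [Amx] does not see null sets. *)
pose h x : 'cV[C]_p := Phi1 x *m v + w + lam *: Amx h0 x.
have hh : aeq r h0 h.
  apply: (aeq_trans (op_aeq r0 hEi gL2 sL2 gs)).
  apply: (aeq_trans (op_lin hEi lam KgL2 s1L2)).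
  have t1 := sim_Einv_col r0 hS v b1BM hP; have t2 := sim_Einv_beta2 r0 bAC hS w.
  have t3 : aeq r (Einv s1) (fun x => Phi1 x *m v + w).
    apply: (aeq_trans (op_lin hEi 1 b1L2 b2L2)); apply: (aeS2 t1 t2) => x e1 e2 xr.
    by rewrite e1// e2// scale1r.
  by apply: (aeS2 Kh t3) => x e1 e2 xr; rewrite e1// e2// addrC.
have hL2 : mL2 r h.
  have PBM : mBM r Phi1 := mAC_BM r0 PAC.
  apply: mL2_D; last by apply: mL2_Z => //; exact: CBM_cst.
  by apply: mBM_L2; apply: mBM_D; [apply: mBM_mul => //; exact: mBM_cst|exact: mBM_cst].
exists h; split; first exact: hL2.
  by move=> x xr; rewrite {1}/h (Amx_aeq r0 h0L2 hL2 hh xr).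
have e : Ir r (fun t => mnormsq (h0 t)) = Ir r (fun t => mnormsq (h t)).
  apply: Ir_ae => //; try exact: L1r_mnormsq.
  by apply: (aeS hh) => x ex xr; rewrite ex.
rewrite -e; have b1 := hM g gL2; rewrite -/h0 in b1.
apply: (@le_trans _ _ (M ^+ 2 * Ir r (fun t => mnormsq (g t)) * Imz lam)).
  by rewrite ler_wpM2r// ltW.
by rewrite -mulrA ler_wpM2l ?sqr_ge0// mulrC; lra.
Qed.

End WeylBound.

(** * Estimates for one coordinate of the Volterra equation *)

Section WeylEstimate.
Context {R : realType} (r : R) (r0 : 0 < r).
Local Notation C := (cplx R).
Local Notation "'i" := (imag_unit : C).

Lemma Ir_decay (k : R) : 0 < k -> Ir r (fun t => expR (- k * t)) <= k^-1.
Proof.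
move=> k0; have [_ h] := AC_cexp r0 (- k)%:C; have rr : 0 <= (r : R) <= r by rewrite (ltW r0) lexx.
have cE t : (- k)%:C * cexp ((- k)%:C * t%:C) = (- k * expR (- k * t))%:C :> C by rewrite -CM cexp_real -CM.
have := h r rr; rewrite (cint_eq (fun t _ => cE t)) (cint_real _ (ltW r0)) mulr0 cexp0 -CM cexp_real -C1E -CD => /CI.
rewrite (IrZ _ (lexx r)); last exact: BMr_L1 (expR_BMr r0 (- k)).
by rewrite -[k^-1]mul1r ler_pdivlMr// => e; have := expR_gt0 (- k * r); lra.
Qed.

(** Cauchy-Schwarz with a free parameter; a = 1/|z| balances the two terms when the squared norm is
    of order |z|^{-2}. *)
Lemma young_Ir (a : R) (h : R -> C) : 0 < a -> CL2 r h ->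
  Ir r (fun t => cabs (h t)) <= a * r / 2 + Ir r (fun t => cabs (h t) ^+ 2) / (2 * a).
Proof.
move=> a0 hh; have [_ L2] := L2r_cabs hh; have L1 := L1r_cabs (CL2_CL1 hh).
have rr : r <= r by [].
have Lc : L1r r (fun=> a / 2) by exact: BMr_L1 (BMr_cst r _).
have -> : a * r / 2 + Ir r (fun t => cabs (h t) ^+ 2) / (2 * a) =
   Ir r (fun t => a / 2 + (2 * a)^-1 * cabs (h t) ^+ 2).
  rewrite (IrD rr Lc (L1rZ _ L2)) (IrZ _ rr L2) Ir_cst ?(ltW r0)// mulrC [_ / (2 * a)]mulrC; congr (_ + _); ring.
apply: Ir_le => //; first exact: L1rD Lc (L1rZ _ L2).
move=> t _; set c := cabs _; rewrite -subr_ge0.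
have -> : a / 2 + (2 * a)^-1 * c ^+ 2 - c = (2 * a)^-1 * (a - c) ^+ 2 by field; rewrite gt_eqF.
by rewrite mulr_ge0 ?sqr_ge0// invr_ge0 mulr_ge0// ltW.
Qed.

Variables (F f h a : R -> C) (w z : C).
Hypothesis FAC : AC r F f.
Hypothesis hL2 : CL2 r h.
Hypothesis aAC : AC r a (fun x => - cint x h).
Hypothesis a0 : a 0 = 0.
Hypothesis hE : forall x, 0 <= x <= r -> h x = F x + w + z ^+ 2 * a x.

Let mu := Ir r (fun t => cabs (h t)).
Let rr : 0 <= (r : R) <= r. Proof. by rewrite (ltW r0) lexx. Qed.

(** With m' = h and a' = -m, the function e^{izt} (m + i z a) has derivative e^{izt} (h - z^2 a) =
    e^{izt} (F + w). Integration over [0, r] and iz times the integral of e^{izt} being e^{izr} - 1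
    give the formula. *)
Lemma volterra_exact :
  'i * w + z * cint r (fun t => cexp ('i * z * t%:C) * F t) =
  cexp ('i * z * r%:C) * ('i * w + z * cint r h + 'i * z ^+ 2 * a r).
Proof.
have mAC := AC_cint 0 hL2.
pose e t : C := cexp ('i * z * t%:C).
have eAC : AC r e (fun t => ('i * z) * e t) := AC_cexp r0 ('i * z).
have eBM := AC_BM r0 eAC; have FBM := AC_BM r0 FAC.
have G := AC_M r0 eAC (AC_D mAC (AC_Z ('i * z) aAC)).
have [_ /(_ r rr)] := G; rewrite a0 cint0 mulr0 !addr0 mulr0 add0r add0r => G1.
have [_ /(_ r rr)] := eAC; rewrite {2}/e mulr0 cexp0 => e1.
have L1 := CBM_CL1 (CBM_M eBM FBM); have L2 := CBM_CL1 eBM.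
rewrite (cintZ _ (lexx r) L2) in e1.
have G2 : cint r (fun t => e t * F t) + w * cint r e = e r * (cint r h + 'i * z * a r).
  rewrite G1 -(cintZ w (lexx r) L2) -(cintD (lexx r) L1 (CL1_Z w L2)); apply: cint_eq => t tr.
  rewrite (hE tr) add0r; have i2 : ('i : C) ^+ 2 = -1 by rewrite expr2 sqr_i.
  have -> : 'i * z * e t * (cint t h + 'i * z * a t) + e t * (F t + w + z ^+ 2 * a t + 'i * z * - cint t h) =
     e t * F t + w * e t + e t * (z ^+ 2 * a t) * (1 + 'i ^+ 2) by ring.
  by rewrite i2 subrr mulr0 addr0.
rewrite -/(e r); have -> : cint r (fun t => cexp ('i * z * t%:C) * F t) = e r * (cint r h + 'i * z * a r) - w * cint r e.
  by rewrite -G2 addrK.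
have i2 : ('i : C) * 'i = -1 by exact: sqr_i.
have -> : z * (e r * (cint r h + 'i * z * a r) - w * cint r e) =
   z * e r * (cint r h + 'i * z * a r) + w * 'i * ('i * z * cint r e).
  have -> : w * 'i * ('i * z * cint r e) = 'i * 'i * (w * z * cint r e) by ring.
  by rewrite i2; ring.
have -> : 'i * z * cint r e = e r - 1 by rewrite e1 addrC addKr.
ring.
Qed.

(** Interpolation for a(r): integrating the derivative of |a|^2 gives |a(r)|^2 <= 2 mu times the L1
    norm of a, and the equation bounds |z|^2 times that norm, since z^2 a = h - F - w. The direct
    |a(r)| <= r mu would lose the o(z). *)
Lemma volterra_bounds (B : R) : z != 0 -> (forall x, 0 <= x <= r -> cabs (F x) <= B) ->
  cabs (cint r h) <= mu /\ (cabs z * cabs (a r)) ^+ 2 <= 2 * mu * (r * (B + cabs w) + mu).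
Proof.
move=> z0 hB; have hL1 := CL2_CL1 hL2; have Lh := L1r_cabs hL1.
have mu0 : 0 <= mu by apply: Ir_ge0 => t _; exact: cabs_ge0.
have hm x : 0 <= x <= r -> cabs (cint x h) <= mu.
  move=> xr; have /andP[x0 xr'] := xr; apply: (le_trans (cint_abs xr' hL1)).
  by apply: Ir_mono => // t _; exact: cabs_ge0.
split; first exact: hm.
have aBM := AC_BM r0 aAC; have La := L1r_cabs (CBM_CL1 aBM).
have A := AC_M r0 aAC (AC_J aAC); have [AL /(_ r rr)] := A; rewrite a0 mul0r add0r => A1.
have b1 : cabs (a r) ^+ 2 <= Ir r (fun t => 2 * mu * cabs (a t)).
  have -> : cabs (a r) ^+ 2 = cabs (a r * (a r)^*) by rewrite cabsM cabsJ expr2.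
  rewrite A1; apply: (cint_le (lexx r) (CL2_CL1 AL) (L1rZ _ La)) => t tr.
  apply: (le_trans (cabsD _ _)); rewrite !cabsM !cabsJ cabsN.
  have := ler_wpM2r (cabs_ge0 (a t)) (hm t tr); lra.
rewrite (IrZ _ (lexx r) La) in b1.
have b2 : cabs z ^+ 2 * Ir r (fun t => cabs (a t)) <= r * (B + cabs w) + mu.
  rewrite -(IrZ _ (lexx r) La) mulrC -(Ir_cst _ (ltW r0)).
  have Lc : L1r r (fun=> B + cabs w) by exact: BMr_L1 (BMr_cst r _).
  rewrite -(IrD (lexx r) Lc Lh); apply: Ir_le => //; [exact: L1rZ|exact: L1rD|].
  move=> t tr; rewrite -cabsX -cabsM.
  have -> : z ^+ 2 * a t = h t - (F t + w) by rewrite (hE tr) addrAC subrr add0r.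
  apply: (le_trans (cabsB _ _)); have := cabsD (F t) w; have := hB t tr; lra.
rewrite exprMn; apply: (le_trans (ler_wpM2l (sqr_ge0 (cabs z)) b1)).
rewrite mulrCA; apply: ler_wpM2l => //; by rewrite mulr_ge0.
Qed.

End WeylEstimate.

(** Bookkeeping of orders in rho, each up to powers of 1 + s: H is O(rho^{-2}), mu is O(rho^{-1}), q
    is O(rho^{-3/2}). The sum is thus O(rho^{1/2}) times 1 + s, and the two lower bounds on rho turn
    this into eta rho (1 + s). *)
Lemma tail_numeric (R : realType) (r s rho M c B H mu q eta K1 K2 : R) : 0 < r ->
  0 <= s -> 1 <= rho -> 0 <= M -> 0 < c -> 0 <= B -> 0 <= mu -> 0 <= q -> 0 < eta ->
  K1 = r + M / c -> K2 = r * (B + 1) + K1 ->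
  8 * K1 * K2 / eta ^+ 2 <= rho -> 2 * (1 + K1) / eta <= rho ->
  H * (c * rho ^+ 2) <= M * s -> mu <= rho^-1 * r / 2 + H / (2 * rho^-1) ->
  (rho * q) ^+ 2 <= 2 * mu * (r * (B + s) + mu) ->
  s + rho * mu + rho ^+ 2 * q <= eta * rho * (1 + s).
Proof.
move=> r0 s0 rho1 M0 c0 B0 mu0 q0 eta0 K1E K2E h1 h2 hH hmu hq.
have rho0 : 0 < rho by lra.
have Mc0 : 0 <= M / c by rewrite divr_ge0// ltW.
have K10 : 0 <= K1 by rewrite K1E; have := r0; lra.
have rB : 0 <= r * (B + 1) by rewrite mulr_ge0 ?(ltW r0)//; lra.
have K20 : 0 <= K2 by rewrite K2E; lra.
have s1 : 0 <= 1 + s by lra.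
have e1 : rho * mu <= K1 * (1 + s).
  have -> : K1 * (1 + s) = r + r * s + M / c + M * s / c by rewrite K1E; ring.
  have rs : 0 <= r * s by rewrite mulr_ge0// ltW.
  have b1 : rho * mu <= r / 2 + rho ^+ 2 * H / 2.
    apply: (le_trans (ler_wpM2l (ltW rho0) hmu)).
    have -> : rho * (rho^-1 * r / 2 + H / (2 / rho)) = r / 2 + rho ^+ 2 * H / 2 by field; rewrite gt_eqF.
    exact: lexx.
  have b2 : rho ^+ 2 * H <= M * s / c.
    by rewrite ler_pdivlMr//; have -> : rho ^+ 2 * H * c = H * (c * rho ^+ 2) by ring.
  have : 0 <= M * s / c by rewrite divr_ge0 ?mulr_ge0// ltW.
  by have := r0; lra.
have e2 : r * (B + s) + mu <= K2 * (1 + s).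
  have m1 : mu <= rho * mu by rewrite ler_peMl.
  have b1 : 0 <= r * (1 + B * s) by rewrite mulr_ge0 ?(ltW r0)// addr_ge0// mulr_ge0.
  have -> : K2 * (1 + s) = r * (B + s) + r * (1 + B * s) + K1 * (1 + s) by rewrite K2E; ring.
  lra.
have e3 : rho ^+ 2 * q <= eta / 2 * rho * (1 + s).
  have y0 : 0 <= eta / 2 * rho * (1 + s) by rewrite mulr_ge0// mulr_ge0 ?(ltW rho0)// divr_ge0// ltW.
  have x0 : 0 <= rho ^+ 2 * q by rewrite mulr_ge0// sqr_ge0.
  rewrite -(ler_pXn2r (n := 2)) ?nnegrE//.
  have -> : (rho ^+ 2 * q) ^+ 2 = rho ^+ 2 * (rho * q) ^+ 2 by ring.
  apply: (@le_trans _ _ (2 * rho * (K1 * (1 + s)) * (K2 * (1 + s)))).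
    apply: (le_trans (ler_wpM2l (sqr_ge0 rho) hq)).
    have -> : rho ^+ 2 * (2 * mu * (r * (B + s) + mu)) = 2 * rho * ((rho * mu) * (r * (B + s) + mu)) by ring.
    rewrite -[leRHS]mulrA; apply: ler_wpM2l; first by rewrite mulr_ge0// ltW.
    apply: ler_pM => //; first by rewrite mulr_ge0// ltW.
    by rewrite addr_ge0// mulr_ge0 ?(ltW r0)// addr_ge0.
  have h1' : 8 * K1 * K2 <= rho * eta ^+ 2 by rewrite -ler_pdivrMr// exprn_gt0.
  have -> : 2 * rho * (K1 * (1 + s)) * (K2 * (1 + s)) = (8 * K1 * K2) * (rho * (1 + s) ^+ 2 / 4) by field.
  have -> : (eta / 2 * rho * (1 + s)) ^+ 2 = (rho * eta ^+ 2) * (rho * (1 + s) ^+ 2 / 4) by field.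
  by rewrite ler_wpM2r// divr_ge0// mulr_ge0 ?sqr_ge0// ltW.
have e4 : (1 + K1) * (1 + s) <= eta / 2 * rho * (1 + s).
  rewrite ler_wpM2r//; have : 2 * (1 + K1) <= rho * eta by rewrite -ler_pdivrMr.
  lra.
have -> : eta * rho * (1 + s) = eta / 2 * rho * (1 + s) + eta / 2 * rho * (1 + s) by field.
lra.
Qed.

(** * Asymptotics of matrices in the Weyl disc *)

Section WeylRepresentation.
Context {R : realType} (r : R) (r0 : 0 < r).
Local Notation C := (cplx R).
Variable p : nat.
Local Notation J := (Jmx (R := R) p).
Local Notation "'i" := (imag_unit : C).
Variables beta db : R -> 'M[C]_(p, p + p).
Hypothesis bAC : mAC r beta db.
Variables E Einv : (R -> 'cV[C]_p) -> (R -> 'cV[C]_p).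
Hypothesis hS : similarity_operator r beta E Einv.
Variables Phi1 dPhi : R -> 'M[C]_p.
Hypothesis PAC : mAC r Phi1 dPhi.
Hypothesis hP : aeq r Phi1 (columnwise Einv (beta1 beta)).
Variable W : R -> C -> 'M[C]_(p + p).
Hypothesis hW : fundamental_solution r beta W.

(** Membership in the Weyl disc at lambda without reference to a pair: solutions starting on the
    graph of -iP end in the J-nonnegative cone at r. *)
Definition J_nonneg lam (P : 'M[C]_p) := forall v : 'cV[C]_p,
  let u := col_mx v (- 'i *: (P *m v)) in
  0 <= Rez (((W r lam *m u)^t* *m J *m (W r lam *m u)) 0 0).

Let remainder z (P : 'M[C]_p) := P + z *: mint r (fun t => cexp ('i * z * t%:C) *: Phi1 t).

(** The column norm of P appears on the right because the energy bound is Re v^* w with w = -iPv.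
    The second estimate, a direct bound of the Laplace integral, is what later controls that
    norm. *)
Lemma column_estimate (c : R) : 0 < c -> exists2 B : R, 0 <= B &
  forall eta : R, 0 < eta -> exists K : R, forall (z : C) (P : 'M[C]_p), K <= cabs z -> c * cabs z <= Imz z -> c * cabs z ^+ 2 <= Imz (z ^+ 2) ->
  J_nonneg (z ^+ 2) P -> forall k j,
    cabs (remainder z P k j) <= expR (- (r * Imz z)) * (eta * cabs z * (1 + mabs (col j P))) /\
    cabs (P k j - remainder z P k j) <= B / c.
Proof.
move=> c0; have [M M0 hM] := weyl_bound r0 bAC hS PAC hP hW.
have [B B0 hB] := mBM_bound r0 (mAC_BM r0 PAC).
exists B => // eta eta0; pose K1 := r + M / c; pose K2 := r * (B + 1) + K1.
have Mc0 : 0 <= M / c by rewrite divr_ge0// ltW.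
have K10 : 0 <= K1 by rewrite /K1; have := r0; lra.
have rB : 0 <= r * (B + 1) by rewrite mulr_ge0 ?(ltW r0)//; lra.
have K20 : 0 <= K2 by rewrite /K2; lra.
pose L1 := 8 * K1 * K2 / eta ^+ 2; pose L2 := 2 * (1 + K1) / eta.
have L10 : 0 <= L1.
  by apply: divr_ge0; [apply: mulr_ge0 => //; apply: mulr_ge0 => //|exact: sqr_ge0].
have L20 : 0 <= L2 by apply: divr_ge0; [apply: mulr_ge0 => //; lra|exact: ltW].
exists (1 + L1 + L2) => z P hK him him2 hJ k j.
set rho := cabs z in hK him him2 *.
have rho1 : 1 <= rho by lra.
have rho0 : 0 < rho by lra.
have imz0 : 0 < Imz z by apply: lt_le_trans him; rewrite mulr_gt0.
have im2 : 0 < Imz (z ^+ 2) by apply: lt_le_trans him2; rewrite mulr_gt0// exprn_gt0.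
(* With this choice i w is the j-th column of P, the quantity on the left of [volterra_exact]. *)
pose v : 'cV[C]_p := delta_mx j 0; pose w : 'cV[C]_p := - 'i *: (P *m v).
have wE l : 'i * w l 0 = P l j.
  by rewrite mxE mulrA mulrN sqr_i opprK mul1r /v -colE mxE.
have wabs l : cabs (w l 0) = cabs (P l j) by rewrite -wE cabsM cabs_i mul1r.
have sE : mabs w = mabs (col j P) by rewrite /w /v -colE mabsZ cabsN cabs_i mul1r.
have [h [hL2 hh hH]] := hM _ v w im2 (hJ v).
have hvw : (v^t* *m w) 0 0 = w j 0.
  rewrite mxE (bigD1 j)//= big1 ?addr0; first by rewrite !mxE !eqxx rmorph1 mul1r.
  by move=> l lj; rewrite !mxE (negbTE lj) rmorph0 mul0r.
rewrite hvw in hH.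
pose s := mabs (col j P).
have s0 : 0 <= s by exact: mabs_ge0.
have ws l : cabs (w l 0) <= s by rewrite /s -sE mabs_entry.
pose H := Ir r (fun t => mnormsq (h t)).
have hkL2 : CL2 r (fun t => h t k 0) by exact: hL2.
pose mu := Ir r (fun t => cabs (h t k 0)).
have mu0 : 0 <= mu by apply: Ir_ge0 => t _; exact: cabs_ge0.
have H0 : 0 <= H by apply: Ir_ge0 => t _; exact: mnormsq_ge0.
have HcE : H * (c * rho ^+ 2) <= M * s.
  apply: (le_trans (ler_wpM2l H0 him2)); apply: (le_trans hH); apply: ler_wpM2l => //.
  by apply: (le_trans (ler_norm _)); apply: (le_trans (cabs_Re _)).
have hmu : mu <= rho^-1 * r / 2 + H / (2 * rho^-1).
  have rhoV : 0 < rho^-1 by rewrite invr_gt0.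
  apply: (le_trans (young_Ir r0 rhoV hkL2)); rewrite lerD2l ler_pM2r ?invr_gt0 ?mulr_gt0//.
  have [_ Lk] := L2r_cabs hkL2.
  apply: Ir_le => //; first exact: L1r_mnormsq.
  move=> t _; rewrite /mnormsq (bigD1 k)//= big_ord1 lerDl sumr_ge0// => l _.
  by rewrite sumr_ge0// => ? _; exact: sqr_ge0.
pose F t := Phi1 t k j.
have FAC : AC r F (fun t => dPhi t k j) by exact: PAC.
pose a x := Amx h x k 0.
have aAC : AC r a (fun x => - cint x (fun t => h t k 0)).
  by have := Amx_AC r0 hL2 k 0; congr AC; apply/funext => x; rewrite mxE mintE.
have a00 : a 0 = 0 by rewrite /a /Amx mint0 mxE.
have hE x : 0 <= x <= r -> h x k 0 = F x + w k 0 + z ^+ 2 * a x.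
  have e0 (A A' D : 'cV[C]_p) q : (A + A' + q *: D) k 0 = A k 0 + A' k 0 + q * D k 0 by rewrite !mxE.
  by move=> xr; rewrite {1}hh// e0 {1}/v -colE mxE.
have ex := volterra_exact r0 FAC hkL2 aAC a00 hE.
have FB x : 0 <= x <= r -> cabs (F x) <= B.
  by move=> xr; apply: (le_trans (mabs_entry _ _ _)); exact: hB.
have z0 : z != 0 by rewrite -cabs_gt0.
have [bm bq] := volterra_bounds r0 hkL2 aAC a00 hE z0 FB.
have remE : remainder z P k j = 'i * w k 0 + z * cint r (fun t => cexp ('i * z * t%:C) * F t).
  rewrite /remainder mxE [X in _ + X]mxE mintE wE; congr (_ + _ * _).
  by apply: cint_eq => t _; rewrite mxE.
split.
  rewrite remE ex cabsM cabs_cexp.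
  have -> : Rez ('i * z * r%:C) = - (r * Imz z) by rewrite !reimE /=; ring.
  rewrite ler_wpM2l ?expR_ge0//.
  have q0 := cabs_ge0 (a r).
  have bq' : (rho * cabs (a r)) ^+ 2 <= 2 * mu * (r * (B + s) + mu).
    apply: (le_trans bq); apply: ler_wpM2l; first by rewrite mulr_ge0.
    by rewrite lerD2r ler_wpM2l ?(ltW r0)// lerD2l.
  have hL1 : L1 <= rho by lra.
  have hL2' : L2 <= rho by lra.
  apply: (le_trans _ (tail_numeric r0 s0 rho1 M0 c0 B0 mu0 q0 eta0 erefl erefl hL1 hL2' HcE hmu bq')).
  apply: (le_trans (cabsD _ _)); rewrite [cabs ('i * z ^+ 2 * a r)]cabsM [cabs ('i * z ^+ 2)]cabsM cabsX cabs_i mul1r lerD2r.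
  apply: (le_trans (cabsD _ _)); rewrite !cabsM cabs_i !mul1r lerD// ?ler_wpM2l//.
rewrite remE wE opprD addNKr cabsN cabsM.
have eL : CL1 r (fun t => cexp ('i * z * t%:C) * F t).
  exact: CBM_CL1 (CBM_M (AC_BM r0 (AC_cexp r0 _)) (AC_BM r0 FAC)).
have eB : L1r r (fun t => expR (- Imz z * t)) by exact: BMr_L1 (expR_BMr r0 _).
have b1 : cabs (cint r (fun t => cexp ('i * z * t%:C) * F t)) <= B * (Imz z)^-1.
  apply: (le_trans (cint_le (lexx r) eL (L1rZ B eB) _)).
    move=> t tr; rewrite cabsM cabs_cexp mulrC.
    have -> : Rez ('i * z * t%:C) = - Imz z * t by rewrite !reimE /=; ring.
    by rewrite ler_wpM2r ?expR_ge0// FB.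
  by rewrite (IrZ _ (lexx r) eB) ler_wpM2l// Ir_decay.
apply: (le_trans (ler_wpM2l (ltW rho0) b1)).
rewrite ler_pdivlMr//.
have -> : rho * (B * (Imz z)^-1) * c = B * ((c * rho) / Imz z) by ring.
by rewrite ler_piMr// ler_pdivrMr// mul1r.
Qed.

(** In the angle |z| e^{-r Im z} <= 1/(rc), so for small eta the two halves of [column_estimate]
    give s <= S for every column norm s of P; this bound is then put back into the first half. *)
Lemma weyl_estimate (c eps : R) : 0 < c -> 0 < eps -> exists K : R,
  forall (z : C) (P : 'M[C]_p), K < cabs z -> c * cabs z <= Imz z -> c * cabs z ^+ 2 <= Imz (z ^+ 2) ->
  J_nonneg (z ^+ 2) P ->
  mabs (P + z *: mint r (fun t => cexp ('i * z * t%:C) *: Phi1 t)) <= eps * cabs (z * cexp ('i * z * r%:C)).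
Proof.
move=> c0 eps0; pose q : R := p%:R + 1.
have q0 : 0 < q by rewrite ltr_wpDl.
have pq : p%:R <= q by rewrite lerDl.
have [B B0 hB] := column_estimate c0.
have Bc : 0 <= B / c by rewrite divr_ge0// ltW.
pose S := 2 * q * (B / c) + 1.
have S0 : 0 < 1 + S by rewrite /S; have := mulr_ge0 (ltW q0) Bc; lra.
have rc0 : 0 < r * c by exact: mulr_gt0.
(* The first bound lets half of 1 + s be absorbed, the second produces eps; q^2 accounts for summing
   over rows and columns. *)
pose eta := Num.min (r * c / (2 * q)) (eps / (q ^+ 2 * (1 + S))).
have eta0 : 0 < eta.
  rewrite lt_min; apply/andP; split; apply: divr_gt0 => //; first exact: mulr_gt0.
  by apply: mulr_gt0 => //; exact: exprn_gt0.
have eta1 : q * (eta / (r * c)) <= 1 / 2.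
  have h : eta <= r * c / (2 * q) by rewrite ge_min lexx.
  rewrite mulrA ler_pdivrMr//; apply: (le_trans (ler_wpM2l (ltW q0) h)).
  have -> : q * (r * c / (2 * q)) = 1 / 2 * (r * c) by field; rewrite gt_eqF.
  exact: lexx.
have eta2 : q ^+ 2 * eta * (1 + S) <= eps.
  have h : eta <= eps / (q ^+ 2 * (1 + S)) by rewrite ge_min lexx orbT.
  rewrite mulrAC mulrC -ler_pdivlMr//; by apply: mulr_gt0 => //; exact: exprn_gt0.
have [K hK] := hB eta eta0; have SE : S = 2 * q * (B / c) + 1 by [].
clearbody eta S.
exists K => z P /ltW zK h1 h2 hJ; have {}hK := hK z P zK h1 h2 hJ.
set rho := cabs z in h1 h2 zK hK *; set ex := expR (- (r * Imz z)) in hK *.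
have rho0 : 0 <= rho by exact: cabs_ge0.
have ex0 : 0 <= ex by exact: expR_ge0.
have exr : ex * rho <= (r * c)^-1.
  rewrite -[(r * c)^-1]mul1r ler_pdivlMr// /ex expRN -mulrA mulrC ler_pdivrMr ?expR_gt0// mul1r.
  apply: (@le_trans _ _ (r * Imz z)).
    by rewrite mulrCA ler_wpM2l ?(ltW r0)// mulrC.
  by have := expR_ge1Dx (r * Imz z); lra.
have sb j : mabs (col j P) <= S.
  set s := mabs _; have s0 : 0 <= s by exact: mabs_ge0.
  have h k : cabs (P k j) <= B / c + ex * (eta * rho * (1 + s)).
    have [b1 b2] := hK k j; have := cabsD (P k j - remainder z P k j) (remainder z P k j).
    by rewrite subrK -/s in b1 * => b3; lra.
  have t1 : s <= q * (B / c + ex * (eta * rho * (1 + s))).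
    have hn : 0 <= B / c + ex * (eta * rho * (1 + s)).
      by apply: addr_ge0 => //; apply: mulr_ge0 => //; apply: mulr_ge0; [apply: mulr_ge0 => //; exact: ltW|lra].
    have := @mabs_le_cst _ p 1 (col j P) (B / c + ex * (eta * rho * (1 + s))).
    move=> /(_ _)/le_trans; apply; first by move=> k l; rewrite mxE.
    by rewrite mul1r ler_wpM2r.
  have t2 : q * (ex * (eta * rho * (1 + s))) <= 1 / 2 * (1 + s).
    have -> : q * (ex * (eta * rho * (1 + s))) = (q * (eta * (ex * rho))) * (1 + s) by ring.
    rewrite ler_wpM2r//; first lra.
    apply: le_trans eta1; apply: ler_wpM2l; first exact: ltW.
    by apply: ler_wpM2l => //; exact: ltW.
  rewrite mulrDr in t1; have t3 : 2 * q * (B / c) = 2 * (q * (B / c)) by ring.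
  by set X := q * (B / c) in t1 t3; rewrite t3 in SE; lra.
have cE : cabs (z * cexp ('i * z * r%:C)) = rho * ex.
  by rewrite cabsM cabs_cexp; congr (_ * expR _); rewrite !reimE /=; ring.
rewrite cE.
have hn : 0 <= ex * (eta * rho * (1 + S)).
  by apply: mulr_ge0 => //; apply: mulr_ge0; [apply: mulr_ge0 => //; exact: ltW|exact: ltW].
have := @mabs_le_cst _ p p (remainder z P) (ex * (eta * rho * (1 + S))).
move=> /(_ _)/le_trans; apply.
  move=> k j; have [b1 _] := hK k j; apply: (le_trans b1); apply: ler_wpM2l => //.
  apply: ler_wpM2l; first by apply: mulr_ge0 => //; exact: ltW.
  by rewrite lerD2l.
apply: (@le_trans _ _ (q * (q * (ex * (eta * rho * (1 + S)))))).
  apply: ler_pM => //; first exact: mulr_ge0.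
  by apply: ler_wpM2r.
have -> : q * (q * (ex * (eta * rho * (1 + S)))) = (q ^+ 2 * eta * (1 + S)) * (rho * ex) by ring.
by apply: ler_wpM2r => //; exact: mulr_ge0.
Qed.

End WeylRepresentation.

(** * Analyticity and limits of matrix functions *)

Section AnalyticMatrices.
Context {R : realType}.
Local Notation C := (cplx R).

Lemma PS_conj (f : C -> C) z0 : PSat f z0^* -> PSat (fun z => (f z^*)^*) z0.
Proof.
move=> [a [B [rho [rho0 B0 h]]]]; exists (fun k => (a k)^*), B, rho; split=> // k n hk.
have := h k^* n; rewrite cabsJ => /(_ hk).
have <- : (z0 + k)^* = z0^* + k^* by exact: rmorphD.
have -> : psum (fun k => (a k)^*) k n = (psum a k^* n)^*.
  have cM (x y : C) : (x * y)^* = x^* * y^* by exact: rmorphM.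
  have cD (x y : C) : (x + y)^* = x^* + y^* by exact: rmorphD.
  have cX l (x : C) : (x ^+ l)^* = x^* ^+ l by exact: rmorphXn.
  elim: n => [|n IH]; first by rewrite /psum !big_ord0 conjC0.
  by rewrite !psumS IH cD cM cX conjCK.
have <- (x y : C) : (x - y)^* = x^* - y^* by exact: rmorphB.
by rewrite cabsJ.
Qed.

Lemma PS_sum I (s : seq I) (P : pred I) (F : I -> C -> C) z0 :
  (forall i, PSat (F i) z0) -> PSat (fun z => \sum_(i <- s | P i) F i z) z0.
Proof.
move=> hF; elim: s => [|i s IH].
  under eq_fun do rewrite big_nil; exact: PS_cst.
under eq_fun do rewrite big_cons; case: (P i) => //.
exact: PS_D.
Qed.

Lemma PS_prod I (s : seq I) (P : pred I) (F : I -> C -> C) z0 :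
  (forall i, PSat (F i) z0) -> PSat (fun z => \prod_(i <- s | P i) F i z) z0.
Proof.
move=> hF; elim: s => [|i s IH].
  under eq_fun do rewrite big_nil; exact: PS_cst.
under eq_fun do rewrite big_cons; case: (P i) => //.
exact: PS_M.
Qed.

Lemma PS_det n (A : C -> 'M[C]_n) z0 : (forall i j, PSat (fun z => A z i j) z0) -> PSat (fun z => \det (A z)) z0.
Proof.
move=> hA; apply: PS_sum => s; apply: PS_M; first exact: PS_cst.
by apply: PS_prod => i.
Qed.

Lemma PS_mulmx m n q (A : C -> 'M[C]_(m, n)) (B : C -> 'M[C]_(n, q)) z0 :
  (forall i j, PSat (fun z => A z i j) z0) -> (forall i j, PSat (fun z => B z i j) z0) ->
  forall i j, PSat (fun z => (A z *m B z) i j) z0.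
Proof.
by move=> hA hB i j; under eq_fun do rewrite mxE; apply: PS_sum => k; exact: PS_M.
Qed.

Lemma PS_neq0 (f : C -> C) z0 : PSat f z0 -> f z0 != 0 ->
  exists2 d : R, 0 < d & forall z, z != z0 -> cabs (z - z0) < d -> f z != 0.
Proof.
move=> /PS_cont/cvg_atC h; rewrite -cabs_gt0 => /h[d d0 hd]; exists d => // z _ /hd.
by apply: contraTneq => ->; rewrite sub0r cabsN ltxx.
Qed.

Lemma cvg_mulmx (T : Type) (F : set_system T) {FF : Filter F} m n q (A : T -> 'M[C]_(m, n)) (B : T -> 'M[C]_(n, q)) (A0 : 'M[C]_(m, n)) (B0 : 'M[C]_(n, q)) :
  A @ F --> A0 -> B @ F --> B0 -> (fun z => A z *m B z) @ F --> A0 *m B0.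
Proof.
move=> /cvg_mabs hA /cvg_mabs hB; apply/cvg_mabs => e e0.
have a0 := mabs_ge0 A0; have b0 := mabs_ge0 B0.
pose d := Num.min 1 (e / (mabs A0 + mabs B0 + 2)).
have D0 : 0 < mabs A0 + mabs B0 + 2 by lra.
have d0 : 0 < d by rewrite lt_min ltr01 divr_gt0.
have d1 : d <= 1 by rewrite ge_min lexx.
have d2 : d * (mabs A0 + mabs B0 + 2) <= e by rewrite -ler_pdivlMr// ge_min lexx orbT.
have := hB d d0; have := hA d d0; apply: filterS2 => z h1 h2.
have -> : A z *m B z - A0 *m B0 = (A z - A0) *m (B z - B0) + (A z - A0) *m B0 + A0 *m (B z - B0).
  by rewrite -mulmxDr subrK mulmxBl mulmxBr addrA subrK.
have t1 := mabsM (A z - A0) (B z - B0); have t2 := mabsM (A z - A0) B0; have t3 := mabsM A0 (B z - B0).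
have t4 := mabsD ((A z - A0) *m (B z - B0) + (A z - A0) *m B0) (A0 *m (B z - B0)).
have t5 := mabsD ((A z - A0) *m (B z - B0)) ((A z - A0) *m B0).
have u1 : mabs (A z - A0) * mabs (B z - B0) <= d.
  apply: (le_trans (ler_pM (mabs_ge0 _) (mabs_ge0 _) (ltW h1) (ltW h2))).
  by rewrite ler_piMr// ltW.
have u2 : mabs (A z - A0) * mabs B0 <= d * mabs B0 by rewrite ler_wpM2r// ltW.
have u3 : mabs A0 * mabs (B z - B0) <= mabs A0 * d by rewrite ler_wpM2l// ltW.
have u4 : d * (mabs A0 + mabs B0 + 2) = d * mabs A0 + d * mabs B0 + d + d by ring.
rewrite [mabs A0 * d]mulrC in u3; lra.
Qed.

Lemma cvg_tJ (T : Type) (F : set_system T) {FF : Filter F} m n (A : T -> 'M[C]_(m, n)) (A0 : 'M[C]_(m, n)) :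
  A @ F --> A0 -> (fun z => (A z)^t*) @ F --> A0^t*.
Proof.
move=> /cvg_mabs hA; apply/cvg_mabs => e /hA; apply: filterS => z.
by have -> : (A z)^t* - A0^t* = (A z - A0)^t*; [apply/matrixP => i j; rewrite !mxE rmorphB|rewrite mabsJ].
Qed.

Lemma PS_cvg_mx m n (A : C -> 'M[C]_(m, n)) z0 : (forall i j, PSat (fun z => A z i j) z0) ->
  A z @[z --> z0^'] --> A z0.
Proof.
move=> hA; apply: cvg_entry => i j.
apply: cvg_trans (PS_cont (hA i j)); apply: cvg_app; exact: cvg_within.
Qed.

Lemma cvg_Re_ge0 (T : Type) (F : set_system T) {FF : ProperFilter F} (f : T -> C) (l : C) : f @ F --> l ->
  (\forall z \near F, 0 <= Rez (f z)) -> 0 <= Rez l.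
Proof.
move=> /cvg_C hf f0; rewrite leNgt; apply/negP => l0.
have h := hf (- Rez l); rewrite oppr_gt0 in h.
have [z [h1 h2]] := @filter_ex _ F _ _ (filterI (h l0) f0).
have := le_lt_trans (cabs_Re _) h1; rewrite !reimE.
by have := ler_norm (Rez (f z) - Rez l); lra.
Qed.

End AnalyticMatrices.

(** * Boundedness of Weyl discs and removal of singularities *)

Section WeylDisk.
Context {R : realType} (r : R) (r0 : 0 < r).
Local Notation C := (cplx R).
Variable p : nat.
Local Notation J := (Jmx (R := R) p).
Local Notation "'i" := (imag_unit : C).
Variables beta db : R -> 'M[C]_(p, p + p).
Hypothesis bAC : mAC r beta db.
Variables E Einv : (R -> 'cV[C]_p) -> (R -> 'cV[C]_p).
Hypothesis hS : similarity_operator r beta E Einv.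
Variables Phi1 dPhi : R -> 'M[C]_p.
Hypothesis PAC : mAC r Phi1 dPhi.
Hypothesis hP : aeq r Phi1 (columnwise Einv (beta1 beta)).
Variable W : R -> C -> 'M[C]_(p + p).
Hypothesis hW : fundamental_solution r beta W.

Let bC : mCcont r beta. Proof. exact: mAC_Ccont bAC. Qed.

(** Integrating the equation over [0, r] isolates r w; the function a and its integral are
    controlled by the L1 norm of h. *)
Lemma volterra_value (F h a : R -> C) (w lam : C) (B L : R) : CBM r F -> CL2 r h ->
  AC r a (fun x => - cint x h) -> a 0 = 0 -> cabs lam <= L ->
  (forall x, 0 <= x <= r -> h x = F x + w + lam * a x) -> (forall x, 0 <= x <= r -> cabs (F x) <= B) ->
  cabs w <= B + (r^-1 + L * r) * Ir r (fun t => cabs (h t)).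
Proof.
move=> FBM hL2 aAC a0 lamL hE hB; set mu := Ir _ _.
have rr : 0 <= (r : R) <= r by rewrite (ltW r0) lexx.
have hL1 := CL2_CL1 hL2; have aBM := AC_BM r0 aAC.
have mu0 : 0 <= mu by apply: Ir_ge0 => t _; exact: cabs_ge0.
have hm x : 0 <= x <= r -> cabs (cint x h) <= mu.
  move=> xr; have /andP[x0 xr'] := xr; apply: (le_trans (cint_abs xr' hL1)).
  have Lh := L1r_cabs hL1.
  by apply: (@Ir_mono _ r) => // t _; exact: cabs_ge0.
have ha x : 0 <= x <= r -> cabs (a x) <= mu * r.
  move=> xr; have /andP[x0 xr'] := xr; have [_ ->//] := aAC; rewrite a0 add0r.
  have := @cint_le_cst _ r _ mu x xr (CL2_CL1 aAC.1).
  move=> /(_ _)/le_trans; apply; last by rewrite ler_wpM2l.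
  by move=> t /andP[t0 tx]; rewrite cabsN hm// t0 (le_trans tx).
have e : w * r%:C = cint r h - cint r F - lam * cint r a.
  rewrite -(cint_cst w (ltW r0)) -(cintZ lam (lexx r) (CBM_CL1 aBM)) -!(cintN (lexx r)); last 2 first.
  - exact: CL1_Z (CBM_CL1 aBM).
  - exact: CBM_CL1.
  rewrite -!(cintD (lexx r)); last 4 first.
  - exact: CL1_D hL1 (CL1_N (CBM_CL1 FBM)).
  - exact: CL1_N (CL1_Z _ (CBM_CL1 aBM)).
  - by [].
  - exact: CL1_N (CBM_CL1 FBM).
  by apply: cint_eq => t tr; rewrite hE//; ring.
have b1 : cabs (cint r F) <= B * r by apply: (@cint_le_cst _ r) => //; exact: CBM_CL1.
have b2 : cabs (lam * cint r a) <= L * (mu * r * r).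
  rewrite cabsM; apply: ler_pM => //; try exact: cabs_ge0.
  by apply: (@cint_le_cst _ r) => //; exact: CBM_CL1.
have b3 : cabs w * r <= mu + B * r + L * (mu * r * r).
  rewrite -{1}(ger0_norm (ltW r0)) -cabs_real -cabsM e; apply: (le_trans (cabsB _ _)).
  have := cabsB (cint r h) (cint r F); have := hm r rr; lra.
have -> : B + (r^-1 + L * r) * mu = (mu + B * r + L * (mu * r * r)) / r by field; rewrite gt_eqF.
by rewrite ler_pdivlMr.
Qed.

Let coordinate lam (v w : 'cV[C]_p) (h : R -> 'cV[C]_p) (L B : R) k : cabs lam <= L -> mL2 r h ->
  (forall x, 0 <= x <= r -> h x = Phi1 x *m v + w + lam *: Amx h x) ->
  (forall x, 0 <= x <= r -> cabs ((Phi1 x *m v) k 0) <= B) ->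
  forall alpha, 0 < alpha ->
  cabs (w k 0) <= B + (r^-1 + L * r) * (alpha * r / 2 + Ir r (fun t => mnormsq (h t)) / (2 * alpha)).
Proof.
move=> lamL hL2 hh hB alpha alpha0.
have L0 : 0 <= L := le_trans (cabs_ge0 _) lamL.
have hk : CL2 r (fun t => h t k 0) by exact: hL2.
have FBM : CBM r (fun t => (Phi1 t *m v) k 0).
  by have := mBM_mul (mAC_BM r0 PAC) (mBM_cst r v); exact.
have aAC : AC r (fun x => Amx h x k 0) (fun x => - cint x (fun t => h t k 0)).
  by have := Amx_AC r0 hL2 k 0; congr AC; apply/funext => x; rewrite mxE mintE.
have a00 : Amx h 0 k 0 = 0 by rewrite /Amx mint0 mxE.
have hE x : 0 <= x <= r -> h x k 0 = (Phi1 x *m v) k 0 + w k 0 + lam * Amx h x k 0.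
  have e0 (A A' D : 'cV[C]_p) q : (A + A' + q *: D) k 0 = A k 0 + A' k 0 + q * D k 0 by rewrite !mxE.
  by move=> xr; rewrite {1}hh// e0.
apply: (le_trans (volterra_value FBM hk aAC a00 lamL hE hB)).
rewrite lerD2l; apply: ler_wpM2l.
  by rewrite addr_ge0 ?invr_ge0 ?(ltW r0)// mulr_ge0// ltW.
apply: (le_trans (young_Ir r0 alpha0 hk)); rewrite lerD2l ler_pM2r ?invr_gt0 ?mulr_gt0//.
have [_ Lk] := L2r_cabs hk.
apply: Ir_le => //; first exact: L1r_mnormsq.
move=> t _; rewrite /mnormsq (bigD1 k)//= big_ord1 lerDl sumr_ge0// => l _.
by rewrite sumr_ge0// => ? _; exact: sqr_ge0.
Qed.

(** For v = 0 the energy bound makes h vanish almost everywhere, and the Volterra equation then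
    leaves w = 0. This is the source of invertibility for the denominator of the transform. *)
Lemma J_nonneg_vertical lam (w : 'cV[C]_p) : 0 < Imz lam ->
  0 <= Rez (((W r lam *m col_mx 0 w)^t* *m J *m (W r lam *m col_mx 0 w)) 0 0) -> w = 0.
Proof.
move=> lam0 hJ; have [M M0 hM] := weyl_bound r0 bAC hS PAC hP hW.
have [h [hL2 hh]] := hM lam 0 w lam0 hJ.
have -> : ((0 : 'cV[C]_p)^t* *m w) 0 0 = 0 by rewrite mxE big1 // => j _; rewrite !mxE rmorph0 mul0r.
rewrite mulr0 pmulr_lle0// => H0.
have {}H0 : Ir r (fun t => mnormsq (h t)) = 0.
  by apply/eqP; rewrite eq_le H0 Ir_ge0// => t _; exact: mnormsq_ge0.
apply/matrixP => k l; rewrite ord1 mxE; apply/eqP; rewrite -cabs_eq0 eq_le cabs_ge0 andbT.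
pose K := (r^-1 + cabs lam * r) * (r / 2).
have K0 : 0 <= K.
  apply: mulr_ge0; last by rewrite divr_ge0// ltW.
  by rewrite addr_ge0 ?invr_ge0 ?(ltW r0)// mulr_ge0// ltW.
apply/ler_addgt0Pr => e e0; rewrite add0r.
have al0 : 0 < e / (K + 1) by rewrite divr_gt0//; lra.
have hB x : 0 <= x <= r -> cabs ((Phi1 x *m (0 : 'cV[C]_p)) k 0) <= 0 by rewrite mulmx0 mxE cabs0.
apply: (le_trans (coordinate (lexx _) hL2 hh hB al0)); rewrite H0 mul0r addr0 add0r.
have -> : (r^-1 + cabs lam * r) * (e / (K + 1) * r / 2) = e * (K / (K + 1)).
  by rewrite {2}/K; field; rewrite !gt_eqF//; lra.
by rewrite ler_piMr ?(ltW e0)// ler_pdivrMr; lra.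
Qed.

(** Weyl discs are bounded locally uniformly in lambda: the squared norm of h is at most linear in
    w, while w is controlled by the norm itself, so half of w can be absorbed. *)
Lemma J_nonneg_bounded (c L : R) : 0 < c -> 0 <= L -> exists B : R, forall lam P,
  c <= Imz lam -> cabs lam <= L -> J_nonneg r W lam P -> forall k j, cabs (P k j) <= B.
Proof.
move=> c0 L0; have [M M0 hM] := weyl_bound r0 bAC hS PAC hP hW.
have [B B0 hB] := mBM_bound r0 (mAC_BM r0 PAC).
pose q : R := p%:R + 1.
have q0 : 0 < q by rewrite ltr_wpDl.
have pq : p%:R <= q by rewrite lerDl.
pose K1 := r^-1 + L * r.
have K10 : 0 < K1 by rewrite ltr_wpDr ?invr_gt0// mulr_ge0// ltW.
(* The Young parameter for which the term with H is at most s/2. *)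
pose al := q * K1 * (M + 1) / c.
have al0 : 0 < al by rewrite divr_gt0// mulr_gt0 ?mulr_gt0//; lra.
exists (2 * (q * (B + K1 * (al * r / 2)))) => lam P lc lL hJ k j.
have lam0 : 0 < Imz lam := lt_le_trans c0 lc.
pose v : 'cV[C]_p := delta_mx j 0; pose w : 'cV[C]_p := - 'i *: (P *m v).
have wE l : 'i * w l 0 = P l j.
  by rewrite mxE mulrA mulrN sqr_i opprK mul1r /v -colE mxE.
have wabs l : cabs (w l 0) = cabs (P l j) by rewrite -wE cabsM cabs_i mul1r.
have [h [hL2 hh hH]] := hM _ v w lam0 (hJ v).
have hvw : (v^t* *m w) 0 0 = w j 0.
  rewrite mxE (bigD1 j)//= big1 ?addr0; first by rewrite !mxE !eqxx rmorph1 mul1r.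
  by move=> l lj; rewrite !mxE (negbTE lj) rmorph0 mul0r.
rewrite hvw in hH; set H := Ir _ _ in hH.
have H0 : 0 <= H by apply: Ir_ge0 => t _; exact: mnormsq_ge0.
pose s := mabs w.
have s0 : 0 <= s by exact: mabs_ge0.
have HcE : H <= M * s / c.
  rewrite ler_pdivlMr//; apply: (le_trans (ler_wpM2l H0 lc)); apply: (le_trans hH); apply: ler_wpM2l => //.
  by apply: (le_trans (ler_norm _)); apply: (le_trans (cabs_Re _)); exact: mabs_entry.
have FB l x : 0 <= x <= r -> cabs ((Phi1 x *m v) l 0) <= B.
  by move=> xr; rewrite /v -colE mxE; apply: (le_trans (mabs_entry _ _ _)); exact: hB.
have cw l : cabs (w l 0) <= B + K1 * (al * r / 2) + K1 * (H / (2 * al)).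
  by have := coordinate lL hL2 hh (FB l) al0; rewrite -/K1 -/H mulrDr addrA.
have t2 : q * (K1 * (H / (2 * al))) <= s / 2.
  have al2 : q * K1 * (M + 1) = al * c by rewrite /al divfK// gt_eqF.
  have -> : q * (K1 * (H / (2 * al))) = (q * K1 * H) / (2 * al) by ring.
  have al20 : 0 < 2 * al by exact: mulr_gt0.
  rewrite ler_pdivrMr//.
  have -> : s / 2 * (2 * al) = s * al by field.
  apply: (@le_trans _ _ (q * K1 * (M * s / c))); first by rewrite ler_wpM2l// mulr_ge0// ltW.
  have -> : s * al = q * K1 * ((M + 1) * s / c) by rewrite /al; ring.
  apply: ler_wpM2l; first by rewrite mulr_ge0// ltW.
  apply: ler_wpM2r; first by rewrite invr_ge0 ltW.
  by apply: ler_wpM2r => //; lra.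
have BK0 : 0 <= B + K1 * (al * r / 2).
  apply: addr_ge0 => //; apply: mulr_ge0; first exact: ltW.
  by apply: divr_ge0 => //; apply: mulr_ge0; exact: ltW.
have t1 : s <= q * (B + K1 * (al * r / 2) + K1 * (H / (2 * al))).
  have hn : 0 <= B + K1 * (al * r / 2) + K1 * (H / (2 * al)).
    apply: addr_ge0 => //; apply: mulr_ge0; first exact: ltW.
    by apply: divr_ge0 => //; apply: mulr_ge0 => //; exact: ltW.
  have := @mabs_le_cst _ p 1 w (B + K1 * (al * r / 2) + K1 * (H / (2 * al))).
  move=> /(_ _)/le_trans; apply; first by move=> a b; rewrite [b]ord1.
  by rewrite mul1r ler_wpM2r.
rewrite -wabs; apply: (le_trans (mabs_entry _ _ _)); rewrite -/s.
rewrite mulrDr in t1; set X := q * (B + _) in t1 *; lra.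
Qed.

Lemma fundamental_inv_PSat z0 i j : PSat (fun z => invmx (W r z) i j) z0.
Proof.
under eq_fun do rewrite (fundamental_invmx r0 bC hW).
have cst A k l : PSat (fun _ : C => (A : 'M[C]_(p + p)) k l) z0 by exact: PS_cst.
apply: PS_mulmx => // k l; apply: PS_mulmx => // a b.
have -> : (fun z => ((W r z^*)^t*) a b) = (fun z => (W r z^* b a)^*) by apply/funext => z; rewrite !mxE.
by apply: (PS_conj (f := fun z => W r z b a)); have := fundamental_PSat r0 bC hW z0^* b a.
Qed.

Variables P1 P2 : C -> 'M[C]_p.
(** The blocks of Y = W^{-1} P: despite the letters, [N] is the matrix that gets inverted and the
    transform is i D N^{-1}. *)
Let P z := col_mx (P1 z) (P2 z).
Let Y z := invmx (W r z) *m P z.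
Let N z := usubmx (Y z).
Let D z := dsubmx (Y z).

Let WY z : W r z *m Y z = P z.
Proof. by rewrite /Y mulmxA mulmxV ?mul1mx// (fundamental_unit r0 bC hW). Qed.

Let lftE z : weyl_lft (W r) P1 P2 z = 'i *: (D z *m invmx (N z)).
Proof.
by rewrite /weyl_lft /N /D /Y /P -{5 6}[invmx (W r z)]submxK mul_block_col col_mxKu col_mxKd.
Qed.

Let possemidef_Re z (q : 'cV[C]_p) : possemidef ((P z)^t* *m J *m P z) ->
  0 <= Rez (((P z *m q)^t* *m J *m (P z *m q)) 0 0).
Proof.
move=> /(_ q); have -> : (P z *m q)^t* *m J *m (P z *m q) = q^t* *m ((P z)^t* *m J *m P z) *m q.
  by rewrite mulmx_tJ !mulmxA.
by rewrite lecE => /andP[_].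
Qed.

(** Where [N] is invertible, W maps [v; -i phi v] to P N^{-1} v, so the condition is property-J of
    the pair. *)
Let lft_J z : N z \in unitmx -> possemidef ((P z)^t* *m J *m P z) -> J_nonneg r W z (weyl_lft (W r) P1 P2 z).
Proof.
move=> uN hP' v /=; rewrite lftE.
have -> : W r z *m col_mx v (- 'i *: ('i *: (D z *m invmx (N z)) *m v)) = P z *m (invmx (N z) *m v).
  rewrite -WY -mulmxA -[in RHS](vsubmxK (Y z)) mul_col_mx -/(N z) -/(D z) mulKVmx// mulmxA.
  by rewrite -scalemxAl scalerA mulNr sqr_i opprK scale1r.
exact: possemidef_Re.
Qed.

Let N_vertical z (q : 'cV[C]_p) : 0 < Imz z -> possemidef ((P z)^t* *m J *m P z) -> N z *m q = 0 -> P z *m q = 0.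
Proof.
move=> z0 hP' Nq; have e : P z *m q = W r z *m col_mx 0 (D z *m q).
  by rewrite -WY -mulmxA -[in LHS](vsubmxK (Y z)) mul_col_mx -/(N z) -/(D z) Nq.
rewrite e; have -> : D z *m q = 0; last by rewrite col_mx0 mulmx0.
apply: (J_nonneg_vertical z0); rewrite -e.
exact: possemidef_Re.
Qed.

Hypothesis nonsing : nonsingular_propertyJ P1 P2.

Let P_Mer z0 : 0 < Imz z0 -> forall i j, Mer (fun z => P z i j) z0.
Proof.
case: nonsing => -[m1 m2] _ _ z0p i0 j; rewrite -(splitK i0); case: (fintype.split i0) => k /=.
  by under eq_fun do rewrite col_mxEu; apply: meromorphic_Mer; exact: m1.
by under eq_fun do rewrite col_mxEd; apply: meromorphic_Mer; exact: m2.
Qed.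

Let Y_Mer z0 : 0 < Imz z0 -> forall i j, Mer (fun z => Y z i j) z0.
Proof.
by move=> z0p; apply: Mer_mulmx => i j; [apply: PS_Mer; exact: fundamental_inv_PSat|exact: P_Mer].
Qed.

Let detN_Mer z0 : 0 < Imz z0 -> Mer (fun z => \det (N z)) z0.
Proof. by move=> z0p; apply: Mer_det => i j; under eq_fun do rewrite mxE; exact: Y_Mer. Qed.

Let analytic_PSat z0 : mx_analytic_at P1 z0 -> mx_analytic_at P2 z0 -> forall i j, PSat (fun z => P z i j) z0.
Proof.
move=> a1 a2 i0 j; rewrite -(splitK i0); case: (fintype.split i0) => k /=.
  by under eq_fun do rewrite col_mxEu; apply: analytic_PS; exact: a1.
by under eq_fun do rewrite col_mxEd; apply: analytic_PS; exact: a2.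
Qed.

(** At the point of positive definiteness a null vector q of [N] satisfies P q = 0 by [N_vertical],
    hence q = 0. From there [Mer_nonvanishing] spreads the conclusion to the half-plane, up to
    isolated points. *)
Let detN_neq0 z0 : 0 < Imz z0 ->
  exists2 d : R, 0 < d & forall z, z != z0 -> cabs (z - z0) < d -> \det (N z) != 0.
Proof.
case: nonsing => _ [zs zsp [[a1 a2] pos]] hJ; move: z0.
apply: (Mer_nonvanishing detN_Mer zsp).
have hd : PSat (fun z => \det (N z)) zs.
  apply: PS_det => i j; under eq_fun do rewrite mxE.
  by apply: PS_mulmx => k l; [exact: fundamental_inv_PSat|exact: analytic_PSat].
have d0 : \det (N zs) != 0.
  apply/negP => /eqP det0; have : \det (N zs)^T == 0 by rewrite det_tr det0.
  case/det0P => v v0 vN; have Nv : N zs *m v^T = 0 by rewrite -[N zs]trmxK -trmx_mul vN trmx0.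
  have hP' := hJ zs zsp (conj a1 a2).
  have Pv := N_vertical zsp hP' Nv.
  have v0' : v^T != 0 by rewrite -trmx0 (inj_eq trmx_inj).
  have := pos _ v0'.
  have -> : (P1 zs)^t* *m P1 zs + (P2 zs)^t* *m P2 zs = (P zs)^t* *m P zs.
    by rewrite /P tr_col_mx map_row_mx mul_row_col.
  by rewrite -!mulmxA Pv !mulmx0 mxE ltxx.
exact: PS_neq0 hd d0.
Qed.

(** The hypothesis says nothing about phi z0 unless the limit exists. Near z0 the transform lies in
    the Weyl discs and is bounded, and its entries are quotients with denominator det N, so the
    limit exists; J-nonnegativity is a closed condition and passes to it. *)
Lemma weyl_function_J (phi : C -> 'M[C]_p) (z0 : C) : 0 < Imz z0 ->
  (forall L : 'M[C]_p, weyl_lft (W r) P1 P2 z @[z --> z0^'] --> L -> phi z0 = L) ->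
  J_nonneg r W z0 (phi z0).
Proof.
move=> z0p hphi; have [d d0 hd] := detN_neq0 z0p.
have [nsm _ hJ] := nonsing.
have nearN : \forall z \near z0^', N z \in unitmx.
  by apply/near_C'; exists d => // z h1 h2; rewrite unitmxE unitfE; exact: hd.
have nearI : \forall z \near z0^', Imz z0 / 2 <= Imz z /\ cabs z <= cabs z0 + Imz z0.
  apply/near_C'; exists (Imz z0 / 2); first by rewrite divr_gt0.
  move=> z _ h; have e1 := cabs_Im (z - z0); rewrite !reimE in e1.
  have := ler_norm (- (Imz z - Imz z0)); rewrite normrN => e2.
  have := cabsD (z - z0) z0; rewrite subrK => e3; split; lra.
have nearA : \forall z \near z0^', mx_analytic_at P1 z /\ mx_analytic_at P2 z.
  have h (Q : C -> 'M[C]_p) : mx_meromorphic upper_half_plane Q -> \forall z \near z0^', mx_analytic_at Q z.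
    move=> mQ; apply: filter_forall => i; apply: filter_forall => j.
    have /Mer_PS_near[e e0 he] := meromorphic_Mer (mQ z0 z0p i j).
    by apply/near_C'; exists e => // z h1 h2; apply: PS_analytic; exact: he.
  exact: filterI (h P1 nsm.1) (h P2 nsm.2).
have nearJ : \forall z \near z0^', J_nonneg r W z (weyl_lft (W r) P1 P2 z).
  apply: filterS3 nearN nearI nearA => z uN [hI _] hA; apply: lft_J => //.
  by apply: hJ => //; apply: lt_le_trans hI; rewrite divr_gt0.
have [B hB] : exists B : R, \forall z \near z0^', forall k j, cabs (weyl_lft (W r) P1 P2 z k j) <= B.
  have c0 : 0 < Imz z0 / 2 by rewrite divr_gt0.
  have L0 : 0 <= cabs z0 + Imz z0 by rewrite addr_ge0// ltW.
  have [B hB] := J_nonneg_bounded c0 L0; exists B.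
  by apply: filterS2 nearJ nearI => z h1 [h2 h3]; exact: (hB z _ h2 h3 h1).
have lim k j : exists l : C, weyl_lft (W r) P1 P2 z k j @[z --> z0^'] --> l.
  (* Cramer's rule: an entry of the transform times det N is meromorphic. *)
  pose num z := 'i * (D z *m \adj (N z)) k j.
  have numM : Mer num z0.
    apply: Mer_M; first exact: PS_Mer (PS_cst _ _).
    apply: Mer_mulmx => a b; first by under eq_fun do rewrite mxE; exact: Y_Mer.
    by apply: Mer_adj => ? ?; under eq_fun do rewrite mxE; exact: Y_Mer.
  apply: (Mer_quotient_lim (B := B) numM (detN_Mer z0p) (detN_neq0 z0p)).
  apply/near_C'; apply: filterS2 nearN hB => z uN hb; split=> //.
  rewrite lftE mxE /num -mulrA; congr (_ * _).
  rewrite /invmx uN -scalemxAr [X in X * _]mxE mulrAC mulVf ?mul1r//.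
have /choice[l hl] : forall k, exists l : 'I_p -> C, forall j, weyl_lft (W r) P1 P2 z k j @[z --> z0^'] --> l j.
  by move=> k; have /choice[l hl] := lim k; exists l.
pose L : 'M[C]_p := \matrix_(k, j) l k j.
have hL : weyl_lft (W r) P1 P2 z @[z --> z0^'] --> L.
  by apply: cvg_entry => k j; rewrite mxE; exact: hl.
rewrite (hphi L hL) => v /=.
pose u (A : 'M[C]_p) : 'cV[C]_(p + p) := col_mx v (- 'i *: (A *m v)).
have uE A : u A = col_mx v 0 + col_mx 0 (- 'i *: 1%:M) *m (A *m v).
  by rewrite mul_col_mx mul0mx add_col_mx addr0 add0r -scalemxAl mul1mx.
have cu : u (weyl_lft (W r) P1 P2 z) @[z --> z0^'] --> u L.
  rewrite uE; under eq_cvg do rewrite uE.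
  apply: cvgD; first exact: cvg_cst.
  apply: cvg_mulmx; first exact: cvg_cst.
  by apply: cvg_mulmx => //; exact: cvg_cst.
have cW : W r z @[z --> z0^'] --> W r z0.
  by apply: PS_cvg_mx => i0 j0; have := fundamental_PSat r0 bC hW z0 i0 j0.
have FF : Filter z0^' := dnbhs_filter z0.
have cX : W r z *m u (weyl_lft (W r) P1 P2 z) @[z --> z0^'] --> W r z0 *m u L by exact: cvg_mulmx cW cu.
have cF : (W r z *m u (weyl_lft (W r) P1 P2 z))^t* *m J *m (W r z *m u (weyl_lft (W r) P1 P2 z)) @[z --> z0^'] -->
    (W r z0 *m u L)^t* *m J *m (W r z0 *m u L).
  apply: cvg_mulmx; last exact: cX.
  by apply: cvg_mulmx; [exact: (cvg_tJ cX)|exact: cvg_cst].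
have cE := @cvg_entry_inv _ _ _ FF _ _ _ _ 0 0 cF.
have PF : ProperFilter z0^' by exact: Proper_dnbhs_numFieldType.
apply: (@cvg_Re_ge0 _ _ _ PF _ _ cE).
by apply: filterS nearJ => z hz; exact: hz v.
Qed.

End WeylDisk.

(** * The representation and its uniqueness *)

Section Assembly.
Context {R : realType} (r : R) (r0 : 0 < r).
Local Notation C := (cplx R).
Local Notation "'i" := (imag_unit : C).

Lemma Cderiv_unique (F : R -> C) x l l' : 0 <= x <= r -> Cderiv r F x l -> Cderiv r F x l' -> l = l'.
Proof.
move=> xr h h'; apply/eqP; rewrite -subr_eq0 -cabs_eq0 eq_le cabs_ge0 andbT.
apply/ler_addgt0Pr => e e0; rewrite add0r; have e2 : 0 < e / 2 by rewrite divr_gt0.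
have [d d0 hd] := h _ e2; have [d' d0' hd'] := h' _ e2.
pose s := Num.min (Num.min d d') r / 2.
have s0 : 0 < s by rewrite divr_gt0// !lt_min d0 d0' r0.
have sr : s <= r / 2 by rewrite ler_pM2r// ge_min lexx orbT.
have sd : s < d by rewrite ltr_pdivrMr// ?ltr_pM//; apply: (@le_lt_trans _ _ d); [rewrite !ge_min lexx|rewrite ltr_pMr//; lra].
have sd' : s < d' by rewrite ltr_pdivrMr//; apply: (@le_lt_trans _ _ d'); [rewrite !ge_min lexx orbT|rewrite ltr_pMr//; lra].
have [y [yr yx y1]] : exists y, [/\ 0 <= y <= r, y != x & `|y - x| = s].
  have /andP[x0 xr'] := xr; case: (leP x (r / 2)) => xs.
    exists (x + s); split; first (by apply/andP; split; lra); last by rewrite addrAC subrr add0r gtr0_norm.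
    by rewrite -subr_eq0 addrAC subrr add0r gt_eqF.
  exists (x - s); split; first (by apply/andP; split; lra); last by rewrite addrAC subrr add0r normrN gtr0_norm.
  by rewrite -subr_eq0 addrAC subrr add0r oppr_eq0 gt_eqF.
have yd : `|y - x| < d by rewrite y1.
have yd' : `|y - x| < d' by rewrite y1.
have b1 := hd y yr yx yd; have b2 := hd' y yr yx yd'.
have := cabsB (((y - x)^-1)%:C * (F y - F x) - l') (((y - x)^-1)%:C * (F y - F x) - l).
by rewrite opprB addrC addrA subrK; lra.
Qed.

Lemma is_deriv_on_unique m n (F : R -> 'M[C]_(m, n)) x A B : 0 <= x <= r ->
  is_deriv_on r F x A -> is_deriv_on r F x B -> A = B.
Proof.
move=> xr /is_deriv_onP h1 /is_deriv_onP h2; apply/matrixP => i j.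
exact: Cderiv_unique xr (h1 i j) (h2 i j).
Qed.

Lemma classU_mAC m n (F : R -> 'M[C]_(m, n)) : classU r F -> exists f g : R -> 'M[C]_(m, n),
  [/\ mAC r F f, mAC r f g & forall x, 0 <= x <= r -> is_deriv_on r F x (f x)].
Proof.
case=> f [g [h1 h2 h3]]; exists f, g.
have fg : mAC r f g.
  by apply: mACP; [exact: isL2_mL2|move=> x xr; apply: h3; rewrite in_itv].
have d x : 0 <= x <= r -> is_deriv_on r F x (f x) by move=> xr; apply: h1; rewrite in_itv.
by split=> //; exact: mAC_deriv d fg.
Qed.

Lemma mAC_classU m n (F f g : R -> 'M[C]_(m, n)) : mAC r F f -> mAC r f g -> classU r F.
Proof.
move=> h1 h2; exists f, g; split.
- by move=> x; rewrite in_itv /= => xr; exact: (mAC_is_deriv r0 h1 h2 xr).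
- exact: mL2_isL2 (mAC_L2 h2).
- by move=> x; rewrite in_itv /= => xr; exact: mAC_E h2 xr.
Qed.

Lemma within_Ccont m n (F : R -> 'M[C]_(m, n)) : {within `[0, r], continuous F} ->
  forall i j x, 0 <= x <= r -> Ccont r (fun t => F t i j) x.
Proof.
move=> /subspace_continuousP h i j x xr e e0.
have := h x; rewrite /= in_itv /= => /(_ xr)/cvg_mabs/(_ e e0).
rewrite near_withinE => /nbhs_normP[d /= d0 hd]; exists d => // y yr yx.
apply: le_lt_trans (hd y _ _); last 2 first.
- by rewrite /ball_ /= distrC.
- by rewrite /= in_itv.
by have := mabs_entry (F y - F x) i j; rewrite !mxE.
Qed.

(** In the angle both sine and cosine of arg z exceed sin(delta/2), and Im z^2 is twice their
    product times |z|^2. *)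
Lemma sector_bounds (delta : R) z : 0 < delta -> sector delta z ->
  let c := sin (delta / 2) ^+ 2 in [/\ 0 < c, 0 < cabs z, c * cabs z <= Imz z & c * cabs z ^+ 2 <= Imz (z ^+ 2)].
Proof.
move=> d0 [rho [th [rho0 /andP[t1 t2] ->]]] /=.
have p0 : 0 < pi :> R := pi_gt0 R.
have s0 : 0 < sin (delta / 2) by apply: sin_gt0_pi; apply/andP; split; lra.
set s := sin (delta / 2) in s0 *.
have s1 : s <= 1 by exact: sin_le1.
have sth : s < sin th by rewrite /s ltr_sin ?in_itv //=; apply/andP; split; lra.
have cth : s < cos th.
  have -> : cos th = sin (pi / 2 - th) by rewrite -[pi / 2 - th]opprB sinN sinBpihalf opprK.
  by rewrite /s ltr_sin ?in_itv /=; [lra|apply/andP; split; lra|apply/andP; split; lra].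
have cz : cabs ((rho * cos th) +i* (rho * sin th) : C) = rho.
  by rewrite /cabs /= !exprMn -mulrDr cos2Dsin2 mulr1 sqrtr_sqr gtr0_norm.
rewrite cz; split=> //; first by rewrite exprn_gt0.
  rewrite mulrC ler_pM2l// expr2; apply: (le_trans (_ : _ <= s)); last exact: ltW.
  by rewrite ler_piMr// ltW.
have -> : rho * cos th * (rho * sin th) + rho * sin th * (rho * cos th) = (2 * (cos th * sin th)) * rho ^+ 2 by ring.
rewrite ler_pM2r ?exprn_gt0//.
have : s ^+ 2 <= cos th * sin th by rewrite expr2; apply: ler_pM; rewrite ?(ltW s0) ?(ltW cth) ?(ltW sth).
have : 0 < s ^+ 2 by rewrite exprn_gt0.
lra.
Qed.

(** The ray is i times that of [laplace_uniqueness]; its direction (20, 99) has the length 101, so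
    that sine and cosine of its angle are rational. *)
Lemma ray_sector : exists2 delta : R, 0 < delta & forall x : R, 0 < x ->
  sector delta ((x * (1 / 5)) +i* (x * (99 / 100)) : C).
Proof.
pose th : R := acos (20 / 101).
have r1 : ((-1 : R) <= 20 / 101) && ((20 / 101 : R) <= 1) by apply/andP; split; lra.
have r2 : ((-1 : R) <= 20 / 101) && ((20 / 101 : R) < 1) by apply/andP; split; lra.
have th0 : 0 < th by exact: acos_gt0.
have ct : cos th = 20 / 101 by rewrite /th acosK// in_itv.
have st : sin th = 99 / 101.
  rewrite /th sin_acos//; have -> : 1 - (20 / 101) ^+ 2 = (99 / 101) ^+ 2 :> R by field.
  by rewrite sqrtr_sqr ger0_norm//; lra.
have p0 : 0 < pi :> R := pi_gt0 R.
have thp : th < pi / 2.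
  have thpi : th <= pi by exact: acos_lepi.
  rewrite -ltr_cos ?in_itv /=; [|apply/andP; split; lra|apply/andP; split; lra].
  by rewrite cos_pihalf ct; lra.
pose delta := Num.min th (pi / 2 - th).
have d0 : 0 < delta by rewrite lt_min th0/=; lra.
have d1 : delta <= th by rewrite ge_min lexx.
have d2 : delta <= pi / 2 - th by rewrite ge_min lexx orbT.
exists delta => // x x0; exists (x * (101 / 100)), th; split.
- by rewrite mulr_gt0//; lra.
- by apply/andP; split; lra.
- by rewrite ct st; congr (_ +i* _); field.
Qed.

Lemma mintE_laplace (Phi : R -> C) (zeta : C) :
  cint r (fun t => cexp ('i * ('i * zeta) * t%:C) * Phi t) = laplace r Phi (- zeta).
Proof. by apply: cint_eq => t _; rewrite mulrA sqr_i mulN1r. Qed.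

(** The values of phi cancel in the difference, and on the ray |z| times the Laplace transform of
    each entry is at most 2 |z e^{izr}|. Below the threshold X a crude bound does, at the price of
    the factor e^{rX} in K. *)
Lemma representation_unique p (phi : C -> 'M[C]_p) (Phi Phi' : R -> 'M[C]_p) :
  (forall i j x, 0 <= x <= r -> Ccont r (fun t => Phi t i j) x) ->
  (forall i j x, 0 <= x <= r -> Ccont r (fun t => Phi' t i j) x) ->
  weyl_representation r phi Phi -> weyl_representation r phi Phi' ->
  forall x, 0 <= x <= r -> Phi x = Phi' x.
Proof.
move=> cP cP' h h'; have [delta d0 hray] := ray_sector.
have [M hM] := h delta d0 1 ltr01; have [M' hM'] := h' delta d0 1 ltr01.
move=> x xr; apply/matrixP => i j; apply/eqP; rewrite -subr_eq0; apply/eqP.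
pose f t := Phi t i j - Phi' t i j.
have hP := Ccont_CBM r0 (cP i j); have hP' := Ccont_CBM r0 (cP' i j).
have cf y : 0 <= y <= r -> Ccont r f y.
  move=> yr; have := Ccont_D (cP i j y yr) (Ccont_Z (-1) (cP' i j y yr)); congr Ccont.
  by apply/funext => t; rewrite mulN1r.
have fBM := Ccont_CBM r0 cf; have [B B0 hB] := CBM_bound r0 fBM.
pose X := Num.max (Num.max M M') 1.
have X1 : 1 <= X by rewrite le_max lexx orbT.
have XM : M <= X by rewrite !le_max lexx.
have XM' : M' <= X by rewrite !le_max lexx orbT.
pose K := 2 + B * r * expR (r * X).
have BE : 0 <= B * r * expR (r * X).
  by apply: mulr_ge0; [apply: mulr_ge0 => //; exact: ltW|exact: expR_ge0].
apply: (laplace_uniqueness r0 (K := K) cf _ xr) => y y0.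
pose zeta : C := (y * (99 / 100)) +i* (- (y * (1 / 5))).
change (is_true (cabs (laplace r f (- zeta)) <= K * expR (- (r * Rez zeta)))).
have zR : Rez zeta = y * (99 / 100) by [].
case: (leP y X) => yX.
  have b1 : cabs (laplace r f (- zeta)) <= B * r.
    apply: (@cint_le_cst _ r); [by rewrite (ltW r0) lexx|exact: CBM_CL1 (CBM_M (CBM_cexp r0 _) fBM)|].
    move=> t tr; rewrite cabsM cabs_cexp mulrC.
    have -> : Rez (- zeta * t%:C) = - (y * (99 / 100) * t) by rewrite !reimE /=; ring.
    apply: (le_trans (ler_pM _ _ (hB t tr) (_ : _ <= 1))); rewrite ?cabs_ge0 ?expR_ge0 ?mulr1//.
    rewrite -[leRHS]expR0 ler_expR oppr_le0; apply: mulr_ge0; last by case/andP: tr.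
    by apply: mulr_ge0 => //; lra.
  apply: (le_trans b1).
  have e1 : 1 <= expR (r * X) * expR (- (r * Rez zeta)).
    rewrite -expRD -[leLHS]expR0 ler_expR zR -mulrBr; apply: mulr_ge0; first exact: ltW.
    lra.
  have e2 := expR_ge0 (- (r * Rez zeta)).
  have Br0 : 0 <= B * r by apply: mulr_ge0 => //; exact: ltW.
  have e3 := ler_wpM2l Br0 e1; rewrite mulr1 mulrA in e3.
  by rewrite /K mulrDl; lra.
have y0' : 0 < y by lra.
pose z : C := (y * (1 / 5)) +i* (y * (99 / 100)).
have zE : z = 'i * zeta by apply: complex_ext; rewrite !reimE /=; ring.
have zs := hray y y0'.
have zabs : y <= cabs z.
  have <- : 101 / 100 * y = cabs z; last by lra.
  rewrite /cabs /=; have -> : (y * (1 / 5)) ^+ 2 + (y * (99 / 100)) ^+ 2 = (101 / 100 * y) ^+ 2 by field.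
  by rewrite sqrtr_sqr ger0_norm//; lra.
have zM : M%:C < `|z| by rewrite normCE ltC; lra.
have zM' : M'%:C < `|z| by rewrite normCE ltC; lra.
have b := hM z zs zM; have b' := hM' z zs zM'.
rewrite scaleNr opprK in b; rewrite scaleNr opprK in b'.
have hz : cabs z * cabs (laplace r f (- zeta)) <= 2 * cabs (z * cexp ('i * z * r%:C)).
  have eL : z * laplace r f (- zeta) = ((phi (z ^+ 2) + z *: mint r (fun t => cexp ('i * z * t%:C) *: Phi t)) -
     (phi (z ^+ 2) + z *: mint r (fun t => cexp ('i * z * t%:C) *: Phi' t))) i j.
    have me (Q : R -> 'M[C]_p) : mint r (fun t => cexp ('i * z * t%:C) *: Q t) i j = laplace r (fun t => Q t i j) (- zeta).
      by rewrite mintE -mintE_laplace -zE; apply: cint_eq => t _; rewrite mxE.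
    have e4 (A S T : 'M[C]_p) : ((A + z *: S) - (A + z *: T)) i j = z * (S i j - T i j) by rewrite !mxE; ring.
    rewrite e4 !me; congr (_ * _).
    have L1 := CBM_CL1 (CBM_M (CBM_cexp r0 (- zeta)) hP); have L2 := CBM_CL1 (CBM_M (CBM_cexp r0 (- zeta)) hP').
    rewrite /laplace -(cintN (lexx r) L2) -(cintD (lexx r) L1 (CL1_N L2)); apply: cint_eq => t _.
    by rewrite /f mulrBr.
  rewrite -cabsM eL -leC; apply: (le_trans (cabs_mx_norm _ _ _)); apply: (le_trans (ler_normB _ _)).
  apply: (le_trans (lerD b b')); rewrite normCE -CM -CD leC; lra.
rewrite cabsM cabs_cexp mulrCA in hz.
have zp : 0 < cabs z by lra.
rewrite ler_pM2l// in hz.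
have eR : Rez ('i * z * r%:C) = - (r * Rez zeta) by rewrite zR !reimE /=; ring.
rewrite eR in hz; apply: (le_trans hz); apply: ler_wpM2r; first exact: expR_ge0.
by rewrite /K; lra.
Qed.

End Assembly.

(** [Einv] determines a function only up to null sets, so the existence of the representative [Phi1]
    of class U is part of the claim. *)
Theorem theorem6p3 (R : realType) (p : nat) (r : R)
    (beta dbeta : R -> 'M[cplx R]_(p, p + p))
    (E Einv : (R -> 'cV[cplx R]_p) -> (R -> 'cV[cplx R]_p)) :
  (0 < p)%N -> 0 < r ->
  classU r beta ->
  (forall x : R, x \in `[0, r] -> is_deriv_on r beta x (dbeta x)) ->
  (forall x : R, x \in `[0, r] -> beta x *m Jmx p *m (beta x)^t* = 0) ->
  (forall x : R, x \in `[0, r] ->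
     dbeta x *m Jmx p *m (beta x)^t* = imag_unit%:M) ->
  \det (beta2 beta 0) != 0 ->
  similarity_operator r beta E Einv ->
  exists Phi1 : R -> 'M[cplx R]_p,
    [/\ ae_equal r Phi1 (columnwise Einv (beta1 beta)),
        classU r Phi1,
        forall phi, weyl_function r beta phi -> weyl_representation r phi Phi1
      & forall phi (Phi : R -> 'M[cplx R]_p), weyl_function r beta phi ->
          {within `[0, r], continuous Phi} ->
          weyl_representation r phi Phi ->
          forall x : R, x \in `[0, r] -> Phi x = Phi1 x].
Proof.
move=> _ r0 bU db hJ hdJ det0 hS.
have [G1 [G2 [bAC dbAC dG]]] := classU_mAC r0 bU.
have H0 x : 0 <= x <= r -> beta x *m Jmx p *m (beta x)^t* = 0.
  by move=> xr; apply: hJ; rewrite in_itv.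
(* The given derivative and the density provided by [classU] coincide because derivatives within
   [0, r] are unique, end points included. *)
have H1 x : 0 <= x <= r -> G1 x *m Jmx p *m (beta x)^t* = imag_unit%:M.
  move=> xr; have xi : x \in `[0, r] by rewrite in_itv.
  by rewrite -(is_deriv_on_unique r0 xr (db x xi) (dG x xr)); exact: hdJ.
have [u0 [bt [dbt [ddbt [Q [uu [[u0BM bt0 bE btAC dbtAC] [F0 F1 QL2 ddQ QJ]]]]]]]] := gauge r0 bAC dbAC H0 H1.
have d0 : \det (rsubmx (bt 0)) != 0 by rewrite bt0.
have [Phi1 [dPhi [g [PAC dPAC hP]]]] := sim_regular r0 bAC hS u0BM uu bE btAC dbtAC F0 F1 QL2 ddQ QJ d0.
have rep phi : weyl_function r beta phi -> weyl_representation r phi Phi1.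
  case=> W [P1 [P2 [hW nonsing hphi]]] delta delta0 eps eps0.
  pose c := sin (delta / 2) ^+ 2.
  (* For large delta the constant may vanish; the angle is then empty and every threshold will
     do. *)
  have [c0|c0] := ltP 0 c; last first.
    exists 0 => z zs _; have [] := sector_bounds delta0 zs.
    by rewrite -/c ltNge c0.
  have [K hK] := weyl_estimate r0 bAC hS PAC hP hW c0 eps0.
  exists K => z zs zK; have [_ zp s1 s2] := sector_bounds delta0 zs; rewrite -/c in s1 s2.
  rewrite normCE ltC in zK.
  have cz : 0 < Imz (z ^+ 2).
    apply: lt_le_trans s2; apply: mulr_gt0 => //; exact: exprn_gt0.
  have J := weyl_function_J r0 bAC hS PAC hP hW nonsing cz (hphi _ cz).
  have e := hK z (phi (z ^+ 2)) zK s1 s2 J.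
  rewrite scaleNr opprK normCE -CM; apply: (le_trans (mx_norm_mabs _)).
  by rewrite leC.
exists Phi1; split=> //.
- have hU := mAC_classU r0 PAC dPAC; exact: hU.
- move=> phi Phi hw cPhi hrep x; rewrite in_itv /= => xr.
  apply: (representation_unique r0 (within_Ccont cPhi) _ hrep (rep phi hw) xr) => i j y yr.
  by have := mAC_Ccont r0 PAC yr i j.
Qed.
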